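(* Let $T>0$, $d\ge 3$, $p\in(1,\infty)$ and $s\in[1,\infty]$, and let $p',s'$ be the Hölder conjugate exponents of $p,s$. Consider the transport equation $$\partial_t\rho+\boldsymbol u\cdot\nabla\rho=0,\qquad \rho|_{t=0}=\rho_0\qquad\text{on }[0,T]\times\mathbb T^d.$$ The following hold. (i) If $s<\infty$, then there exists a divergence-free vector field $$\boldsymbol u\in L^1(0,T;W^{1,p'}(\mathbb T^d))\cap L^{s'}(0,T;L^{p'}(\mathbb T^d))$$ such that uniqueness of weak solutions to the transport equation fails in the class $L^s(0,T;L^p(\mathbb T^d))$. (ii) If $s=\infty$, then for any divergence-free vector field $\boldsymbol u\in L^1(0,T;W^{1,p'}(\mathbb T^d))$ and any initial datum $\rho_0\in L^p(\mathbb T^d)$, there exists a unique weak solution of the transport equation in the class $L^\infty(0,T;L^p(\mathbb T^d))$.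
   Context: $\mathbb T^d=\mathbb R^d/\mathbb Z^d$. Divergence-free means $\operatorname{div}\boldsymbol u=0$ in the sense of distributions (in $x$). If $s=1$ then $s'=\infty$. Weak solution: for a divergence-free $\boldsymbol u:[0,T]\times\mathbb T^d\to\mathbb R^d$, a function $\rho:[0,T]\times\mathbb T^d\to\mathbb R$ is a weak solution with initial datum $\rho_0$ if $$\int_0^T\!\!\int_{\mathbb T^d}\rho(\partial_t\phi+\boldsymbol u\cdot\nabla\phi)\,dx\,dt=-\int_{\mathbb T^d}\rho_0\,\phi(0,x)\,dx\quad\text{for all }\phi\in C_c^\infty([0,T)\times\mathbb T^d).$$ Equivalently, the left-hand side vanishes for all $\phi\in C_c^\infty((0,T)\times\mathbb T^d)$, and $\rho$ is continuous in time in the distributional sense with $\lim_{t\to0^+}\rho(t)=\rho_0$ in the distributional sense. ''Uniqueness fails in a class'' means that, for this $\boldsymbol u$, there is an initial datum $\rho_0$ admitting at least two distinct weak solutions in that class. *)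

(* Defs.v *)
From HB Require Import structures.
From mathcomp Require Import all_boot all_order all_algebra.
From mathcomp Require Import all_classical all_reals all_analysis.

Set Implicit Arguments.
Unset Strict Implicit.
Unset Printing Implicit Defensive.
Import Order.TTheory GRing.Theory Num.Theory.
Import numFieldNormedType.Exports.
Local Open Scope classical_set_scope.
Local Open Scope ring_scope.

(* The Borel sigma-algebra of R^n, generated by the n coordinate functions. *)
Definition measure_rV_display : measure_display -> measure_display.
Proof. exact. Qed.

Section measurable_rV.
Context (R : realType) (n : nat).

Let coord (i : 'I_n) (x : 'rV[R]_n) : measurableTypeR R := x 0 i.

Let rV_set0 : g_sigma_preimage coord set0.
Proof. exact: sigma_algebra0. Qed.

Let rV_setC A : g_sigma_preimage coord A -> g_sigma_preimage coord (~` A).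
Proof. exact: sigma_algebraC. Qed.

Let rV_bigcup (F : (set 'rV[R]_n)^nat) :
  (forall i, g_sigma_preimage coord (F i)) ->
  g_sigma_preimage coord (\bigcup_i (F i)).
Proof. exact: sigma_algebra_bigcup. Qed.

HB.instance Definition _ := @isMeasurable.Build
  (measure_rV_display default_measure_display) 'rV[R]_n
  (g_sigma_preimage coord) rV_set0 rV_setC rV_bigcup.

Lemma measurable_rV_coord (i : 'I_n) :
  measurable_fun [set: 'rV[R]_n] (fun x => x 0 i : measurableTypeR R).
Proof.
move=> _ Y mY; rewrite setTI; apply: sub_sigma_algebra => /=.
rewrite -bigcup_seq/=; exists i => /=; first by rewrite mem_index_enum.
by exists Y => //; rewrite setTI.
Qed.

Lemma measurable_fun_rVP d (T : measurableType d) (f : T -> 'rV[R]_n) :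
  (forall i, measurable_fun [set: T] (fun x => f x 0 i : measurableTypeR R)) ->
  measurable_fun [set: T] f.
Proof.
move=> mf.
pose G := \big[setU/set0]_(i < n) preimage_set_system setT (coord i) measurable.
apply: (measurability G) => //.
move=> _ [B GB <-]; move: GB; rewrite /G -bigcup_seq/= => -[i _ [A mA <-]].
have := mf i measurableT A mA.
by rewrite !setTI.
Qed.

End measurable_rV.

Definition cons_rV (R : realType) (n : nat)
    (z : measurableTypeR R * 'rV[R]_n) : 'rV[R]_n.+1 :=
  row_mx (z.1)%:M z.2 : 'rV[R]_(1 + n).

Lemma measurable_cons_rV (R : realType) (n : nat) :
  measurable_fun setT (@cons_rV R n).
Proof.
apply: measurable_fun_rVP => i; rewrite /cons_rV.
case: (splitP (i : 'I_(1 + n))) => j ij.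
- have -> : i = lshift n j by exact: val_inj.
  rewrite (_ : (fun _ => _) = fst); first exact: measurable_fst.
  by apply/funext => z; rewrite [LHS](row_mxEl z.1%:M z.2) ord1 mxE eqxx mulr1n.
- have -> : i = rshift 1 j by exact: val_inj.
  rewrite (_ : (fun _ => _) = (fun x : 'rV[R]_n => x 0 j) \o snd).
    by apply: measurableT_comp; [exact: measurable_rV_coord|exact: measurable_snd].
  by apply/funext => z; rewrite [LHS](row_mxEr z.1%:M z.2).
Qed.

HB.instance Definition _ (R : realType) (n : nat) :=
  isMeasurableFun.Build _ _ _ _ (@cons_rV R n) (@measurable_cons_rV R n).

(* Integration over T^d = R^d/Z^d: the normalized Haar measure of T^d is
   carried to the fundamental domain [0,1]^d of R^d, where it is the n-fold
   product of Lebesgue measure on [0,1]. *)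
Fixpoint torus_measure (R : realType) (n : nat) : probability 'rV[R]_n R :=
  if n is m.+1 then
    distribution (uniform_prob (@ltr01 R) \x torus_measure R m)%E (@cons_rV R m)
  else \d_(0 : 'rV[R]_0).

(* Functions on T^d are Z^d-periodic functions on R^d. *)
Definition Zd_periodic (R : realType) (d : nat) (U : Type)
    (f : 'rV[R]_d -> U) : Prop :=
  forall (x : 'rV[R]_d) (k : 'rV[int]_d), f (x + map_mx intr k) = f x.

(* On a finite-dimensional V, existence and continuity of all iterated
   directional derivatives up to order k is the usual C^k regularity. *)
Fixpoint Ck (R : realType) (V : normedModType R) (k : nat) (f : V -> R)
    : Prop :=
  continuous f /\
  (if k is k'.+1
   then forall v : V, (forall x, derivable f x v) /\ Ck k' ('D_v f)
   else True).

Definition smooth (R : realType) (V : normedModType R) (f : V -> R) : Prop :=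
  forall k, Ck k f.

Section torus_spaces.
Context (R : realType) (d : nat).
Implicit Types (T : R) (p q r s : \bar R).

Local Notation leb := (@lebesgue_measure R).
Local Notation haar := (torus_measure R d).

Definition Lp_torus p (f : 'rV[R]_d -> R) : Prop :=
  [/\ Zd_periodic f, measurable_fun setT f & finite_norm haar p f].

(* L^s(0,T; L^p(T^d)), for p < +oo, as a mixed-norm space of jointly measurable
   functions; values at times outside [0,T] are irrelevant. *)
Definition LsLp T s p (f : R -> 'rV[R]_d -> R) : Prop :=
  [/\ forall t : R, t \in `[0, T] -> Zd_periodic (f t),
      @measurable_fun _ _ (measurableTypeR R * 'rV[R]_d)%type R
        (`[0, T] `*` setT) (fun z => f z.1 z.2) &
      ('N[leb]_s[(fun t : R => 'N[haar]_p[EFin \o f t]) \_ `[0%R, T]] < +oo)%E].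

(* g is the j-th weak partial derivative of f on T^d. *)
Definition weak_partial (j : 'I_d) (f g : 'rV[R]_d -> R) : Prop :=
  forall psi : 'rV[R]_d -> R, smooth psi -> Zd_periodic psi ->
    \int[haar]_x (f x * 'D_('e_j) psi x) = - \int[haar]_x (g x * psi x).

(* L^r(0,T; W^{1,q}(T^d)): the W^{1,q} norm is that of (f, grad f) in
   (L^q)^{1+d}, with the spatial gradient taken at almost every time. *)
Definition LrW1q T r q (f : R -> 'rV[R]_d -> R) : Prop :=
  LsLp T r q f /\
  forall j : 'I_d, exists2 g : R -> 'rV[R]_d -> R,
    LsLp T r q g &
    {ae leb, forall t : R, t \in `[0, T] -> weak_partial j (f t) (g t)}.

Definition component (u : R -> 'rV[R]_d -> 'rV[R]_d) (i : 'I_d)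
  : R -> 'rV[R]_d -> R := fun t x => u t x 0 i.

Definition vLsLp T s p (u : R -> 'rV[R]_d -> 'rV[R]_d) : Prop :=
  forall i, LsLp T s p (component u i).

Definition vLrW1q T r q (u : R -> 'rV[R]_d -> 'rV[R]_d) : Prop :=
  forall i, LrW1q T r q (component u i).

Definition divergence_free T (u : R -> 'rV[R]_d -> 'rV[R]_d) : Prop :=
  {ae leb, forall t : R, t \in `[0, T] ->
    forall psi : 'rV[R]_d -> R, smooth psi -> Zd_periodic psi ->
      \int[haar]_x (\sum_(i < d) u t x 0 i * 'D_('e_i) psi x) = 0}.

(* C_c^oo([0,T) x T^d): restrictions to [0,T) x T^d of smooth functions on
   R x T^d which vanish for all times close to T. *)
Definition test_function T (phi : R * 'rV[R]_d -> R) : Prop :=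
  [/\ smooth phi,
      forall t, Zd_periodic (fun x => phi (t, x)) &
      exists2 T1, T1 < T & forall t x, T1 <= t -> phi (t, x) = 0].

Definition transport (u : R -> 'rV[R]_d -> 'rV[R]_d)
    (phi : R * 'rV[R]_d -> R) (t : R) (x : 'rV[R]_d) : R :=
  'D_((1, 0) : R * 'rV[R]_d) phi (t, x) +
  \sum_(i < d) u t x 0 i * 'D_((0, 'e_i) : R * 'rV[R]_d) phi (t, x).

Definition weak_solution T (u : R -> 'rV[R]_d -> 'rV[R]_d)
    (rho0 : 'rV[R]_d -> R) (rho : R -> 'rV[R]_d -> R) : Prop :=
  forall phi : R * 'rV[R]_d -> R, test_function T phi ->
    \int[leb]_(t in `[0, T])
      (\int[haar]_x (rho t x * transport u phi t x)) =
    - \int[haar]_x (rho0 x * phi (0, x)).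

(* Equality of elements of L^s(0,T; L^p(T^d)). *)
Definition ae_same T (rho1 rho2 : R -> 'rV[R]_d -> R) : Prop :=
  {ae leb, forall t : R, t \in `[0, T] ->
    {ae haar, forall x, rho1 t x = rho2 t x}}.

End torus_spaces.

(* Main.v *)
Require Import Defs.
From HB Require Import structures.
From mathcomp Require Import all_boot all_order all_algebra.
From mathcomp Require Import all_classical all_reals all_analysis.
From mathcomp Require Import measurable_realfun ring lra zify.
Set Implicit Arguments.
Unset Strict Implicit.
Unset Printing Implicit Defensive.
Import Order.TTheory GRing.Theory Num.Theory.
Import numFieldNormedType.Exports.
Local Open Scope classical_set_scope.
Local Open Scope ring_scope.
Arguments torus_measure : simpl never.

(** (i) Two step functions [B] and [B'] whose difference is a discrete divergence of a flux [H] with small support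
are connected by a fast shear flow in one coordinate, active for a short time: it carries an oscillating density
close to [B] to one close to [B'], the velocity being small of order 1/N. The two jumps left over, from [B] to the
oscillating density and from there to [B'], have fluxes on much finer scales, so they are jumps of the same kind
with a smaller budget. Iterating gives a tree of pulses in time; what remains at depth m contributes O((3/4)^m)
to the weak formulation, and a nonzero density is reached from 0.
(ii) Uniqueness is the DiPerna-Lions argument: commutator estimate, then renormalization by [1 - cos(lam z)].
Existence is dual: the adjoint estimate [sup_t |phi(t)|_q <= q int |(d_t + u.grad) phi|_q] makes the initial
pairing a bounded functional of the transported test functions, which Hahn-Banach and Radon-Nikodym represent
by a density. *)

(** Moving mass costs the product of the norms of density and velocity. On a set of measure theta
    the two factors shrink like theta^(1/p) and theta^(1/q), and the product like theta; so what
    must be small for a jump is [budget], the fraction of cells carrying the flux times the flux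
    over the number of cells per unit length. The velocity gradient does not profit from a small
    displacement: the frequency of the shear in x_k divided by N is the fixed number 4K. Only the
    factor theta^(1/q), with theta at most 3/Q, makes it small, so Q is chosen after K, while K and
    c make the budgets of the remaining jumps small. The price is a density that is huge in L^p,
    paid by a very short pulse; this is where s < oo enters. Flux, quarters and strips occupy three
    different coordinates, hence d >= 3. Each jump leaves three jumps with a quarter of its
    tolerance, so a cost that is at least linear in the tolerance loses a factor 3/4 per generation.
    In (ii) the chain rule in time is integrated against the weight T - t, which does the work of a
    Gronwall argument and leaves only the commutator. *)

Notation mR := measurableTypeR.
Notation mfun := (measurable_fun setT).
Notation jmfun f := (@measurable_fun _ _ (mR _ * 'rV[_]_ _)%type _ setT f).
Notation haar := (torus_measure _ _).
Notation leb := (@lebesgue_measure _).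
Notation unif := (uniform_prob (@ltr01 _)).
Notation mcomp := measurableT_comp.
Notation mfunM := measurable_funM.
Notation mfunTS := measurable_funTS.
Notation mEFinP := measurable_EFinP.
Notation mcst := measurable_cst.
Notation mfunB := measurable_funB.
Notation mfunD := measurable_funD.
Notation mitv := measurable_itv.
Notation leb_itv := lebesgue_measure_itv.
Notation mfubiniF := measurable_fun_fubini_tonelli_F.
Notation mcontinuous := continuous_measurable_fun.
Notation eqRint := eq_Rintegral.
Notation Zper := Zd_periodic.
Notation mcoord := measurable_rV_coord.
Notation int_fin := integrable_fin_num.
Notation mindic := measurable_indic.
Notation msnd := measurable_snd.
Notation mfst := measurable_fst.
Notation mpair1 := measurable_pair1.
Notation RintB := RintegralB.
Notation intZl := integrableZl.
Notation int_ge0 := integral_ge0.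
Notation RintZl := RintegralZl.
Notation cont_subT := continuous_subspaceT.
Notation prob_setT := probability_setT.
Notation RintD := RintegralD.
Notation hL1 f := ((torus_measure _ _).-integrable setT (EFin \o f)).
Notation lL1 D f := ((@lebesgue_measure _).-integrable D (EFin \o f)).
Notation hnorm p f := ('N[torus_measure _ _]_p%:E[EFin \o f])%E.
Notation ST R d := (R * 'rV[R]_d)%type.
Notation mST R d := (mR R * 'rV[R]_d)%type.

(** * Integral inequalities and small general facts *)

Lemma mfun_norm (R : realType) d (T : measurableType d) (D : set T) (f : T -> R) :
  measurable_fun D f -> measurable_fun D (fun x => `|f x|).
Proof. exact: (mcomp (@normr_measurable R setT)). Qed.

Lemma aesS (R : realType) (P Q : set (mR R)) : P `<=` Q -> {ae leb, forall x, P x} -> {ae leb, forall x, Q x}.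
Proof. by move=> PQ; exact: (@filterS _ _ (ae_filter_ringOfSetsType leb)). Qed.

Section integral_monotone.
Import HBNNSimple.
Local Open Scope ereal_scope.
Context d (T : measurableType d) (R : realType) (mu : {measure set T -> \bar R}) (D : set T).
Implicit Types f g : T -> \bar R.

(* The integral is a supremum over simple functions, so these need no measurability. *)
Lemma int_le f g : (forall x, D x -> f x <= g x) -> \int[mu]_(x in D) f x <= \int[mu]_(x in D) g x.
Proof.
move=> fg; apply: leeB; apply: le_ereal_sup => _ [h hf <-]; exists h => // x; apply: (le_trans (hf x));
  rewrite ?funeposE ?funenegE /patch; case: ifPn => // /set_mem Dx; rewrite ge_max !le_max lexx orbT ?leeN2 fg//.
Qed.

Lemma int_scale (c : R) f : (0 <= c)%R ->
  \int[mu]_(x in D) (c%:E * f x) = c%:E * \int[mu]_(x in D) f x.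
Proof.
rewrite le_eqVlt => /predU1P[<-|]. by rewrite mul0e integral0_eq// => x _; rewrite mul0e.
(* Scaling turns simple functions below [g] into simple functions below [e g]. The reverse
   inequality is this one for 1/e, and signed functions follow from their two parts. *)
have sub (e : R) g : (0 < e)%R -> (forall x, 0 <= g x) ->
    e%:E * \int[mu]_(x in D) g x <= \int[mu]_(x in D) (e%:E * g x).
  move=> e0 g0; rewrite -lee_pdivlMl// !ge0_integralE//; last by move=> x _; rewrite mule_ge0// lee_fin ltW.
  apply: ge_ereal_sup => _ [h hf <-]; rewrite lee_pdivlMl// -sintegralrM.
  apply: ereal_sup_ubound; exists (scale_nnsfun h (ltW e0)) => // x.
  apply: (@le_trans _ _ (e%:E * (g \_ D) x)); first by rewrite EFinM lee_wpmul2l// lee_fin ltW.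
  by rewrite /patch; case: ifP; rewrite ?mule0. have eqs (e : R) g : (0 < e)%R -> (forall x, 0 <= g x) ->
    \int[mu]_(x in D) (e%:E * g x) = e%:E * \int[mu]_(x in D) g x.
  move=> e0 g0; apply/eqP; rewrite eq_le sub// andbT -lee_pdivrMl// (le_trans (sub _ _ _ _))// ?invr_gt0//.
    by move=> x; rewrite mule_ge0// lee_fin ltW. by under eq_integral do rewrite muleA -EFinM mulVf ?gt_eqF// mul1e.
move=> c0; rewrite (integralE _ _ f) integralE ge0_funeposM ?ltW// ge0_funenegM ?ltW// !eqs//.
by do 2 case: integral => [?||]; rewrite /= ?EFinM ?EFinB -?EFinM -?EFinB ?mulrBr// ?gt0_muley ?gt0_muleNy//=.
Qed.

Lemma int_le_scale (c : R) f g : (0 <= c)%R -> (forall x, D x -> f x <= c%:E * g x) ->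
  \int[mu]_(x in D) f x <= c%:E * \int[mu]_(x in D) g x.
Proof. by move=> c0 fg; rewrite -int_scale//; exact: int_le. Qed.

Lemma int_leD f (g h : T -> R) (A B : \bar R) : measurable D -> measurable_fun setT g -> measurable_fun setT h ->
  (forall x, D x -> f x <= (`|g x| + `|h x|)%:E) ->
  \int[mu]_(x in D) `|g x|%:E <= A -> \int[mu]_(x in D) `|h x|%:E <= B -> \int[mu]_(x in D) f x <= A + B.
Proof.
move=> mD mg mh fgh gA hB; apply: le_trans (leeD gA hB); rewrite -ge0_integralD//; first exact: int_le.
  by apply/measurable_EFinP/measurable_funTS; exact: mfun_norm.
by apply/measurable_EFinP/measurable_funTS; exact: mfun_norm.
Qed.

(** Both parts of [f] have integrals between 0 and that of |f|, so the difference of their finite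
    values obeys the bound; an infinite right-hand side is trivial. *)
Lemma Rint_abs_le (f : T -> R) : `|\int[mu]_(x in D) f x|%:E <= \int[mu]_(x in D) `|f x|%:E.
Proof.
have [|fin] := leP +oo (\int[mu]_(x in D) `|f x|%:E); first by apply: le_trans; exact: leey.
have h (g : T -> \bar R) : (forall x, 0 <= g x) -> (forall x, g x <= `|f x|%:E) ->
    0 <= \int[mu]_(x in D) g x <= \int[mu]_(x in D) `|f x|%:E. by move=> g0 gf; rewrite int_ge0//=; exact: int_le.
have /andP[a0 aM] : 0 <= \int[mu]_(x in D) (EFin \o f)^\+ x <= \int[mu]_(x in D) `|f x|%:E.
  by apply: h => x; rewrite // funeposE /= -EFin_max lee_fin ge_max ler_norm normr_ge0.
have /andP[b0 bM] : 0 <= \int[mu]_(x in D) (EFin \o f)^\- x <= \int[mu]_(x in D) `|f x|%:E.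
  by apply: h => x; rewrite // funenegE /= -EFin_max lee_fin ge_max -normrN ler_norm normr_ge0.
rewrite /Rintegral integralE.
move: (integral mu D (EFin \o f)^\+) (integral mu D (EFin \o f)^\-) (\int[mu]_(x in D) `|f x|%:E) a0 aM b0 bM fin.
by move=> [a||] [b||] [M||]//=; rewrite !lee_fin => a0 aM b0 bM _; rewrite ler_norml; lra.
Qed.
End integral_monotone.
Arguments int_le_scale {d T R mu D c f g}.

Lemma mfun_powR_EFin d (T : measurableType d) (R : realType) (f : T -> R) (p : R) :
  mfun f -> mfun (fun x => (`|f x| `^ p)%:E).
Proof. by move=> mf; apply/mEFinP; apply: (mcomp (measurable_powR p)); exact: mfun_norm. Qed.

Lemma prob_int_cst d (T : measurableType d) (R : realType) (P : probability T R) (c : \bar R) :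
  (\int[P]_x c = c)%E.
Proof. by rewrite integral_cst// [X in (_ * X)%E](_ : _ = 1%E) ?mule1//; exact: prob_setT. Qed.

Lemma prob_int_le d (T : measurableType d) (R : realType) (P : probability T R) (f : T -> \bar R) (c : \bar R) :
  (forall x, (f x <= c)%E) -> (\int[P]_x f x <= c)%E.
Proof. by move=> fc; rewrite -[leRHS](prob_int_cst P); exact: int_le. Qed.

Lemma eqW (disp : Order.disp_t) (T : porderType disp) (x y : T) : x = y -> (x <= y)%O.
Proof. by move=> ->. Qed.

Lemma derive_ex (R : realType) (V W : normedModType R) (f : V -> W) x v df : is_derive x v f df -> derivable f x v.
Proof. by case. Qed.

Lemma derive_eq (R : realType) (V W : normedModType R) (f : V -> W) x v df : is_derive x v f df -> 'D_v f x = df.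
Proof. by case. Qed.

Lemma is_derive_cont (R : realType) (f df : R -> R) :
  (forall z, is_derive z (1 : R) f (df z)) -> continuous f.
Proof. by move=> fE z; apply: differentiable_continuous; apply/derivable1_diffP; exact: derive_ex (fE z). Qed.

Lemma is_derive_mfun (R : realType) (f df : R -> R) :
  (forall z, is_derive z (1 : R) f (df z)) -> mfun (f : mR R -> R).
Proof. by move=> fE; apply: mcontinuous; exact: is_derive_cont fE. Qed.

Lemma prob_Rint_abs_le d (T : measurableType d) (R : realType) (P : probability T R) (f : T -> R) (c : R) :
  (forall x, `|f x| <= c) -> `|\int[P]_x f x| <= c.
Proof. by move=> fc; rewrite -lee_fin (le_trans (Rint_abs_le _ _ _))// prob_int_le. Qed.

(** * Resampling one coordinate of the torus *)

Section torus_resampling.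
Variable R : realType.

Definition setc d (j : 'I_d) (z : R) (x : 'rV[R]_d) : 'rV[R]_d :=
  \row_i (if i == j then z else x 0 i).

Lemma setcE d (j : 'I_d) z x i :
  setc j z x 0 i = if i == j then z else x 0 i.
Proof. by rewrite mxE. Qed.

Lemma mfun_set_coord d dT (T : measurableType dT) (j : 'I_d)
    (f : T -> mR R) (g : T -> 'rV[R]_d) :
  mfun f -> mfun g ->
  mfun (fun w => setc j (f w) (g w)).
Proof.
move=> mf mg; apply: measurable_fun_rVP => i. have [->|ij] := eqVneq i j.
- by rewrite (_ : (fun _ => _) = f)//; apply/funext => w; rewrite setcE eqxx.
- rewrite (_ : (fun _ => _) = (fun x : 'rV[R]_d => x 0 i) \o g). by apply: mcomp => //; exact: mcoord.
  by apply/funext => w; rewrite setcE (negbTE ij).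
Qed.

Lemma cons_rV0 n (z : R) (y : 'rV[R]_n) : cons_rV (z, y) 0 ord0 = z.
Proof.
rewrite (_ : ord0 = lshift n (ord0 : 'I_1)); last exact: val_inj.
by rewrite /cons_rV [LHS](row_mxEl z%:M y) mxE eqxx mulr1n.
Qed.

Lemma cons_rVS n (z : R) (y : 'rV[R]_n) i : cons_rV (z, y) 0 (lift ord0 i) = y 0 i.
Proof.
have -> : lift ord0 i = rshift 1 i by exact: val_inj. by rewrite /cons_rV [LHS](row_mxEr z%:M y).
Qed.

Lemma set_coord_cons0 n (z z' : R) (y : 'rV[R]_n) :
  setc ord0 z (cons_rV (z', y)) = cons_rV (z, y).
Proof.
apply/rowP => i; rewrite setcE. by case: (unliftP ord0 i) => [k ->|->]; rewrite ?cons_rV0 ?cons_rVS.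
Qed.

Lemma set_coord_consS n (j : 'I_n) (z z' : R) (y : 'rV[R]_n) :
  setc (lift ord0 j) z (cons_rV (z', y)) = cons_rV (z', setc j z y).
Proof.
apply/rowP => i; rewrite setcE. case: (unliftP ord0 i) => [k ->|->]; last by rewrite !cons_rV0.
by rewrite !cons_rVS setcE (inj_eq lift_inj).
Qed.

Local Open Scope ereal_scope.

Lemma ge0_integral_cons n (f : 'rV[R]_n.+1 -> \bar R) :
  mfun f -> (forall x, 0 <= f x) ->
  \int[torus_measure R n.+1]_x f x =
  \int[unif]_z \int[torus_measure R n]_y f (cons_rV (z, y)).
Proof.
move=> mf f0. rewrite [LHS]ge0_integral_pushforward//. rewrite preimage_setT fubini_tonelli1//.
- by apply: mcomp => //; exact: measurable_cons_rV.
- by move=> x; exact: f0.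
Qed.

(** An independent uniform value put in place of one coordinate does not change the product measure.
    Induction on the dimension: a later coordinate is the induction hypothesis, and for the first
    one the old value has disappeared, so its integral is that of a constant. Statements about a
    single coordinate are thereby reduced to integrals over [0,1]. *)
Lemma ge0_resample d (j : 'I_d) (f : 'rV[R]_d -> \bar R) :
  mfun f -> (forall x, 0 <= f x) ->
  \int[haar]_x f x =
  \int[haar]_x \int[unif]_z f (setc j z x).
Proof.
elim: d j f => [[]//|n IH] j f mf f0. have mg : mfun (fun x : 'rV[R]_n.+1 => \int[unif]_z f (setc j z x)).
  apply: (@mfubiniF _ _ _ _ _ unif (fun w : 'rV[R]_n.+1 * mR R => f (setc j w.2 w.1))) => //. apply: mcomp => //.
  by apply: mfun_set_coord; [exact: msnd|exact: mfst].
rewrite ge0_integral_cons// [RHS]ge0_integral_cons//; last first. by move=> x; apply: int_ge0.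
have mfz z : mfun (fun y : 'rV[R]_n => f (cons_rV (z, y))). apply: mcomp => //.
  by apply: (mcomp (@measurable_cons_rV R n)); exact: mpair1. case: (unliftP ord0 j) => [k ->|->].
- by apply: eq_integral => z _; rewrite (IH k)//; under [RHS]eq_integral do
    under eq_integral do rewrite set_coord_consS.
- under [RHS]eq_integral do under eq_integral do under eq_integral do rewrite set_coord_cons0.
  rewrite [RHS]integral_cst//. rewrite [X in _ = _ * X](_ : _ = 1) ?mule1; last exact: prob_setT.
  rewrite (@fubini_tonelli _ _ _ _ _ unif (torus_measure R n) (f \o @cons_rV R n))//.
    by apply: mcomp => //; exact: measurable_cons_rV. by move=> x; exact: f0.
Qed.

End torus_resampling.

(** * Translations of periodic functions of one variable *)

Section lebesgue_shift.
Variable R : realType.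

Definition addr_m (s x : mR R) : mR R := (x + s)%R.

Lemma mfun_addr_m s : mfun (addr_m s).
Proof. by apply: mfunD => //; exact: mcst. Qed.

HB.instance Definition _ s :=
  isMeasurableFun.Build _ _ _ _ (addr_m s) (mfun_addr_m s).

Lemma lebesgue_measure_shift (s : R) (A : set R) : measurable A ->
  pushforward leb (addr_m s) A = leb A.
Proof.
move=> mA; apply/esym/lebesgue_measure_unique => //= _ [[a b]] _ <-.
rewrite /pushforward (_ : _ @^-1` _ = `](a - s), (b - s)]%classic); last first.
  by apply/seteqP; split=> x /=; rewrite /addr_m !in_itv/= ltrBlDr lerBrDr. rewrite !leb_itv/= !lte_fin ltrD2r.
by case: ifPn => // _; rewrite -!EFinB; congr EFin; lra.
Qed.

Local Open Scope ereal_scope.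

Lemma ge0_int_shift (s a b : R) (f : mR R -> \bar R) :
  mfun f -> (forall x, 0 <= f x) ->
  \int[leb]_(x in `[a, b[) f (x + s)%R = \int[leb]_(x in `[(a + s)%R, (b + s)%R[) f x.
Proof.
move=> mf f0; rewrite (_ : `[a, b[%classic = addr_m s @^-1` `[(a + s)%R, (b + s)%R[); last first.
  by apply/seteqP; split=> x /=; rewrite /addr_m !in_itv/= lerD2r ltrD2r.
rewrite -(@ge0_integral_pushforward _ _ _ _ _ (addr_m s) _ leb _ f)//.
- by apply: eq_measure_integral => A mA AS; exact: lebesgue_measure_shift.
- exact: measurable_funS mf.
Qed.

Lemma unifE (f : mR R -> \bar R) :
  mfun f -> (forall x, 0 <= f x) ->
  \int[unif]_z f z = \int[leb]_(z in `[0%R, 1%R]) f z.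
Proof. by move=> mf f0; rewrite integral_uniform// subr0 invr1 mul1e. Qed.

Lemma periodicZ (T : Type) (f : R -> T) : (forall x, f (x + 1)%R = f x) ->
  forall (k : int) x, f (x + k%:~R)%R = f x.
Proof.
move=> pf; have pn (n : nat) x : f (x + n%:R)%R = f x. elim: n x => [|n IH] x; first by rewrite addr0.
  by rewrite -natr1 addrA pf IH. case=> n x; first exact: pn.
by rewrite NegzE -(pn n.+1 (x + _)%R) mulrNz -addrA addNr addr0.
Qed.

(** Periodicity replaces [s] by its fractional part t. Then [t, 1 + t[ is cut at 1, and the piece
    beyond 1 is moved back by one period. *)
Lemma unif_integral_shift (s : R) (f : mR R -> \bar R) :
  mfun f -> (forall x, 0 <= f x) ->
  (forall x, f (x + 1)%R = f x) ->
  \int[unif]_z f (z + s)%R = \int[unif]_z f z.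
Proof.
move=> mf f0 pf. have mfs r : mfun (fun z : mR R => f (z + r)%R). by apply: (mcomp mf); exact: mfun_addr_m.
pose t := (s - (Num.floor s)%:~R)%R. have t01 : (0 <= t < 1)%R.
  by rewrite subr_ge0 ge_floor/= ltrBlDl -intrD1 floorD1_gt.
have -> : (fun z => f (z + s)%R) = (fun z => f (z + t)%R).
  apply/funext => z; rewrite -(periodicZ pf (Num.floor s) (z + t)%R). by congr f; rewrite /t; lra.
rewrite !unifE// -!integral_itv_bndo_bndc; [|exact: (mfunTS mf)|exact: (mfunTS (mfs t))].
rewrite ge0_int_shift// add0r.
rewrite (@itv_bndbnd_setU _ _ (BLeft t) (BLeft 1%R) (BLeft (1 + t)%R)) ?bnd_simp; [|lra|lra].
rewrite (@itv_bndbnd_setU _ _ (BLeft 0%R) (BLeft t) (BLeft 1%R)) ?bnd_simp; [|lra|lra].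
have dis (a b c : R) : [disjoint `[a, b[ & `[b, c[]%classic.
  apply/disj_setPRL => x /=; rewrite !in_itv/= => /andP[bx _]. by apply/negP; rewrite negb_and -!leNgt bx orbT.
rewrite !ge0_integral_setU//; [|exact: (mfunTS mf)..]. have -> : (1 + t = t + 1)%R by rewrite addrC.
rewrite -[X in `[X, (t + 1)%R[%classic](add0r 1%R) -(@ge0_int_shift 1 0 t)// addeC.
by congr (_ + _); apply: eq_integral => x _; exact: pf.
Qed.

End lebesgue_shift.

(** * Shears of the torus *)

Section torus_shift.
Variables (R : realType) (d : nat).

Lemma set_coord_add (j : 'I_d) z r (x : 'rV[R]_d) :
  setc j z x + r *: 'e_j = setc j (z + r) x.
Proof.
by apply/rowP => i; rewrite !mxE eqxx/=; case: eqVneq; rewrite ?mulr1 ?mulr0 ?addr0.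
Qed.

Lemma set_coord_id (j : 'I_d) (x : 'rV[R]_d) : setc j (x 0 j) x = x.
Proof. by apply/rowP => i; rewrite !mxE; case: eqVneq => [->|]. Qed.

Lemma Zd_periodic_coord (T : Type) (f : 'rV[R]_d -> T) (j : 'I_d) x :
  Zper f -> f (x + 'e_j) = f x.
Proof.
move=> /(_ x (delta_mx 0 j)) <-; congr (f (x + _)).
by apply/rowP => i; rewrite !mxE; case: (i == j); rewrite ?andbT ?andbF.
Qed.

Lemma Zd_periodic_set_coord (T : Type) (f : 'rV[R]_d -> T) (j : 'I_d) x :
  Zper f -> forall z, f (setc j (z + 1) x) = f (setc j z x).
Proof.
by move=> pf z; rewrite -(set_coord_add j z 1 x) scale1r Zd_periodic_coord.
Qed.

Lemma mfun_shift_coord (j : 'I_d) (s : 'rV[R]_d -> R) :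
  mfun s ->
  mfun (fun x : 'rV[R]_d => x + s x *: 'e_j).
Proof.
move=> ms; apply: measurable_fun_rVP => i.
rewrite (_ : (fun _ => _) = (fun x : 'rV[R]_d => x 0 i + s x * ('e_j : 'rV[R]_d) 0 i)); last first.
  by apply/funext => x; rewrite !mxE. apply: mfunD; first exact: mcoord. by apply: mfunM => //; exact: mcst.
Qed.

(* The shear x |-> x + s(x) e_j, with s independent of x_j, preserves the Haar measure. *)
Lemma ge0_torus_shear (j : 'I_d) (s : 'rV[R]_d -> R) (f : 'rV[R]_d -> \bar R) :
  mfun s -> (forall z x, s (setc j z x) = s x) ->
  mfun f -> (forall x, (0 <= f x)%E) -> Zper f ->
  (\int[haar]_x f (x + s x *: 'e_j)%R = \int[haar]_x f x)%E.
Proof.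
move=> ms sj mf f0 pf. rewrite (ge0_resample j)//; last first. by apply: (mcomp mf); exact: mfun_shift_coord.
rewrite [RHS](ge0_resample j)//; apply: eq_integral => x _. under eq_integral do rewrite sj set_coord_add.
apply: (@unif_integral_shift R (s x) (fun z => f (setc j z x))) => //.
- apply: (mcomp mf); apply: mfun_set_coord => //.
- by move=> z; exact: Zd_periodic_set_coord.
Qed.

End torus_shift.

(** * Bounded functions on sets of finite measure *)

Section bounded_integrals.
Context d (T : measurableType d) (R : realType) (mu : {measure set T -> \bar R}).
Variable D : set T.
Hypotheses (mD : measurable D) (muD : (mu D < +oo)%E).

Lemma bnd_int (f : T -> R) (M : R) :
  measurable_fun D f -> (forall x, D x -> `|f x| <= M) ->
  mu.-integrable D (EFin \o f).
Proof.
move=> mf fM; apply: measurable_bounded_integrable => //. exists M; split; first by rewrite num_real.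
by move=> x Mx y Dy /=; rewrite (le_trans (fM _ Dy))// ltW.
Qed.

Lemma Rintegral_cvg (f : (T -> R)^nat) (g : T -> R) (M : R) :
  (forall n, measurable_fun D (f n)) -> (forall n x, D x -> `|f n x| <= M) ->
  (forall x, D x -> f n x @[n --> \oo] --> g x) ->
  \int[mu]_(x in D) f n x @[n --> \oo] --> \int[mu]_(x in D) g x.
Proof.
move=> mf fM fg. have mg : measurable_fun D g by apply: (measurable_fun_cvg mf). have gM x : D x -> `|g x| <= M.
  move=> Dx; have h := cvg_norm (fg x Dx).
  by apply: (ler_cvg_to (h _) (@cvg_cst _ M _ _ _)); apply: nearW => n; exact: fM. have ig := bnd_int mg gM.
apply: fine_cvg; rewrite fineK; last exact: int_fin.
apply: (@dominated_cvg _ _ _ mu D mD (fun n => EFin \o f n) (EFin \o g) (cst M%:E)) => //.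
- by move=> n; exact/mEFinP.
- by move=> x Dx; apply: cvg_EFin; [exact: nearW|exact: fg].
- by apply: (@bnd_int (cst M) `|M|) => //; exact: mcst.
Unshelve. all: by end_near. Qed.

Lemma Rintegral_le_bound (f : T -> R) (M : R) : 0 <= M ->
  measurable_fun D f -> (forall x, D x -> `|f x| <= M) ->
  `|\int[mu]_(x in D) f x| <= M * fine (mu D).
Proof.
move=> M0 mf fM; have iF := bnd_int mf fM. apply: (le_trans (le_normr_Rintegral mD iF)).
rewrite -(Rintegral_cst mu mD); apply: le_Rintegral => //.
- by apply: (@bnd_int _ M) => [|x Dx]; [exact: mcomp|rewrite normr_id fM].
- by apply: (@bnd_int (cst M) `|M|) => //; exact: mcst.
Qed.

End bounded_integrals.

(** * Directional derivatives of smooth functions *)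

Section directional_derivatives.
Variables (R : realType) (V : normedModType R).
Implicit Types (f : V -> R) (v w x z : V).

Lemma sm_cont f : smooth f -> continuous f.
Proof. by move=> /(_ 0)[]. Qed.

Lemma sm_dv f v x : smooth f -> derivable f x v.
Proof. by move=> /(_ 1)[_ /(_ v)[]]. Qed.

Lemma sm_D f v : smooth f -> smooth ('D_v f).
Proof. by move=> sf k; have [_ /(_ v)[]] := sf k.+1. Qed.

Lemma is_derive_line f z v (t : R) : derivable f (z + t *: v) v ->
  is_derive t 1 (fun s => f (z + s *: v)) ('D_v f (z + t *: v)).
Proof.
move=> df; have E : (fun h : R => h^-1 *: (((fun s => f (z + s *: v)) \o shift t) (h *: 1) - f (z + t *: v))) =
    (fun h => h^-1 *: ((f \o shift (z + t *: v)) (h *: v) - f (z + t *: v))).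
  apply/funext => h /=; congr (_ *: (f _ - _)). by rewrite [h%:A]mulr1 scalerDl addrCA.
by apply: DeriveDef; rewrite ?/derivable ?/derive/= E.
Qed.

Lemma line_continuous f z v : (forall x, derivable f x v) ->
  continuous (fun s : R => f (z + s *: v)).
Proof.
move=> df s; apply: differentiable_continuous; apply/derivable1_diffP. exact: (derive_ex (is_derive_line (df _))).
Qed.

Lemma line_MVT f z v (h : R) : (forall x, derivable f x v) ->
  exists2 c : R, `|c| <= `|h| & f (z + h *: v) - f z = h * 'D_v f (z + c *: v).
Proof.
move=> df; pose F s := f (z + s *: v); pose dF (s : R) : R := 'D_v f (z + s *: v).
have dFP (s : R) : is_derive s (1 : R) F (dF s) by exact: is_derive_line.
have cF (i : interval R) : {within [set` i], continuous F}. by apply: cont_subT; exact: line_continuous.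
have F0 : F 0 = f z by rewrite /F scale0r addr0. have [h0|h0] := leP 0 h.
- have [c] := @MVT_segment R F dF _ _ h0 (fun y _ => dFP y) (@cF _).
  rewrite in_itv/= F0 subr0 => /andP[c0 ch] E; exists c; first by rewrite !ger0_norm. by rewrite mulrC -E.
- have [c] := @MVT_segment R F dF _ _ (ltW h0) (fun y _ => dFP y) (@cF _).
  rewrite in_itv/= F0 sub0r => /andP[c0 ch] E; exists c. by rewrite !ler0_norm ?lerN2// ltW.
  by rewrite -[LHS]opprB E mulrN opprK mulrC.
Qed.

Lemma sm_MVT f : smooth f -> forall z v (h : R),
  exists2 c : R, `|c| <= `|h| & f (z + h *: v) - f z = h * 'D_v f (z + c *: v).
Proof. by move=> sf z v h; apply: line_MVT => y; exact: sm_dv. Qed.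

Lemma harmonic_cvg0 (c : nat -> R) v : (forall n, `|c n| <= n.+1%:R^-1) ->
  c n *: v @[n --> \oo] --> (0 : V).
Proof.
move=> cn; rewrite -[X in _ --> X](scale0r v); apply: cvgZr_tmp.
apply/norm_cvg0P; apply: (@squeeze_cvgr _ _ _ _ (cst 0) (fun n => n.+1%:R^-1)).
- by apply: nearW => n /=; rewrite normr_ge0 cn.
- exact: cvg_cst.
- exact: cvg_harmonic.
Qed.

(** The derivative as a limit along the steps 1/(n+1), the form in which dominated convergence can
    use it. The mean value theorem writes each quotient as a derivative at a nearby point. *)
Lemma derive_seq f x v : (forall x, derivable f x v) -> continuous ('D_v f) ->
  n.+1%:R * (f (x + n.+1%:R^-1 *: v) - f x) @[n --> \oo] --> 'D_v f x.
Proof.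
move=> df cf. have /choice[c Hc] : forall n : nat, exists c : R, `|c| <= n.+1%:R^-1 /\
    n.+1%:R * (f (x + n.+1%:R^-1 *: v) - f x) = 'D_v f (x + c *: v).
  move=> n; have [c c1 c2] := line_MVT x n.+1%:R^-1 df. exists c; split; first by rewrite (le_trans c1)// ger0_norm.
  by rewrite c2 mulrA divff ?mul1r// pnatr_eq0.
rewrite (_ : (fun _ => _) = (fun n => 'D_v f (x + c n *: v))); last first. by apply/funext => n; have [] := Hc n.
suff H : x + c n *: v @[n --> \oo] --> x by exact: (cvg_comp _ _ H (cf x)).
rewrite -[X in _ --> X]addr0; apply: cvgD; first exact: cvg_cst. by apply: harmonic_cvg0 => n; have [] := Hc n.
Qed.

(** Linearity in the direction comes from continuity of the directional derivatives: the increment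
    along v + a w is split at x + v/(n+1), the mean value theorem treats the leg along w, and
    continuity of ['D_w f] gives the limit. *)
Lemma derive_dirDZ f x v w (a : R) : smooth f ->
  'D_(v + a *: w) f x = 'D_v f x + a * 'D_w f x.
Proof.
move=> sf; have df u y := @sm_dv f u y sf. have cD u := sm_cont (sm_D u sf).
have /choice[c Hc] : forall n : nat, exists c : R, `|c| <= `|a| * n.+1%:R^-1 /\
    n.+1%:R * (f (x + n.+1%:R^-1 *: (v + a *: w)) - f (x + n.+1%:R^-1 *: v)) =
      a * 'D_w f (x + n.+1%:R^-1 *: v + c *: w).
  move=> n; have [c c1 c2] := line_MVT (x + n.+1%:R^-1 *: v) (n.+1%:R^-1 * a) (df w).
  exists c; split; first by rewrite (le_trans c1)// normrM mulrC [`|_^-1|]ger0_norm.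
  rewrite scalerDr scalerA addrA c2 !mulrA divff ?mul1r// pnatr_eq0//.
have l1 := @derive_seq f x _ (df (v + a *: w)) (cD _). have l2 := @derive_seq f x _ (df v) (cD _).
have c0 : c n *: w @[n --> \oo] --> (0 : V). rewrite -[X in _ --> X](scale0r w); apply: cvgZr_tmp.
  apply/norm_cvg0P; apply: (@squeeze_cvgr _ _ _ _ (cst 0) (fun n => `|a| * n.+1%:R^-1)).
  - by apply: nearW => n /=; rewrite normr_ge0 (Hc n).1.
  - exact: cvg_cst.
  - by rewrite -[X in _ --> X](mulr0 `|a|); apply: cvgMl_tmp; exact: cvg_harmonic.
have h0 : n.+1%:R^-1 *: v @[n --> \oo] --> (0 : V). by apply: harmonic_cvg0 => n; rewrite ger0_norm.
have l3 : a * 'D_w f (x + n.+1%:R^-1 *: v + c n *: w) @[n --> \oo] --> a * 'D_w f x. apply: cvgMl_tmp.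
  suff H : x + n.+1%:R^-1 *: v + c n *: w @[n --> \oo] --> x. exact: (cvg_comp _ _ H (cD w x)).
  rewrite -[X in _ --> X]addr0 -[X in _ --> X + _]addr0. by apply: cvgD => //; apply: cvgD => //; exact: cvg_cst.
apply: (cvg_unique _ l1) => //. rewrite (_ : (fun _ => _) = (fun n => n.+1%:R * (f (x + n.+1%:R^-1 *: v) - f x) +
    a * 'D_w f (x + n.+1%:R^-1 *: v + c n *: w))); first exact: cvgD.
by apply/funext => n; rewrite -(Hc n).2 -mulrDr; congr (_ * _); lra.
Qed.

Lemma line_FTC f z v (a b : R) : smooth f -> a <= b ->
  \int[leb]_(s in `[a, b]) 'D_v f (z + s *: v) =
  f (z + b *: v) - f (z + a *: v).
Proof.
move=> sf; rewrite le_eqVlt => /predU1P[->|ab]. by rewrite set_itv1 Rintegral_set1 subrr.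
have df y := @sm_dv f v y sf. have cl g : smooth g -> continuous (fun s : R => g (z + s *: v)).
  by move=> sg; apply: line_continuous => y; exact: sm_dv.
rewrite /Rintegral (@continuous_FTC2 _ _ (fun s => f (z + s *: v)))//.
- by apply: cont_subT; exact: (cl _ (@sm_D f v sf)).
- split.
  + by move=> x _; exact: (derive_ex (is_derive_line (df _))).
  + by apply: cvg_at_right_filter; exact: cl.
  + by apply: cvg_at_left_filter; exact: cl.
- move=> x _; rewrite derive1E. exact: (derive_eq (is_derive_line (df _))).
Qed.

End directional_derivatives.

(** * Measurability, periodicity and weak derivatives on the torus *)

Section torus_functions.
Variables (R : realType) (d : nat).

Lemma rV_norm_le (x : 'rV[R]_d) e : 0 <= e -> (forall i, `|x 0 i| <= e) -> `|x| <= e.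
Proof.
move=> e0 xe; rewrite [`|x|]mx_normrE; apply: bigmax_le => // -[a b] _ /=. by rewrite ord1 xe.
Qed.

Lemma rV_coord_le (x : 'rV[R]_d) i : `|x 0 i| <= `|x|.
Proof.
rewrite [leRHS]mx_normrE. exact: (@le_bigmax _ _ _ 0 (fun ij : 'I_1 * 'I_d => `|x ij.1 ij.2|) (0, i)).
Qed.

Lemma finite_setI_mfun dT (T : measurableType dT) (A : 'I_d -> set T) :
  (forall i, measurable (A i)) -> measurable [set x | forall i, A i x].
Proof.
move=> mA; rewrite (_ : [set x | _] = \bigcap_(i in [set: 'I_d]) A i). by apply: fin_bigcap_measurable.
by apply/seteqP; split=> [x Ax i _|x Ax i]; exact: Ax.
Qed.

Lemma mfun_floor_fiber dT (T : measurableType dT) (f : T -> R) (n : R) (k : int) :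
  mfun f -> measurable [set x | Num.floor (n * f x) = k].
Proof.
move=> mf; rewrite (_ : [set x | _] = setT `&` (fun x => n * f x) @^-1` `[k%:~R, (k + 1)%:~R[).
  apply: mfunM => //; exact: mcst. rewrite setTI; apply/seteqP; split => x /=; rewrite in_itv/=.
  by move=> <-; exact: floor_itv. exact: floor_def.
Qed.

Definition same_cell (n : nat) (w w' : ST R d) : Prop :=
  Num.floor (n%:R * w.1) = Num.floor (n%:R * w'.1) /\
  forall i, Num.floor (n%:R * w.2 0 i) = Num.floor (n%:R * w'.2 0 i).

Definition cell_corner (n : nat) (w : ST R d) : ST R d :=
  ((Num.floor (n%:R * w.1))%:~R / n%:R,
   \row_i ((Num.floor (n%:R * w.2 0 i))%:~R / n%:R)).

Lemma floor_corner (n : nat) (z : R) : (0 < n)%N ->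
  Num.floor ((n%:R : R) * ((Num.floor (n%:R * z))%:~R / n%:R)) = Num.floor (n%:R * z).
Proof.
by move=> n0; rewrite mulrC divfK ?pnatr_eq0 -?lt0n// intrKfloor.
Qed.

(** There are countably many cells, so a preimage is a countable union of cells, and a cell is a
    finite intersection of coordinate conditions. *)
Lemma grid_mfun (n : nat) (f : ST R d -> R) : (0 < n)%N ->
  (forall w w', same_cell n w w' -> f w = f w') ->
  jmfun f.
Proof.
move=> n0 fn _ Y mY; rewrite setTI. pose h (w : mST R d) : int * 'rV[int]_d :=
  (Num.floor (n%:R * w.1), \row_i Num.floor (n%:R * w.2 0 i)). pose F (m : nat) : set (mST R d) :=
  [set w | pickle (h w) = m /\ Y (f w)]. have -> : f @^-1` Y = \bigcup_m F m.
  by apply/seteqP; split => [w Yw|w [m _ []//]]; exists (pickle (h w)). apply: bigcup_measurable => m _.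
have [[w [wm Yw]]|nE] := pselect (exists w, F m w); last first.
  rewrite (_ : F m = set0)//; apply/seteqP; split => // w Fw; apply: nE; by exists w.
rewrite (_ : F m = [set w' : mST R d | Num.floor (n%:R * w'.1) = Num.floor (n%:R * w.1)] `&`
    [set w' : mST R d | forall i, Num.floor (n%:R * w'.2 0 i) = Num.floor (n%:R * w.2 0 i)]). apply: measurableI.
  - by apply: mfun_floor_fiber; exact: mfst.
  - apply: finite_setI_mfun => i. apply: (@mfun_floor_fiber _ _ (fun w' : mST R d => w'.2 0 i)).
    exact: (mcomp (@mcoord R d i) msnd). apply/seteqP; split => w'.
- move=> [w'm _]; have [E1 /rowP E2] : h w' = h w. by apply: (pcan_inj pickleK); rewrite w'm wm.
  by split => //= i; have := E2 i; rewrite !mxE.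
- move=> [/= E1 E2]; split. by rewrite -wm; congr pickle; rewrite /h E1; congr pair; apply/rowP => i; rewrite !mxE.
  by rewrite (fn _ w).
Qed.

Lemma cell_corner_dist (n : nat) (z : R) :
  `|z - (Num.floor (n.+1%:R * z))%:~R / n.+1%:R| <= n.+1%:R^-1.
Proof.
have n0 : 0 < n.+1%:R :> R by []. have /andP[h1 h2] := floor_itv (n.+1%:R * z).
rewrite -(ler_pM2l n0) -[X in X * `|_|]gtr0_norm// -normrM mulrBr [_ * (_ / _)]mulrCA.
rewrite !divff ?mulr1 ?gt_eqF// ger0_norm ?subr_ge0// lerBlDl. by move: h2; rewrite intrD1 => /ltW.
Qed.

Lemma cell_corner_cvg (w : ST R d) : cell_corner n.+1 w @[n --> \oo] --> w.
Proof.
have H (V : normedModType R) (u : nat -> V) (l : V) : (forall n, `|l - u n| <= n.+1%:R^-1) -> u n @[n --> \oo] --> l.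
  move=> ul; apply/subr_cvg0/norm_cvg0P. apply: (@squeeze_cvgr _ _ _ _ (cst 0) (fun n => n.+1%:R^-1)).
  - by apply: nearW => n /=; rewrite normr_ge0 distrC ul.
  - exact: cvg_cst.
  - exact: cvg_harmonic. case: w => t x; apply: H => n; rewrite [`|_|]prod_normE ge_max cell_corner_dist/=.
apply: rV_norm_le => // i; rewrite !mxE; exact: cell_corner_dist.
Qed.

(** The sigma-algebra is generated by the coordinates, not by the open sets. Evaluating [f] at the
    corner of the cell of mesh 1/(n+1) gives grid functions, which converge to [f] pointwise by
    continuity. *)
Lemma cont_mfun2 (f : ST R d -> R) : continuous f ->
  jmfun f.
Proof.
move=> cf; apply: (@measurable_fun_cvg _ _ _ _ (fun n => f \o cell_corner n.+1)).
- move=> n; apply: (@grid_mfun n.+1) => // w w' [E1 E2] /=. rewrite /cell_corner E1; congr (f (_, _)).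
  by apply/rowP => i; rewrite !mxE E2.
- by move=> w _; exact: (cvg_comp _ _ (@cell_corner_cvg w) (cf w)).
Qed.

Lemma comp_snd_continuous (f : 'rV[R]_d -> R) :
  continuous f -> continuous (fun w : ST R d => f w.2).
Proof.
move=> cf [t x]; have h : (snd : ST R d -> 'rV[R]_d) y @[y --> (t, x)] --> x. exact: cvg_snd.
exact: (cvg_comp _ _ h (cf x)).
Qed.

Lemma cont_meas (f : 'rV[R]_d -> R) : continuous f ->
  mfun f.
Proof.
move=> cf; rewrite (_ : f = (fun w : mST R d => f w.2) \o pair (0 : R))//. apply: mcomp; last exact: mpair1.
by apply: cont_mfun2; exact: comp_snd_continuous.
Qed.

Lemma sm_mfun (f : 'rV[R]_d -> R) : smooth f -> mfun f.
Proof. by move=> /sm_cont/cont_meas. Qed.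

Definition step (n : nat) (f : 'rV[R]_d -> R) := forall x y : 'rV[R]_d,
  (forall i, Num.floor (n%:R * x 0 i) = Num.floor (n%:R * y 0 i)) -> f x = f y.

Lemma step_mfun n (f : 'rV[R]_d -> R) : (0 < n)%N -> step n f -> mfun f.
Proof.
move=> n0 sf; rewrite (_ : f = (fun w : mST R d => f w.2) \o pair (0 : R))//. apply: mcomp; last exact: mpair1.
by apply: (@grid_mfun n) => // w w' [_ ?]; exact: sf.
Qed.

Lemma periodic_bounded2 (f : ST R d -> R) (a b : R) : continuous f ->
  (forall t, Zper (fun x => f (t, x))) ->
  exists2 M : R, 0 <= M & forall t x, a <= t <= b -> `|f (t, x)| <= M.
Proof.
move=> cf pf. pose K : set (ST R d) := `[a, b] `*` [set v : 'rV[R]_d | forall i, `[0, 1]%classic (v ord0 i)].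
have cK : compact K. apply: compact_setX; first exact: segment_compact.
  exact: (@rV_compact R d (fun=> `[0, 1]%classic) (fun=> @segment_compact _ _ _)).
have : compact (f @` K) by apply: continuous_compact => //; exact: cont_subT. move/compact_bounded => [M0 [_ HM]].
exists (`|M0| + 1) => [|t x tab]; first by rewrite addr_ge0.
have := HM (`|M0| + 1); rewrite ltr_pwDr ?ler_norm// => /(_ isT) /=; apply.
exists (t, x + map_mx intr (\row_i - Num.floor (x 0 i))); last by rewrite (pf t).
split => /=; first by rewrite in_itv. move=> i; rewrite !mxE in_itv/= intrN subr_ge0 floor_le/= lerBlDl.
by have := floorD1_gt (x 0 i); rewrite intrD1 addrC => /ltW; rewrite addrC.
Qed.

Lemma Zper_bounded (f : 'rV[R]_d -> R) : continuous f -> Zper f ->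
  exists2 M : R, 0 <= M & forall x, `|f x| <= M.
Proof.
move=> cf pf; have [| |M M0 fM] := @periodic_bounded2 (fun w => f w.2) 0 0.
- exact: comp_snd_continuous.
- by [].
- by exists M => // x; apply: (fM 0); rewrite lexx.
Qed.

Lemma haar_ltoo : (torus_measure R d setT < +oo)%E.
Proof. by rewrite prob_setT ltry. Qed.

Lemma haar_bnd (f : 'rV[R]_d -> R) (M : R) :
  mfun f -> (forall x, setT x -> `|f x| <= M) -> hL1 f.
Proof. by move=> mf fM; exact: (bnd_int measurableT haar_ltoo mf fM). Qed.

Lemma torus_shear (j : 'I_d) (s f : 'rV[R]_d -> R) :
  mfun s -> (forall z x, s (setc j z x) = s x) ->
  mfun f -> Zper f ->
  \int[haar]_x f (x + s x *: 'e_j) = \int[haar]_x f x.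
Proof.
move=> ms sj mf pf; rewrite /Rintegral; congr fine. rewrite integralE [RHS]integralE.
have mEf : mfun (EFin \o f) by exact/mEFinP. congr (_ - _)%E.
- rewrite -[RHS](@ge0_torus_shear _ _ j s)//.
  + by apply: eq_integral => x _; rewrite !funeposE.
  + exact: measurable_funepos.
  + by move=> x k; rewrite !funeposE /= pf.
- rewrite -[RHS](@ge0_torus_shear _ _ j s)//.
  + by apply: eq_integral => x _; rewrite !funenegE.
  + exact: measurable_funeneg.
  + by move=> x k; rewrite !funenegE /= pf.
Qed.

Lemma torus_translate (j : 'I_d) (s : R) (f : 'rV[R]_d -> R) :
  mfun f -> Zper f ->
  \int[haar]_x f (x + s *: 'e_j) = \int[haar]_x f x.
Proof. by move=> mf pf; exact: (@torus_shear j (cst s)). Qed.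

Lemma mfun_translate (j : 'I_d) (s : R) (f : 'rV[R]_d -> R) :
  mfun f -> mfun (fun x : 'rV[R]_d => f (x + s *: 'e_j)).
Proof.
move=> mf; apply: (mcomp mf). by apply: (@mfun_shift_coord _ _ j (cst s)); exact: mcst.
Qed.

Lemma Zper_shift (T : Type) (f : 'rV[R]_d -> T) v : Zper f ->
  Zper (fun x => f (x + v)).
Proof. by move=> pf x k; rewrite addrAC pf. Qed.

Lemma periodic_D (f : 'rV[R]_d -> R) v : Zper f -> Zper ('D_v f).
Proof.
move=> pf x k; rewrite /derive.
have -> : (fun h : R => h^-1 *: ((f \o shift (x + map_mx intr k)) (h *: v) - f (x + map_mx intr k)))
    = (fun h : R => h^-1 *: ((f \o shift x) (h *: v) - f x)). by apply/funext => h /=; rewrite addrA !pf. by [].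
Qed.

(* Right difference quotients suffice: they are exactly adjoint to left ones. *)
Lemma weak_partial_quotient (j : 'I_d) (f g : 'rV[R]_d -> R) (M L : R) :
  Zper f -> mfun f -> (forall x, `|f x| <= M) ->
  (forall n (x : 'rV[R]_d), `|n.+1%:R * (f (x + n.+1%:R^-1 *: 'e_j) - f x)| <= L) ->
  (forall x : 'rV[R]_d, n.+1%:R * (f (x + n.+1%:R^-1 *: 'e_j) - f x) @[n --> \oo] --> g x) ->
  weak_partial j f g.
Proof.
move=> pf mf fM fL fg psi spsi ppsi. have cpsi := sm_cont spsi. have mpsi := cont_meas cpsi.
have [P P0 psiP] := Zper_bounded cpsi ppsi. have cD := sm_cont (@sm_D _ _ _ ('e_j) spsi).
have dpsi y := @sm_dv _ _ psi ('e_j) y spsi. have [Q Q0 DQ] := Zper_bounded cD (@periodic_D psi _ ppsi).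
have mT : measurable [set: 'rV[R]_d] by exact: measurableT. have mtr n (h : 'rV[R]_d -> R) : mfun h ->
    mfun (fun x : 'rV[R]_d => n.+1%:R * (h (x + n.+1%:R^-1 *: 'e_j) - h x)).
  move=> mh; apply: mfunM; first exact: mcst. by apply: mfunB => //; exact: mfun_translate.
have psiL n x : `|n.+1%:R * (psi (x + n.+1%:R^-1 *: 'e_j) - psi x)| <= Q. have [c _ ->] := line_MVT x n.+1%:R^-1 dpsi.
  by rewrite mulrA divff ?mul1r ?pnatr_eq0.
have l1 : \int[haar]_x (f x * (n.+1%:R * (psi (x + n.+1%:R^-1 *: 'e_j) - psi x)))
    @[n --> \oo] --> \int[haar]_x (f x * 'D_('e_j) psi x).
  apply: (@Rintegral_cvg _ _ _ haar _ mT haar_ltoo _ _ (M * Q)).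
  - by move=> n; apply: mfunM => //; exact: mtr.
  - by move=> n x _; rewrite normrM ler_pM.
  - by move=> x _; apply: cvgMl_tmp; exact: derive_seq.
have l2 : \int[haar]_x ((n.+1%:R * (f (x + n.+1%:R^-1 *: 'e_j) - f x)) *
      psi (x + n.+1%:R^-1 *: 'e_j)) @[n --> \oo] --> \int[haar]_x (g x * psi x).
  apply: (@Rintegral_cvg _ _ _ haar _ mT haar_ltoo _ _ (L * P)).
  - move=> n; apply: mfunM => //; first exact: mtr. exact: mfun_translate.
  - by move=> n x _; rewrite normrM ler_pM.
  - move=> x _; apply: cvgM; first exact: fg.
    suff H : x + n.+1%:R^-1 *: 'e_j @[n --> \oo] --> x by exact: (cvg_comp _ _ H (cpsi x)).
    rewrite -[X in _ --> X]addr0; apply: cvgD; first exact: cvg_cst. by apply: harmonic_cvg0 => n; rewrite ger0_norm.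
have bi (h : 'rV[R]_d -> R) K : mfun h -> (forall x, `|h x| <= K) -> hL1 (h).
  by move=> mh hK; apply: (bnd_int mT haar_ltoo mh (M := K)).
have E n : \int[haar]_x (f x * (n.+1%:R * (psi (x + n.+1%:R^-1 *: 'e_j) - psi x))) =
   - \int[haar]_x ((n.+1%:R * (f (x + n.+1%:R^-1 *: 'e_j) - f x)) * psi (x + n.+1%:R^-1 *: 'e_j)).
  set h := n.+1%:R^-1. have mfp : mfun (fun x => f x * psi x) by exact: mfunM. have ifp : hL1 (fun x => f x * psi x).
    by apply: (bi _ (M * P)) => // x; rewrite normrM ler_pM.
  have ifp' : hL1 (fun x => f (x + h *: 'e_j) * psi (x + h *: 'e_j)).
    apply: (bi _ (M * P)) => [|x]; last by rewrite normrM ler_pM. exact: (mfun_translate j h mfp).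
  have ifg : hL1 (fun x => f x * psi (x + h *: 'e_j)). apply: (bi _ (M * P)) => [|x]; last by rewrite normrM ler_pM.
    by apply: mfunM => //; exact: mfun_translate.
  have -> : (fun x => f x * (n.+1%:R * (psi (x + h *: 'e_j) - psi x))) =
      (fun x => n.+1%:R * (f x * psi (x + h *: 'e_j) - f x * psi x)). by apply/funext => x; ring.
  have -> : (fun x => n.+1%:R * (f (x + h *: 'e_j) - f x) * psi (x + h *: 'e_j)) =
      (fun x => n.+1%:R * (f (x + h *: 'e_j) * psi (x + h *: 'e_j) - f x * psi (x + h *: 'e_j))).
    by apply/funext => x; ring. rewrite !RintZl//; last 2 first.
  - exact: (@integrableB _ _ _ _ _ mT _ _ ifp' ifg).
  - exact: (@integrableB _ _ _ _ _ mT _ _ ifg ifp). rewrite !RintB//.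
  have -> : \int[haar]_x (f (x + h *: 'e_j) * psi (x + h *: 'e_j)) = \int[haar]_x (f x * psi x).
    apply: (@torus_translate j h (fun x => f x * psi x)) => //. by move=> x k; rewrite pf ppsi. ring.
apply: (cvg_unique _ l1) => //. rewrite (funext E); exact: cvgN.
Qed.

End torus_functions.
Arguments periodic_D {R d f} v pf.

(** * Piecewise linear interpolation *)

Section piecewise_linear.
Variable R : realType.
Implicit Types (a : int -> R) (s h : R).

(** Linear interpolation of the values [a z] prescribed at the integers z. *)
Definition pl a s : R :=
  a (Num.floor s) + (a (Num.floor s + 1) - a (Num.floor s)) * (s - (Num.floor s)%:~R).

Lemma frac_itv s : 0 <= s - (Num.floor s)%:~R < 1.
Proof.
have /andP[h1 h2] := floor_itv s; rewrite subr_ge0 h1 /= ltrBlDl. by move: h2; rewrite intrD1.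
Qed.

Lemma pl_bound a s : (forall z, 0 <= a z <= 1) -> 0 <= pl a s <= 1.
Proof.
move=> a01; rewrite /pl; have /andP[] := frac_itv s.
have /andP[] := a01 (Num.floor s); have /andP[] := a01 (Num.floor s + 1).
set u := a _; set v := a _; set f := s - _ => u0 u1 v0 v1 f0 f1.
have : 0 <= (1 - f) * v /\ 0 <= f * u /\ 0 <= (1 - f) * (1 - v) /\ 0 <= f * (1 - u).
  by rewrite !mulr_ge0// subr_ge0// ltW. lra.
Qed.

Lemma floor_addr_lt1 s h : 0 <= h -> h < 1 ->
  Num.floor (s + h) = Num.floor s \/ Num.floor (s + h) = Num.floor s + 1.
Proof.
move=> h0 h1; have /andP[f1 f2] := floor_itv s; rewrite intrD1 in f2.
have [sh|sh] := ltP (s + h) ((Num.floor s)%:~R + 1).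
- by left; apply: floor_def; rewrite intrD1 sh andbT (le_trans f1)// lerDl.
- by right; apply: floor_def; rewrite !intrD1 sh /=; lra.
Qed.

Lemma pl_lip a s h : (forall z, 0 <= a z <= 1) -> 0 <= h ->
  `|pl a (s + h) - pl a s| <= h.
Proof.
move=> a01 h0; have [h1|h1] := leP 1 h. have := pl_bound (s + h) a01; have := pl_bound s a01; rewrite ler_norml; lra.
have /andP[f0 f1] := frac_itv s; have /andP[g0 g1] := frac_itv (s + h). have dz z : `|a (z + 1) - a z| <= 1.
  by have := a01 z; have := a01 (z + 1); rewrite ler_norml; lra.
rewrite /pl; have [E|E] := floor_addr_lt1 s h0 h1; rewrite E in g0 g1 *.
- rewrite [X in `|X|](_ : _ = (a (Num.floor s + 1) - a (Num.floor s)) * h); last by ring.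
  by rewrite normrM (ger0_norm h0) ler_piMl.
- move: g0 g1; rewrite intrD1 => g0 g1. set z := Num.floor s in f0 f1 g0 g1 *.
  rewrite [X in `|X|](_ : _ = (a (z + 1) - a z) * (1 - (s - z%:~R)) +
    (a (z + 1 + 1) - a (z + 1)) * (s + h - (z%:~R + 1))); last by ring. rewrite (le_trans (ler_normD _ _))// !normrM.
  rewrite [leRHS](_ : h = (1 - (s - z%:~R)) + (s + h - (z%:~R + 1))); last by ring. rewrite lerD//.
    by rewrite [X in _ * X <= _]ger0_norm ?ler_piMl// subr_ge0 ltW. by rewrite [X in _ * X <= _]ger0_norm ?ler_piMl.
Qed.

(** The quotients are eventually constant: a small step to the right stays in the same cell. Right
    quotients therefore have a limit at every point, the nodes included. *)
Lemma pl_quotient_cvg a (kappa : nat) (y : R) : (0 < kappa)%N ->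
  n.+1%:R * (pl a (kappa%:R * (y + n.+1%:R^-1)) - pl a (kappa%:R * y)) @[n --> \oo] -->
  kappa%:R * (a (Num.floor (kappa%:R * y) + 1) - a (Num.floor (kappa%:R * y))).
Proof.
move=> k0; apply: cvg_near_cst. have /andP[_ f1] := frac_itv (kappa%:R * y).
have e0 : 0 < (1 - (kappa%:R * y - (Num.floor (kappa%:R * y))%:~R)) / kappa%:R. by rewrite divr_gt0 ?ltr0n// subr_gt0.
have nI := near_infty_natSinv_lt (PosNum e0). near=> n.
have : n.+1%:R^-1 < (1 - (kappa%:R * y - (Num.floor (kappa%:R * y))%:~R)) / kappa%:R. by near: n.
rewrite ltr_pdivlMr ?ltr0n// => hn. have E : Num.floor (kappa%:R * (y + n.+1%:R^-1)) = Num.floor (kappa%:R * y).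
  apply: floor_def; rewrite intrD1 mulrDr. have /andP[h1 h2] := floor_itv (kappa%:R * y).
  have h3 : 0 <= kappa%:R * n.+1%:R^-1 :> R by rewrite mulr_ge0.
  apply/andP; split; first by rewrite (le_trans h1)// lerDl.
  set F := (Num.floor _)%:~R in hn *; set A := _ * y in hn *. have -> : F + 1 = A + (1 - (A - F)) by ring.
  by rewrite ltrD2l mulrC. rewrite /pl E; set z := Num.floor _; set b := a _; set c := a _.
rewrite mulrDr; have := @divff R n.+1%:R; rewrite pnatr_eq0 => /(_ isT) dn.
transitivity (kappa%:R * (c - b) * (n.+1%:R / n.+1%:R)); first by ring. by rewrite dn mulr1.
Unshelve. all: by end_near. Qed.

Lemma floorM_addrz (m : nat) (y : R) (k : int) :
  Num.floor (m%:R * (y + k%:~R)) = Num.floor (m%:R * y) + m%:Z * k.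
Proof.
rewrite mulrDr (_ : m%:R * k%:~R = (m%:Z * k)%:~R); last by rewrite intrM. by rewrite floorDrz ?intrKfloor// intr_int.
Qed.

Lemma periodic_intZ (T : Type) (m : nat) (f : int -> T) :
  (forall z, f (z + m%:Z) = f z) -> forall z k, f (z + m%:Z * k) = f z.
Proof.
move=> pf z; case=> n. elim: n => [|n IH]; first by rewrite mulr0 addr0.
  by rewrite -addn1 PoszD mulrDr mulr1 addrA pf IH.
rewrite NegzE; elim: n z => [|n IH] z; first by rewrite mulrN1 -[LHS]pf subrK.
by rewrite -[RHS](IH z) -[LHS]pf; congr f; rewrite -addn1 PoszD; ring.
Qed.

Lemma pl_periodic a (m : nat) (y : R) (k : int) : (forall z, a (z + m%:Z) = a z) ->
  pl a (m%:R * (y + k%:~R)) = pl a (m%:R * y).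
Proof.
move=> pa; rewrite /pl floorM_addrz. rewrite addrAC !(periodic_intZ pa); congr (_ + _ * _).
by rewrite mulrDr intrD intrM /=; ring.
Qed.

End piecewise_linear.

(** * Proportion of selected cells *)

Section cell_volume.
Variables (R : realType) (d : nat).

Lemma mfun_floorM (m : nat) (f : int -> \bar R) :
  mfun (fun z : mR R => f (Num.floor (m%:R * z))).
Proof.
move=> _ Y mY; rewrite setTI. rewrite (_ : _ @^-1` Y = \bigcup_n [set z : mR R |
    pickle (Num.floor (m%:R * z)) = n /\ Y (f (Num.floor (m%:R * z)))]). apply: bigcup_measurable => n _.
  have [[z [zn Yz]]|nE] := pselect (exists z : mR R,
      pickle (Num.floor (m%:R * z)) = n /\ Y (f (Num.floor (m%:R * z)))); last first.
    rewrite (_ : [set z | _] = set0)//; apply/seteqP; split => // z Fz; apply: nE; by exists z.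
  rewrite (_ : [set z | _] = [set z' : mR R | Num.floor (m%:R * z') = Num.floor (m%:R * z)]).
    exact: (@mfun_floor_fiber R _ (mR R) id). apply/seteqP; split => z' /=; last by move=> ->.
  by move=> [z'n _]; apply: (pcan_inj pickleK); rewrite z'n zn.
by apply/seteqP; split => [z Yz|z [n _ []//]]; exists (pickle (Num.floor (m%:R * z))).
Qed.

Lemma lebesgue_cells (m : nat) (f : int -> \bar R) : (0 < m)%N ->
  (forall z, 0 <= f z)%E ->
  (\int[unif]_z f (Num.floor (m%:R * z)%R) =
   (m%:R^-1)%:E * \sum_(i < m) f i%:Z)%E.
Proof.
move=> m0 f0. have mf := mfun_floorM m f. rewrite unifE// -integral_itv_bndo_bndc; last exact: (mfunTS mf).
have m0' : 0 < m%:R :> R by rewrite ltr0n.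
suff H : forall i : nat, (\int[leb]_(z in `[0%R, (i%:R / m%:R)%R[) f (Num.floor (m%:R * z)%R) =
    (m%:R^-1)%:E * \sum_(i < i) f i%:Z)%E. by rewrite -H divff// gt_eqF.
elim=> [|i IH]; first by rewrite mul0r set_itvco0 integral_set0 big_ord0 mule0.
rewrite (@itv_bndbnd_setU _ _ (BLeft 0%R) (BLeft (i%:R / m%:R)) (BLeft (i.+1%:R / m%:R))) ?bnd_simp; last 2 first.
- by [].
- by rewrite ler_pM2r ?invr_gt0// ler_nat. rewrite ge0_integral_setU//; last 2 first.
- exact: (mfunTS mf).
- apply/disj_setPRL => x /=; rewrite !in_itv/= => /andP[bx _]. by apply/negP; rewrite negb_and -!leNgt bx orbT.
rewrite IH big_ord_recr/= ge0_muleDr//; last by apply: sume_ge0. congr (_ + _)%E.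
rewrite (eq_integral (cst (f i%:Z))); last first.
  move=> x; rewrite inE/= in_itv/= ler_pdivrMr// ltr_pdivlMr// => /andP[h1 h2].
  congr f; apply: floor_def; rewrite intrD1 mulrC h1 /=. by move: h2; rewrite -natr1.
rewrite integral_cst// [X in (_ * X)%E](_ : _ = (m%:R^-1)%:E); first by rewrite muleC.
apply: (etrans (@leb_itv R `[i%:R / m%:R, i.+1%:R / m%:R[)). rewrite /= lte_fin ltr_pM2r ?invr_gt0// ltr_nat ltnSn.
by rewrite -EFinB -mulrBl -natr1 addrAC subrr add0r mul1r.
Qed.

Lemma ge0_torus_cells (l : 'I_d) (m : nat) (f : int -> \bar R) : (0 < m)%N ->
  (forall z, 0 <= f z)%E ->
  (\int[haar]_x f (Num.floor (m%:R * x 0 l)%R) =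
   (m%:R^-1)%:E * \sum_(i < m) f i%:Z)%E.
Proof.
move=> m0 f0; rewrite (ge0_resample l)//; last first. apply: (mcomp (mfun_floorM m f)). exact: mcoord.
rewrite (eq_integral (cst ((m%:R^-1)%:E * \sum_(i < m) f i%:Z)%E)); last first.
  move=> x _; rewrite -lebesgue_cells//; apply: eq_integral => z _. by rewrite setcE eqxx. rewrite integral_cst//.
by rewrite [X in (_ * X)%E](_ : _ = 1%E) ?mule1//; exact: prob_setT.
Qed.

(** The fraction of the [m] cells of [0,1[ selected by [e], that is, the measure of their union. *)
Definition density (m : nat) (e : int -> bool) : R := m%:R^-1 * \sum_(i < m) (e i%:Z)%:R.

Lemma density_ge0 m e : 0 <= density m e.
Proof. by rewrite mulr_ge0// sumr_ge0. Qed.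

Lemma density_le1 m e : density m e <= 1.
Proof.
rewrite /density; case: m => [|m]; first by rewrite big_ord0 mulr0.
rewrite ler_pdivrMl// mulr1 -[leRHS]mulr_natr mul1r -[X in X%:R]card_ord -sumr_const.
by apply: ler_sum => i _; rewrite lern1 leq_b1.
Qed.

Lemma density_true m : (0 < m)%N -> density m xpredT = 1.
Proof.
move=> m0; rewrite /density sumr_const card_ord mulVf// pnatr_eq0 -lt0n//.
Qed.

Lemma torus_density (l : 'I_d) (m : nat) (e : int -> bool) (c : R) : (0 < m)%N -> 0 <= c ->
  (\int[haar]_x (c * (e (Num.floor (m%:R * x 0 l)))%:R)%:E = (c * density m e)%:E)%E.
Proof.
move=> m0 c0; rewrite (@ge0_torus_cells l m (fun z => (c * (e z)%:R)%:E))//; last first.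
  by move=> z; rewrite lee_fin mulr_ge0. by rewrite sumEFin -EFinM -mulr_sumr mulrCA.
Qed.

Lemma sum_ord_mul (a b : nat) (f : nat -> R) :
  \sum_(i < a * b) f i = \sum_(i < a) \sum_(j < b) f (i * b + j)%N.
Proof.
elim: a => [|a IH]; first by rewrite mul0n !big_ord0. rewrite big_ord_recr/= -IH -!(big_mkord xpredT) mulSnr.
rewrite (@big_cat_nat _ _ _ (a * b))//= ?leq_addr//; congr (_ + _).
by rewrite -{1}[(a * b)%N]add0n big_addn addKn big_mkord; apply: eq_bigr => i _; rewrite addnC.
Qed.

(* [z %/ (Q c)] is the coarse cell and [z mod Q] the piece of the fine cell z. *)
Lemma density_refine (n c Q r : nat) (e : int -> bool) : (0 < n)%N -> (0 < c)%N ->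
  (r <= Q)%N -> (0 < Q)%N ->
  density (n * (c * Q)) (fun z => e (divz z (c * Q)%:Z) && (modz z Q%:Z < r%:Z)) =
  r%:R / Q%:R * density n e.
Proof.
move=> n0 c0 rQ Q0; rewrite /density.
rewrite (sum_ord_mul n (c * Q) (fun z : nat => (e (divz z%:Z (c * Q)%:Z) && (modz z%:Z Q%:Z < r%:Z))%:R)).
have cQ0 : (0 < c * Q)%N by rewrite muln_gt0 c0.
have -> : \sum_(i < n) \sum_(j < c * Q) (e (divz (i * (c * Q) + j)%N%:Z (c * Q)%:Z) &&
    (modz (i * (c * Q) + j)%N%:Z Q%:Z < r%:Z))%:R = \sum_(i < n) ((c * r)%:R * (e i%:Z)%:R) :> R.
  apply: eq_bigr => i _. transitivity ((e i%:Z)%:R * \sum_(j < c * Q) ((modz j%:Z Q%:Z < r%:Z)%R : bool)%:R : R).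
    rewrite mulr_sumr; apply: eq_bigr => j _. rewrite divz_nat divnMDl// divn_small// addn0 !modz_nat mulnA modnMDl.
    by rewrite -natrM mulnb. rewrite mulrC; congr (_ * _).
  rewrite (sum_ord_mul c Q (fun z : nat => ((modz z%:Z Q%:Z < r%:Z)%R : bool)%:R)).
  under eq_bigr => i' _ do under eq_bigr => j _ do rewrite modz_nat modnMDl modn_small// ltz_nat.
  rewrite (eq_bigr (fun=> r%:R)) ?sumr_const ?card_ord ?natrM ?mulr_natl// => i' _. rewrite -natr_sum; congr (_%:R).
  by rewrite -(subnKC rQ) big_split_ord/= (eq_bigr (fun=> 1%N)) => [|j _]; rewrite ?ltn_ord//
     sum_nat_const card_ord muln1 big1 ?addn0// => j _; rewrite ltnNge leq_addr. rewrite -mulr_sumr !natrM.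
have nz k : (0 < k)%N -> k%:R != 0 :> R by rewrite pnatr_eq0 -lt0n. by field; rewrite !nz.
Qed.

End cell_volume.

(** * Cell indices at two nested meshes *)

Section cells.
Variable R : realType.
Implicit Types (y : R) (m M kappa : nat) (z : int).

Lemma modz_bounds z kappa : (0 < kappa)%N -> 0 <= modz z kappa%:Z < kappa%:Z.
Proof. by move=> k0; rewrite modz_ge0 ?ltz_pmod// -lt0n. Qed.

Lemma divz_modz_unique (q r : int) kappa : (0 < kappa)%N -> 0 <= r < kappa%:Z ->
  divz (q * kappa%:Z + r) kappa%:Z = q /\ modz (q * kappa%:Z + r) kappa%:Z = r.
Proof.
move=> k0 /andP[r0 rk]; have kn : kappa%:Z != 0 by rewrite -lt0n.
by rewrite divzMDl// modzMDl divz_small ?modz_small ?addr0// r0//= gtz0_abs// ltz_nat.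
Qed.

Lemma floor_divz m kappa y : (0 < kappa)%N ->
  Num.floor (m%:R * y) = divz (Num.floor ((m * kappa)%:R * y)) kappa%:Z.
Proof.
move=> k0; have k0' : 0 < kappa%:R :> R by rewrite ltr0n. apply: floor_def; set z := Num.floor ((m * kappa)%:R * y).
have /andP[h1 h2] := floor_itv ((m * kappa)%:R * y); rewrite -/z in h1 h2. have /andP[r0 r1] := modz_bounds z k0.
have zE := divz_eq z kappa%:Z; set q := divz _ _ in zE *. have E : m%:R * y = (m * kappa)%:R * y / kappa%:R.
  by rewrite natrM mulrAC mulfK// gt_eqF. rewrite E; apply/andP; split.
- rewrite ler_pdivlMr// (le_trans _ h1)//. rewrite (_ : q%:~R * kappa%:R = (q * kappa%:Z)%:~R); last by rewrite intrM.
  by rewrite ler_int zE lerDl.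
- rewrite ltr_pdivrMr// (lt_le_trans h2)//.
  rewrite (_ : (q + 1)%:~R * kappa%:R = ((q + 1) * kappa%:Z)%:~R); last by rewrite intrM.
  by rewrite ler_int {1}zE mulrDl mul1r -addrA lerD2l -ltzD1 ltrD2r.
Qed.

Lemma floor_pred M y : (0 < M)%N ->
  Num.floor (M%:R * (y - M%:R^-1)) = Num.floor (M%:R * y) - 1.
Proof.
move=> M0; rewrite mulrBr divff ?pnatr_eq0 -?lt0n//. have -> : M%:R * y - 1 = M%:R * y + (-1)%:~R by rewrite intrN.
by rewrite floorDrz; [rewrite intrKfloor|exact: intr_int].
Qed.

Lemma modz_pred z kappa : (0 < kappa)%N -> modz z kappa%:Z != 0 ->
  divz (z - 1) kappa%:Z = divz z kappa%:Z /\ modz (z - 1) kappa%:Z = modz z kappa%:Z - 1.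
Proof.
move=> k0 r0; have /andP[r1 r2] := modz_bounds z k0.
have := divz_eq z kappa%:Z; move: r0 r1 r2; set q := divz z _; set r := modz z _.
move=> rn r1 r2 ->; rewrite -addrA; apply: divz_modz_unique => //. by lia.
Qed.

Lemma modz_pred0 z kappa : (0 < kappa)%N -> modz z kappa%:Z = 0 ->
  divz (z - 1) kappa%:Z = divz z kappa%:Z - 1 /\ modz (z - 1) kappa%:Z = kappa%:Z - 1.
Proof.
move=> k0 r0; have zE := divz_eq z kappa%:Z; rewrite r0 addr0 in zE.
rewrite {1 3}zE; have -> : divz z kappa%:Z * kappa%:Z - 1 = (divz z kappa%:Z - 1) * kappa%:Z + (kappa%:Z - 1) by ring.
apply: divz_modz_unique => //. by lia.
Qed.

Lemma floor_pred_same m kappa y : (0 < m)%N -> (0 < kappa)%N ->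
  modz (Num.floor ((m * kappa)%:R * y)) kappa%:Z != 0 ->
  Num.floor (m%:R * (y - (m * kappa)%:R^-1)) = Num.floor (m%:R * y).
Proof.
move=> m0 k0 r0; have mk : (0 < m * kappa)%N by rewrite muln_gt0 m0.
by rewrite !(floor_divz m _ k0) floor_pred// (modz_pred k0 r0).1.
Qed.

Lemma floor_pred_prev m kappa y : (0 < m)%N -> (0 < kappa)%N ->
  modz (Num.floor ((m * kappa)%:R * y)) kappa%:Z = 0 ->
  Num.floor (m%:R * (y - (m * kappa)%:R^-1)) = Num.floor (m%:R * (y - m%:R^-1)).
Proof.
move=> m0 k0 r0; have mk : (0 < m * kappa)%N by rewrite muln_gt0 m0.
by rewrite floor_pred// !(floor_divz m _ k0) floor_pred// (modz_pred0 k0 r0).1.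
Qed.

Lemma modz_addM z (k : int) (m kappa : nat) :
  modz (z + (m * kappa)%:Z * k) kappa%:Z = modz z kappa%:Z.
Proof.
rewrite PoszM (_ : m%:Z * kappa%:Z * k = (m%:Z * k) * kappa%:Z); last by ring. by rewrite addrC modzMDl.
Qed.

Lemma divz_addM z (k : int) (m kappa : nat) : (0 < kappa)%N ->
  divz (z + (m * kappa)%:Z * k) kappa%:Z = divz z kappa%:Z + m%:Z * k.
Proof.
move=> k0; rewrite PoszM (_ : m%:Z * kappa%:Z * k = (m%:Z * k) * kappa%:Z); last by ring.
by rewrite addrC divzMDl 1?addrC// -lt0n.
Qed.

End cells.

Section backward_step.
Variables (R : realType) (d : nat).
Implicit Types (x : 'rV[R]_d) (k : 'I_d).

Definition bwd (M : nat) k x : 'rV[R]_d := x - M%:R^-1 *: 'e_k.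

Lemma bwd_same M k x : bwd M k x 0 k = x 0 k - M%:R^-1.
Proof. by rewrite !mxE !eqxx mulr1. Qed.

Lemma bwd_neq M k x i : i != k -> bwd M k x 0 i = x 0 i.
Proof. by move=> ik; rewrite !mxE eqxx/= (negbTE ik) mulr0 subr0. Qed.

Lemma step_mul m kappa (f : 'rV[R]_d -> R) : (0 < kappa)%N -> step m f -> step (m * kappa) f.
Proof.
by move=> k0 sf x y xy; apply: sf => i; rewrite !(floor_divz m _ k0) xy.
Qed.

(** A backward step of the fine mesh leaves the coarse cell only from its first fine cell; in that
    case, treated next, it enters the previous coarse cell. *)
Lemma step_bwd_same m kappa k x (f : 'rV[R]_d -> R) : (0 < m)%N -> (0 < kappa)%N -> step m f ->
  modz (Num.floor ((m * kappa)%:R * x 0 k)) kappa%:Z != 0 -> f (bwd (m * kappa) k x) = f x.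
Proof.
move=> m0 k0 sf r0; apply: sf => i; have [->|ik] := eqVneq i k. by rewrite bwd_same floor_pred_same.
by rewrite bwd_neq.
Qed.

Lemma step_bwd_prev m kappa k x (f : 'rV[R]_d -> R) : (0 < m)%N -> (0 < kappa)%N -> step m f ->
  modz (Num.floor ((m * kappa)%:R * x 0 k)) kappa%:Z = 0 ->
  f (bwd (m * kappa) k x) = f (bwd m k x).
Proof.
move=> m0 k0 sf r0; apply: sf => i; have [->|ik] := eqVneq i k. by rewrite !bwd_same floor_pred_prev.
by rewrite !bwd_neq.
Qed.

Lemma step_bwd m k (f : 'rV[R]_d -> R) : (0 < m)%N -> step m f -> step m (f \o bwd m k).
Proof.
move=> m0 sf x y xy; apply: sf => i; have [->|ik] := eqVneq i k. by rewrite !bwd_same !floor_pred// xy.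
by rewrite !bwd_neq// xy.
Qed.

Lemma periodic_bwd m k (f : 'rV[R]_d -> R) : Zper f -> Zper (f \o bwd m k).
Proof. exact: Zper_shift. Qed.

End backward_step.

(* One level of the construction. The flux [H] (mesh 1/n, direction j) is
   traded for a shear in direction j of displacement 1/N, concentrated in
   the first three of [Q] pieces of x_l and in the first three quarters of
   x_k, plus three fluxes of finer meshes. *)
Section one_step.
Variables (R : realType) (d : nat) (j k l : 'I_d).
Hypotheses (jk : j != k) (jl : j != l) (kl : k != l).
Variables (n c b K Q : nat).
Hypotheses (n0 : (0 < n)%N) (c0 : (0 < c)%N) (b0 : (0 < b)%N) (K0 : (0 < K)%N) (Q4 : (3 < Q)%N).
Variables (e : int -> bool) (B B' H : 'rV[R]_d -> R).
Hypotheses (pe : forall z, e (z + n%:Z) = e z)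
  (pB : Zper B) (pB' : Zper B') (pH : Zper H)
  (sB : step n B) (sB' : step n B') (sH : step n H)
  (eH : forall x : 'rV[R]_d, ~~ e (Num.floor (n%:R * x 0 l)) -> H x = 0)
  (BH : forall x : 'rV[R]_d, B' x - B x = H x - H (bwd n j x)).

(** In x_j, [os_N] divides a coarse cell into [os_lam] cells. In x_l, [os_ml] divides it into [c]
    groups of [Q] pieces. In x_k, [os_mk] refines [os_N] by 4K, and four consecutive cells form one
    group of quarters. The factor [b] makes [os_N] large while [os_ml] stays fixed. *)
Definition os_lam := (c * Q * b)%N.
Definition os_ml := (n * (c * Q))%N.
Definition os_N := (n * os_lam)%N.
Definition os_K4 := (4 * K)%N.
Definition os_mk := (os_N * os_K4)%N.

Definition os_p (x : 'rV[R]_d) : int := modz (Num.floor (os_ml%:R * x 0 l)) Q%:Z.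
Definition os_q (x : 'rV[R]_d) : int := modz (Num.floor (os_mk%:R * x 0 k)) 4.
Definition os_i (x : 'rV[R]_d) : int := modz (Num.floor (os_N%:R * x 0 j)) os_lam%:Z.
Definition os_E (x : 'rV[R]_d) : bool := e (Num.floor (n%:R * x 0 l)).
Definition os_E1 (x : 'rV[R]_d) : bool := os_E x && (os_p x < 3).

Definition os_F x := B' x - B x.
(** A discrete primitive in x_j: inside a coarse cell it interpolates linearly between -4Q lam times
    the values of [H] on the previous cell and on this one. A step 1/N therefore changes it by 4Q
    times the jump. *)
Definition os_al x : R := - (4 * Q%:R) *
  ((os_lam%:R - 1 - (os_i x)%:~R) * H (bwd n j x) + ((os_i x)%:~R + 1) * H x).
Definition os_al1 x : R := if os_p x == 1 then os_al x else 0.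
Definition os_F1 x : R := if os_p x == 1 then os_F x else 0.
(** On the strip [os_E1] the density is redistributed over the four quarters of x_k with the same
    mean [B]: [os_al1] in the second, the rest in the last. The two empty quarters in between give
    the shear room to rise and to fall. *)
Definition os_A x : R := if os_E1 x then
    (if os_q x == 3 then 4 * B x - os_al1 x else if os_q x == 1 then os_al1 x else 0)
  else B x.
Definition os_A' x : R := if os_E1 x then
    (if os_q x == 3 then 4 * B x - os_al1 x
     else if os_q x == 1 then os_al1 x + 4 * Q%:R * os_F1 x else 0)
  else B x.
(** The mean of [os_A'] over the quarters of x_k. The increment Q F sits on one of the Q pieces of
    x_l, so a further mean over the pieces is B + F, which is [B']; this is why [os_al] carries the
    factor 4Q. *)
Definition os_B2 x : R := B x + Q%:R * os_F1 x.
(** Running sums of [os_A - B] over the quarters of x_k, and likewise [os_H2] for [os_B2 - os_A'];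
    [os_H3] is the running sum of [B' - os_B2] over the pieces of x_l. Equality of the means makes
    the last sum 0, so that each flux closes up within its group. *)
Definition os_H1 x : R := if os_E1 x then
    (if os_q x == 3 then 0 else if os_q x == 0 then - B x
     else if os_q x == 1 then os_al1 x - 2 * B x else os_al1 x - 3 * B x)
  else 0.
Definition os_H2 x : R := if os_E1 x then
    (if os_q x == 3 then 0 else if os_q x == 0 then os_B2 x
     else if os_q x == 1 then 2 * os_B2 x - (os_al1 x + 4 * Q%:R * os_F1 x)
     else 3 * os_B2 x - (os_al1 x + 4 * Q%:R * os_F1 x))
  else 0.
Definition os_H3 x : R :=
  ((os_p x)%:~R + 1) * os_F x - (if os_p x == 0 then 0 else Q%:R * os_F x).
Definition os_e1 (z : int) : bool :=
  let z' := divz z (b * os_K4)%:Z in e (divz z' (c * Q)%:Z) && (modz z' Q%:Z < 3).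

Let Q0 : (0 < Q)%N. Proof. exact: leq_ltn_trans Q4. Qed.
Let cQ0 : (0 < c * Q)%N. Proof. by rewrite muln_gt0 c0. Qed.
Let lam0 : (0 < os_lam)%N. Proof. by rewrite muln_gt0 cQ0. Qed.
Let K40 : (0 < os_K4)%N. Proof. by rewrite muln_gt0. Qed.
Lemma os_N_gt0 : (0 < os_N)%N. Proof. by rewrite muln_gt0 n0 lam0. Qed.
Lemma os_mk_gt0 : (0 < os_mk)%N. Proof. by rewrite muln_gt0 os_N_gt0. Qed.
Lemma os_ml_gt0 : (0 < os_ml)%N. Proof. by rewrite muln_gt0 n0. Qed.

Lemma os_mkE : os_mk = (os_ml * (b * os_K4))%N.
Proof. by rewrite /os_mk /os_N /os_ml /os_lam; ring. Qed.

Lemma os_mlE : os_ml = (n * c * Q)%N. Proof. by rewrite /os_ml mulnA. Qed.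

Lemma os_mk4 : os_mk = (os_N * K * 4)%N. Proof. by rewrite /os_mk /os_K4; ring. Qed.

Lemma os_mk_n : os_mk = (n * (os_lam * os_K4))%N. Proof. by rewrite /os_mk /os_N mulnA. Qed.

Lemma os_E1_e1 x : os_E1 x = os_e1 (Num.floor (os_mk%:R * x 0 l)).
Proof.
rewrite /os_E1 /os_E /os_e1 /os_p os_mkE -(@floor_divz R os_ml)// ?muln_gt0 ?b0//.
by rewrite -(@floor_divz R n (c * Q)).
Qed.

Lemma os_e1_periodic z : os_e1 (z + os_mk%:Z) = os_e1 z.
Proof.
rewrite /os_e1 os_mkE -[(_ * _)%N%:Z]mulr1 divz_addM ?muln_gt0 ?b0//.
rewrite /os_ml divz_addM// mulr1 pe; congr (_ && _). by rewrite mulnA modz_addM.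
Qed.

Lemma os_density : density R os_mk os_e1 = 3 / Q%:R * density R n e.
Proof.
have h := @density_refine R n c Q 3 e n0 c0 (ltnW Q4) Q0. rewrite -h -/os_ml os_mkE -[in LHS](muln1 (b * os_K4)%N).
have h2 := @density_refine R os_ml (b * os_K4) 1 1 (fun z => e (divz z (c * Q)%:Z) && (modz z Q%:Z < 3)) os_ml_gt0.
rewrite divr1 mul1r !muln1 in h2; rewrite muln1 -h2 ?muln_gt0 ?b0//.
by congr (density _ _); apply/funext => z; rewrite modz1 andbT.
Qed.

Lemma os_p_bounds x : 0 <= os_p x < Q%:Z. Proof. exact: modz_bounds. Qed.
Lemma os_q_bounds x : 0 <= os_q x < 4. Proof. exact: (@modz_bounds _ 4). Qed.
Lemma os_i_bounds x : 0 <= os_i x < os_lam%:Z. Proof. exact: modz_bounds. Qed.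

Lemma os_p_eq (x y : 'rV[R]_d) : x 0 l = y 0 l -> os_p x = os_p y.
Proof. by rewrite /os_p => ->. Qed.
Lemma os_q_eq (x y : 'rV[R]_d) : x 0 k = y 0 k -> os_q x = os_q y.
Proof. by rewrite /os_q => ->. Qed.
Lemma os_i_eq (x y : 'rV[R]_d) : x 0 j = y 0 j -> os_i x = os_i y.
Proof. by rewrite /os_i => ->. Qed.
Lemma os_E1_eq (x y : 'rV[R]_d) : x 0 l = y 0 l -> os_E1 x = os_E1 y.
Proof. by move=> xy; rewrite /os_E1 /os_E (os_p_eq xy) xy. Qed.

Lemma os_p_periodic x (z : 'rV[int]_d) : os_p (x + map_mx intr z) = os_p x.
Proof. by rewrite /os_p !mxE floorM_addrz {2}os_mlE modz_addM. Qed.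
Lemma os_q_periodic x (z : 'rV[int]_d) : os_q (x + map_mx intr z) = os_q x.
Proof. by rewrite /os_q !mxE floorM_addrz {2}os_mk4 modz_addM. Qed.
Lemma os_i_periodic x (z : 'rV[int]_d) : os_i (x + map_mx intr z) = os_i x.
Proof. by rewrite /os_i !mxE floorM_addrz {2}/os_N modz_addM. Qed.
Lemma os_E1_periodic x (z : 'rV[int]_d) : os_E1 (x + map_mx intr z) = os_E1 x.
Proof.
by rewrite /os_E1 os_p_periodic /os_E !mxE floorM_addrz (periodic_intZ pe).
Qed.

Definition os_perE := (os_p_periodic, os_q_periodic, os_i_periodic, os_E1_periodic).

Lemma os_F1_periodic : Zper os_F1.
Proof. by move=> x z; rewrite /os_F1 /os_F os_perE pB pB'. Qed.
Lemma os_al1_periodic : Zper os_al1.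
Proof. move=> x z; rewrite /os_al1 /os_al !os_perE pH.
by have /= -> := periodic_bwd n j pH x z. Qed. Lemma os_A_periodic : Zper os_A.
Proof. by move=> x z; rewrite /os_A !os_perE pB os_al1_periodic. Qed.
Lemma os_A'_periodic : Zper os_A'.
Proof. by move=> x z; rewrite /os_A' !os_perE pB os_al1_periodic os_F1_periodic. Qed.
Lemma os_B2_periodic : Zper os_B2.
Proof. by move=> x z; rewrite /os_B2 pB os_F1_periodic. Qed.
Lemma os_H1_periodic : Zper os_H1.
Proof. by move=> x z; rewrite /os_H1 !os_perE pB os_al1_periodic. Qed.
Lemma os_H2_periodic : Zper os_H2.
Proof. by move=> x z; rewrite /os_H2 !os_perE os_B2_periodic os_al1_periodic os_F1_periodic. Qed.
Lemma os_H3_periodic : Zper os_H3.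
Proof. by move=> x z; rewrite /os_H3 !os_perE /os_F pB pB'. Qed.

Section same_mk_cell.
Variables x y : 'rV[R]_d.
Hypothesis xy : forall i, Num.floor (os_mk%:R * x 0 i) = Num.floor (os_mk%:R * y 0 i).

Let ml i : Num.floor (os_ml%:R * x 0 i) = Num.floor (os_ml%:R * y 0 i).
Proof.
have bK : (0 < b * os_K4)%N by rewrite muln_gt0 b0. by rewrite !(floor_divz os_ml _ bK) -os_mkE xy.
Qed.
Let nn i : Num.floor (n%:R * x 0 i) = Num.floor (n%:R * y 0 i).
Proof. by rewrite !(floor_divz n _ cQ0) ml. Qed.
Let nN i : Num.floor (os_N%:R * x 0 i) = Num.floor (os_N%:R * y 0 i).
Proof. by rewrite !(floor_divz os_N _ K40) xy. Qed.

Lemma os_mk_step : [/\ os_E1 x = os_E1 y, os_p x = os_p y, os_q x = os_q y, os_F1 x = os_F1 y &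
  os_al1 x = os_al1 y].
Proof.
have pp : os_p x = os_p y by rewrite /os_p ml. have ii : os_i x = os_i y by rewrite /os_i nN.
split => //; first by rewrite /os_E1 /os_E pp nn.
- by rewrite /os_q xy.
- by rewrite /os_F1 pp /os_F (sB nn) (sB' nn).
- by rewrite /os_al1 pp /os_al ii (sH nn); have /= -> := step_bwd j n0 sH nn.
Qed.
Lemma os_mk_stepB : B x = B y. Proof. exact: sB. Qed.
End same_mk_cell.

Lemma os_A_step : step os_mk os_A.
Proof. by move=> x y xy; rewrite /os_A; have [-> _ -> _ ->] := os_mk_step xy; rewrite (os_mk_stepB xy). Qed.
Lemma os_A'_step : step os_mk os_A'.
Proof. by move=> x y xy; rewrite /os_A'; have [-> _ -> -> ->] := os_mk_step xy; rewrite (os_mk_stepB xy). Qed.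
Lemma os_B2_step_mk : step os_mk os_B2.
Proof. by move=> x y xy; rewrite /os_B2; have [_ _ _ -> _] := os_mk_step xy; rewrite (os_mk_stepB xy). Qed.
Lemma os_H1_step : step os_mk os_H1.
Proof. by move=> x y xy; rewrite /os_H1; have [-> _ -> _ ->] := os_mk_step xy; rewrite (os_mk_stepB xy). Qed.
Lemma os_H2_step : step os_mk os_H2.
Proof. by move=> x y xy; rewrite /os_H2 (os_B2_step_mk xy); have [-> _ -> -> ->] := os_mk_step xy. Qed.
Lemma os_F_step : step n os_F.
Proof. by move=> x y xy; rewrite /os_F (sB xy) (sB' xy). Qed.
Lemma os_F1_step : step os_ml os_F1.
Proof.
by move=> x y xy; rewrite /os_F1 /os_p xy (step_mul cQ0 os_F_step xy).
Qed.
Lemma os_B2_step : step os_ml os_B2.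
Proof. by move=> x y xy; rewrite /os_B2 (os_F1_step xy) (step_mul cQ0 sB xy). Qed.
Lemma os_H3_step : step os_ml os_H3.
Proof. by move=> x y xy; rewrite /os_H3 /os_p xy (step_mul cQ0 os_F_step xy). Qed.

Lemma os_F_off x : ~~ os_E x -> os_F x = 0.
Proof. by move=> Ex; rewrite /os_F BH !eH ?subrr// bwd_neq// eq_sym. Qed.

Lemma os_al_bwd x : os_al (bwd os_N j x) - os_al x = 4 * Q%:R * os_F x.
Proof.
rewrite /os_F BH /os_al. have iE : os_i (bwd os_N j x) = modz (Num.floor (os_N%:R * x 0 j) - 1) os_lam%:Z.
  by rewrite /os_i bwd_same floor_pred// os_N_gt0. have [i0|i0] := eqVneq (os_i x) 0.
(* From i = 0 the step enters the previous coarse cell at i = lam - 1, where the coefficient lam - 1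
   - i of the value two coarse cells back is 0. *)
- rewrite iE (modz_pred0 lam0 i0).2 (step_bwd_prev n0 lam0 sH i0) i0.
  rewrite intrB /= (_ : os_lam%:~R = os_lam%:R :> R)//; ring.
- rewrite iE (modz_pred lam0 i0).2 (step_bwd_same n0 lam0 sH i0).
  have /= -> := step_bwd_same n0 lam0 (step_bwd j n0 sH) i0. rewrite -/(os_i x). rewrite intrB /=; ring.
Qed.

Lemma os_al1_bwd x : os_al1 (bwd os_N j x) = os_al1 x + 4 * Q%:R * os_F1 x.
Proof.
rewrite /os_al1 /os_F1 (@os_p_eq _ x) ?bwd_neq 1?eq_sym//. case: ifP => _; last by rewrite mulr0 addr0.
by rewrite -os_al_bwd addrC subrK.
Qed.

Section along_k.
Variable x : 'rV[R]_d.
Let y := bwd os_mk k x.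
Let yl : y 0 l = x 0 l. Proof. by rewrite bwd_neq// eq_sym. Qed.
Let yj : y 0 j = x 0 j. Proof. by rewrite bwd_neq. Qed.
Let yE : os_E1 y = os_E1 x. Proof. exact: os_E1_eq. Qed.
Let y_p : os_p y = os_p x. Proof. exact: os_p_eq. Qed.
Let y_i : os_i y = os_i x. Proof. exact: os_i_eq. Qed.
Let y_q : os_q y = modz (Num.floor (os_mk%:R * x 0 k) - 1) 4.
Proof. by rewrite /os_q bwd_same floor_pred// os_mk_gt0. Qed.
Let y_q0 : os_q x = 0 -> os_q y = 3.
Proof. by move=> q0; rewrite y_q (@modz_pred0 _ 4 _ q0).2. Qed.
Let y_q1 : os_q x != 0 -> os_q y = os_q x - 1.
Proof. by move=> q0; rewrite y_q (@modz_pred _ 4 _ q0).2. Qed.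
Let y_n (f : 'rV[R]_d -> R) : step n f -> os_q x != 0 -> f y = f x.
Proof.
move=> sf q0; apply: sf => i; have [->|ik] := eqVneq i k; last by rewrite bwd_neq.
have nlK : os_mk = (n * (os_lam * K) * 4)%N by rewrite os_mk4 /os_N !mulnA.
have lK : (0 < os_lam * K)%N by rewrite muln_gt0 lam0. rewrite bwd_same !(floor_divz n _ lK); congr divz.
have nl : (0 < n * (os_lam * K))%N by rewrite muln_gt0 n0.
by have := @floor_pred_same R _ 4 (x 0 k) nl isT; rewrite -nlK => /(_ q0) ->.
Qed.
Let y_al : os_q x != 0 -> os_al1 y = os_al1 x.
Proof.
move=> q0; rewrite /os_al1 y_p /os_al y_i (y_n sH q0). by have /= -> := y_n (step_bwd j n0 sH) q0.
Qed.
Let y_F1 : os_q x != 0 -> os_F1 y = os_F1 x.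
Proof. by move=> q0; rewrite /os_F1 y_p (y_n os_F_step q0). Qed.

Lemma os_q_cases : [\/ os_q x = 0, os_q x = 1, os_q x = 2 | os_q x = 3].
Proof.
have := os_q_bounds x; case: (os_q x) => // -[|[|[|[|q]]]] //= _; [exact: Or41|exact: Or42|exact: Or43|exact: Or44].
Qed.

Lemma os_gap1 : os_A x - B x = os_H1 x - os_H1 (bwd os_mk k x).
Proof.
rewrite -/y /os_A /os_H1 yE; case: ifP => _; last by rewrite !subrr. have [q0|q0|q0|q0] := os_q_cases; rewrite q0 /=.
- by rewrite (y_q0 q0)/=; ring.
- by rewrite y_q1 ?q0//= (y_n sB) ?q0//=; ring.
- by rewrite y_q1 ?q0//= (y_n sB) ?q0// y_al ?q0//=; ring.
- by rewrite y_q1 ?q0//= (y_n sB) ?q0// y_al ?q0//=; ring.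
Qed.

Lemma os_gap2 : os_B2 x - os_A' x = os_H2 x - os_H2 (bwd os_mk k x).
Proof.
(* Off the strip, [os_p x = 1] can only happen where [os_E x] fails, and there the jump vanishes
   together with the flux. *)
rewrite -/y /os_A' /os_H2 yE; case: ifP => E1; last first. rewrite /os_B2 subrr /os_F1; case: ifP => p1; last by ring.
  rewrite os_F_off; first by ring. by move: E1; rewrite /os_E1 (eqP p1) andbT => ->.
have yB2 : os_q x != 0 -> os_B2 y = os_B2 x. by move=> q0; rewrite /os_B2 y_F1// (y_n sB q0).
have [q0|q0|q0|q0] := os_q_cases; rewrite q0 /=.
- by rewrite (y_q0 q0)/=; ring.
- by rewrite y_q1 ?q0//= yB2 ?q0//=; ring.
- by rewrite y_q1 ?q0//= yB2 ?q0// y_al ?q0// y_F1 ?q0//; ring.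
- by rewrite y_q1 ?q0//= yB2 ?q0// y_al ?q0// y_F1 ?q0//= /os_B2; ring.
Qed.

End along_k.

Lemma os_gap3 x : B' x - os_B2 x = os_H3 x - os_H3 (bwd os_ml l x).
Proof.
have BE : B' x - os_B2 x = os_F x - Q%:R * os_F1 x by rewrite /os_B2 /os_F; ring.
have y_p : os_p (bwd os_ml l x) = modz (Num.floor (os_ml%:R * x 0 l) - 1) Q%:Z.
  by rewrite /os_p bwd_same floor_pred// os_ml_gt0. rewrite BE /os_H3 y_p. have [p0|p0] := eqVneq (os_p x) 0.
- rewrite (modz_pred0 Q0 p0).2 /os_F1 p0 /=.
  have -> : (Q%:Z - 1 == 0) = false by apply/negbTE; rewrite subr_eq0; case: (Q) Q4 => [|[|]].
  rewrite intrB (_ : Q%:~R = Q%:R :> R)//=; ring.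
- rewrite (modz_pred Q0 p0).2 -/(os_p x). have -> : os_F (bwd os_ml l x) = os_F x.
    have E : os_ml = (n * c * Q)%N := os_mlE. have sF : step (n * c) os_F by exact: step_mul os_F_step.
    rewrite E; apply: (step_bwd_same _ Q0 sF); first by rewrite muln_gt0 n0. by rewrite -E.
  rewrite /os_F1; have [p1|p1] := eqVneq (os_p x) 1; first by rewrite p1 /=; ring.
  have -> : (os_p x - 1 == 0) = false by rewrite subr_eq0 (negbTE p1).
  have -> : (os_p x - 1)%:~R = (os_p x)%:~R - 1 :> R by rewrite intrB.
  set P : R := (os_p x)%:~R; set F := os_F x; ring.
Qed.

Lemma os_H1_off x : os_H1 x != 0 -> os_E1 x.
Proof. by rewrite /os_H1; case: ifP => // _; rewrite eqxx. Qed.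
Lemma os_H2_off x : os_H2 x != 0 -> os_E1 x.
Proof. by rewrite /os_H2; case: ifP => // _; rewrite eqxx. Qed.

Variables (M h : R).
Hypotheses (h0 : 0 <= h) (BM : forall x, `|B x| <= M) (BM' : forall x, `|B' x| <= M)
  (Hh : forall x, `|H x| <= h).
Let M0 : 0 <= M. Proof. exact: le_trans (BM 0). Qed.
Let Q1 : 1 <= Q%:R :> R. Proof. by rewrite ler1n. Qed.
Let al0 : 0 <= 4 * Q%:R * os_lam%:R * h :> R. Proof. by rewrite !mulr_ge0. Qed.

(** The weights lam - 1 - i and i + 1 are nonnegative with sum lam. *)
Lemma os_al_bound x : `|os_al1 x| <= 4 * Q%:R * os_lam%:R * h.
Proof.
rewrite /os_al1; case: ifP => _; last by rewrite normr0.
rewrite /os_al mulNr normrN normrM ger0_norm// -!mulrA !ler_pM2l ?ltr0n//. have /andP[i1 i2] := os_i_bounds x.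
have j1 : 0 <= (os_i x)%:~R :> R by rewrite ler0z. have j2 : (os_i x)%:~R + 1 <= os_lam%:R :> R.
  by rewrite -intrD1 (_ : os_lam%:R = os_lam%:Z%:~R :> R)// ler_int -ltzD1 ltrD2r.
rewrite (le_trans (ler_normD _ _))// !normrM. rewrite (ger0_norm (_ : 0 <= os_lam%:R - 1 - _)); last by lra.
rewrite (ger0_norm (_ : 0 <= _ + 1)); last by lra. have := Hh x; have := Hh (bwd n j x); move: j1 j2.
set i := (_%:~R : R); set lam := (_%:R : R); set a := `|_|; set a' := `|_|. move=> j1 j2 ah a'h.
have h1 : (lam - 1 - i) * a <= (lam - 1 - i) * h by rewrite ler_wpM2l//; lra.
have h2 : (i + 1) * a' <= (i + 1) * h by rewrite ler_wpM2l//; lra.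
have E : lam * h = (lam - 1 - i) * h + (i + 1) * h by ring. by rewrite E (le_trans (lerD h1 h2)).
Qed.

Lemma os_F1_bound x : `|os_F1 x| <= 2 * M.
Proof.
rewrite /os_F1; case: ifP => _; last by rewrite normr0 mulr_ge0.
by rewrite (le_trans (ler_normB _ _))//; have := BM x; have := BM' x; lra.
Qed.

Let QM : M <= Q%:R * M. Proof. by rewrite ler_peMl. Qed.
Let QF1 x : `|Q%:R * os_F1 x| <= 2 * (Q%:R * M).
Proof.
rewrite normrM ger0_norm// mulrCA ler_wpM2l//; exact: os_F1_bound.
Qed.

Lemma os_B2_bound x : `|os_B2 x| <= 3 * Q%:R * M.
Proof.
rewrite (le_trans (ler_normD _ _))//; have := QF1 x; have := BM x; move: QM. set a := `|_|; set a' := `|_|; lra.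
Qed.

Lemma os_A_bound x : `|os_A x| <= (4 * Q%:R * os_lam%:R * h + 4 * M) * (os_E1 x)%:R + M * (~~ os_E1 x)%:R.
Proof.
rewrite /os_A; have := os_al_bound x; have := BM x; rewrite !ler_norml => Bx ax.
case: ifP => _ /=; last by rewrite mulr0 mulr1 add0r.
by rewrite mulr0 mulr1 addr0; case: ifP => _; [|case: ifP => _]; move: al0 M0 Bx ax;
  set al := (_ * h); set v := os_al1 x; lra.
Qed.

Let QM4 x : `|4 * Q%:R * os_F1 x| <= 8 * (Q%:R * M).
Proof. by rewrite -mulrA normrM (ger0_norm (_ : 0 <= 4))//; have := QF1 x; lra. Qed.

Lemma os_A'_bound x : `|os_A' x| <= 4 * Q%:R * os_lam%:R * h + 12 * Q%:R * M.
Proof.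
rewrite /os_A'; have := os_al_bound x; have := BM x; have := QM4 x; rewrite !ler_norml => Fx Bx ax.
by case: ifP => _ /=; [case: ifP => _; [|case: ifP => _]|]; move: al0 M0 Fx Bx ax QM;
  set al := (_ * h); set v := os_al1 x; set w := _ * os_F1 x; lra.
Qed.

Lemma os_H1_bound x : `|os_H1 x| <= 4 * Q%:R * os_lam%:R * h + 17 * Q%:R * M.
Proof.
rewrite /os_H1; have := os_al_bound x; have := BM x; rewrite !ler_norml => Bx ax.
by case: ifP => _ /=; [case: ifP => _; [|case: ifP => _; [|case: ifP => _]]|]; move: al0 M0 Bx ax QM;
  set al := (_ * h); set v := os_al1 x; lra.
Qed.

Lemma os_H2_bound x : `|os_H2 x| <= 4 * Q%:R * os_lam%:R * h + 17 * Q%:R * M.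
Proof.
rewrite /os_H2; have := os_al_bound x; have := os_B2_bound x; have := QM4 x; rewrite !ler_norml => Fx Bx ax.
by case: ifP => _ /=; [case: ifP => _; [|case: ifP => _; [|case: ifP => _]]|]; move: al0 M0 Fx Bx ax QM;
  set al := (_ * h); set v := os_al1 x; set w := _ * os_F1 x; set u := os_B2 x; lra.
Qed.

Lemma os_H3_bound x : `|os_H3 x| <= 2 * Q%:R * M.
Proof.
have Fx : `|os_F x| <= 2 * M. by rewrite (le_trans (ler_normB _ _))//; have := BM x; have := BM' x; lra.
have /andP[p0 pQ] := os_p_bounds x. rewrite /os_H3; case: ifP => [/eqP ->|/negbT pn0].
  by rewrite add0r mul1r subr0; move: QM; lra. have p1 : 1 <= (os_p x)%:~R :> R by rewrite ler1z; move: p0 pn0; lia.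
have p2 : (os_p x)%:~R + 1 <= Q%:R :> R. by rewrite -intrD1 (_ : Q%:R = Q%:Z%:~R :> R)// ler_int -ltzD1 ltrD2r.
rewrite -mulrBl normrM [`|_ - Q%:R|]distrC (ger0_norm (_ : 0 <= Q%:R - _)) ?subr_ge0//.
have -> : 2 * Q%:R * M = Q%:R * (2 * M) by ring. apply: ler_pM => //; first by rewrite subr_ge0.
by rewrite gerBl; lra.
Qed.

End one_step.

(** * Exchange of integrals and Lebesgue norms *)

Section Rintegral_swap.
Local Open Scope ereal_scope.

Lemma Rintegral_Fubini d1 d2 (T1 : measurableType d1) (T2 : measurableType d2) (R : realType)
    (m1 : {sigma_finite_measure set T1 -> \bar R})
    (m2 : {sigma_finite_measure set T2 -> \bar R}) (f : T1 * T2 -> R) :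
  (m1 \x m2)%E.-integrable setT (EFin \o f) ->
  (\int[m1]_x \int[m2]_y f (x, y) = \int[m2]_y \int[m1]_x f (x, y))%R.
Proof.
move=> intf; have h := Fubini intf.
have hF : \int[m1]_x (\int[m2]_y f (x, y))%R%:E = \int[m1]_x \int[m2]_y (f (x, y))%:E.
  have iF := integrable_fubini_F intf. apply: ae_eq_integral => //.
  - have /integrableP[mF _] := iF; apply/mEFinP. exact: (mcomp (fine_measurable measurableT) mF).
  - by have /integrableP[] := iF.
  - apply: filterS (integrable_ae measurableT iF) => x /(_ Logic.I) xf _. by rewrite /Rintegral fineK.
have hG : \int[m2]_y (\int[m1]_x f (x, y))%R%:E = \int[m2]_y \int[m1]_x (f (x, y))%:E.
  have mf : mfun (EFin \o f) by have /integrableP[] := intf. have mG := measurable_fubini_G intf.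
  have iG : m2.-integrable setT (fubini_G m1 (EFin \o f)).
    apply/integrableP; split => //; have /= lt := (@integrable21ltyP _ _ _ _ _ m1 m2 _ mf).1 intf; apply: (le_lt_trans _ lt).
    apply: int_le => y _; apply: le_abse_integral => //. by apply: (mcomp mf); exact: measurable_pair2.
  apply: ae_eq_integral => //.
  - apply/mEFinP. exact: (mcomp (fine_measurable measurableT) mG).
  - apply: filterS (integrable_ae measurableT iG) => x /(_ Logic.I) xf _. by rewrite /Rintegral fineK.
by rewrite /Rintegral; congr fine; move: hF hG; rewrite /Rintegral => -> ->.
Qed.

Lemma time_space_swap (R : realType) d (T : measurableType d)
    (mu : {sigma_finite_measure set T -> \bar R}) (D : set R) (f : R * T -> R) :
  measurable D -> @measurable_fun _ _ (mR R * T)%type R setT f ->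
  \int[leb]_(t in D) \int[mu]_x `|f (t, x)|%:E < +oo ->
  (\int[leb]_(t in D) \int[mu]_x f (t, x) =
   \int[mu]_x \int[leb]_(t in D) f (t, x))%R.
Proof.
move=> mD mf finf. pose g (w : mR R * T) : R := (f w * \1_D w.1)%R. have mg : mfun g. apply: mfunM => //.
  by apply: (mcomp (mindic mD)); exact: mfst. have gE t x : g (t, x) = ((fun t => f (t, x)) \_ D) t.
  by rewrite /g/= patchE indicE; case: ifP => _; rewrite ?mulr1 ?mulr0.
have intg : (leb \x mu)%E.-integrable setT (EFin \o g). apply/integrable12ltyP; first exact/mEFinP.
  rewrite /=; apply: le_lt_trans finf; rewrite [leRHS]integral_mkcond. apply: eqW; apply: eq_integral => t _.
  rewrite patchE; case: ifPn => tD.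
  - by apply: eq_integral => x _; rewrite gE patchE tD.
  - by apply: integral0_eq => x _; rewrite gE patchE (negbTE tD) normr0. have := Rintegral_Fubini intg => /= h.
rewrite [LHS]Rintegral_mkcond; transitivity (\int[leb]_t \int[mu]_x g (t, x))%R.
  apply: eqRint => t _; rewrite patchE; case: ifPn => tD.
  - by apply: eqRint => x _; rewrite gE patchE tD.
  - rewrite (_ : (fun x => _) = cst 0%R); first by rewrite /Rintegral integral0.
    by apply/funext => x; rewrite gE patchE (negbTE tD).
rewrite h; apply: eqRint => x _; rewrite [RHS]Rintegral_mkcond. by apply: eqRint => t _; rewrite gE.
Qed.

End Rintegral_swap.

Section Lnorm_bounds.
Context d (T : measurableType d) (R : realType) (mu : {measure set T -> \bar R}).

Lemma Lnorm_EFinE (r : R) (f : T -> R) :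
  'N[mu]_r%:E[EFin \o f]%E = ((\int[mu]_x (`|f x| `^ r)%:E) `^ r^-1)%E.
Proof. by rewrite Lnorm.unlock. Qed.

Lemma Lnorm_powR (r : R) (f : T -> R) (Y : R) : 0 < r -> 0 <= Y ->
  (\int[mu]_x (`|f x| `^ r)%:E <= (Y `^ r)%:E)%E -> ('N[mu]_r%:E[EFin \o f] <= Y%:E)%E.
Proof.
move=> r0 Y0 h; rewrite Lnorm_EFinE. have -> : Y%:E = (((Y `^ r)%:E) `^ r^-1)%E.
  by rewrite poweR_EFin -powRrM mulfV ?gt_eqF// powRr1.
apply: gt0_ler_poweR => //; rewrite ?invr_ge0 ?ltW// in_itv/= ?leey ?andbT ?lee_fin ?powR_ge0//.
by apply: int_ge0 => x _; rewrite lee_fin powR_ge0.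
Qed.

Lemma Lnorm_le_abs (p : R) (f g : T -> R) : 0 < p ->
  (forall x, `|f x| <= `|g x|) -> ('N[mu]_p%:E[EFin \o f] <= 'N[mu]_p%:E[EFin \o g])%E.
Proof.
move=> p0 fg; rewrite !Lnorm_EFinE. apply: gt0_ler_poweR; rewrite ?invr_ge0 ?(ltW p0)// ?in_itv/= ?leey ?andbT.
- by apply: int_ge0 => x _; rewrite lee_fin powR_ge0.
- by apply: int_ge0 => x _; rewrite lee_fin powR_ge0.
- by apply: int_le => x _; rewrite lee_fin ge0_ler_powR// ltW.
Qed.

Lemma powRD_le (r a b : R) : 1 <= r -> 0 <= a -> 0 <= b -> a `^ r + b `^ r <= (a + b) `^ r.
Proof.
move=> r1 a0 b0; have r0 : 0 <= r - 1 by rewrite subr_ge0. have P x : 0 <= x -> x `^ r = x * x `^ (r - 1).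
  rewrite le_eqVlt => /predU1P[<-|x0]; first by rewrite mul0r powR0// gt_eqF// (lt_le_trans _ r1).
  by rewrite -{2}(powRr1 (ltW x0)) -powRD ?(gt_eqF x0) ?implybT// addrC subrK.
rewrite !P ?addr_ge0// mulrDl lerD// ler_wpM2l//; apply: ge0_ler_powR => //; rewrite ?nnegrE ?addr_ge0 ?lerDl ?lerDr//.
Qed.

End Lnorm_bounds.

Lemma Lnorm_bounded d (T : measurableType d) (R : realType) (P : probability T R) (f : T -> R) (r M : R) :
  0 < r -> 0 <= M -> (forall x, `|f x| <= M) ->
  ('N[P]_r%:E[EFin \o f] <= M%:E)%E.
Proof.
move=> r0 M0 fM; apply: Lnorm_powR => //; apply: prob_int_le => x. by rewrite lee_fin ge0_ler_powR ?nnegrE// ltW.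
Qed.

(** * Transport of a density by a shear *)

Section shear.
Variables (R : realType) (d : nat).

(** The gain from concentration: a large value [a] on the selected cells enters only with the factor
    density^(1/r). Superadditivity of the r-th power lets the sum of the two contributions be taken
    outside the root. *)
Lemma Lnorm_cell_bound (r : R) (l : 'I_d) (m : nat) (e : int -> bool) (f : 'rV[R]_d -> R) (a b : R) :
  1 <= r -> (0 < m)%N -> 0 <= a -> 0 <= b -> mfun f ->
  (forall x : 'rV[R]_d, let ex := e (Num.floor (m%:R * x 0 l)) in `|f x| <= a * ex%:R + b * (~~ ex)%:R) ->
  (hnorm r f <= (a * (density R m e) `^ r^-1 + b)%:E)%E.
Proof.
move=> r1 m0 a0 b0 mf fab. have r0 : 0 < r by rewrite (lt_le_trans _ r1). have D0 := density_ge0 R m e.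
apply: Lnorm_powR => //; first by rewrite addr_ge0// mulr_ge0// powR_ge0.
apply: (@le_trans _ _ (\int[haar]_x ((a `^ r * (e (Num.floor (m%:R * x 0 l)))%:R)%:E + (b `^ r)%:E))%E).
  apply: int_le => x _; rewrite -EFinD lee_fin; have := fab x => /=.
  case: (e _) => /=; rewrite ?mulr1 ?mulr0 ?add0r ?addr0 => fx.
  + by rewrite (@le_trans _ _ (a `^ r))// ?lerDl ?powR_ge0// ge0_ler_powR ?nnegrE// ltW.
  + by rewrite ge0_ler_powR ?nnegrE// ltW. rewrite ge0_integralD//; last 3 first.
- by move=> x _; rewrite lee_fin mulr_ge0// powR_ge0.
- have := mfun_floorM m (fun z => (a `^ r * (e z)%:R)%:E). by move=> mm; apply: (mcomp mm); exact: mcoord.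
- by move=> x _; rewrite lee_fin powR_ge0. rewrite torus_density ?powR_ge0// integral_cst//.
rewrite [X in (_ + _ * X)%E](_ : _ = 1%E); last exact: prob_setT. rewrite mule1 -EFinD lee_fin.
apply: le_trans (powRD_le r1 _ b0); last by rewrite mulr_ge0// powR_ge0.
by rewrite powRM ?powR_ge0// -powRrM mulVf ?gt_eqF// powRr1.
Qed.

Lemma slice_continuous (phi : ST R d -> R) t : continuous phi ->
  continuous (fun x : 'rV[R]_d => phi (t, x)).
Proof.
move=> cphi x; apply: (@continuous_comp _ _ _ (fun x => (t, x)) phi x _ (cphi (t, x))).
by apply: (@cvg_pair _ _ _ (nbhs x) (nbhs t) (nbhs x) _ _ _ (fun=> t) id); [exact: cvg_cst|exact: cvg_id].
Qed.

Lemma shear_invariant (j : 'I_d) (T : Type) (f : 'rV[R]_d -> T) :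
  (forall z x, f (setc j z x) = f x) -> forall r x, f (x + r *: 'e_j) = f x.
Proof. by move=> fj r x; rewrite -{1}(set_coord_id j x) set_coord_add fj. Qed.

Lemma mfun_shear2 (j : 'I_d) (s : ST R d -> R) :
  jmfun s ->
  mfun (fun w : mST R d => w.2 + s w *: 'e_j).
Proof.
move=> ms; apply: measurable_fun_rVP => i. rewrite (_ : (fun _ => _) = (fun w : mST R d =>
    w.2 0 i + s w * ('e_j : 'rV[R]_d) 0 i)); last by apply/funext => w; rewrite !mxE. apply: mfunD.
  exact: (mcomp (@mcoord R d i) msnd). by apply: mfunM => //; exact: mcst.
Qed.

Section shear_transport.
Variables (j : 'I_d) (A psi : 'rV[R]_d -> R) (MA v t0 tau : R).
Hypotheses (pA : Zper A) (mA : mfun A) (AM : forall x, `|A x| <= MA).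
Hypotheses (ppsi : Zper psi) (mpsi : mfun psi)
  (psi1 : forall x, `|psi x| <= 1) (psij : forall z x, psi (setc j z x) = psi x).
Hypothesis tau0 : 0 <= tau.

(** The solution with value [A] at time [t0] for the velocity v psi in direction j. As psi does not
    depend on x_j, trajectories are straight lines run at constant speed. *)
Definition sheared (t : R) (x : 'rV[R]_d) : R := A (x - ((t - t0) * v * psi x) *: 'e_j).

Lemma sheared_mfun :
  jmfun (fun w => sheared w.1 w.2).
Proof.
apply: (mcomp mA). rewrite (_ : (fun w => _) = (fun w : mST R d =>
  w.2 + (- ((w.1 - t0) * v * psi w.2)) *: 'e_j)); last first. by apply/funext => w; rewrite scaleNr.
apply: mfun_shear2; apply: mcomp => //. apply: mfunM; last exact: (mcomp mpsi). apply: mfunM; last exact: mcst.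
apply: mfunB; [exact: mfst|exact: mcst].
Qed.

Lemma sheared_periodic t : Zper (sheared t).
Proof. by move=> x k; rewrite /sheared ppsi addrAC pA. Qed.

(** The change of variables x + (t - t0) v psi(x) e_j preserves the Haar measure and turns the
    integrand into A(x) times the derivative of [phi] along a line of space-time. After exchanging
    the integrals the fundamental theorem of calculus leaves the two end times. *)
Lemma shear_transport (phi : ST R d -> R) : smooth phi ->
  (forall t, Zper (fun x => phi (t, x))) ->
  \int[leb]_(t in `[t0, (t0 + tau)]) \int[haar]_x (sheared t x *
    ('D_((1, 0) : ST R d) phi (t, x) +
     (v * psi x) * 'D_((0, 'e_j) : ST R d) phi (t, x))) =
  \int[haar]_x (sheared (t0 + tau) x * phi (t0 + tau, x)) - \int[haar]_x (A x * phi (t0, x)).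
Proof.
move=> sphi pphi. pose w (x : 'rV[R]_d) : ST R d := (1, 0) + (v * psi x) *: (0, 'e_j).
(* Start at time 0 of the straight trajectory that is at [x] at time [t0]; the parameter along [w x]
   is then time itself. *)
pose z (x : 'rV[R]_d) : ST R d := (0, x - (t0 * v * psi x) *: 'e_j).
have zwE t x : z x + t *: w x = (t, x + ((t - t0) * v * psi x) *: 'e_j). rewrite /z /w; congr pair => /=.
    by rewrite add0r scaler0 addr0 [t *: 1]mulr1.
  by rewrite add0r -addrA -scaleNr scalerA -scalerDl; congr (_ + _ *: _); ring.
have Dper u t : Zper (fun x => 'D_u phi (t, x)). move=> x k; rewrite /derive.
  have -> : (fun h : R => h^-1 *: ((phi \o shift (t, x + map_mx intr k)) (h *: u) - phi (t, x + map_mx intr k)))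
      = (fun h : R => h^-1 *: ((phi \o shift (t, x)) (h *: u) - phi (t, x))).
    apply/funext => h /=; rewrite (pphi t); congr (_ *: (_ - _)).
    have E y : h *: u + (t, y) = ((h *: u).1 + t, (h *: u).2 + y) by []. by rewrite !E addrA (pphi _). by [].
have Dcont u : continuous ('D_u phi) := sm_cont (@sm_D _ _ phi u sphi). have mD u := cont_mfun2 (Dcont u).
have slice (f : ST R d -> R) t : jmfun f -> mfun (fun x => f (t, x)). by move=> mf; apply: (mcomp mf); exact: mpair1.
have mvpsi : mfun (fun x => v * psi x) by exact: mfunM.
pose G (tx : ST R d) := A tx.2 * 'D_(w tx.2) phi (z tx.2 + tx.1 *: w tx.2).
have step1 t : \int[haar]_x (sheared t x * ('D_((1, 0) : ST R d) phi (t, x) +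
     (v * psi x) * 'D_((0, 'e_j) : ST R d) phi (t, x))) = \int[haar]_x G (t, x).
  rewrite -(@torus_shear _ _ j (fun x => (t - t0) * v * psi x)).
  - apply: eqRint => x _; rewrite /G /sheared /= zwE /w derive_dirDZ//. by rewrite (shear_invariant psij) addrK.
  - by apply: mfunM => //; exact: mcst.
  - by move=> y x; rewrite psij.
  - apply: mfunM; first exact: (slice _ t sheared_mfun). apply: mfunD; first exact: (slice _ t (mD (1, 0))).
    by apply: mfunM => //; exact: (slice _ t (mD (0, 'e_j))).
  - by move=> x k; rewrite sheared_periodic !Dper ppsi. under eqRint do rewrite step1.
have [M0 M00 HM0] := periodic_bounded2 t0 (t0 + tau) (Dcont (1, 0)) (Dper _).
have [M1 M10 HM1] := periodic_bounded2 t0 (t0 + tau) (Dcont (0, 'e_j)) (Dper _).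
have GM t x : t0 <= t <= t0 + tau -> `|G (t, x)| <= MA * (M0 + `|v| * M1).
  move=> tt; rewrite /G normrM ler_pM//= zwE /w derive_dirDZ// (le_trans (ler_normD _ _))//.
  rewrite lerD ?HM0// normrM ler_pM// ?HM1// normrM ler_piMr//. have mG : jmfun G.
  apply: mfunM; first exact: (mcomp mA). pose S (tx : mST R d) : mST R d :=
    (tx.1, tx.2 + ((tx.1 - t0) * v * psi tx.2) *: 'e_j). have mS : mfun S.
    apply: measurable_fun_pair; first exact: mfst. apply: (@mfun_shear2 j (fun tx => (tx.1 - t0) * v * psi tx.2)).
    apply: mfunM; last exact: (mcomp mpsi). apply: mfunM; last exact: mcst. apply: mfunB; [exact: mfst|exact: mcst].
  rewrite (_ : (fun tx => _) = (fun tx : mST R d =>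
    'D_((1, 0) : ST R d) phi (S tx) + v * psi tx.2 * 'D_((0, 'e_j) : ST R d) phi (S tx))).
    apply: mfunD; first exact: (mcomp (mD _) mS). apply: mfunM; last exact: (mcomp (mD _) mS).
    by apply: (mcomp mvpsi); exact: msnd. by apply/funext => tx; rewrite zwE /w derive_dirDZ.
have mI : measurable `[t0, t0 + tau]%classic by exact: mitv. rewrite (@time_space_swap _ _ _ haar _ G)//; last first.
  apply: (@le_lt_trans _ _ (\int[leb]_(t in `[t0, (t0 + tau)%R]) (MA * (M0 + `|v| * M1))%R%:E)%E).
    apply: int_le => t; rewrite /= in_itv/= => tt.
    by apply: (@prob_int_le _ _ _ haar _ (MA * (M0 + `|v| * M1))%R%:E) => x; rewrite lee_fin GM.
  rewrite integral_cst//= leb_itv/= lte_fin. by case: ifP => _; rewrite ?mule0 ?ltry// -EFinB -EFinM ltry.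
have iphi (f g : 'rV[R]_d -> R) : (forall x, `|f x| <= MA) -> mfun f ->
    continuous g -> Zper g -> hL1 (fun x => f x * g x). move=> fM mf cg pg; have [P P0 gP] := Zper_bounded cg pg.
  apply: (haar_bnd (M := MA * P)).
  - by apply: mfunM => //; exact: cont_meas.
  - by move=> x _; rewrite normrM ler_pM. have cphi t : continuous (fun x => phi (t, x)).
  exact: slice_continuous (sm_cont sphi).
transitivity (\int[haar]_x (A x * phi (t0 + tau, x + (tau * v * psi x) *: 'e_j) - A x * phi (t0, x))).
  apply: eqRint => x _; rewrite /G /= RintZl//; last first. apply: (@bnd_int _ _ _ leb _ mI _ _ (M0 + `|v| * M1)).
    - by rewrite /= leb_itv/=; case: ifP => _; rewrite ?ltry// -EFinB ltry.
    - have cl : continuous (fun s : R => 'D_(w x) phi (z x + s *: w x)).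
        exact: (@line_continuous _ _ ('D_(w x) phi) (z x) (w x)
          (fun y => @sm_dv _ _ ('D_(w x) phi) (w x) y (@sm_D _ _ phi (w x) sphi))). exact: (mfunTS (mcontinuous cl)).
    - move=> t; rewrite /= in_itv/= => tt; rewrite zwE /w derive_dirDZ// (le_trans (ler_normD _ _))//.
      by rewrite lerD ?HM0// normrM ler_pM// ?HM1// normrM ler_piMr.
  rewrite line_FTC ?lerDl// !zwE -mulrBr; congr (_ * (phi (_, _) - phi (_, _))). by rewrite addrAC subrr add0r.
  by rewrite subrr !mul0r scale0r addr0. have mpsh : mfun (fun x => tau * v * psi x).
  by apply: mfunM => //; exact: mcst.
have shift_eq : \int[haar]_x (A x * phi (t0 + tau, x + (tau * v * psi x) *: 'e_j)) =
    \int[haar]_x (sheared (t0 + tau) x * phi (t0 + tau, x)).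
  rewrite -[RHS](@torus_shear _ _ j (fun x => tau * v * psi x))//.
  - apply: eqRint => x _; rewrite /sheared (shear_invariant psij). by rewrite [t0 + tau]addrC addrK addrK.
  - by move=> y x; rewrite psij.
  - apply: mfunM; first exact: (slice _ _ sheared_mfun). exact: cont_meas.
  - by move=> x k; rewrite sheared_periodic (pphi _). rewrite RintB//; first by rewrite shift_eq.
- have [P P0 gP] := Zper_bounded (cphi (t0 + tau)) (pphi _). apply: (haar_bnd (M := MA * P)).
  + apply: mfunM => //. exact: (mcomp (cont_meas (cphi (t0 + tau))) (mfun_shift_coord j mpsh)).
  + by move=> x _; rewrite normrM ler_pM.
- exact: iphi.
Qed.

End shear_transport.

(** * The velocity profile of a pulse *)

Section shear_profile.
Variables (k l : 'I_d) (kl : k != l) (mk ml : nat) (mk0 : (0 < mk)%N) (ml0 : (0 < ml)%N).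
Variables (ak al : int -> R).
Hypotheses (pak : forall z, ak (z + mk%:Z) = ak z) (pal : forall z, al (z + ml%:Z) = al z).
Hypotheses (ak01 : forall z, 0 <= ak z <= 1) (al01 : forall z, 0 <= al z <= 1).

Definition profile (x : 'rV[R]_d) : R := pl ak (mk%:R * x 0 k) * pl al (ml%:R * x 0 l).
Definition dprofile (i : 'I_d) (x : 'rV[R]_d) : R :=
  let zk := Num.floor (mk%:R * x 0 k) in let zl := Num.floor (ml%:R * x 0 l) in
  if i == k then mk%:R * (ak (zk + 1) - ak zk) * pl al (ml%:R * x 0 l)
  else if i == l then pl ak (mk%:R * x 0 k) * (ml%:R * (al (zl + 1) - al zl))
  else 0.

Lemma profile_bound x : 0 <= profile x <= 1.
Proof.
have /andP[a0 a1] := pl_bound (mk%:R * x 0 k) ak01. have /andP[b0 b1] := pl_bound (ml%:R * x 0 l) al01.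
by rewrite mulr_ge0//= -(mulr1 1) ler_pM.
Qed.

Lemma pprofile : Zper profile.
Proof. by move=> x z; rewrite /profile !mxE !pl_periodic. Qed.

Lemma mfun_pl (a : int -> R) (m : nat) :
  mfun (fun y : mR R => pl a (m%:R * y)).
Proof.
have mF (f : int -> R) : mfun (fun y : mR R => f (Num.floor (m%:R * y))).
  by apply/mEFinP; exact: (@mfun_floorM R m (EFin \o f)). apply: mfunD; first exact: mF.
apply: mfunM; first by apply: mfunB; [exact: (mF (fun z => a (z + 1)))|exact: mF].
apply: mfunB; last exact: (mF (fun z => z%:~R)). by apply: mfunM => //; exact: mcst.
Qed.

Lemma profile_mfun : mfun profile.
Proof.
by apply: mfunM; apply: (mcomp (@mfun_pl _ _)); exact: mcoord.
Qed.

Lemma profile_grad_mfun i : mfun (dprofile i).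
Proof.
have mF (f : int -> R) m (c : 'I_d) : mfun (fun x : 'rV[R]_d => f (Num.floor (m%:R * x 0 c))).
  have h : mfun (fun y : mR R => f (Num.floor (m%:R * y))). by apply/mEFinP; exact: (@mfun_floorM R m (EFin \o f)).
  by apply: (mcomp h); exact: mcoord.
have mP (a : int -> R) m (c : 'I_d) : mfun (fun x : 'rV[R]_d => pl a (m%:R * x 0 c)).
  by apply: (mcomp (@mfun_pl _ _)); exact: mcoord.
rewrite /dprofile; case: (i == k); [|case: (i == l); last exact: mcst].
- apply: mfunM => //. exact: (mF (fun z => mk%:R * (ak (z + 1) - ak z))).
- apply: mfunM => //. exact: (mF (fun z => ml%:R * (al (z + 1) - al z))).
Qed.

Let d1 (a : int -> R) z : (forall z, 0 <= a z <= 1) -> `|a (z + 1) - a z| <= 1.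
Proof. by move=> a01; have := a01 z; have := a01 (z + 1); rewrite ler_norml; lra. Qed.

Lemma profile_grad_bound i x : `|dprofile i x| <= mk%:R + ml%:R.
Proof.
have /andP[a0 a1] := pl_bound (mk%:R * x 0 k) ak01. have /andP[b0 b1] := pl_bound (ml%:R * x 0 l) al01.
rewrite /dprofile; case: ifP => _; [|case: ifP => _; last by rewrite normr0 addr_ge0].
- rewrite normrM (ger0_norm b0) (@le_trans _ _ mk%:R)// ?lerDl//.
  rewrite -[leRHS]mulr1 ler_pM// normrM ger0_norm// -[leRHS]mulr1 ler_pM//; exact: d1.
- rewrite normrM (ger0_norm a0) (@le_trans _ _ ml%:R)// ?lerDr//.
  rewrite -[leRHS]mul1r ler_pM// normrM ger0_norm// -[leRHS]mulr1 ler_pM//; exact: d1.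
Qed.

(** The profile is Lipschitz and its right difference quotients converge at every point, kinks
    included, to [dprofile], which is what [weak_partial_quotient] asks for. *)
Lemma profile_weak_partial i : weak_partial i profile (dprofile i).
Proof.
have coord_shift (c : 'I_d) (h : R) (x : 'rV[R]_d) : (x + h *: 'e_i) 0 c = if c == i then x 0 c + h else x 0 c.
  by rewrite !mxE eqxx/=; case: eqVneq; rewrite ?mulr1 ?mulr0 ?addr0.
have nn n : n.+1%:R * (n.+1%:R^-1 : R) = 1 by rewrite divff// pnatr_eq0.
apply: (@weak_partial_quotient _ _ _ _ _ 1 (mk%:R + ml%:R)).
- exact: pprofile.
- exact: profile_mfun.
- by move=> x; have /andP[p0 p1] := profile_bound x; rewrite ger0_norm.
- move=> n x; rewrite /profile !coord_shift. have /andP[a0 a1] := pl_bound (mk%:R * x 0 k) ak01.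
  have /andP[b0 b1] := pl_bound (ml%:R * x 0 l) al01. have [ki|ki] := eqVneq k i.
    have -> : (l == i) = false by rewrite -ki eq_sym (negbTE kl).
    rewrite -mulrBl mulrA normrM (ger0_norm b0) (@le_trans _ _ mk%:R)// ?lerDl//.
    rewrite -[leRHS]mulr1 ler_pM// normrM ger0_norm//. have h0 : 0 <= mk%:R * n.+1%:R^-1 :> R by rewrite mulr_ge0.
    have := pl_lip (mk%:R * x 0 k) ak01 h0; rewrite -mulrDr => hl.
    by rewrite (le_trans (ler_wpM2l _ hl))// mulrCA nn mulr1.
  have [li|li] := eqVneq l i; last by rewrite subrr mulr0 normr0 addr_ge0.
  rewrite -mulrBr mulrCA normrM (ger0_norm a0) (@le_trans _ _ ml%:R)// ?lerDr//.
  rewrite -[leRHS]mul1r ler_pM// normrM ger0_norm//. have h0 : 0 <= ml%:R * n.+1%:R^-1 :> R by rewrite mulr_ge0.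
  have := pl_lip (ml%:R * x 0 l) al01 h0; rewrite -mulrDr => hl.
  by rewrite (le_trans (ler_wpM2l _ hl))// mulrCA nn mulr1.
- move=> x; rewrite /profile /dprofile [i == k]eq_sym [i == l]eq_sym. have [ki|ki] := eqVneq k i.
    have li : (l == i) = false by rewrite -ki eq_sym (negbTE kl).
    rewrite (_ : (fun n => _) = (fun n => n.+1%:R * (pl ak (mk%:R * (x 0 k + n.+1%:R^-1)) -
        pl ak (mk%:R * x 0 k)) * pl al (ml%:R * x 0 l))); last first.
      by apply/funext => n; rewrite !coord_shift ki eqxx li -mulrBl mulrA.
    by apply: cvgMr_tmp; exact: pl_quotient_cvg. have [li|li] := eqVneq l i.
    rewrite (_ : (fun n => _) = (fun n => pl ak (mk%:R * x 0 k) * (n.+1%:R *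
        (pl al (ml%:R * (x 0 l + n.+1%:R^-1)) - pl al (ml%:R * x 0 l))))); last first.
      by apply/funext => n; rewrite !coord_shift (negbTE ki) li eqxx -mulrBr mulrCA.
    by apply: cvgMl_tmp; exact: pl_quotient_cvg. rewrite (_ : (fun n => _) = cst 0); last first.
    by apply/funext => n; rewrite !coord_shift (negbTE ki) (negbTE li) subrr mulr0. exact: cvg_cst.
Qed.

Lemma profile_off (e : int -> bool) :
  (forall z, ~~ e z -> al z = 0 /\ al (z + 1) = 0) ->
  forall x : 'rV[R]_d, ~~ e (Num.floor (ml%:R * x 0 l)) -> profile x = 0 /\ forall i, dprofile i x = 0.
Proof.
move=> eal x /eal[z0 z1]. have p0 : pl al (ml%:R * x 0 l) = 0 by rewrite /pl z0 z1 subrr mul0r addr0.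
split=> [|i]; first by rewrite /profile p0 mulr0.
by rewrite /dprofile p0 z0 z1 subrr !mulr0; case: ifP => // _; case: ifP.
Qed.

End shear_profile.
End shear.

(** * Jumps, pulses and their quantitative bounds *)

Section gaps.
Variables (R : realType) (d : nat).

(* A jump of the density from [gB] to [gB'], to be realized by a flow later:
   the difference is the divergence of the flux [gH], of mesh 1/[gn] in
   direction [gj], supported where the cell of x_[gl] satisfies [ge]. *)
Record gap := Gap { gj : 'I_d; gl : 'I_d; gn : nat; ge : int -> bool;
  gB : 'rV[R]_d -> R; gB' : 'rV[R]_d -> R; gH : 'rV[R]_d -> R; gM : R; gh : R }.

(** The bound [gM] is kept at least 1 so that gM <= gM^s. *)
Record gap_ok (G : gap) : Prop := GapOk {
  gap_jl : gj G != gl G;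
  gap_n : (0 < gn G)%N;
  gap_e : forall z, ge G (z + (gn G)%:Z) = ge G z;
  gap_pB : Zper (gB G);
  gap_pB' : Zper (gB' G);
  gap_pH : Zper (gH G);
  gap_sB : step (gn G) (gB G);
  gap_sB' : step (gn G) (gB' G);
  gap_sH : step (gn G) (gH G);
  gap_off : forall x : 'rV[R]_d, ~~ ge G (Num.floor ((gn G)%:R * x 0 (gl G))) -> gH G x = 0;
  gap_div : forall x : 'rV[R]_d, gB' G x - gB G x = gH G x - gH G (bwd (gn G) (gj G) x);
  gap_M : 1 <= gM G;
  gap_h : 0 <= gh G;
  gap_BM : forall x, `|gB G x| <= gM G;
  gap_BM' : forall x, `|gB' G x| <= gM G;
  gap_Hh : forall x, `|gH G x| <= gh G }.

(** A bound for the L^1 norm of the flux times the mesh size: after summation by parts, pairing the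
    jump with a test function costs at most this times the Lipschitz constant. *)
Definition budget (G : gap) : R := density R (gn G) (ge G) * gh G / (gn G)%:R.

Variables (p q s : R).
Hypotheses (p1 : 1 < p) (q1 : 1 < q) (pq : p^-1 + q^-1 = 1) (s1 : 1 <= s).

(** The constant 24 is twice 12: the product of the norms of density and velocity in a pulse
    contains 12 [budget], which may use up half of [del ^+ 2]. The last condition makes resting for
    the time [D] at a density of size [gM] affordable in L^s(L^p). *)
Record good (G : gap) (del D : R) : Prop := Good {
  good_ok : gap_ok G;
  good_D : 0 < D;
  good_del : 0 < del;
  good_budget : 24 * budget G <= del ^+ 2;
  good_time : gM G `^ s * D <= del `^ s }.

(* [prho r] is the density at time [r] after the start of the pulse. *)
Record pulse := Pulse { pj : 'I_d; prho : R -> 'rV[R]_d -> R; pu : 'rV[R]_d -> R;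
  pg : 'I_d -> 'rV[R]_d -> R; pA : 'rV[R]_d -> R; pA' : 'rV[R]_d -> R;
  ptau : R; pX : R; pW : R; pV : R }.

(** [pulse_sW] is the L^{s'}(L^q) bound raised to the power 1/s' = 1 - 1/s; in this form it also
    covers s = 1, where it bounds the velocity uniformly in time. *)
Record pulse_ok (P : pulse) (del : R) : Prop := PulseOk {
  pulse_tau : 0 < ptau P;
  pulse_X : 0 <= pX P;
  pulse_W : 0 <= pW P;
  pulse_V : 0 <= pV P;
  pulse_mrho : jmfun
    (fun w => prho P w.1 w.2);
  pulse_prho : forall r, Zper (prho P r);
  pulse_Nrho : forall r, (hnorm p (prho P r) <= (pX P)%:E)%E;
  pulse_pu : Zper (pu P);
  pulse_mu : mfun (pu P);
  pulse_Nu : (hnorm q (pu P) <= (pW P)%:E)%E;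
  pulse_pg : forall i, Zper (pg P i);
  pulse_mg : forall i, mfun (pg P i);
  pulse_g : forall i, weak_partial i (pu P) (pg P i);
  pulse_gj : forall x, pg P (pj P) x = 0;
  pulse_Ng : forall i, (hnorm q (pg P i) <= (pV P)%:E)%E;
  pulse_tX : ptau P * pX P `^ s <= del `^ s;
  pulse_tW : ptau P * pW P <= del;
  pulse_tV : ptau P * pV P <= del;
  pulse_XW : ptau P * (pX P * pW P) <= del ^+ 2;
  pulse_sW : ptau P `^ (1 - s^-1) * pW P <= del;
  pulse_weak : forall (t0 : R) (phi : ST R d -> R), smooth phi ->
    (forall t, Zper (fun x => phi (t, x))) ->
    \int[leb]_(t in `[t0, (t0 + ptau P)]) \int[haar]_x (prho P (t - t0) x *
      ('D_((1, 0) : ST R d) phi (t, x) +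
       pu P x * 'D_((0, 'e_(pj P)) : ST R d) phi (t, x))) =
    \int[haar]_x (pA' P x * phi (t0 + ptau P, x)) - \int[haar]_x (pA P x * phi (t0, x)) }.

Record node := Node { nP : pulse; n1 : gap; n2 : gap; n3 : gap; ng : R }.

(** The inequality in [node_time] is strict, so a rest of positive length follows the last of the
    three gaps; at the root this rest shows that the solution is not zero. *)
Record node_ok (G : gap) (del D : R) (N : node) : Prop := NodeOk {
  node_P : pulse_ok (nP N) del;
  node_1 : good (n1 N) (del / 4) (ng N);
  node_2 : good (n2 N) (del / 4) (ng N);
  node_3 : good (n3 N) (del / 4) (ng N);
  node_B1 : gB (n1 N) = gB G;
  node_B1' : gB' (n1 N) = pA (nP N);
  node_B2 : gB (n2 N) = pA' (nP N);
  node_B2' : gB' (n2 N) = gB (n3 N);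
  node_B3' : gB' (n3 N) = gB' G;
  node_time : 3 * ng N + ptau (nP N) < D }.

Section one_pulse.
Variables (G : gap) (k : 'I_d) (c b K Q : nat).
Hypotheses (GO : gap_ok G) (jk : gj G != k) (kl : k != gl G)
  (c0 : (0 < c)%N) (b0 : (0 < b)%N) (K0 : (0 < K)%N) (Q4 : (3 < Q)%N).

Let j := gj G. Let l := gl G. Let n := gn G. Let e := ge G. Let M := gM G. Let h := gh G.
Let jl : j != l := gap_jl GO.
Let n0 : (0 < n)%N := gap_n GO.
Let mk := os_mk n c b K Q.
Let ml := os_ml n c Q.
Let NN := os_N n c b Q.
Let lam := os_lam c b Q.
Let A := os_A j k l n c b K Q e (gB G) (gH G).
Let A' := os_A' j k l n c b K Q e (gB G) (gB' G) (gH G).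
Let B2 := os_B2 l n c Q (gB G) (gB' G).
Let h1 := 4 * Q%:R * lam%:R * h + 17 * Q%:R * M.
Let M1 := 4 * Q%:R * lam%:R * h + 12 * Q%:R * M.

Definition os_kid1 := Gap k l mk (os_e1 c b K Q e) (gB G) A
  (os_H1 j k l n c b K Q e (gB G) (gH G)) M1 h1.
Definition os_kid2 := Gap k l mk (os_e1 c b K Q e) A' B2
  (os_H2 j k l n c b K Q e (gB G) (gB' G) (gH G)) M1 h1.
Definition os_kid3 := Gap l j ml xpredT B2 (gB' G)
  (os_H3 l n c Q (gB G) (gB' G)) M1 (2 * Q%:R * M).

Let M0 : 0 <= M. Proof. exact: le_trans ler01 (gap_M GO). Qed.
Let h0 : 0 <= h. Proof. exact: gap_h GO. Qed.
Let Q1 : 1 <= Q%:R :> R. Proof. by rewrite ler1n (leq_trans _ Q4). Qed.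
Let al0 : 0 <= 4 * Q%:R * lam%:R * h. Proof. by rewrite !mulr_ge0. Qed.
Let MQ : M <= Q%:R * M. Proof. by rewrite ler_peMl. Qed.
Let h10 : 0 <= h1. Proof. by rewrite addr_ge0// !mulr_ge0. Qed.
Let M11 : 1 <= M1. Proof. by have := gap_M GO; rewrite /M1; move: MQ al0; rewrite -/M; lra. Qed.
Let BM1 x : `|gB G x| <= M1.
Proof. by have := gap_BM GO x; rewrite /M1; move: MQ al0 M0; rewrite -/M; lra. Qed.
Let BM1' x : `|gB' G x| <= M1.
Proof. by have := gap_BM' GO x; rewrite /M1; move: MQ al0 M0; rewrite -/M; lra. Qed.
Let AM x : `|A x| <= 4 * Q%:R * lam%:R * h + 4 * M.
Proof.
have := os_A_bound j k l n K c0 b0 Q4 e h0 (gap_BM GO) (gap_Hh GO) x.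
rewrite -/A -/lam -/M; case: (os_E1 _ _ _ _ _ _) => /=; rewrite ?mulr1 ?mulr0 ?addr0 ?add0r//. by move: al0 M0; lra.
Qed.
Let B2M x : `|B2 x| <= M1.
Proof.
have := os_B2_bound l n c Q4 (gap_BM GO) (gap_BM' GO) x. by rewrite /M1 -/M; move: MQ al0 M0; lra.
Qed.

Lemma os_kid1_ok : gap_ok os_kid1.
Proof.
have sH := gap_sH GO; have sB := gap_sB GO; have sB' := gap_sB' GO. split => //=.
- exact: os_mk_gt0.
- by move=> z; apply: os_e1_periodic => //; exact: gap_e GO.
- exact: gap_pB GO.
- by apply: os_A_periodic; [exact: gap_e GO|exact: gap_pB GO|exact: gap_pH GO].
- by apply: os_H1_periodic; [exact: gap_e GO|exact: gap_pB GO|exact: gap_pH GO].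
- by rewrite /mk os_mk_n; apply: step_mul => //; rewrite !muln_gt0 c0 b0 K0 (leq_trans _ Q4).
- exact: os_A_step sB sB' sH.
- exact: os_H1_step sB sB' sH.
- move=> x Ex; apply/eqP/negPn; apply: contra Ex => /os_H1_off. by rewrite (os_E1_e1 l n c0 b0 K0 Q4).
- by move=> x; apply: os_gap1.
- by move=> x; rewrite (le_trans (AM x))// /M1; move: MQ al0 M0; lra.
- by move=> x; apply: os_H1_bound => //; [exact: gap_BM GO|exact: gap_Hh GO].
Qed.

Lemma os_kid2_ok : gap_ok os_kid2.
Proof.
have sH := gap_sH GO; have sB := gap_sB GO; have sB' := gap_sB' GO. split => //=.
- exact: os_mk_gt0.
- by move=> z; apply: os_e1_periodic => //; exact: gap_e GO.
- by apply: os_A'_periodic; [exact: gap_e GO|exact: gap_pB GO|exact: gap_pB' GO|exact: gap_pH GO].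
- by apply: os_B2_periodic; [exact: gap_pB GO|exact: gap_pB' GO].
- by apply: os_H2_periodic; [exact: gap_e GO|exact: gap_pB GO|exact: gap_pB' GO|exact: gap_pH GO].
- exact: os_A'_step sB sB' sH.
- exact: (@os_B2_step_mk _ _ j k l n c b K Q n0 c0 b0 K0 Q4 e _ _ _ sB sB' sH).
- exact: os_H2_step sB sB' sH.
- move=> x Ex; apply/eqP/negPn; apply: contra Ex => /os_H2_off. by rewrite (os_E1_e1 l n c0 b0 K0 Q4).
- by move=> x; apply: os_gap2 => //; [exact: gap_off GO|exact: gap_div GO].
- by move=> x; apply: os_A'_bound => //; [exact: gap_BM GO|exact: gap_BM' GO|exact: gap_Hh GO].
- by move=> x; apply: os_H2_bound => //; [exact: gap_BM GO|exact: gap_BM' GO|exact: gap_Hh GO].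
Qed.

Lemma os_kid3_ok : gap_ok os_kid3.
Proof.
have sH := gap_sH GO; have sB := gap_sB GO; have sB' := gap_sB' GO. split => //=.
- by rewrite eq_sym.
- by apply: os_ml_gt0.
- by apply: os_B2_periodic; [exact: gap_pB GO|exact: gap_pB' GO].
- exact: gap_pB' GO.
- by apply: os_H3_periodic; [exact: gap_pB GO|exact: gap_pB' GO].
- exact: os_B2_step.
- by rewrite /ml /os_ml; apply: step_mul => //; rewrite !muln_gt0 c0 (leq_trans _ Q4).
- exact: os_H3_step.
- by move=> x; apply: os_gap3.
- by rewrite !mulr_ge0.
- by move=> x; apply: (@os_H3_bound _ _ j k l jk jl kl n c b K Q n0 c0 b0 K0 Q4 _ _ M h) => //;
    [exact: gap_BM GO|exact: gap_BM' GO].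
Qed.

(** Values at the nodes. The interpolated profile rises on the first cell, equals 1 on the second,
    falls on the third and vanishes on the others: hence three of four quarters in x_k and three of
    Q pieces in x_l. *)
Let ak (z : int) : R := ((modz z 4 == 1) || (modz z 4 == 2))%:R.
Let al (z : int) : R := (e (divz z (c * Q)%:Z) && ((modz z Q%:Z == 1) || (modz z Q%:Z == 2)))%:R.
Let e' (z : int) : bool := e (divz z (c * Q)%:Z) && (modz z Q%:Z < 3).
Let psi := profile k l mk ml ak al.

Let Q0 : (0 < Q)%N. Proof. exact: leq_ltn_trans Q4. Qed.
Let cQ0 : (0 < c * Q)%N. Proof. by rewrite muln_gt0 c0. Qed.

Let E1e' (x : 'rV[R]_d) : os_E1 l n c Q e x = e' (Num.floor (ml%:R * x 0 l)).
Proof. by rewrite /os_E1 /os_E /e' /os_p -(@floor_divz R n (c * Q)). Qed.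

Let de' : density R ml e' = 3 / Q%:R * density R n e.
Proof. by rewrite -(@density_refine R n c Q 3 e n0 c0 (ltnW Q4) Q0). Qed.

Let div_succ z : modz (z + 1) Q%:Z != 0 ->
  divz (z + 1) (c * Q)%:Z = divz z (c * Q)%:Z /\ modz z Q%:Z = modz (z + 1) Q%:Z - 1.
Proof.
move=> r0; have := modz_pred Q0 r0; rewrite addrK => -[_ ->]; split => //.
have := @modz_pred (z + 1) _ cQ0; rewrite addrK => H. suff nz : modz (z + 1) (c * Q)%:Z != 0 by have [->] := H nz.
apply: contra r0 => /eqP r0; rewrite (divz_eq (z + 1) (c * Q)%:Z) r0 addr0. by rewrite PoszM mulrA modzMl.
Qed.

Let al_off z : ~~ e' z -> al z = 0 /\ al (z + 1) = 0.
Proof.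
rewrite /e' /al => ez; split.
- case: (e _) ez => //=; case: eqP => [->//|_]; case: eqP => [->//|_] //.
- have [r0|r0] := eqVneq (modz (z + 1) Q%:Z) 0; first by rewrite r0 /= andbF.
  have [-> E] := div_succ r0; move: ez; rewrite E.
  case: (e _) => //=; case: eqP => [->//|_]; case: eqP => [->//|_] //.
Qed.

Let pak z : ak (z + mk%:Z) = ak z.
Proof. by rewrite /ak /mk os_mk4 -[(_ * 4)%N%:Z]mulr1 modz_addM. Qed.

Let pal z : al (z + ml%:Z) = al z.
Proof.
have pe : forall z, e (z + n%:Z) = e z := gap_e GO. rewrite /al -[ml%:Z]mulr1 {1}/ml /os_ml divz_addM// mulr1 pe.
by rewrite ?mulr1 /ml os_mlE -[(n * c * Q)%N%:Z]mulr1 modz_addM.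
Qed.

Let ak01 z : 0 <= ak z <= 1. Proof. by rewrite ler0n lern1 leq_b1. Qed.
Let al01 z : 0 <= al z <= 1. Proof. by rewrite ler0n lern1 leq_b1. Qed.

Let psij z (x : 'rV[R]_d) : psi (setc j z x) = psi x.
Proof. by rewrite /psi /profile !setcE [k == j]eq_sym (negbTE jk) [l == j]eq_sym (negbTE jl). Qed.

Let coord_move (x : 'rV[R]_d) r i : i != j -> (x - r *: 'e_j) 0 i = x 0 i.
Proof. by move=> ij; rewrite !mxE eqxx/= (negbTE ij) mulr0 subr0. Qed.

Let psi_off (x : 'rV[R]_d) : ~~ os_E1 l n c Q e x -> psi x = 0.
Proof. by rewrite E1e' => /(profile_off k mk ak al_off)[]. Qed.

(** Where [os_A] is sensitive to the shift, psi is exactly 0 or 1. In the empty quarters any shift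
    moves zero; in the last quarter psi = 0; in the second quarter [os_al1] lives only on the middle
    piece, where psi = 1 and the step 1/N produces the increment. *)
Let A_shift (x : 'rV[R]_d) : A (x - (psi x / NN%:R) *: 'e_j) = A' x.
Proof.
have lj : l != j by rewrite eq_sym. have kj : k != j by rewrite eq_sym.
have [E1|E1] := boolP (os_E1 l n c Q e x); last first.
  by rewrite psi_off// mul0r scale0r subr0 /A /A' /os_A /os_A' (negbTE E1).
have yl r := @coord_move x r l lj; have yk r := @coord_move x r k kj. have [q0|q0|q0|q0] := os_q_cases k n c b K Q x.
- rewrite /A /A' /os_A /os_A' (os_E1_eq n c Q e (yl _)) E1. by rewrite (os_q_eq n c b K Q (yk _)) q0.
- rewrite /A /A' /os_A /os_A' (os_E1_eq n c Q e (yl _)) E1 (os_q_eq n c b K Q (yk _)) q0 /=.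
  have [pp|pp] := eqVneq (os_p l n c Q x) 1; last first. rewrite /os_al1 /os_F1 (os_p_eq n c Q (yl _)) (negbTE pp).
    by rewrite mulr0 addr0. have -> : psi x = 1. have pk : pl ak (mk%:R * x 0 k) = 1.
      have a1 : ak (Num.floor (mk%:R * x 0 k)) = 1 by rewrite /ak -/(os_q k n c b K Q x) q0.
      have a2 : ak (Num.floor (mk%:R * x 0 k) + 1) = 1. by rewrite /ak -modzDml -/(os_q k n c b K Q x) q0.
      by rewrite /pl a1 a2 subrr mul0r addr0. have pl1 : pl al (ml%:R * x 0 l) = 1.
      have Ee : e (divz (Num.floor (ml%:R * x 0 l)) (c * Q)%:Z). by move: E1; rewrite E1e' => /andP[].
      have a1 : al (Num.floor (ml%:R * x 0 l)) = 1. by rewrite /al Ee -/(os_p l n c Q x) pp.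
      have a2 : al (Num.floor (ml%:R * x 0 l) + 1) = 1. have r2 : modz (Num.floor (ml%:R * x 0 l) + 1) Q%:Z = 2.
          rewrite -modzDml -/(os_p l n c Q x) pp modz_small//. by rewrite -[1 + 1]/(2%:Z) ltz_nat (leq_trans _ Q4).
        have r20 : modz (Num.floor (ml%:R * x 0 l) + 1) Q%:Z != 0 by rewrite r2.
        by rewrite /al (div_succ r20).1 r2 Ee. by rewrite /pl a1 a2 subrr mul0r addr0.
    by rewrite /psi /profile pk pl1 mulr1. rewrite div1r; exact: (os_al1_bwd jl n0 c0 b0 Q4 (gap_sH GO) (gap_div GO)).
- rewrite /A /A' /os_A /os_A' (os_E1_eq n c Q e (yl _)) E1. by rewrite (os_q_eq n c b K Q (yk _)) q0.
- have -> : psi x = 0. have a1 : ak (Num.floor (mk%:R * x 0 k)) = 0 by rewrite /ak -/(os_q k n c b K Q x) q0.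
    have a2 : ak (Num.floor (mk%:R * x 0 k) + 1) = 0. by rewrite /ak -modzDml -/(os_q k n c b K Q x) q0.
    by rewrite /psi /profile /pl a1 a2 subrr mul0r addr0 mul0r.
  by rewrite mul0r scale0r subr0 /A /A' /os_A /os_A' E1 q0.
Qed.

Variables (tau X : R).
Hypothesis tau0 : 0 < tau.
Let N0 : 0 < NN%:R :> R. Proof. by rewrite ltr0n; apply: os_N_gt0. Qed.
Let v := (NN%:R * tau)^-1.
Let v0 : 0 < v. Proof. by rewrite invr_gt0 mulr_gt0. Qed.
Let v1 := 3 / Q%:R * density R n e.

Definition os_pulse := Pulse j (sheared j A psi v 0) (fun x => v * psi x)
  (fun i x => v * dprofile k l mk ml ak al i x) A A' tau X
  (v * v1 `^ q^-1) (v * (mk%:R + ml%:R) * v1 `^ q^-1).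

Let v10 : 0 <= v1. Proof. by rewrite mulr_ge0// ?divr_ge0// density_ge0. Qed.
Let psi1 (x : 'rV[R]_d) : `|psi x| <= 1.
Proof. by have /andP[a0 a1] := profile_bound k l mk ml ak01 al01 x; rewrite ger0_norm. Qed.
Let mpsi : mfun psi. Proof. exact: profile_mfun. Qed.
Let mA : mfun A.
Proof.
apply: (@step_mfun _ _ mk); first exact: os_mk_gt0. exact: os_A_step (gap_sB GO) (gap_sB' GO) (gap_sH GO).
Qed.
Let pAA : Zper A.
Proof. by apply: os_A_periodic; [exact: gap_e GO|exact: gap_pB GO|exact: gap_pH GO]. Qed.
Let weak_partialZ i (f g : 'rV[R]_d -> R) a : mfun f -> (forall x, `|f x| <= 1) ->
  mfun g -> (exists C, forall x, `|g x| <= C) ->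
  weak_partial i f g -> weak_partial i (fun x => a * f x) (fun x => a * g x).
Proof.
move=> mf f1 mg [C gC] wfg u su pu_; have cu := sm_cont su. have cD := sm_cont (@sm_D _ _ u ('e_i) su).
have [U U0 HU] := Zper_bounded cu pu_. have [U' U'0 HU'] := Zper_bounded cD (periodic_D _ pu_).
under eqRint do rewrite -mulrA; under [in RHS]eqRint do rewrite -mulrA.
rewrite !RintZl//; first by rewrite wfg// mulrN.
- apply: (haar_bnd (M := C * U)).
  + by apply: mfunM => //; exact: cont_meas.
  + by move=> x _; rewrite normrM ler_pM.
- apply: (haar_bnd (M := 1 * U')).
  + by apply: mfunM => //; exact: cont_meas.
  + by move=> x _; rewrite normrM ler_pM.
Qed.

Lemma os_pulse_ok del : 0 <= X ->
  (4 * Q%:R * lam%:R * h + 4 * M) * v1 `^ p^-1 + M <= X ->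
  tau * X `^ s <= del `^ s ->
  v1 `^ q^-1 / NN%:R <= del ->
  (mk%:R + ml%:R) * v1 `^ q^-1 / NN%:R <= del ->
  X * (v1 `^ q^-1 / NN%:R) <= del ^+ 2 ->
  tau `^ (- s^-1) * (v1 `^ q^-1 / NN%:R) <= del ->
  pulse_ok os_pulse del.
Proof.
move=> X0 HX HtX HW HV HXW HsW. have tv : tau * v = NN%:R^-1. by rewrite /v invfM mulrCA divff ?mulr1// gt_eqF.
have q1' : 1 <= q := ltW q1. have p1' : 1 <= p := ltW p1. have ml0 : (0 < ml)%N by apply: os_ml_gt0.
have mk0 : (0 < mk)%N by apply: os_mk_gt0. split => //=.
- by rewrite mulr_ge0 ?powR_ge0// ltW.
- by rewrite !mulr_ge0 ?powR_ge0// ltW.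
- exact: (@sheared_mfun _ _ j A psi v 0 mA mpsi).
- by move=> r; apply: sheared_periodic => //; exact: pprofile.
- move=> r; apply: (@le_trans _ _ ((4 * Q%:R * lam%:R * h + 4 * M) * v1 `^ p^-1 + M)%:E); last by rewrite lee_fin.
  rewrite /v1 -de'; apply: (@Lnorm_cell_bound _ _ p l ml e') => //.
  + by rewrite addr_ge0// mulr_ge0.
  + have ms := @sheared_mfun _ _ j A psi v 0 mA mpsi. exact: (mcomp ms (mpair1 r)).
  + move=> x /=; rewrite -E1e' /sheared. have lj : l != j by rewrite eq_sym.
    have := os_A_bound j k l n K c0 b0 Q4 e h0 (gap_BM GO) (gap_Hh GO) (x - ((r - 0) * v * psi x) *: 'e_j).
    by rewrite (os_E1_eq n c Q e (coord_move x _ lj)).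
- by move=> x z; congr (_ * _); exact: (@pprofile R d k l mk ml ak al pak pal x z).
- by apply: mfunM => //; exact: mcst.
- rewrite -[X in (_ <= X%:E)%E]addr0 /v1 -de'; apply: (@Lnorm_cell_bound _ _ q l ml e') => //.
  + exact: ltW.
  + by apply: mfunM => //; exact: mcst.
  + move=> x /=; rewrite -E1e' mul0r addr0 normrM gtr0_norm//. have [E1|E1] := boolP (os_E1 l n c Q e x).
      by rewrite ler_pM2l ?mulr1// ltW. by rewrite psi_off// normr0 !mulr0.
- by move=> i x z; rewrite /dprofile !mxE !pl_periodic// !floorM_addrz
    ![_ + _ * _ + 1]addrAC !(periodic_intZ pak) !(periodic_intZ pal).
- by move=> i; apply: mfunM; [exact: mcst|exact: profile_grad_mfun].
- move=> i; apply: weak_partialZ => //; first exact: profile_grad_mfun.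
    by exists (mk%:R + ml%:R) => x; exact: profile_grad_bound. exact: profile_weak_partial.
- by move=> x; rewrite /dprofile (negbTE jk) (negbTE jl) mulr0.
- move=> i; rewrite -[X in (_ <= X%:E)%E]addr0 /v1 -de'; apply: (@Lnorm_cell_bound _ _ q l ml e') => //.
  + by rewrite mulr_ge0// ltW.
  + by apply: mfunM; [exact: mcst|exact: profile_grad_mfun].
  + move=> x /=; rewrite mul0r addr0 normrM gtr0_norm//.
    have [E1|E1] := boolP (e' _); first by rewrite mulr1 ler_pM2l// profile_grad_bound.
    by rewrite (profile_off k mk ak al_off E1).2 normr0 !mulr0.
- by rewrite mulrA tv mulrC.
- by rewrite !mulrA tv -mulrA mulrC.
- by have -> : tau * (X * (v * v1 `^ q^-1)) = X * (v1 `^ q^-1 / NN%:R) by rewrite -tv; ring.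
- rewrite powRD ?(gt_eqF tau0) ?implybT// powRr1 ?(ltW tau0)//.
  by have -> : tau * tau `^ (- s^-1) * (v * v1 `^ q^-1) = tau `^ (- s^-1) * (v1 `^ q^-1 / NN%:R) by rewrite -tv; ring.
- move=> t0 phi sphi pphi. have := @shear_transport _ _ j A psi (4 * Q%:R * lam%:R * h + 4 * M) v t0 tau pAA mA AM
    (pprofile k l pak pal) mpsi psi1 psij (ltW tau0) phi sphi pphi.
  have shE t : sheared j A psi v t0 t = sheared j A psi v 0 (t - t0). by apply/funext => x; rewrite /sheared subr0.
  under eqRint do under eqRint do rewrite shE. move=> ->; congr (_ - _); apply: eqRint => x _; congr (_ * _).
  rewrite -A_shift shE /sheared subr0 [t0 + tau]addrC addrK tv. by rewrite [psi x / _]mulrC.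
Qed.

End one_pulse.
End gaps.

(** * Limits of integrals and Hölder bounds *)

Lemma fatou_bound d (T : measurableType d) (R : realType) (mu : {measure set T -> \bar R})
    (D : set T) (mD : measurable D) (f : (T -> \bar R)^nat) (g : T -> \bar R) (C : \bar R) :
  (forall n, measurable_fun D (f n)) -> (forall n x, D x -> (0 <= f n x)%E) ->
  (forall x, D x -> f n x @[n --> \oo] --> g x) ->
  (forall n, (\int[mu]_(x in D) f n x <= C)%E) -> (\int[mu]_(x in D) g x <= C)%E.
Proof.
move=> mf f0 fg fC; apply: (@le_trans _ _ (\int[mu]_(x in D) limn_einf (f^~ x))%E).
  apply: eqW; apply: eq_integral => x /set_mem Dx. by rewrite (cvg_limn_einf_sup (fg x Dx)).1.
apply: (le_trans (fatou mu mD mf f0)). rewrite limn_einf_lim; apply: lime_le; first exact: is_cvg_einfs.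
by apply: nearW => n; apply: (le_trans _ (fC n)); apply: ereal_inf_lbound; exists n => /=.
Qed.

Section parametric_integrals.
Context d (T : measurableType d) (R : realType) (mu : {sigma_finite_measure set T -> \bar R}).

Lemma mfun_Rint (f : R * T -> R) :
  @measurable_fun _ _ (mR R * T)%type R setT f ->
  mfun (fun t : mR R => \int[mu]_x f (t, x)).
Proof.
move=> mf; rewrite /Rintegral. have mEf : mfun (EFin \o f) by exact/mEFinP.
apply: (mcomp (fine_measurable measurableT)).
rewrite (_ : (fun t => _) = (fun t => (\int[mu]_x ((EFin \o f)^\+ (t, x)) - \int[mu]_x ((EFin \o f)^\- (t, x)))%E)).
  apply: emeasurable_funB.
  - apply: (@mfubiniF _ _ _ _ _ mu ((EFin \o f)^\+)%E) => //. exact: measurable_funepos.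
  - apply: (@mfubiniF _ _ _ _ _ mu ((EFin \o f)^\-)%E) => //. exact: measurable_funeneg.
apply/funext => t; rewrite integralE; congr (_ - _)%E; apply: eq_integral => x _. by rewrite !funeposE.
by rewrite !funenegE.
Qed.
End parametric_integrals.

Section Rintegral_bounds.
Context d (T : measurableType d) (R : realType) (mu : {measure set T -> \bar R}).

Lemma normr_Rint_le (D : set T) (f : T -> R) (r : R) : measurable D -> measurable_fun D f ->
  (\int[mu]_(x in D) `|f x|%:E <= r%:E)%E ->
  mu.-integrable D (EFin \o f) /\ `|\int[mu]_(x in D) f x| <= r.
Proof.
move=> mD mf fr; have fi : mu.-integrable D (EFin \o f). apply/integrableP; split; first exact/mEFinP.
  by rewrite (le_lt_trans fr)// ltry. by split=> //; rewrite -lee_fin (le_trans (Rint_abs_le _ _ _)).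
Qed.

Lemma Rint_split (m : {measure set (mR R) -> \bar R}) (a b e : R) (f : R -> R) : a <= b -> b <= e ->
  m.-integrable `[a, e[ (EFin \o f) ->
  \int[m]_(t in `[a, e[) f t = \int[m]_(t in `[a, b[) f t + \int[m]_(t in `[b, e[) f t.
Proof.
move=> ab be; rewrite (@itv_bndbnd_setU _ _ (BLeft a) (BLeft b) (BLeft e)) ?bnd_simp// => fi.
rewrite Rintegral_setU//; apply/disj_setPRL => x /=; rewrite !in_itv/= => /andP[bx _].
by apply/negP; rewrite negb_and -!leNgt bx orbT.
Qed.

End Rintegral_bounds.

Section hoelder_probability.
Context d (T : measurableType d) (R : realType) (mu : probability T R).
Variables (p q : R) (p1 : 1 < p) (q1 : 1 < q) (pq : p^-1 + q^-1 = 1).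
Let p0 : 0 < p := lt_trans ltr01 p1.
Let q0 : 0 < q := lt_trans ltr01 q1.

Lemma hoelder_le (f g : T -> R) (X Y : R) : mfun f -> mfun g ->
  ('N[mu]_p%:E[EFin \o f] <= X%:E)%E -> ('N[mu]_q%:E[EFin \o g] <= Y%:E)%E ->
  (\int[mu]_x `|f x * g x|%:E <= (X * Y)%:E)%E.
Proof.
move=> mf mg fX gY; have := hoelder mu mf mg p0 q0 pq; rewrite Lnorm1 => h.
by rewrite (le_trans h)// EFinM lee_pmul ?Lnorm_ge0.
Qed.

Lemma Lnorm_cst1_prob (r : R) : ('N[mu]_r%:E[EFin \o (fun=> 1%R : R)] = 1)%E.
Proof.
transitivity (mu setT `^ r^-1)%E; first exact: Lnorm_cst1. by rewrite prob_setT poweR1r.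
Qed.

Lemma L1_le_Lp (f : T -> R) (X : R) : mfun f ->
  ('N[mu]_p%:E[EFin \o f] <= X%:E)%E -> (\int[mu]_x `|f x|%:E <= X%:E)%E.
Proof.
move=> mf fX; have := @hoelder_le f (fun=> 1) X 1 mf (mcst _) fX.
rewrite Lnorm_cst1_prob => /(_ (lexx _)); rewrite mulr1. by under eq_integral do rewrite mulr1.
Qed.
End hoelder_probability.

(** The three terms [k1], [k2], [k3] carry an error of at most a quarter of [e2] each, while the
    pulse (a2 - a1) and the final rest (a5 - a4) are exact. This is the source of the factor 3/4. *)
Lemma three_errors (R : realType) (e1 e2 k1 k2 k3 a0 a1 a2 a3 a4 a5 : R) : e1 <= e2 / 4 ->
  `|k3 - (a4 - a3)| <= e1 -> `|k2 - (a3 - a2)| <= e1 -> `|k1 - (a1 - a0)| <= e1 ->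
  `|k1 + (a2 - a1 + (k2 + (k3 + (a5 - a4)))) - (a5 - a0)| <= 3 / 4 * e2.
Proof.
rewrite !ler_norml => h /andP[? ?] /andP[? ?] /andP[? ?]; apply/andP; split; lra.
Qed.

Lemma Rint_eq0 d (T : measurableType d) (R : realType) (mu : {measure set T -> \bar R})
  (D : set T) (f : T -> R) : (forall x, f x = 0) -> \int[mu]_(x in D) f x = 0.
Proof. by move=> f0; rewrite /Rintegral integral0_eq// => x _; rewrite f0. Qed.

(** * Mixed norms in time and space *)

Section mixed_norms.
Variables (R : realType) (d : nat).

Lemma LnormE d' (X : measurableType d') (mu : {measure set X -> \bar R}) (r : R) (f : X -> \bar R) :
  'N[mu]_r%:E[f]%E = ((\int[mu]_x `|f x| `^ r) `^ r^-1)%E.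
Proof. by rewrite Lnorm.unlock. Qed.

Lemma LnormyE d' (X : measurableType d') (mu : {measure set X -> \bar R}) (f : X -> \bar R) :
  'N[mu]_+oo[f]%E = (if (0 < mu setT)%E then ess_sup_inf.ess_sup mu (abse \o f) else 0)%E.
Proof. by rewrite Lnorm.unlock. Qed.

Lemma mfun_Lnorm_slices (r : R) (f : R -> 'rV[R]_d -> R) :
  jmfun (fun w => f w.1 w.2) ->
  mfun (fun t : mR R => hnorm r (f t)%E).
Proof.
move=> mf; rewrite (_ : (fun t => _) = (fun t : mR R => (\int[haar]_x (`|f t x| `^ r)%:E) `^ r^-1)%E); last first.
  by apply/funext => t; rewrite Lnorm_EFinE. apply: (mcomp (measurable_poweR r^-1)).
apply: (@mfubiniF _ _ (mR R) 'rV[R]_d R haar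
  (fun w => (`|f w.1 w.2| `^ r)%:E)) => [|w]; last by rewrite lee_fin powR_ge0. exact: mfun_powR_EFin.
Qed.

Lemma LsLp_bounded_cost (T sg r : R) (f : R -> 'rV[R]_d -> R) (c : R -> R) :
  0 < sg -> 0 <= T ->
  jmfun (fun w => f w.1 w.2) ->
  mfun (c : mR R -> R) ->
  (forall t, Zper (f t)) -> (forall t, 0 <= c t) ->
  (forall t, (hnorm r (f t) `^ sg <= (c t)%:E)%E) ->
  (\int[leb]_(t in `[0%R, T[) (c t)%:E < +oo)%E ->
  LsLp T sg%:E r%:E f.
Proof.
move=> sg0 T0 mf mc pf c0 fc ci; split; first by move=> t _; exact: pf. exact: (measurable_funS measurableT _ mf).
rewrite (LnormE leb) poweR_lty//. have mN := mfun_Lnorm_slices r mf.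
rewrite [X in integral _ _ X](_ : _ = (fun t => hnorm r (f t) `^ sg)%E \_ `[0, T]); last first.
  apply/funext => t; rewrite !patchE; case: ifP => _; first by rewrite gee0_abs ?Lnorm_ge0.
  by rewrite abse0 poweR0r ?gt_eqF. rewrite -integral_mkcond -integral_itv_bndo_bndc; last first.
  by apply: mfunTS; apply: (mcomp (measurable_poweR sg)). apply: le_lt_trans ci; exact: int_le.
Qed.

Lemma LsLp_bounded (T r C : R) (f : R -> 'rV[R]_d -> R) :
  jmfun (fun w => f w.1 w.2) ->
  (forall t, Zper (f t)) -> 0 <= C ->
  (forall t, (hnorm r (f t) <= C%:E)%E) ->
  LsLp T +oo%E r%:E f.
Proof.
move=> mf pf C0 fC; split; first by move=> t _; exact: pf. exact: (measurable_funS measurableT _ mf).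
rewrite LnormyE; case: ifP => _; last by rewrite ltry. apply: (@le_lt_trans _ _ C%:E); last by rewrite ltry.
apply/ess_sup_inf.ess_supP; apply: aeW => t /=; rewrite patchE; case: ifP => _. by rewrite gee0_abs ?Lnorm_ge0.
by rewrite abse0 lee_fin.
Qed.

Lemma LsLp0 (T : R) (s p : \bar R) : (1 <= s)%E -> (1 <= p)%E ->
  LsLp T s p (fun _ _ => 0 : R) (d := d).
Proof.
move=> s1 p1; have s0 : (0 < s)%E by exact: lt_le_trans s1. have p0 : (0 < p)%E by exact: lt_le_trans p1. split=> //.
rewrite (_ : (fun t => _) \_ _ = cst 0%E); first by rewrite Lnorm0 ?gt_eqF// ltry.
apply/funext => t; rewrite patchE; case: ifP => // _. by rewrite (_ : EFin \o _ = cst 0%E)// Lnorm0 ?gt_eqF.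
Qed.
End mixed_norms.

Lemma periodic_derive2 (R : realType) (d : nat) (f : ST R d -> R) v :
  (forall t, Zper (fun x => f (t, x))) -> forall t, Zper (fun x => 'D_v f (t, x)).
Proof.
move=> pf t x k; rewrite /derive.
have -> // : (fun h : R => h^-1 *: ((f \o shift (t, x + map_mx intr k)) (h *: v) - f (t, x + map_mx intr k)))
    = (fun h : R => h^-1 *: ((f \o shift (t, x)) (h *: v) - f (t, x))).
apply/funext => h /=; rewrite (pf t); congr (_ *: (_ - _)).
have E y : h *: v + (t, y) = ((h *: v).1 + t, (h *: v).2 + y) by []. by rewrite !E addrA (pf _).
Qed.

(** * The tree of pulses *)

Section nonuniqueness.
Variables (R : realType) (d : nat) (p q s : R).
Hypotheses (d3 : (2 < d)%N) (p1 : 1 < p) (q1 : 1 < q) (pq : p^-1 + q^-1 = 1) (s1 : 1 <= s).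

(** The coordinate of the quarters has to differ from the direction of the flux and from the
    coordinate of its support, hence d >= 3. *)
Lemma third_index (j l : 'I_d) : exists k, j != k /\ k != l.
Proof.
have /allPn[k _] : ~~ all (mem [:: j; l]) (enum 'I_d).
  apply/negP => /allP sub; have := uniq_leq_size (enum_uniq 'I_d) sub. by rewrite size_enum_ord leqNgt d3.
by rewrite !inE negb_or => /andP[kj kl]; exists k; rewrite eq_sym.
Qed.

Lemma nat_above (a : R) : exists2 n, (0 < n)%N & a <= n%:R.
Proof.
exists (Num.bound `|a|).+1 => //; rewrite (le_trans (ler_norm a))//.
by rewrite (le_trans (ltW (archi_boundP (normr_ge0 a))))// ler_nat.
Qed.

Lemma node_exists (G : gap R d) (del D : R) : good s G del D ->
  exists N, node_ok p q s G del D N.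
Proof.
move=> [GO D0 del0 bud time]. have [k [jk kl]] := third_index (gj G) (gl G).
set th := density R (gn G) (ge G); set M := gM G; set h := gh G; set n := gn G.
have th0 : 0 <= th by exact: density_ge0. have th1 : th <= 1 by exact: density_le1. have M1 : 1 <= M := gap_M GO.
have M0 : 0 <= M by exact: le_trans M1. have h0 : 0 <= h := gap_h GO. have n0 : (0 < n)%N := gap_n GO.
have s0 : 0 < s by rewrite (lt_le_trans _ s1). have q0 := lt_trans ltr01 q1.
(* The numbers anticipate the budgets checked at the end: 24 times the budget is at most 18(4h +
   17M)/K for the two gaps in x_k and 48M/c for the gap in x_l, and both must be below (del/4)^2 =
   del^2/16. *)
have d20 : 0 < del ^+ 2 by rewrite exprn_gt0. have [K K0 HK] := nat_above (384 * (3 * h + 13 * M) / del ^+ 2).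
(* Q answers for the gradient: its frequency over N is at most 4K + 1, the strip has measure at most
   3/Q, and (4K + 1)(3/Q)^(1/q) <= del. *)
have [c c0 Hc] := nat_above (768 * M / del ^+ 2). have [Q' _ HQ'] := nat_above (3 * ((4 * K%:R + 1) / del) `^ q).
pose Q := (Q' + 4)%N. have Q4 : (3 < Q)%N by rewrite /Q addnS ltnS leq_addl.
have HQ : 3 * ((4 * K%:R + 1) / del) `^ q <= Q%:R by rewrite (le_trans HQ')// ler_nat leq_addr.
(* A lower bound imposed on X; it forces the duration (del/X)^s to be at most D/4. *)
pose C := del * (4 / D) `^ s^-1. have C0 : 0 < C by rewrite mulr_gt0// powR_gt0// divr_gt0.
(* N is made large last: 1/N <= del bounds the velocity, and the part of X w/N that the budget does
   not cover is at most (13M + C)/N <= del^2/2. *)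
have [b1 _ Hb1] := nat_above del^-1. have [b2 _ Hb2] := nat_above (2 * (13 * M + C) / del ^+ 2).
pose b := (b1 + b2).+1. have {}Hb1 : del^-1 <= b%:R by rewrite (le_trans Hb1)// ler_nat leqW// leq_addr.
have {}Hb2 : 2 * (13 * M + C) / del ^+ 2 <= b%:R by rewrite (le_trans Hb2)// ler_nat leqW// leq_addl.
pose lam := os_lam c b Q; pose NN := os_N n c b Q. pose mk := os_mk n c b K Q; pose ml := os_ml n c Q.
have pn m : (0 < m)%N -> 0 < m%:R :> R by rewrite ltr0n. have Q0 : (0 < Q)%N by exact: leq_ltn_trans Q4.
have lam0 : (0 < lam)%N by rewrite !muln_gt0 c0 Q0. have N0 : (0 < NN)%N by apply: os_N_gt0.
have bN : (b <= NN)%N by rewrite /NN /os_N /os_lam mulnA leq_pmull// !muln_gt0 n0 c0 Q0.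
have bNR : b%:R <= NN%:R :> R by rewrite ler_nat. have NE : NN%:R = n%:R * lam%:R :> R by rewrite -natrM.
have mkE : mk%:R = NN%:R * (4 * K%:R) :> R by rewrite -!natrM.
have mlE : ml%:R * b%:R = NN%:R :> R by rewrite -natrM /ml /NN /os_ml /os_N /os_lam !mulnA.
pose v1 := 3 / Q%:R * th; pose w := v1 `^ q^-1.
have Q3 : 3 / Q%:R <= 1 :> R by rewrite ler_pdivrMr ?pn// mul1r ler_nat ltnW. have v10 : 0 <= v1 by rewrite mulr_ge0.
have v1Q : v1 <= 3 / Q%:R by rewrite ler_piMr. have v11 : v1 <= 1 by exact: le_trans Q3.
have w0 : 0 <= w by exact: powR_ge0. have powle1 r a : 0 <= a -> a <= 1 -> 0 <= r -> a `^ r <= 1 :> R.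
  move=> a0 a1 r0; have E : 1 `^ r = 1 :> R by rewrite powR1.
  rewrite -[leRHS]E; apply: ge0_ler_powR => //; rewrite nnegrE//. have w1 : w <= 1 by rewrite powle1// invr_ge0 ltW.
have wK : (4 * K%:R + 1) * w <= del. have a0 : 0 < 4 * K%:R + 1 :> R by rewrite ltr_wpDl// mulr_ge0.
  have A0 : 0 < (4 * K%:R + 1) / del by rewrite divr_gt0. set Z := _ / del in A0. have h1 : v1 <= Z `^ (- q).
    rewrite powRN (le_trans v1Q)// ler_pdivrMr ?pn// mulrC ler_pdivlMr ?powR_gt0//. have h2 : w <= Z^-1.
    have -> : Z^-1 = (Z `^ (- q)) `^ q^-1. by rewrite -powRrM mulNr mulfV ?gt_eqF// powR_inv1// ltW.
    by apply: ge0_ler_powR; rewrite ?nnegrE ?powR_ge0// invr_ge0 ltW.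
  apply: (@le_trans _ _ ((4 * K%:R + 1) * Z^-1)); first by rewrite ler_wpM2l// ltW.
  by rewrite /Z invf_div mulrCA divff ?mulr1// gt_eqF. pose X0 := (4 * Q%:R * lam%:R * h + 4 * M) * v1 `^ p^-1 + M.
have al0 : 0 <= 4 * Q%:R * lam%:R * h by rewrite !mulr_ge0.
have X00 : 0 <= X0 by rewrite addr_ge0// mulr_ge0 ?powR_ge0// addr_ge0// mulr_ge0. pose X := X0 + C.
(* The longest duration compatible with tau X^s <= del^s, where X bounds the norm of the density. *)
have XC : C <= X by rewrite lerDr. have Xp : 0 < X by exact: lt_le_trans XC. pose tau := (del / X) `^ s.
have dX0 : 0 < del / X by rewrite divr_gt0. have tau0 : 0 < tau by rewrite powR_gt0.
have NNp : 0 < NN%:R :> R by exact: pn. have XW : X * (w / NN%:R) <= del ^+ 2. have e1 : v1 `^ p^-1 * w = v1.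
    rewrite /w -powRD; first by rewrite pq powRr1. by rewrite pq oner_eq0.
  have -> : X * (w / NN%:R) = (4 * Q%:R * lam%:R * h + 4 * M) * (v1 `^ p^-1 * w) / NN%:R +
      (M + C) * w / NN%:R by rewrite /X /X0; ring. rewrite e1.
  (* The exponents 1/p and 1/q have put [v1] to the first power; its factor 3/Q cancels the
     amplitude Q, and lam cancels against N = n lam. What remains of the main term is 12
     [budget]. *)
  have e2 : (4 * Q%:R * lam%:R * h + 4 * M) * v1 / NN%:R = 12 * (th * h / n%:R) + 12 * M * th / Q%:R / NN%:R.
    by rewrite /v1 NE; field; rewrite !pnatr_eq0 -!lt0n ?lam0 ?n0 ?Q0.
  have e3 : 12 * (th * h / n%:R) <= del ^+ 2 / 2 by move: bud; rewrite /budget -/th -/h -/n; lra.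
  have e4 : 12 * M * th / Q%:R / NN%:R <= 12 * M / NN%:R. rewrite ler_pM2r ?invr_gt0// ler_pdivrMr ?pn//.
    by rewrite ler_wpM2l ?mulr_ge0// (le_trans th1)// ler1n. have e5 : (M + C) * w / NN%:R <= (M + C) / NN%:R.
    by rewrite ler_pM2r ?invr_gt0// ler_piMr// addr_ge0// ltW. have e6 : (13 * M + C) / NN%:R <= del ^+ 2 / 2.
    rewrite ler_pdivrMr// -ler_pdivrMl ?divr_gt0// (le_trans _ (le_trans Hb2 bNR))//.
    by apply: eqW; field; rewrite gt_eqF. rewrite e2; have -> : del ^+ 2 = del ^+ 2 / 2 + del ^+ 2 / 2 by field.
  rewrite -addrA lerD// (le_trans _ e6)// (le_trans (lerD e4 e5))//.
  by have -> : 12 * M / NN%:R + (M + C) / NN%:R = (13 * M + C) / NN%:R by ring.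
have PO : pulse_ok p q s (os_pulse q G k c b K Q tau X) del.
  apply: os_pulse_ok => //; rewrite -/th -/v1 -/w -/lam -/NN -/mk -/ml -/M -/h.
  - exact: ltW.
  - by rewrite /X /X0 lerDl ltW.
  - by rewrite /tau -(powRM _ (ltW dX0) (ltW Xp)) divfK ?gt_eqF.
  - rewrite ler_pdivrMr// (le_trans w1)// mulrC -ler_pdivrMr// mul1r; exact: le_trans bNR.
  - apply: le_trans wK; rewrite mulrAC ler_wpM2r// ler_pdivrMr// mulrDl mul1r mkE mulrC lerD2l.
    by rewrite -mlE ler_peMr// ler1n.
  (* As tau^(-1/s) = X/del, the L^{s'} bound is the bound on the product of the two norms divided by
     del. *)
  - have -> : tau `^ (- s^-1) = X / del. by rewrite /tau -powRrM mulrN mulfV ?gt_eqF// powR_inv1 ?ltW// invf_div.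
    by rewrite mulrAC ler_pdivrMr// -expr2. pose M' := 4 * Q%:R * lam%:R * h + 12 * Q%:R * M. have M'0 : 0 < M'.
  have Qn : 0 < 12 * Q%:R * M by rewrite !mulr_gt0// ?pn// (lt_le_trans _ M1). by rewrite /M' ltr_wpDl.
(* Three gaps of duration at most D/8 and a pulse of at most D/4 leave time for a rest; the second
   entry is the time condition of the three new gaps. *)
pose g := Num.min (D / 8) ((del / 4 / M') `^ s). have g0 : 0 < g by rewrite lt_min divr_gt0// powR_gt0// !divr_gt0.
have gM' : M' `^ s * g <= (del / 4) `^ s. have -> : (del / 4) `^ s = M' `^ s * (del / 4 / M') `^ s.
    rewrite -powRM ?(ltW M'0)//; last by rewrite ltW// !divr_gt0. by congr (_ `^ s); field; rewrite gt_eqF.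
  by rewrite ler_wpM2l ?powR_ge0// ge_min lexx orbT. have d4 : 0 < del / 4 by rewrite divr_gt0.
have bud1 : 24 * (density R mk (os_e1 c b K Q (ge G)) * (4 * Q%:R * lam%:R * h + 17 * Q%:R * M) / mk%:R) <= (del / 4) ^+ 2.
  rewrite /mk os_density// -/th mkE NE.
  have -> : 24 * (3 / Q%:R * th * (4 * Q%:R * lam%:R * h + 17 * Q%:R * M) / (n%:R * lam%:R * (4 * K%:R)))
     = (18 * th * (4 * h + 17 * (M / lam%:R)) / n%:R) / K%:R. by field; rewrite !pnatr_eq0 -!lt0n ?lam0 ?n0 ?K0 ?Q0.
  have -> : (del / 4) ^+ 2 = del ^+ 2 / 16 by field. rewrite ler_pdivrMr ?pn//.
  have a1 : M / lam%:R <= M by rewrite ler_pdivrMr ?pn// ler_peMr// ler1n.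
  have a2 : 0 <= M / lam%:R by rewrite divr_ge0. apply: (@le_trans _ _ (18 * (4 * h + 17 * M))).
    rewrite ler_pdivrMr ?pn// -mulrA; apply: (@le_trans _ _ (18 * (4 * h + 17 * M))).
      rewrite ler_wpM2l//; apply: (@le_trans _ _ (4 * h + 17 * (M / lam%:R))); last by lra.
      by rewrite ler_piMl// addr_ge0// mulr_ge0. by rewrite ler_peMr ?ler1n// mulr_ge0// addr_ge0// mulr_ge0.
  have := HK; rewrite ler_pdivrMr//; lra.
have bud3 : 24 * (density R ml xpredT * (2 * Q%:R * M) / ml%:R) <= (del / 4) ^+ 2.
  rewrite density_true ?os_ml_gt0// mul1r. have -> : 24 * (2 * Q%:R * M / ml%:R) = 48 * M / n%:R / c%:R.
    by rewrite /ml /os_ml !natrM; field; rewrite !pnatr_eq0 -!lt0n ?n0 ?c0 ?Q0.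
  have -> : (del / 4) ^+ 2 = del ^+ 2 / 16 by field. rewrite ler_pdivrMr ?pn//; apply: (@le_trans _ _ (48 * M)).
    by rewrite ler_pdivrMr ?pn// ler_peMr ?mulr_ge0// ler1n. have := Hc; rewrite ler_pdivrMr//; lra.
exists (Node (os_pulse q G k c b K Q tau X) (os_kid1 G k c b K Q) (os_kid2 G k c b K Q) (os_kid3 G c b Q) g).
split => //=.
- by split => //; exact: os_kid1_ok.
- by split => //; exact: os_kid2_ok.
- by split => //; exact: (@os_kid3_ok _ _ _ k _ b K).
- have g4 : g <= D / 8 by rewrite ge_min lexx. have t4 : tau <= D / 4. apply: (@le_trans _ _ ((del / C) `^ s)).
      apply: ge0_ler_powR; [exact: ltW|exact: ltW|by rewrite nnegrE ltW// divr_gt0|]. by rewrite ler_pM2l// lef_pV2.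
    have -> : del / C = (4 / D) `^ (- s^-1). by rewrite /C invfM mulrA divff ?gt_eqF// mul1r powRN.
    by rewrite -powRrM mulNr mulVf ?gt_eqF// powR_inv1 ?invf_div// ltW// divr_gt0. lra.
Qed.

Record job := Job { jG : gap R d; jt : R; jdel : R; jD : R; jok : good s jG jdel jD }.

Definition jN (J : job) : node R d :=
  sval (cid (node_exists (jok J))).
Lemma jN_ok J : node_ok p q s (jG J) (jdel J) (jD J) (jN J).
Proof. exact: (svalP (cid (node_exists (jok J)))). Qed.

Definition jP J := nP (jN J).
Definition jP_ok J : pulse_ok p q s (jP J) (jdel J) := node_P (jN_ok J).
Definition jt1 J := jt J + ng (jN J).
Definition jt2 J := jt1 J + ptau (jP J).
Definition jt3 J := jt2 J + ng (jN J).
Definition jt4 J := jt3 J + ng (jN J).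
Definition jend J := jt J + jD J.
Definition kid1 J := Job (jt J) (node_1 (jN_ok J)).
Definition kid2 J := Job (jt2 J) (node_2 (jN_ok J)).
Definition kid3 J := Job (jt3 J) (node_3 (jN_ok J)).

Lemma ng_gt0 J : 0 < ng (jN J). Proof. exact: good_D (node_1 (jN_ok J)). Qed.
Lemma jdel_gt0 J : 0 < jdel J. Proof. exact: good_del (jok J). Qed.
Lemma jD_gt0 J : 0 < jD J. Proof. exact: good_D (jok J). Qed.
Lemma jt_order J : [/\ jt J < jt1 J, jt1 J < jt2 J, jt2 J < jt3 J, jt3 J < jt4 J & jt4 J < jend J].
Proof.
have g0 := ng_gt0 J; have t0 := pulse_tau (jP_ok J); have := node_time (jN_ok J).
rewrite -/(jP J) => h; rewrite /jt4 /jt3 /jt2 /jt1 /jend !ltrDl; split => //; lra.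
Qed.

(* The job responsible for time [t], when the gaps of depth [m] are left
   unresolved; [true] is for the pulse of this job, [false] for its final rest. *)
Fixpoint pos (m : nat) (J : job) (t : R) : option (job * bool) :=
  if m isn't m'.+1 then None
  else if t < jt1 J then pos m' (kid1 J) t
  else if t < jt2 J then Some (J, true)
  else if t < jt3 J then pos m' (kid2 J) t
  else if t < jt4 J then pos m' (kid3 J) t
  else Some (J, false).

Lemma pos_mono m J t x : pos m J t = Some x -> pos m.+1 J t = Some x.
Proof.
elim: m J => // m IH J; rewrite [in X in X -> _]/=; rewrite [pos m.+2 _ _]/=. case: ifP => _; first exact: IH.
case: ifP => _ //; case: ifP => _; first exact: IH. by case: ifP => _ //; exact: IH.
Qed.

Lemma pos_monon m n J t x : (m <= n)%N -> pos m J t = Some x -> pos n J t = Some x.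
Proof.
move=> /subnKC <-; elim: (n - m)%N => [|k IH]; first by rewrite addn0.
by move=> h; rewrite addnS; apply: pos_mono; exact: IH.
Qed.

(** The value at which [pos] stabilizes; [None] at the times that stay unresolved at every depth,
    where [run] sets density and velocity to 0. *)
Definition posoo (J : job) (t : R) : option (job * bool) :=
  if pselect (exists m, pos m J t <> None) is left h then pos (sval (cid h)) J t else None.

Lemma posoo_spec J t : \forall m \near \oo, pos m J t = posoo J t.
Proof.
rewrite /posoo; case: pselect => [h|h].
- case: (cid h) => m /=; case E : (pos m J t) => [x|] // _. by exists m => // n /= mn; exact: pos_monon E.
- apply: nearW => m; case E : (pos m J t) => [x|] //; exfalso; apply: h. by exists m; rewrite E.
Qed.

Lemma pos_le m J t x : pos m J t = Some x -> posoo J t = Some x.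
Proof.
move=> E; have [n _ /(_ (maxn m n))] := posoo_spec J t.
by rewrite /= leq_maxr => <- //; apply: pos_monon E; exact: leq_maxl.
Qed.

Lemma pos_del m J t J' b : pos m J t = Some (J', b) -> jdel J' <= jdel J.
Proof.
elim: m J => // m IH J /=; have d4 : jdel J / 4 <= jdel J by have := jdel_gt0 J; lra.
case: ifP => _; first by move=> /IH/le_trans; apply. case: ifP => _; first by case=> <-.
case: ifP => _; first by move=> /IH/le_trans; apply. by case: ifP => _; [move=> /IH/le_trans; apply|case=> <-].
Qed.

Lemma posoo_del J t J' b : posoo J t = Some (J', b) -> jdel J' <= jdel J.
Proof.
by have [n _ /(_ n (leqnn n))] := posoo_spec J t => <-; exact: pos_del.
Qed.

Section run.
Variable F : job -> bool -> R -> 'rV[R]_d -> R.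
Definition run (o : option (job * bool)) (t : R) (x : 'rV[R]_d) : R :=
  if o is Some (J, b) then F J b t x else 0.

Hypothesis mF : forall J b, jmfun
  (fun w => F J b w.1 w.2).

Lemma mfun_lt_cst (a : R) : @measurable_fun _ _ (mST R d) bool
  setT (fun w => w.1 < a).
Proof. by apply: measurable_fun_ltr; [exact: mfst|exact: mcst]. Qed.

Lemma run_mfun m J : jmfun
  (fun w => run (pos m J w.1) w.1 w.2).
Proof.
elim: m J => [|m IH] J; first exact: mcst. rewrite (_ : (fun w => _) = (fun w : mST R d =>
  if w.1 < jt1 J then run (pos m (kid1 J) w.1) w.1 w.2 else if w.1 < jt2 J then F J true w.1 w.2
  else if w.1 < jt3 J then run (pos m (kid2 J) w.1) w.1 w.2 else if w.1 < jt4 J then run (pos m (kid3 J) w.1) w.1 w.2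
  else F J false w.1 w.2)); last first. by apply/funext => w /=; do 4 case: ifP => // _.
by do 4 (apply: measurable_fun_ifT => //; first exact: mfun_lt_cst).
Qed.

Lemma runoo_mfun J : jmfun
  (fun w => run (posoo J w.1) w.1 w.2).
Proof.
apply: (measurable_fun_cvg (run_mfun^~ J)) => w _. apply: cvg_near_cst; apply: filterS (posoo_spec J w.1) => m ->//.
Qed.

Lemma runoo_cvg J t x : run (pos m J t) t x @[m --> \oo] --> run (posoo J t) t x.
Proof. by apply: cvg_near_cst; apply: filterS (posoo_spec J t) => m ->. Qed.
End run.

(** * Summation of costs over the tree *)

Section cost.
Variables (c : job -> bool -> R) (cst : R -> R).
Hypotheses (c0 : forall J b, 0 <= c J b)
  (c_pulse : forall J, c J true * ptau (jP J) <= cst (jdel J))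
  (c_idle : forall J, c J false * jD J <= cst (jdel J))
  (cst4 : forall del, 0 < del -> cst (del / 4) <= cst del / 4).
Let Fc J b (t : R) (x : 'rV[R]_d) : R := c J b.
Definition cost m J t := run Fc (pos m J t) t 0.
Definition costoo J t := run Fc (posoo J t) t 0.

Let mslice (f : ST R d -> R) :
  jmfun f ->
  mfun (fun t : mR R => f (t, 0)).
Proof. move=> mf.
have mp : mfun (fun t : mR R => (t, 0 : 'rV[R]_d)). by apply: measurable_fun_pair => //; exact: mcst.
exact: (mcomp mf mp).
Qed.

Lemma cost_mfun m J : mfun (cost m J : mR R -> R).
Proof. by apply: (mslice (run_mfun _ m J)) => J' b; exact: mcst. Qed.
Lemma costoo_mfun J : mfun (costoo J : mR R -> R).
Proof. by apply: (mslice (runoo_mfun _ J)) => J' b; exact: mcst. Qed.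
Lemma cost_ge0 m J t : 0 <= cost m J t.
Proof. by rewrite /cost; case: (pos _ _ _) => // -[? ?]; exact: c0. Qed.
Lemma costoo_ge0 J t : 0 <= costoo J t.
Proof. by rewrite /costoo; case: (posoo _ _) => // -[? ?]; exact: c0. Qed.
Lemma cost_le m J t : cost m J t <= costoo J t.
Proof.
rewrite {1}/cost; case E : (pos m J t) => [[J' b]|]; last exact: costoo_ge0. by rewrite /costoo (pos_le E).
Qed.

Lemma ge0_int_split (a b e : R) (f : mR R -> \bar R) :
  a <= b -> b <= e -> mfun f -> (forall x, 0 <= f x)%E ->
  (\int[leb]_(t in `[a, e[) f t = \int[leb]_(t in `[a, b[) f t + \int[leb]_(t in `[b, e[) f t)%E.
Proof.
move=> ab be mf f0; rewrite (@itv_bndbnd_setU _ _ (BLeft a) (BLeft b) (BLeft e)) ?bnd_simp//.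
rewrite ge0_integral_setU//; first exact: (mfunTS mf). apply/disj_setPRL => x /=; rewrite !in_itv/= => /andP[bx _].
by apply/negP; rewrite negb_and -!leNgt bx orbT.
Qed.

Lemma integral_itv_le (a b k : R) (f : mR R -> R) : a <= b -> 0 <= k ->
  mfun f -> (forall t, 0 <= f t) ->
  (forall t, a <= t < b -> f t <= k) ->
  (\int[leb]_(t in `[a, b[) (f t)%:E <= (k * (b - a))%:E)%E.
Proof.
move=> ab k0 mf f0 fk; apply: (@le_trans _ _ (\int[leb]_(t in `[a, b[) k%:E)%E). exact: int_le.
rewrite integral_cst//= (@leb_itv R `[a, b[) /= lte_fin. case: ltP => [_|ba]; first by rewrite -EFinB -EFinM.
by rewrite mule0 lee_fin mulr_ge0// subr_ge0.
Qed.

(** A node pays [cst] for its pulse and [cst] for its rest, and each of the three subjobs at most a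
    quarter of the claimed bound: 8 = 2 + 3 * 8/4. *)
Lemma cost_bound m J : (\int[leb]_(t in `[jt J, jend J[) (cost m J t)%:E <= (8 * cst (jdel J))%:E)%E.
Proof.
have cst0 J' : 0 <= cst (jdel J') by apply: le_trans (c_idle J'); rewrite mulr_ge0// ltW// jD_gt0.
elim: m J => [|m IH] J. by rewrite integral0_eq// lee_fin mulr_ge0. have [h1 h2 h3 h4 h5] := jt_order J.
have mc := cost_mfun m.+1 J. have mc' : mfun (fun t : mR R => (cost m.+1 J t)%:E). exact/mEFinP.
have c0' t : (0 <= (cost m.+1 J t)%:E)%E by rewrite lee_fin cost_ge0.
rewrite (@ge0_int_split _ (jt1 J))//; [|lra|lra]. rewrite (@ge0_int_split (jt1 J) (jt2 J))//; [|lra|lra].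
rewrite (@ge0_int_split (jt2 J) (jt3 J))//; [|lra|lra]. rewrite (@ge0_int_split (jt3 J) (jt4 J))//; [|lra|lra].
have kid K (a b : R) : jdel K = jdel J / 4 -> jt K = a -> jend K = b ->
    (forall t, a <= t < b -> cost m.+1 J t = cost m K t) ->
    (\int[leb]_(t in `[a, b[) (cost m.+1 J t)%:E <= (2 * cst (jdel J))%:E)%E.
  move=> dK <- <- Ec; have := IH K; rewrite dK => IHK.
  rewrite (eq_integral (fun t : mR R => (cost m K t)%:E)); last first. by move=> t; rewrite inE/= in_itv/= => /Ec ->.
  rewrite (le_trans IHK)// lee_fin; have := cst4 (jdel_gt0 J); lra.
have k1 : (\int[leb]_(t in `[jt J, jt1 J[) (cost m.+1 J t)%:E <= (2 * cst (jdel J))%:E)%E.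
  apply: (kid (kid1 J)) => // t /andP[_ t1]; by rewrite /cost/= t1.
have k2 : (\int[leb]_(t in `[jt2 J, jt3 J[) (cost m.+1 J t)%:E <= (2 * cst (jdel J))%:E)%E.
  apply: (kid (kid2 J)) => // t /andP[t2 t3]; rewrite /cost/= t3. by rewrite !ltNge t2 (le_trans _ t2)//= ltW.
have k3 : (\int[leb]_(t in `[jt3 J, jt4 J[) (cost m.+1 J t)%:E <= (2 * cst (jdel J))%:E)%E.
  apply: (kid (kid3 J)) => // t /andP[t2 t3]; rewrite /cost/= t3. by rewrite !ltNge t2 !(le_trans _ t2)//=; lra.
have k4 : (\int[leb]_(t in `[jt1 J, jt2 J[) (cost m.+1 J t)%:E <= (cst (jdel J))%:E)%E.
  apply: (le_trans (integral_itv_le (ltW h2) (c0 J true) mc _ _)).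
  - by move=> t; exact: cost_ge0.
  - by move=> t /andP[t1 t2]; rewrite /cost/= t2 ltNge t1.
  - by rewrite lee_fin /jt2 addrAC subrr add0r.
have k5 : (\int[leb]_(t in `[jt4 J, jend J[) (cost m.+1 J t)%:E <= (cst (jdel J))%:E)%E.
  apply: (le_trans (integral_itv_le (ltW h5) (c0 J false) mc _ _)).
  - by move=> t; exact: cost_ge0.
  - by move=> t /andP[t1 t2]; rewrite /cost/= !ltNge t1 !(le_trans _ t1)//=; lra.
  - rewrite lee_fin (le_trans _ (c_idle J))// ler_wpM2l// /jend lerBlDr; lra.
apply: (le_trans (leeD k1 (leeD k4 (leeD k2 (leeD k3 k5))))). rewrite -!EFinD lee_fin; lra.
Qed.

Lemma costoo_bound J : (\int[leb]_(t in `[jt J, jend J[) (costoo J t)%:E <= (8 * cst (jdel J))%:E)%E.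
Proof.
have mI : measurable `[jt J, jend J[%classic by exact: mitv.
apply: (@fatou_bound _ _ _ leb _ mI (fun m t => (cost m J t)%:E)).
- by move=> m; apply/mEFinP; exact: (mfunTS (cost_mfun m J)).
- by move=> m t _; rewrite lee_fin cost_ge0.
- by move=> t _; apply: cvg_EFin; [exact: nearW|exact: runoo_cvg].
- by move=> m; exact: cost_bound.
Qed.
End cost.

Definition rhoF (J : job) (b : bool) (t : R) (x : 'rV[R]_d) : R :=
  if b then prho (jP J) (t - jt1 J) x else gB' (jG J) x.
Definition uF (i : 'I_d) (J : job) (b : bool) (t : R) (x : 'rV[R]_d) : R :=
  if b && (i == pj (jP J)) then pu (jP J) x else 0.

Lemma rhoF_mfun J b : jmfun
  (fun w => rhoF J b w.1 w.2).
Proof.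
rewrite /rhoF; case: b.
- have mp : mfun (fun w : mST R d => (w.1 - jt1 J : mR R, w.2)). apply: measurable_fun_pair; last exact: msnd.
    by apply: mfunB; [exact: mfst|exact: mcst]. exact: (mcomp (pulse_mrho (jP_ok J)) mp).
- have gok := good_ok (jok J). exact: (mcomp (step_mfun (gap_n gok) (gap_sB' gok)) msnd).
Qed.

Lemma uF_mfun i J b : jmfun
  (fun w => uF i J b w.1 w.2).
Proof.
rewrite /uF; case: (b && _); last exact: mcst. exact: (mcomp (pulse_mu (jP_ok J)) msnd).
Qed.

Lemma slice_mfun (f : R -> 'rV[R]_d -> R) t :
  jmfun (fun w => f w.1 w.2) ->
  mfun (f t).
Proof. by move=> mf; exact: (mcomp mf (mpair1 (t : mR R))). Qed.

(** Dominates the spatial integral of the weak formulation, up to the size of the derivatives of the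
    test function: X <= 1 + X^s for the time derivative and X W, by Hölder, for the flux. *)
Definition cweak (J : job) (b : bool) : R :=
  if b then 1 + pX (jP J) `^ s + pX (jP J) * pW (jP J) else 1 + gM (jG J) `^ s.
Definition cstweak (del : R) : R := 2 * del `^ s + del ^+ 2.

Let s0 : 0 < s. Proof. exact: lt_le_trans s1. Qed.

Lemma powRs_ge (x : R) : 1 <= x -> x <= x `^ s.
Proof. by move=> x1; rewrite -{1}[x]powRr1 ?(le_trans _ x1)// ler_powR. Qed.

Lemma jD_le (J : job) : jD J <= jdel J `^ s.
Proof.
have gok := good_ok (jok J); apply: le_trans (good_time (jok J)).
rewrite ler_peMl ?(ltW (good_D (jok J)))// (le_trans (gap_M gok))// powRs_ge//; exact: gap_M.
Qed.

Lemma pow_quarter (r del : R) : 1 <= r -> 0 < del -> (del / 4) `^ r <= del `^ r / 4.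
Proof.
move=> r1 del0; rewrite powRM ?invr_ge0 ?(ltW del0)// ler_wpM2l ?powR_ge0//. have r0 : 0 < r by exact: lt_le_trans r1.
have h : (4^-1 : R) `^ r * 4 `^ r = 1 by rewrite -powRM// mulVf// powR1.
have : (4 : R) <= 4 `^ r by rewrite -{1}[4]powRr1// ler_powR// ler1n.
have := powR_gt0 r (ltr0n R 4 : 0 < 4 :> R); nra.
Qed.

Lemma sqr_quarter (del : R) : 0 < del -> (del / 4) ^+ 2 <= del ^+ 2 / 4.
Proof. by move=> d0; have := sqr_ge0 del; rewrite !expr2; nra. Qed.

Lemma cweak_ge0 J b : 0 <= cweak J b.
Proof.
rewrite /cweak; case: b; rewrite ?addr_ge0 ?powR_ge0//.
by rewrite mulr_ge0// ?(pulse_X (jP_ok J)) ?(pulse_W (jP_ok J)).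
Qed.

Lemma tau_le_D J : ptau (jP J) <= jD J.
Proof.
have := node_time (jN_ok J); have := good_D (node_1 (jN_ok J)). rewrite -/(jP J); lra.
Qed.

Lemma cweak_pulse J : cweak J true * ptau (jP J) <= cstweak (jdel J).
Proof.
have P := jP_ok J; have := pulse_tX P; have := pulse_XW P. have := le_trans (tau_le_D J) (jD_le J).
rewrite /cweak /cstweak; set t := ptau _; set X := pX _; set W := pW _ => h1 h2 h3.
have -> : (1 + X `^ s + X * W) * t = t + t * X `^ s + t * (X * W) by ring. lra.
Qed.

Lemma cweak_idle J : cweak J false * jD J <= cstweak (jdel J).
Proof.
have := good_time (jok J); have := jD_le J; have := sqr_ge0 (jdel J).
rewrite /cweak /cstweak => h1 h2 h3; rewrite mulrDl mul1r; lra.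
Qed.

Lemma cstweak_quarter del : 0 < del -> cstweak (del / 4) <= cstweak del / 4.
Proof.
by move=> d0; have := pow_quarter s1 d0; have := sqr_quarter d0; rewrite /cstweak; lra.
Qed.

(** * The weak formulation along the tree *)

Section test.
Variables (phi : ST R d -> R) (sphi : smooth phi)
  (pphi : forall t, Zper (fun x => phi (t, x))).
Variables (C a b : R).
Hypothesis C0 : 0 <= C.
Hypothesis CD : forall t x, a <= t <= b -> `|'D_((1, 0) : ST R d) phi (t, x)| <= C.
Hypothesis CDi : forall i t x, a <= t <= b -> `|'D_((0, 'e_i) : ST R d) phi (t, x)| <= C.

Definition integrand (o : R -> option (job * bool)) (w : ST R d) : R :=
  run rhoF (o w.1) w.1 w.2 * ('D_((1, 0) : ST R d) phi w +
    \sum_(i < d) run (uF i) (o w.1) w.1 w.2 * 'D_((0, 'e_i) : ST R d) phi w).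

Definition inner (o : option (job * bool)) (t : R) : R :=
  \int[haar]_x integrand (fun=> o) (t, x).

Let mD v : jmfun ('D_v phi).
Proof. exact: (cont_mfun2 (sm_cont (@sm_D _ _ phi v sphi))). Qed.

Let mintegrand (o : R -> option (job * bool)) :
  jmfun (fun w => run rhoF (o w.1) w.1 w.2) ->
  (forall i, jmfun (fun w => run (uF i) (o w.1) w.1 w.2)) ->
  jmfun (integrand o).
Proof.
move=> mr mu; apply: mfunM => //; apply: mfunD => //. by apply: measurable_sum => i; apply: mfunM.
Qed.

Let mD1 v t : mfun (fun x : 'rV[R]_d => 'D_v phi (t, x)).
Proof. exact: (mcomp (mD v) (mpair1 (t : mR R))). Qed.

Let cphi t : continuous (fun x : 'rV[R]_d => phi (t, x)).
Proof. exact: (slice_continuous (sm_cont sphi)). Qed.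

Lemma inner_pos_mfun m J : mfun (fun t : mR R => inner (pos m J t) t).
Proof.
have mi : jmfun (integrand (fun t => pos m J t)).
  by apply: mintegrand => [|i]; apply: run_mfun => *; [exact: rhoF_mfun|exact: uF_mfun]. exact: (mfun_Rint haar mi).
Qed.

Lemma inner_posoo_mfun J : mfun (fun t : mR R => inner (posoo J t) t).
Proof.
have mi : jmfun (integrand (fun t => posoo J t)).
  by apply: mintegrand => [|i]; apply: runoo_mfun => *; [exact: rhoF_mfun|exact: uF_mfun]. exact: (mfun_Rint haar mi).
Qed.

Lemma sum_uF J t x : \sum_(i < d) uF i J true t x * 'D_((0, 'e_i) : ST R d) phi (t, x) =
  pu (jP J) x * 'D_((0, 'e_(pj (jP J))) : ST R d) phi (t, x).
Proof.
rewrite (bigD1 (pj (jP J)))//= /uF /= eqxx big1 ?addr0// => i ij. by rewrite (negbTE ij) mul0r.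
Qed.

Lemma gB'_Lnorm (J : job) : (hnorm p (gB' (jG J)) <= (gM (jG J))%:E)%E.
Proof.
have gok := good_ok (jok J); have p0 := lt_trans ltr01 p1. have M0 : 0 <= gM (jG J) by exact: le_trans (gap_M gok).
by apply: Lnorm_bounded => // x; exact: gap_BM'.
Qed.

Lemma inner_bound o t : a <= t <= b ->
  `|inner o t| <= C * (if o is Some (J, b) then cweak J b else 0).
Proof.
move=> tab; rewrite /inner; case: o => [[J []]|]; last first.
- rewrite /Rintegral integral0_eq ?normr0 ?mulr0// => x _. by rewrite /integrand/= mul0r.
- have gok := good_ok (jok J). have mB : mfun (gB' (jG J)) := step_mfun (gap_n gok) (gap_sB' gok).
  have E x : integrand (fun=> Some (J, false)) (t, x) = gB' (jG J) x * 'D_((1, 0) : ST R d) phi (t, x).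
    rewrite /integrand/= /rhoF big1 ?addr0// => i _; by rewrite /uF mul0r. under eqRint do rewrite E.
  apply: (@le_trans _ _ (C * gM (jG J))).
    by apply: prob_Rint_abs_le => x; rewrite normrM mulrC ler_pM// ?CD//; exact: gap_BM'.
  rewrite ler_wpM2l// /cweak (le_trans (powRs_ge (gap_M gok)))// lerDr//.
- have P := jP_ok J. have mr : mfun (rhoF J true t) by exact: slice_mfun (rhoF_mfun J true). have mu := pulse_mu P.
  have E x : integrand (fun=> Some (J, true)) (t, x) = rhoF J true t x * ('D_((1, 0) : ST R d) phi (t, x) +
      pu (jP J) x * 'D_((0, 'e_(pj (jP J))) : ST R d) phi (t, x)). by rewrite /integrand/= sum_uF.
  under eqRint do rewrite E. have N1 : (\int[haar]_x `|rhoF J true t x|%:E <= (pX (jP J))%:E)%E.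
    by apply: (L1_le_Lp p1 q1 pq mr); exact: (pulse_Nrho P (t - jt1 J)).
  have N2 : (\int[haar]_x `|rhoF J true t x * pu (jP J) x|%:E <= (pX (jP J) * pW (jP J))%:E)%E.
    by apply: (hoelder_le p1 q1 pq mr mu); [exact: (pulse_Nrho P (t - jt1 J))|exact: (pulse_Nu P)].
  rewrite -lee_fin (le_trans (Rint_abs_le _ _ _))//; apply: (@le_trans _ _ (\int[haar]_x (C%:E * (`|rhoF J true t x|%:E + `|rhoF J true t x * pu (jP J) x|%:E)))%E).
    apply: int_le => x _; rewrite -EFinD -EFinM lee_fin mulrDr (le_trans (ler_normD _ _))// mulrDr lerD//.
      by rewrite normrM mulrC ler_wpM2r// CD. by rewrite mulrA normrM [leRHS]mulrC ler_wpM2l// CDi.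
  rewrite int_scale// ge0_integralD//; last 2 first.
  - by apply/mEFinP; exact: mfun_norm.
  - apply/mEFinP; apply: mfun_norm; exact: mfunM.
  rewrite EFinM lee_wpmul2l ?lee_fin// (le_trans (leeD N1 N2))// -EFinD lee_fin /cweak.
  rewrite lerD2r; have [X1|X1] := leP 1 (pX (jP J)). by rewrite (le_trans (powRs_ge X1))// lerDr.
  by rewrite (le_trans (ltW X1))// lerDl powR_ge0.
Qed.

Lemma inner_cost o t : a <= t <= b ->
  `|inner o t| <= C * run (fun J b (_ : R) (_ : 'rV[R]_d) => cweak J b) o t 0.
Proof. by move=> tab; rewrite (le_trans (inner_bound o tab))// /run; case: o => [[]|]. Qed.

Lemma inner_integrable m J : a <= jt J -> jend J <= b ->
  leb.-integrable `[jt J, jend J[ (fun t => (inner (pos m J t) t)%:E).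
Proof.
move=> aJ Jb; have mI : measurable `[jt J, jend J[%classic by exact: mitv.
apply: (@le_integrable _ _ _ leb _ mI _ (fun t => (C * cost cweak m J t)%:E)).
- by apply/mEFinP; exact: (mfunTS (inner_pos_mfun m J)).
- move=> t /=; rewrite in_itv/= => /andP[t1 t2]; rewrite lee_fin [leRHS]ger0_norm.
    by apply: inner_cost; rewrite (le_trans aJ t1) (le_trans (ltW t2) Jb).
  by rewrite mulr_ge0// cost_ge0// => *; exact: cweak_ge0.
- rewrite [X in _.-integrable _ X](_ : _ = fun t => (C%:E * (cost cweak m J t)%:E)%E)//.
  apply: intZl => //; apply/integrableP; split. by apply/mEFinP; exact: (mfunTS (cost_mfun _ m J)).
  have c0 t : 0 <= cost cweak m J t by apply: cost_ge0; exact: cweak_ge0.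
  under eq_integral do rewrite gee0_abs ?lee_fin//.
  apply: (le_lt_trans (cost_bound cweak_ge0 cweak_pulse cweak_idle cstweak_quarter m J)). by rewrite ltry.
Qed.

Definition bal (f : 'rV[R]_d -> R) (t : R) : R := \int[haar]_x (f x * phi (t, x)).

Let mphi t : mfun (fun x : 'rV[R]_d => phi (t, x)).
Proof. exact: (cont_meas (@cphi t)). Qed.

Let bal_int (f : 'rV[R]_d -> R) M t : mfun f -> (forall x, `|f x| <= M) ->
  hL1 (fun x => f x * phi (t, x)).
Proof.
move=> mf fM; have [U U0 HU] := Zper_bounded (@cphi t) (pphi t). apply: (haar_bnd (M := M * U)).
- exact: mfunM.
- by move=> x _; rewrite normrM ler_pM.
Qed.

(** An unresolved jump errs in space and in time. Summation by parts moves the flux onto the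
    increment of the test function over one cell, which costs C [budget]; the time that elapses
    costs C gM jD. Both are covered by the tolerance. *)
Lemma gap_error (J : job) : a <= jt J -> jend J <= b ->
  `|bal (gB' (jG J)) (jend J) - bal (gB (jG J)) (jt J)| <= C * (jdel J ^+ 2 + jdel J `^ s).
Proof.
move=> aJ Jb; set G := jG J; have gok := good_ok (jok J); rewrite -/G in gok. have n0 := gap_n gok.
have mB := step_mfun n0 (gap_sB gok); have mB' := step_mfun n0 (gap_sB' gok). have mH := step_mfun n0 (gap_sH gok).
have tD : jt J <= jend J by rewrite lerDl ltW// (good_D (jok J)). have nR : 0 < (gn G)%:R :> R by rewrite ltr0n.
have df v x : derivable phi x v by exact: sm_dv. have mbH : mfun (fun x : 'rV[R]_d => gH G (bwd (gn G) (gj G) x)).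
  exact: (step_mfun n0 (step_bwd (gj G) n0 (gap_sH gok))). have ->: bal (gB' G) (jend J) - bal (gB G) (jt J) =
    \int[haar]_x (gH G x * (phi (jend J, x) - phi (jend J, x + (gn G)%:R^-1 *: 'e_(gj G)))) +
    \int[haar]_x (gB G x * (phi (jend J, x) - phi (jt J, x))). have i1 := bal_int (jend J) mB (gap_BM gok).
  have i2 := bal_int (jt J) mB (gap_BM gok). have i3 := bal_int (jend J) mH (gap_Hh gok).
  have i4 := bal_int (jend J) mbH (fun x => gap_Hh gok _).
  have i5 : hL1 (fun x : 'rV[R]_d => gH G x * phi (jend J, x + (gn G)%:R^-1 *: 'e_(gj G))).
    have [U U0 HU] := Zper_bounded (@cphi (jend J)) (pphi (jend J)). apply: (haar_bnd (M := gh G * U)).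
    - by apply: mfunM => //; exact: (mfun_translate _ _ (mphi (jend J))).
    - by move=> x _; rewrite normrM ler_pM// (gap_Hh gok). have e1 : bal (gB' G) (jend J) = bal (gB G) (jend J) +
     (\int[haar]_x (gH G x * phi (jend J, x)) - \int[haar]_x (gH G (bwd (gn G) (gj G) x) * phi (jend J, x))).
    rewrite /bal -RintB// -RintD//; last exact: (integrableB measurableT i3 i4).
    by apply: eqRint => x _; rewrite -mulrBl -(gap_div gok); ring.
  (* Translation invariance trades the backward step of the flux for a forward step of [phi]. *)
  have e2 : \int[haar]_x (gH G (bwd (gn G) (gj G) x) * phi (jend J, x)) =
      \int[haar]_x (gH G x * phi (jend J, x + (gn G)%:R^-1 *: 'e_(gj G))).
    rewrite -(@torus_translate _ _ (gj G) (gn G)%:R^-1).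
    - by apply: eqRint => x _; rewrite /bwd addrK.
    - exact: mfunM.
    - move=> x k; rewrite pphi; congr (_ * _); exact: (periodic_bwd (gn G) (gj G) (gap_pH gok) x k).
  under [X in _ = X + _]eqRint do rewrite mulrBr. under [X in _ = _ + X]eqRint do rewrite mulrBr.
  rewrite !RintB// e1 e2 /bal; ring.
have iH : `|\int[haar]_x (gH G x * (phi (jend J, x) - phi (jend J, x + (gn G)%:R^-1 *: 'e_(gj G))))| <= C * budget G.
  rewrite -lee_fin (le_trans (Rint_abs_le _ _ _))//; have -> : (C * budget G)%:E = (\int[haar]_x ((C * gh G / (gn G)%:R) *
      (ge G (Num.floor ((gn G)%:R * x 0 (gl G))))%:R)%:E)%E.
    rewrite torus_density// ?mulr_ge0 ?(gap_h gok)//; congr EFin; rewrite /budget; ring.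
  apply: int_le => x _; rewrite lee_fin; have [ex|ex] := boolP (ge G _); last first.
    by rewrite (gap_off gok ex) mul0r normr0 mulr0.
  have [c _ cE] := line_MVT (jend J, x) (gn G)%:R^-1 (df (0, 'e_(gj G))).
  have pE r : (jend J, x) + r *: (0, 'e_(gj G)) = (jend J, x + r *: 'e_(gj G)) :> ST R d.
    by apply/pair_equal_spec; split=> //=; rewrite scaler0 addr0. rewrite !pE in cE.
  rewrite mulr1 normrM -opprB normrN cE normrM [`|(gn G)%:R^-1|]gtr0_norm ?invr_gt0//.
  have -> : C * gh G / (gn G)%:R = gh G * ((gn G)%:R^-1 * C) by ring. apply: ler_pM => //; first exact: (gap_Hh gok).
  rewrite ler_wpM2l ?invr_ge0//. by apply: CDi; rewrite Jb (le_trans aJ).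
have iB : `|\int[haar]_x (gB G x * (phi (jend J, x) - phi (jt J, x)))| <= C * (gM G * jD J).
  apply: prob_Rint_abs_le => x; rewrite normrM mulrCA ler_pM ?(gap_BM gok)//.
  have dfl (t : R) : is_derive t 1 (fun s => phi ((0, x) + s *: (1, 0))) ('D_((1, 0) : ST R d) phi ((0, x) + t *: (1, 0))).
    by apply: is_derive_line; exact: df. have tE (t : R) : (0, x) + t *: (1, 0) = (t, x) :> ST R d.
    by apply/pair_equal_spec; split; rewrite /= ?scaler0 ?addr0// add0r [t *: 1]mulr1.
  have [c] := @MVT_segment R (fun s => phi ((0, x) + s *: (1, 0)))
    (fun t => 'D_((1, 0) : ST R d) phi ((0, x) + t *: (1, 0))) _ _ tD (fun t _ => dfl t)
    (cont_subT (@line_continuous _ _ phi (0, x) (1, 0) (df _))).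
  rewrite in_itv/= !tE => /andP[c1 c2] ->; rewrite normrM (_ : jend J - jt J = jD J); last by rewrite /jend addrAC subrr add0r.
  rewrite (gtr0_norm (good_D (jok J))) ler_wpM2r ?(ltW (good_D (jok J)))//.
  by apply: CD; rewrite (le_trans aJ c1) (le_trans c2 Jb). rewrite (le_trans (ler_normD _ _))// mulrDr; apply: lerD.
- rewrite (le_trans iH)// ler_wpM2l//; have := good_budget (jok J).
  have : 0 <= budget G by rewrite /budget divr_ge0// mulr_ge0 ?density_ge0 ?(gap_h gok). rewrite -/G; lra.
- rewrite (le_trans iB)// ler_wpM2l// (le_trans _ (good_time (jok J)))//.
  by rewrite ler_wpM2r ?(ltW (good_D (jok J)))// powRs_ge// (gap_M gok).
Qed.

(** The pulse and the final rest satisfy the balance exactly, so the error at depth m + 1 is the sum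
    of three errors at depth m with tolerance del/4; both del^2 and del^s drop at least to a
    quarter. *)
Lemma weak_level m J : a <= jt J -> jend J <= b ->
  `|\int[leb]_(t in `[jt J, jend J[) inner (pos m J t) t -
    (bal (gB' (jG J)) (jend J) - bal (gB (jG J)) (jt J))| <=
  (3 / 4) ^+ m * (C * (jdel J ^+ 2 + jdel J `^ s)).
Proof.
elim: m J => [|m IH] J aJ Jb. rewrite expr0 mul1r /Rintegral integral0_eq; last first.
    move=> t _; rewrite /inner /Rintegral integral0_eq// => x _. by rewrite /integrand/= mul0r.
  by rewrite sub0r normrN; exact: gap_error. have [h1 h2 h3 h4 h5] := jt_order J.
have iI := inner_integrable m.+1 aJ Jb. have sub (x y : R) : jt J <= x -> y <= jend J ->
    leb.-integrable `[x, y[ (fun t => (inner (pos m.+1 J t) t)%:E).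
  move=> xJ yJ; apply: (integrableS _ _ _ iI); rewrite ?mitv//.
  by move=> t /=; rewrite !in_itv/= => /andP[t1 t2]; rewrite (le_trans xJ t1) (lt_le_trans t2 yJ).
have eqI (x y : R) (o : R -> option (job * bool)) : jt J <= x -> y <= jend J ->
    (forall t, x <= t < y -> pos m.+1 J t = o t) -> leb.-integrable `[x, y[ (EFin \o (fun t => inner (o t) t)).
  move=> xJ yJ E; apply: eq_integrable (sub x y xJ yJ); first exact: mitv.
  by move=> t tI; rewrite /= -E//; move: tI; rewrite inE/= in_itv.
rewrite (@Rint_split _ leb _ (jt1 J) _ (fun t => inner (pos m.+1 J t) t))//; [|lra|lra].
rewrite (@Rint_split _ leb (jt1 J) (jt2 J) (jend J) (fun t => inner (pos m.+1 J t) t))//; [|lra|lra|by apply: sub; lra].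
rewrite (@Rint_split _ leb (jt2 J) (jt3 J) (jend J) (fun t => inner (pos m.+1 J t) t))//; [|lra|lra|by apply: sub; lra].
rewrite (@Rint_split _ leb (jt3 J) (jt4 J) (jend J) (fun t => inner (pos m.+1 J t) t))//; [|lra|lra|by apply: sub; lra].
have eP t : jt1 J <= t < jt2 J -> pos m.+1 J t = Some (J, true). by move=> /andP[t1 t2] /=; rewrite t2 ltNge t1.
have eF t : jt4 J <= t < jend J -> pos m.+1 J t = Some (J, false).
  move=> /andP[t1 t2] /=; rewrite !ltNge t1 !(le_trans _ t1)//=; lra. have j1 : jt J <= jt1 J by lra.
have j2 : jt2 J <= jend J by lra. have j4 : jt J <= jt4 J by lra. have zt : 0 <= jend J - jt4 J by lra.
have iP := eqI _ _ _ j1 j2 eP. have iF := eqI _ _ _ j4 (lexx _) eF.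
have eqR (x y : R) (o : R -> option (job * bool)) : (forall t, x <= t < y -> pos m.+1 J t = o t) ->
    \int[leb]_(t in `[x, y[) inner (pos m.+1 J t) t = \int[leb]_(t in `[x, y[) inner (o t) t.
  by move=> E; apply: eqRint => t tI; rewrite E//; move: tI; rewrite inE/= in_itv.
rewrite (@eqR _ _ (fun t => pos m (kid1 J) t)); last by move=> t /andP[_ t1] /=; rewrite t1.
rewrite (@eqR _ _ (fun t => Some (J, true)) eP). rewrite (@eqR _ _ (fun t => pos m (kid2 J) t)); last first.
  move=> t /andP[t1 t2] /=; rewrite t2 !ltNge t1 (le_trans _ t1)//=; lra.
rewrite (@eqR _ _ (fun t => pos m (kid3 J) t)); last first.
  move=> t /andP[t1 t2] /=; rewrite t2 !ltNge t1 !(le_trans _ t1)//=; lra.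
rewrite (@eqR _ _ (fun t => Some (J, false)) eF). have end1 : jend (kid1 J) = jt1 J by [].
have end2 : jend (kid2 J) = jt3 J by []. have end3 : jend (kid3 J) = jt4 J by []. have I1 : a <= jt (kid1 J) by [].
have I1' : jend (kid1 J) <= b by rewrite end1; lra. have I2 : a <= jt (kid2 J) by rewrite /=; lra.
have I2' : jend (kid2 J) <= b by rewrite end2; lra. have I3 : a <= jt (kid3 J) by rewrite /=; lra.
have I3' : jend (kid3 J) <= b by rewrite end3; lra. have := IH _ I1 I1'; have := IH _ I2 I2'; have := IH _ I3 I3'.
rewrite end1 end2 end3 /=. have N := jN_ok J.
rewrite (node_B1 N) (node_B1' N) (node_B2 N) (node_B2' N) (node_B3' N) -/(jP J).
have -> : \int[leb]_(t in `[jt1 J, jt2 J[) inner (Some (J, true)) t =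
    bal (pA' (jP J)) (jt2 J) - bal (pA (jP J)) (jt1 J). rewrite Rintegral_itv_bndo_bndc; last exact: iP.
  rewrite /bal -(pulse_weak (jP_ok J) (jt1 J) sphi pphi). apply: eqRint => t _; congr Rintegral; apply/funext => x.
  by rewrite /integrand/= sum_uF. have -> : \int[leb]_(t in `[jt4 J, jend J[) inner (Some (J, false)) t =
    bal (gB' (jG J)) (jend J) - bal (gB' (jG J)) (jt4 J). have gok := good_ok (jok J).
  rewrite Rintegral_itv_bndo_bndc; last exact: iF. have z1 (x : 'rV[R]_d) : `|0 : R| <= 1 by rewrite normr0.
  have pz : Zper (fun _ : 'rV[R]_d => 0 : R) by [].
  (* A density at rest is a shear with zero profile and zero speed. *)
  have := @shear_transport _ _ (gj (jG J)) (gB' (jG J)) (fun=> 0) (gM (jG J)) 0 (jt4 J)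
    (jend J - jt4 J) (gap_pB' gok) (step_mfun (gap_n gok) (gap_sB' gok)) (gap_BM' gok)
    pz (mcst _) z1 (fun _ _ => erefl) zt phi sphi pphi.
  have shE t : sheared (gj (jG J)) (gB' (jG J)) (fun=> 0) 0 (jt4 J) t = gB' (jG J).
    by apply/funext => x; rewrite /sheared mulr0 scale0r subr0. rewrite !shE addrC subrK /bal => <-.
  apply: eqRint => t _; congr Rintegral; apply/funext => x.
  rewrite shE /integrand/= /rhoF mul0r mul0r; congr (_ * (_ + _)). by rewrite big1// => i _; rewrite /uF mul0r.
set k1 := \int[leb]_(t in `[jt J, jt1 J[) _; set k2 := \int[leb]_(t in `[jt2 J, jt3 J[) _.
set k3 := \int[leb]_(t in `[jt3 J, jt4 J[) _. have d0 := good_del (jok J).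
set c := (3 / 4) ^+ m; have c0 : 0 <= c by rewrite exprn_ge0. have -> : (3 / 4) ^+ m.+1 = 3 / 4 * c by rewrite exprS.
have hq := sqr_quarter d0; have hp := pow_quarter s1 d0. have cC : 0 <= c * C by rewrite mulr_ge0.
have H : c * (C * ((jdel J / 4) ^+ 2 + (jdel J / 4) `^ s)) <= c * (C * (jdel J ^+ 2 + jdel J `^ s)) / 4.
  rewrite !mulrA -[leRHS]mulrA ler_wpM2l//; lra. rewrite -mulrA; move: H; set e1 := c * _; set e2 := c * _ => H.
exact: three_errors.
Qed.

(** For each time the integrand is eventually constant in the depth, and [costoo cweak] is an
    integrable majorant for all depths; meanwhile the errors (3/4)^m tend to 0. *)
Lemma weak_oo J : a <= jt J -> jend J <= b ->
  leb.-integrable `[jt J, jend J[ (fun t => (inner (posoo J t) t)%:E) /\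
  \int[leb]_(t in `[jt J, jend J[) inner (posoo J t) t =
    bal (gB' (jG J)) (jend J) - bal (gB (jG J)) (jt J).
Proof.
move=> aJ Jb; have mI : measurable `[jt J, jend J[%classic by exact: mitv.
pose g t : \bar R := (C * costoo cweak J t)%:E. have ig : leb.-integrable `[jt J, jend J[ g.
  rewrite [X in _.-integrable _ X](_ : _ = fun t => (C%:E * (costoo cweak J t)%:E)%E)//.
  apply: intZl => //; apply/integrableP; split. by apply/mEFinP; exact: (mfunTS (costoo_mfun _ J)).
  have c0 t : 0 <= costoo cweak J t. by rewrite /costoo /run; case: (posoo J t) => [[? ?]|//]; exact: cweak_ge0.
  under eq_integral do rewrite gee0_abs ?lee_fin//.
  apply: (le_lt_trans (costoo_bound cweak_ge0 cweak_pulse cweak_idle cstweak_quarter J)). by rewrite ltry.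
have cv t : `[jt J, jend J[%classic t -> (inner (pos m J t) t)%:E @[m --> \oo] --> (inner (posoo J t) t)%:E.
  by move=> _; apply: cvg_near_cst; apply: filterS (posoo_spec J t) => m ->.
have dom m t : `[jt J, jend J[%classic t -> (`|(inner (pos m J t) t)%:E| <= g t)%E.
  rewrite /= in_itv/= => /andP[t1 t2]; rewrite lee_fin. apply: (le_trans (inner_cost _ (_ : a <= t <= b))).
    by rewrite (le_trans aJ t1) (le_trans (ltW t2) Jb). by rewrite ler_wpM2l//; exact: (cost_le cweak_ge0).
have mm m : measurable_fun `[jt J, jend J[ (fun t => (inner (pos m J t) t)%:E).
  by apply/mEFinP; exact: (mfunTS (inner_pos_mfun m J)).
have moo : measurable_fun `[jt J, jend J[ (fun t => (inner (posoo J t) t)%:E).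
  by apply/mEFinP; exact: (mfunTS (inner_posoo_mfun J)).
have [i1 _ i3] := @dominated_convergence _ _ _ leb _ mI _ _ g mm moo (aeW leb cv) ig (aeW leb (fun t m => dom m t)).
split=> //; set l := bal _ _ - bal _ _.
have h1 : \int[leb]_(t in `[jt J, jend J[) inner (pos m J t) t @[m --> \oo] -->
    \int[leb]_(t in `[jt J, jend J[) inner (posoo J t) t.
  by apply: fine_cvg; rewrite /Rintegral fineK//; exact: int_fin.
have h2 : \int[leb]_(t in `[jt J, jend J[) inner (pos m J t) t @[m --> \oo] --> l. apply/subr_cvg0/norm_cvg0P.
  apply: (@squeeze_cvgr _ _ _ _ (cst 0) (fun m => (3 / 4) ^+ m * (C * (jdel J ^+ 2 + jdel J `^ s)))).
  - by apply: nearW => m /=; rewrite normr_ge0 weak_level.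
  - exact: cvg_cst.
  - rewrite -[X in _ --> X](mul0r (C * (jdel J ^+ 2 + jdel J `^ s))); apply: cvgMr_tmp.
    by apply: cvg_expr; rewrite ger0_norm//; lra. exact: (cvg_unique _ h1 h2).
Qed.

End test.

(** * The root of the tree and the second solution *)

Variable T : R.
Hypothesis T0 : 0 < T.

Let j0 : 'I_d := Ordinal (ltn_trans (isT : 0 < 2)%N d3).
Let l0 : 'I_d := Ordinal (ltn_trans (isT : 1 < 2)%N d3).

Definition halfwave (x : 'rV[R]_d) : R :=
  (modz (Num.floor (2%:R * x 0 j0)) 2 == 0)%:R.
Definition wave (x : 'rV[R]_d) : R := halfwave x - halfwave (bwd 2 j0 x).

Lemma halfwave_step : step 2 halfwave.
Proof. by move=> x y xy; rewrite /halfwave xy. Qed.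

Lemma halfwave_periodic : Zper halfwave.
Proof.
by move=> x k; rewrite /halfwave !mxE floorM_addrz addrC mulrC modzMDl.
Qed.

Lemma halfwave_le x : `|halfwave x| <= 1.
Proof. by rewrite /halfwave; case: eqP => _; rewrite ?normr1 ?normr0. Qed.

Lemma wave_norm x : `|wave x| = 1.
Proof.
rewrite /wave /halfwave bwd_same floor_pred//.
have : (modz (Num.floor (2%:R * x 0 j0) - 1) 2 == 0) = ~~ (modz (Num.floor (2%:R * x 0 j0)) 2 == 0). lia.
by move=> ->; case: eqP => _; rewrite ?subr0 ?sub0r ?normrN normr1.
Qed.

(** The jump from density 0 to a function of modulus 1: the initial datum is 0, and the rest after
    the last gap is spent at [wave]. *)
Definition root_gap : gap R d :=
  Gap j0 l0 2 xpredT (fun=> 0) wave halfwave 1 1.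

Lemma root_gap_ok : gap_ok root_gap.
Proof.
split => //=.
- by move=> x k; rewrite /wave halfwave_periodic; congr (_ - _); exact: (periodic_bwd 2 j0 halfwave_periodic).
- exact: halfwave_periodic.
- by move=> x y xy; rewrite /wave (halfwave_step xy); congr (_ - _); exact: (step_bwd j0 _ halfwave_step).
- exact: halfwave_step.
- by move=> x; rewrite subr0.
- by move=> x; rewrite normr0.
- by move=> x; rewrite wave_norm.
- exact: halfwave_le.
Qed.

(** At the root 24 [budget] is 12, below 4^2, and T <= del <= del^s is the time condition. *)
Let del : R := Num.max 4 (T + 1).
Let del4 : 4 <= del. Proof. by rewrite le_max lexx. Qed.
Let delT : T <= del. Proof. by rewrite le_max lerDl ler01 orbT. Qed.

Lemma root_good : good s root_gap del T.
Proof.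
split=> //; first exact: root_gap_ok.
- by rewrite (lt_le_trans _ del4).
- have h : 4 * 4 <= del ^+ 2 by rewrite expr2 ler_pM. by apply: le_trans h; rewrite /budget/= density_true//; lra.
- rewrite /= powR1 mul1r (le_trans delT)// powRs_ge// (le_trans _ del4)//; lra.
Qed.

Let J : job := Job 0 root_good.
Let jendJ : jend J = T. Proof. exact: add0r. Qed.

Definition gF (i k : 'I_d) (J : job) (b : bool) (t : R) (x : 'rV[R]_d) : R :=
  if b && (i == pj (jP J)) then pg (jP J) k x else 0.

Definition rho2 t x := run rhoF (posoo J t) t x.
Definition u2 t x : 'rV[R]_d := \row_i run (uF i) (posoo J t) t x.

Lemma gF_mfun i k K b : jmfun
  (fun w => gF i k K b w.1 w.2).
Proof.
rewrite /gF; case: (b && _); last exact: mcst. exact: (mcomp (pulse_mg (jP_ok K) k) msnd).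
Qed.

Section run_LsLp.
Variables (sg r : R) (F : job -> bool -> R -> 'rV[R]_d -> R) (c : job -> bool -> R).
Hypotheses (sg1 : 1 <= sg) (r1 : 1 < r)
  (mF : forall K b, jmfun (fun w => F K b w.1 w.2))
  (pF : forall K b t, Zper (F K b t))
  (Fc : forall K b t, (hnorm r (F K b t) <= (c K b)%:E)%E)
  (c0 : forall K b, 0 <= c K b).

Let r0 : r%:E != 0%E. Proof. by rewrite gt_eqF// lte_fin (lt_trans _ r1). Qed.

Lemma run_periodic o t : Zper (run F o t).
Proof. by case: o => [[K b]|] // x k; rewrite /run pF. Qed.

Lemma run_LsLp : (forall K, ptau (jP K) * c K true `^ sg <= jdel K `^ sg) ->
  (forall K, c K false `^ sg * jD K <= jdel K `^ sg) ->
  LsLp T sg%:E r%:E (fun t x => run F (posoo J t) t x).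
Proof.
move=> cp ci; have sg0 : 0 < sg by exact: lt_le_trans sg1. pose c' K b := c K b `^ sg.
have c'0 K b : 0 <= c' K b by exact: powR_ge0. apply: (@LsLp_bounded_cost _ _ _ _ _ _ (costoo c' J)) => //.
- exact: ltW.
- exact: runoo_mfun.
- exact: costoo_mfun.
- by move=> t; exact: run_periodic.
- exact: costoo_ge0.
- move=> t; rewrite /costoo /run; case: (posoo J t) => [[K b]|].
    rewrite -poweR_EFin; apply: gt0_ler_poweR => //; rewrite ?in_itv/= ?leey ?andbT ?Lnorm_ge0 ?lee_fin//. exact: ltW.
  by rewrite (_ : EFin \o _ = cst 0%E)// Lnorm0// poweR0r ?gt_eqF.
- have := @costoo_bound c' (fun x => x `^ sg) c'0. rewrite -[X in _ `[_, X[%classic _]jendJ => /(_ _ _ _ J) h.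
  apply: le_lt_trans (h _ _ _) _; last by rewrite ltry.
  + by move=> K; rewrite mulrC.
  + exact: ci.
  + by move=> x; exact: pow_quarter.
Qed.
End run_LsLp.

Lemma rho2_LsLp : LsLp T s%:E p%:E rho2.
Proof.
apply: (@run_LsLp s p rhoF (fun K b => if b then pX (jP K) else gM (jG K))) => //.
- exact: rhoF_mfun.
- move=> K [] t; first exact: pulse_prho (jP_ok K) _. exact: gap_pB' (good_ok (jok K)).
- move=> K [] t; first exact: pulse_Nrho (jP_ok K) _. exact: gB'_Lnorm.
- move=> K []; first exact: pulse_X (jP_ok K). by rewrite (le_trans _ (gap_M (good_ok (jok K)))).
- by move=> K; exact: pulse_tX (jP_ok K).
- by move=> K; exact: good_time (jok K).
Qed.

Let uc K (b : bool) : R := if b then pW (jP K) else 0.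

Let Nq0 : ('N[torus_measure R d]_q%:E[EFin \o (fun=> 0%R : R)] = 0)%E.
Proof. by rewrite (_ : EFin \o _ = cst 0%E)// Lnorm0// gt_eqF// lte_fin (lt_trans _ q1). Qed.

Lemma uF_Lnorm i K b t : (hnorm q (uF i K b t) <= (uc K b)%:E)%E.
Proof.
rewrite /uF /uc; case: b => /=; last by rewrite Nq0. case: eqP => _; first exact: pulse_Nu (jP_ok K).
by rewrite Nq0 lee_fin (pulse_W (jP_ok K)).
Qed.

Lemma uF_periodic i K b t : Zper (uF i K b t).
Proof. by rewrite /uF; case: (b && _) => // x k; rewrite (pulse_pu (jP_ok K)). Qed.

Let uc0 K b : 0 <= uc K b.
Proof. by rewrite /uc; case: b => //; exact: pulse_W (jP_ok K). Qed.

Lemma u2_LsLp i sg : 1 <= sg -> (forall K, ptau (jP K) * pW (jP K) `^ sg <= jdel K `^ sg) ->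
  LsLp T sg%:E q%:E (component u2 i).
Proof.
move=> sg1 h; rewrite (_ : component u2 i = fun t x => run (uF i) (posoo J t) t x); last first.
  by apply/funext => t; apply/funext => x; rewrite /component mxE. apply: (@run_LsLp sg q (uF i) uc) => //.
- exact: uF_mfun.
- exact: uF_periodic.
- exact: uF_Lnorm.
- by move=> K; rewrite /uc powR0 ?mul0r ?powR_ge0// gt_eqF// (lt_le_trans _ sg1).
Qed.

(** For s = 1 the exponent 1 - 1/s in [pulse_sW] is 0, which bounds every pulse by its own
    tolerance; tolerances decrease down the tree, so the one of the root bounds them all. *)
Lemma u2_Linfty i : s = 1 -> LsLp T +oo%E q%:E (component u2 i).
Proof.
move=> s_1; rewrite (_ : component u2 i = fun t x => run (uF i) (posoo J t) t x); last first.
  by apply/funext => t; apply/funext => x; rewrite /component mxE. apply: (@LsLp_bounded _ _ _ _ del).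
- by apply: runoo_mfun; exact: uF_mfun.
- by move=> t; apply: run_periodic; exact: uF_periodic.
- by rewrite (le_trans _ del4).
- move=> t; rewrite /run; case E : (posoo J t) => [[K b]|]; last first. by rewrite Nq0 lee_fin (le_trans _ del4).
  apply: (le_trans (uF_Lnorm i K b t)); rewrite lee_fin.
  apply: (le_trans _ (posoo_del E)); rewrite /uc; case: b {E}; last exact: ltW (jdel_gt0 K).
  have := pulse_sW (jP_ok K); rewrite [X in _ `^ X](_ : _ = 0) ?powRr0 ?mul1r//. by rewrite s_1 invr1 subrr.
Qed.

Lemma u2_LrW1q i : LrW1q T 1%E q%:E (component u2 i).
Proof.
have pow1 (x : R) : 0 <= x -> x `^ 1 = x by exact: powRr1. split.
  apply: u2_LsLp => // K; rewrite !pow1//; first exact: pulse_tW (jP_ok K).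
  - exact: ltW (jdel_gt0 K).
  - exact: pulse_W (jP_ok K). move=> k; exists (fun t x => run (gF i k) (posoo J t) t x).
  apply: (@run_LsLp 1 q (gF i k) (fun K b => if b then pV (jP K) else 0)) => //.
  - exact: gF_mfun.
  - by move=> K b t; rewrite /gF; case: (b && _) => // x z; rewrite (pulse_pg (jP_ok K)).
  - move=> K [] t; rewrite /gF/=; last by rewrite Nq0. case: eqP => _; first exact: pulse_Ng (jP_ok K) _.
    by rewrite Nq0 lee_fin (pulse_V (jP_ok K)).
  - by move=> K []; last by []; exact: pulse_V (jP_ok K).
  - move=> K; rewrite !pow1//; first exact: pulse_tV (jP_ok K).
    + exact: ltW (jdel_gt0 K).
    + exact: pulse_V (jP_ok K).
  - by move=> K; rewrite pow1// mul0r powR_ge0. have wp0 : weak_partial k (fun _ : 'rV[R]_d => 0 : R) (fun=> 0).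
  by move=> psi _ _; rewrite !Rint_eq0 ?oppr0// => x; rewrite mul0r.
apply: aeW => t _; rewrite (_ : component u2 i t = run (uF i) (posoo J t) t); last first.
  by apply/funext => x; rewrite /component mxE. case: (posoo J t) => [[K b]|]; last exact: wp0.
change (weak_partial k (fun x => if b && (i == pj (jP K)) then pu (jP K) x else 0) (gF i k K b t)).
by rewrite /gF; case: (b && _); [exact: (pulse_g (jP_ok K) k)|exact: wp0].
Qed.

Lemma u2_divergence_free : divergence_free T u2.
Proof.
apply: aeW => t _ psi spsi ppsi; under eqRint do under eq_bigr do rewrite mxE.
case: (posoo J t) => [[K b]|]; last by apply: Rint_eq0 => x; rewrite big1// => i _; rewrite mul0r.
case: b; last by apply: Rint_eq0 => x; rewrite big1// => i _; rewrite /run /uF mul0r.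
transitivity (\int[haar]_x (pu (jP K) x * 'D_('e_(pj (jP K))) psi x)).
  apply: eqRint => x _; rewrite (bigD1 (pj (jP K)))//= /uF eqxx big1 ?addr0// => i ik. by rewrite (negbTE ik) mul0r.
rewrite (pulse_g (jP_ok K) (pj (jP K)) spsi ppsi) Rint_eq0 ?oppr0// => x. by rewrite (pulse_gj (jP_ok K)) mul0r.
Qed.

Lemma zero_weak_solution : weak_solution T u2 (fun=> 0) (fun _ _ => 0).
Proof.
move=> phi _; rewrite [in RHS]Rint_eq0 ?oppr0; last by move=> x; rewrite mul0r.
by apply: Rint_eq0 => t; apply: Rint_eq0 => x; rewrite mul0r.
Qed.

Lemma rho2_weak_solution : weak_solution T u2 (fun=> 0) rho2.
Proof.
move=> phi [sphi pphi [T1 T1T phi0]].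
have bd v : exists2 M : R, 0 <= M & forall t x, 0 <= t <= T -> `|'D_v phi (t, x)| <= M.
  apply: (@periodic_bounded2 _ _ ('D_v phi)); first exact: (sm_cont (@sm_D _ _ phi v sphi)).
  by move=> t; exact: periodic_derive2. have [C1 C10 HC1] := bd (1, 0).
have [Ci HCi] : exists Ci : 'I_d -> R, forall i, 0 <= Ci i /\
    forall t x, 0 <= t <= T -> `|'D_((0, 'e_i) : ST R d) phi (t, x)| <= Ci i.
  exists (fun i => s2val (cid2 (bd (0, 'e_i)))) => i. by case: (cid2 (bd (0, 'e_i))). pose C := C1 + \sum_i Ci i.
have S0 : 0 <= \sum_i Ci i by apply: sumr_ge0 => i _; exact: (HCi i).1. have C0 : 0 <= C by rewrite addr_ge0.
have CD t x : 0 <= t <= T -> `|'D_((1, 0) : ST R d) phi (t, x)| <= C.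
  by move=> tT; rewrite (le_trans (HC1 t x tT))// lerDl.
have CDi i t x : 0 <= t <= T -> `|'D_((0, 'e_i) : ST R d) phi (t, x)| <= C.
  move=> tT; rewrite (le_trans ((HCi i).2 t x tT))// /C (bigD1 i)//= addrCA lerDl addr_ge0//.
  by apply: sumr_ge0 => k _; exact: (HCi k).1. have jT : jend J <= T by rewrite jendJ.
have [iI] := @weak_oo phi sphi pphi C 0 T C0 CD CDi J (lexx _) jT. have -> : bal phi (gB' (jG J)) (jend J) = 0.
  by apply: Rint_eq0 => x; rewrite jendJ phi0 ?mulr0// ltW.
have -> : bal phi (gB (jG J)) (jt J) = 0 by apply: Rint_eq0 => x; rewrite mul0r.
rewrite jendJ subr0 Rintegral_itv_bndo_bndc => [h|]; last by move: iI; rewrite jendJ.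
rewrite [X in - X]Rint_eq0 ?oppr0; last by move=> x; rewrite mul0r.
rewrite -[RHS]h; apply: eqRint => t _; apply: eqRint => x _. rewrite /integrand/= /transport; congr (_ * (_ + _)).
by apply: eq_bigr => i _; rewrite mxE.
Qed.

(** The rest of the root job has positive length, and throughout it the density is [wave], of
    modulus 1. *)
Lemma rho2_neq0 : ~ ae_same T (fun _ _ => 0) rho2.
Proof.
have [h1 h2 h3 h4] := jt_order J; rewrite jendJ => h5. set t4 := jt4 J in h4 h5 *.
move=> [N [mN N0 sN]]; have : (leb `[t4, T[%classic <= leb N)%E. apply: (@le_measure _ _ _ leb); rewrite ?inE//.
  move=> t /=; rewrite in_itv/= => /andP[t4t tT]; apply: sN => /= h. have t0 : t \in `[0, T].
    rewrite in_itv/= (ltW tT) andbT (le_trans _ t4t)//. rewrite -[0]/(jt J); lra. have [N' [mN' N'0 sN']] := h t0.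
  have : (torus_measure R d setT <= haar N')%E.
    apply: (@le_measure _ _ _ haar); rewrite ?inE// => x _; apply: sN' => /=. have -> : rho2 t x = wave x.
      rewrite /rho2 (@pos_le 1 J t (J, false))//=. by rewrite !ltNge t4t !(le_trans _ t4t)//= ; rewrite -/t4; lra.
    by move=> w0; have := wave_norm x; rewrite -w0 normr0 => /eqP; rewrite eq_sym oner_eq0.
  by rewrite N'0 prob_setT lee_fin ler10. by rewrite N0 leb_itv/= lte_fin h5 -EFinB lee_fin subr_le0 leNgt h5.
Qed.
End nonuniqueness.

(** * Assembly of part (i) *)

Lemma conjE (R : realType) (p : R) : 1 < p ->
  exists2 q, hoelder_conjugate p%:E = q%:E & 1 < q /\ p^-1 + q^-1 = 1.
Proof.
move=> p1; have p10 : 0 < p - 1 by rewrite subr_gt0. have p0 := lt_trans ltr01 p1. exists (p / (p - 1)).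
  apply/esym/hoelder_conjugateP; [by rewrite ltNyr|by rewrite gt_eqF|].
  rewrite !inver !gt_eqF ?divr_gt0//= -EFinD; congr EFin; by field; rewrite !gt_eqF.
split; first by rewrite ltr_pdivlMr// mul1r ltrBlDr ltrDl. by field; rewrite !gt_eqF.
Qed.

Theorem nonuniqueness (R : realType) (T : R) (d : nat) (p : R) (s : \bar R) :
  0 < T -> (3 <= d)%N -> 1 < p -> (1 <= s)%E -> (s < +oo)%E ->
  let p' := hoelder_conjugate p%:E in
  let s' := hoelder_conjugate s in
  exists u : R -> 'rV[R]_d -> 'rV[R]_d,
      [/\ divergence_free T u,
          vLrW1q T 1%E p' u,
          vLsLp T s' p' u &
          exists (rho0 : 'rV[R]_d -> R) (rho1 rho2 : R -> 'rV[R]_d -> R),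
            [/\ Lp_torus p%:E rho0,
                LsLp T s p%:E rho1 /\ weak_solution T u rho0 rho1,
                LsLp T s p%:E rho2 /\ weak_solution T u rho0 rho2 &
                ~ ae_same T rho1 rho2]].
Proof.
move=> T0 d3 p1; case: s => [s||]; rewrite ?ltxx//= lee_fin => s1 _. have [q -> [q1 pq]] := conjE p1.
exists (u2 d3 p1 q1 pq s1 T0); split.
- exact: u2_divergence_free.
- by move=> i; exact: u2_LrW1q.
- move=> i; have [s_1|] := eqVneq s 1. have -> : hoelder_conjugate s%:E = +oo%E by rewrite s_1 hoelder_conjugate1.
    exact: u2_Linfty. move=> sn1; have : 1 < s by rewrite lt_neqAle eq_sym sn1. move=> /conjE[s' -> [s'1 ss']].
  apply: u2_LsLp => [|K]; first exact: ltW.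
  set P := jP _ _ _ _ _ K; have ok : pulse_ok p q s P (jdel K) := jP_ok d3 p1 q1 pq s1 K.
  (* With 1 - 1/s = 1/s', [pulse_sW] raised to the power s' is the bound on tau W^{s'} required of a
     pulse. *)
  have s'0 : 0 < s' by exact: lt_trans s'1. have := pulse_sW ok; rewrite [X in _ `^ X](_ : _ = s'^-1); last by lra.
  move=> h; have -> : ptau P = (ptau P `^ s'^-1) `^ s'.
    by rewrite -powRrM mulVf ?gt_eqF// powRr1// ltW// (pulse_tau ok).
  rewrite -powRM ?powR_ge0 ?(pulse_W ok)//; apply: ge0_ler_powR => //; rewrite ?nnegrE.
  - exact: ltW.
  - by rewrite mulr_ge0 ?powR_ge0 ?(pulse_W ok).
  - exact: ltW (jdel_gt0 K).
- exists (fun=> 0), (fun _ _ => 0), (rho2 d3 p1 q1 pq s1 T0); split.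
  + split=> //; rewrite /finite_norm.
    by rewrite (_ : EFin \o _ = cst 0%E)// Lnorm0// gt_eqF// lte_fin (lt_trans _ p1).
  + split; last exact: zero_weak_solution. by apply: LsLp0; rewrite lee_fin// ltW.
  + by split; [exact: rho2_LsLp|exact: rho2_weak_solution].
  + exact: rho2_neq0.
Qed.

(** * Smooth functions *)
Lemma cont_comp (X Y Z : topologicalType) (f : X -> Y) (g : Y -> Z) :
  continuous f -> continuous g -> continuous (fun x => g (f x)).
Proof. by move=> cf cg x; exact: (@continuous_comp _ _ _ f g x (cf x) (cg (f x))). Qed.

Section smooth_algebra.
Variables (R : realType) (V : normedModType R).
Implicit Types (f g : V -> R) (v x : V).

Lemma is_derive_of_line f x v (df : R) :
  is_derive (0 : R) (1 : R) (fun s : R => f (x + s *: v)) df -> is_derive x v f df.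
Proof.
have E : (fun h : R => h^-1 *: (((fun s => f (x + s *: v)) \o shift 0) (h *: 1) - f (x + 0 *: v))) =
    (fun h => h^-1 *: ((f \o shift x) (h *: v) - f x)).
  by apply/funext => h /=; rewrite [h%:A]mulr1 addr0 scale0r addr0 [x + _]addrC.
case=> dv dE; apply: DeriveDef; first by move: dv; rewrite /derivable E. by rewrite -dE /derive E.
Qed.

Lemma Ck_continuous k f : Ck k f -> continuous f.
Proof. by case: k => [[]|k []]. Qed.

Lemma Ck_le k f : Ck k.+1 f -> Ck k f.
Proof.
elim: k f => [|k IH] f; first by case. by move=> [cf H]; split=> // v; have [h1 h2] := H v; split=> //; exact: IH.
Qed.

Lemma sm_cst (c : R) : smooth (fun _ : V => c).
Proof.
move=> k; elim: k c => [|k IH] c; first by split=> //; exact: cst_continuous. split; first exact: cst_continuous.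
move=> v; split; first by move=> x; exact: derivable_cst.
by rewrite (_ : 'D_v _ = fun=> 0)//; apply/funext => x; rewrite derive_cst.
Qed.

Lemma Ck_add k f g : Ck k f -> Ck k g -> Ck k (fun x => f x + g x).
Proof.
elim: k f g => [|k IH] f g [cf Hf] [cg Hg]. by split=> // x; apply: continuousD; [exact: cf|exact: cg].
split; first by move=> x; apply: continuousD; [exact: cf|exact: cg].
move=> v; have [df kf] := Hf v; have [dg kg] := Hg v; split. by move=> x; apply: derivableD.
rewrite (_ : 'D_v _ = fun x => 'D_v f x + 'D_v g x); first exact: IH. by apply/funext => x; rewrite -deriveD.
Qed.

Lemma Ck_mul k f g : Ck k f -> Ck k g -> Ck k (fun x => f x * g x).
Proof.
elim: k f g => [|k IH] f g hf hg.
  split=> // x; apply: continuousM; [exact: (Ck_continuous hf)|exact: (Ck_continuous hg)].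
have [cf Hf] := hf; have [cg Hg] := hg. split; first by move=> x; apply: continuousM; [exact: cf|exact: cg].
move=> v; have [df kf] := Hf v; have [dg kg] := Hg v; split. by move=> x; apply: derivableM.
rewrite (_ : 'D_v _ = fun x => f x * 'D_v g x + g x * 'D_v f x). by apply: Ck_add; apply: IH => //; exact: Ck_le.
by apply/funext => x; rewrite -[RHS]/(f x *: 'D_v g x + g x *: 'D_v f x) -deriveM.
Qed.

Lemma sm_add f g : smooth f -> smooth g -> smooth (fun x => f x + g x).
Proof. by move=> sf sg k; exact: Ck_add. Qed.

Lemma sm_mul f g : smooth f -> smooth g -> smooth (fun x => f x * g x).
Proof. by move=> sf sg k; exact: Ck_mul. Qed.

Lemma smooth_prod (I : Type) (r : seq I) (F : I -> V -> R) :
  (forall i, smooth (F i)) -> smooth (fun x => \prod_(i <- r) F i x).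
Proof.
move=> sF; elim: r => [|i r IH]. by under eq_fun do rewrite big_nil; exact: sm_cst.
by under eq_fun do rewrite big_cons; exact: sm_mul.
Qed.

Lemma derive_smooth_mul f g x v : smooth f -> smooth g ->
  'D_v (fun y => f y * g y) x = f x * 'D_v g x + g x * 'D_v f x.
Proof.
move=> sf sg; rewrite -[RHS]/(f x *: 'D_v g x + g x *: 'D_v f x) -deriveM//; exact: sm_dv.
Qed.

(* A class of functions of one variable that is closed under derivation consists of smooth functions. *)
Section composition.
Variable H : (R -> R) -> Prop.
Hypothesis H_derive : forall h, H h -> exists2 h', H h' & forall x : R, is_derive x (1 : R) h (h' x).

Lemma is_derive_chain h (dh : R) f x v : is_derive (f x) (1 : R) h dh -> smooth f ->
  is_derive x v (fun y => h (f y)) (dh * 'D_v f x).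
Proof.
move=> hd sf; apply: is_derive_of_line. have lf := @is_derive_line _ _ f x v 0 (@sm_dv _ _ f v _ sf).
rewrite scale0r addr0 in lf.
have hd' : is_derive ((fun s : R => f (x + s *: v)) 0) (1 : R) h dh by rewrite scale0r addr0.
by have := @is_derive1_comp _ h _ 0 _ _ hd' lf; rewrite mulrC.
Qed.

Lemma smooth_chain h f : H h -> smooth f -> smooth (fun x => h (f x)).
Proof.
move=> Hh sf k; elim: k h Hh => [|k IH] h Hh; have [h' Hh' dh] := H_derive Hh. all: have ch := is_derive_cont dh.
all: have chf := cont_comp (sm_cont sf) ch.
- by [].
- split=> // v; have E x := @is_derive_chain h _ f x v (dh (f x)) sf.
  split; first by move=> x; exact: (derive_ex (E x)). rewrite (_ : 'D_v _ = fun x => h' (f x) * 'D_v f x).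
    by apply: Ck_mul; [exact: IH|exact: (sm_D v sf)]. by apply/funext => x; exact: (derive_eq (E x)).
Qed.
End composition.
End smooth_algebra.

Section smooth_precomposition.
Variables (R : realType) (V W : normedModType R) (A L : W -> V).
Hypothesis (AL : forall (h : R) v w, A (h *: v + w) = h *: L v + A w) (cA : continuous A).

Lemma derive_precomp (f : V -> R) v w : 'D_v (fun w => f (A w)) w = 'D_(L v) f (A w).
Proof. rewrite /derive (_ : (fun h : R => h^-1 *: ((f \o shift (A w)) (h *: L v) - f (A w))) =
      (fun h : R => h^-1 *: (((fun w => f (A w)) \o shift w) (h *: v) - f (A w))))//.
by apply/funext => h /=; rewrite AL. Qed.  Lemma smooth_precomp (f : V -> R) : smooth f -> smooth (fun w => f (A w)).
Proof.
move=> sf k; elim: k f sf => [|k IH] f sf. all: have cf := cont_comp cA (sm_cont sf).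
- by [].
- split=> // v; split. move=> w; have := @sm_dv _ _ f (L v) (A w) sf; rewrite /derivable.
    rewrite (_ : (fun h : R => h^-1 *: ((f \o shift (A w)) (h *: L v) - f (A w))) =
      (fun h : R => h^-1 *: (((fun w => f (A w)) \o shift w) (h *: v) - f (A w))))//.
    by apply/funext => h /=; rewrite AL.
  rewrite (_ : 'D_v _ = fun w => 'D_(L v) f (A w)); first exact: IH (sm_D _ sf).
  by apply/funext => w; exact: derive_precomp.
Qed.
End smooth_precomposition.

(** * Flat and trigonometric functions *)

Section flat_functions.
Variable R : realType.

Let scR (a b : R) : a *: b = a * b :> R. Proof. by []. Qed.

(** r^(1-k) exp(-1/r) for r > 0. For k = 1 this is the usual flat function, used in the mollifiers;
    for k = 0 it is a smooth substitute for max(r, 0), used for cut-offs in time. The family is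
    closed under derivation up to linear combinations. *)
Definition flat (k : nat) (r : R) : R :=
  if 0 < r then r^-1 ^+ k * (r * expR (- r^-1)) else 0.

Lemma flat_ge0 k r : 0 <= flat k r.
Proof.
rewrite /flat; case: ifP => // r0. by rewrite !mulr_ge0 ?exprn_ge0 ?invr_ge0 ?expR_ge0// ltW.
Qed.

Lemma flat_neg k r : r <= 0 -> flat k r = 0.
Proof. by move=> r0; rewrite /flat ltNge r0. Qed.

Lemma expRN_inv_le n (r : R) : 0 < r -> expR (- r^-1) <= (n.+1)`!%:R * r ^+ n.+1.
Proof.
move=> r0; have := @expR_ge1Dxn R r^-1 n; rewrite invr_ge0 => /(_ (ltW r0)) h.
have n0 : 0 < (n.+1)`!%:R :> R by rewrite ltr0n fact_gt0.
rewrite expRN -[leRHS]invrK lef_pV2 ?posrE ?expR_gt0 ?invr_gt0 ?mulr_gt0 ?exprn_gt0//.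
by apply: le_trans h; rewrite invfM exprVn mulrC -[leLHS]add0r lerD2r.
Qed.

Lemma flat_le k n (r : R) : 0 < r -> (k <= n)%N ->
  flat k r <= (n.+1)`!%:R * (r * r ^+ (n.+1 - k)).
Proof.
move=> r0 kn; rewrite /flat r0 mulrCA [leRHS]mulrCA ler_wpM2l ?(ltW r0)//.
have -> : (n.+1)`!%:R * r ^+ (n.+1 - k) = r^-1 ^+ k * ((n.+1)`!%:R * r ^+ n.+1).
  rewrite mulrCA; congr (_ * _); rewrite exprVn -{2}(subnK (leqW kn)) exprD mulrA.
  by rewrite mulrAC mulVf ?mul1r// expf_neq0// gt_eqF.
by rewrite ler_wpM2l ?exprn_ge0 ?invr_ge0 ?(ltW r0)// expRN_inv_le.
Qed.

Lemma is_derive_flat k (r : R) :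
  is_derive r (1 : R) (flat k) ((1 - k%:R) * flat k.+1 r + flat k.+2 r).
Proof.
have [r0|r0|r0] := ltgtP 0 r.
- have dV : is_derive r (1 : R) (fun y : R => y^-1) (- r ^- 2).
    have := @is_deriveV _ id r 1 1 (lt0r_neq0 r0) (is_derive_id _ _). by rewrite /= scaler1. elim: k => [|k IH].
  + have E : \near r, r * expR (- r^-1) = flat 0 r.
      near=> y; rewrite /flat expr0 mul1r ifT//; near: y; exact: lt_nbhsr. apply: (near_eq_is_derive E).
    have dE : is_derive r (1 : R) (fun y : R => expR (- y^-1)) (expR (- r^-1) * r ^- 2).
      apply: (@is_derive1_comp _ expR (fun y => - y^-1)). by have := is_deriveN dV; rewrite opprK.
    have := is_deriveM (is_derive_id r (1 : R)) dE.
    set D := (X in is_derive _ _ _ X); set D' := (X in _ -> is_derive _ _ _ X).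
    have -> // : D = D'; rewrite /D /D' /flat r0 /= subr0 mul1r !scR. by field; rewrite gt_eqF.
  + have E : \near r, r^-1 * flat k r = flat k.+1 r.
      near=> y; rewrite /flat !ifT; [by rewrite exprS !mulrA|near: y; exact: lt_nbhsr..].
    apply: (near_eq_is_derive E). have := is_deriveM dV IH.
    set D := (X in is_derive _ _ _ X); set D' := (X in _ -> is_derive _ _ _ X).
    have -> // : D = D'; rewrite /D /D' /flat r0 !scR. by rewrite !exprS -natr1; field; rewrite gt_eqF.
- have E : \near r, 0 = flat k r. near=> y; rewrite flat_neg// ltW//; near: y; exact: lt_nbhsl.
  apply: (near_eq_is_derive E). by rewrite !flat_neg ?mulr0 ?addr0 ?ltW//; exact: is_derive_cst.
- rewrite -r0 !flat_neg// mulr0 addr0.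
  (* At 0 the difference quotient is O(h), since the exponential beats every power: [flat_le] with n
     = k. *)
  have q (h : R) : `|h^-1 *: (flat k (h *: 1 + 0) - flat k 0)| <= (k.+1)`!%:R * `|h|.
    rewrite [flat k 0]flat_neg// subr0 addr0 [h%:A]mulr1.
    have [h0|h0] := ltP 0 h; last by rewrite flat_neg// scaler0 normr0 mulr_ge0.
    rewrite normrZ normfV ler_pdivrMl ?normr_gt0 ?gt_eqF//. rewrite (ger0_norm (flat_ge0 _ _)) (gtr0_norm h0) mulrCA.
    by have := flat_le h0 (leqnn k); rewrite subSnn expr1.
  have lim0 : h^-1 *: ((flat k \o shift 0) (h *: 1) - flat k 0) @[h --> 0^'] --> (0 : R).
    apply/cvgr0Pnorm_le => e e0; near=> h. apply: (le_trans (q h)); rewrite -ler_pdivlMl ?ltr0n ?fact_gt0//.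
    near: h; apply: dnbhs0_le; by rewrite mulr_gt0// invr_gt0 ltr0n fact_gt0.
  apply: DeriveDef; first by apply/cvg_ex; exists 0. exact: cvg_lim lim0.
Unshelve. all: by end_near. Qed.

Inductive flats : (R -> R) -> Prop :=
| flats_base k : flats (flat k)
| flats_lin (a : R) f g : flats f -> flats g -> flats (fun x => a * f x + g x).

Lemma flats_derive h : flats h -> exists2 h', flats h' & forall x : R, is_derive x (1 : R) h (h' x).
Proof.
elim=> [k|a f g _ [f' Ff' df] _ [g' Fg' dg]].
  exists (fun x => (1 - k%:R) * flat k.+1 x + flat k.+2 x) => [|x]; last exact: is_derive_flat.
  by apply: flats_lin; exact: flats_base. exists (fun x => a * f' x + g' x) => [|x]; first exact: flats_lin.
apply: is_deriveD; exact: (is_deriveZ a (df x)).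
Qed.

Definition trig (h : R -> R) : Prop := exists c a b : R, h = fun z => a * sin (c * z) + b * cos (c * z).

Lemma is_derive_trig (c a b z : R) :
  is_derive z (1 : R) (fun z => a * sin (c * z) + b * cos (c * z))
    ((- (b * c)) * sin (c * z) + (a * c) * cos (c * z)).
Proof.
have dc : is_derive z (1 : R) (fun z => c * z) c.
  by have := is_deriveZ c (is_derive_id z (1 : R)); rewrite [c%:A]mulr1.
have ds : is_derive z (1 : R) (fun z => sin (c * z)) (cos (c * z) * c) by exact: (@is_derive1_comp _ sin).
have dk : is_derive z (1 : R) (fun z => cos (c * z)) (- sin (c * z) * c) by exact: (@is_derive1_comp _ cos).
have := is_deriveD (is_deriveZ a ds) (is_deriveZ b dk).
set D := (X in is_derive _ _ _ X); set D' := (X in _ -> is_derive _ _ _ X).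
by have -> // : D = D'; rewrite /D /D' !scR; ring.
Qed.

Lemma trig_derive h : trig h -> exists2 h', trig h' & forall x : R, is_derive x (1 : R) h (h' x).
Proof.
move=> [c [a [b ->]]]; exists (fun z => (- (b * c)) * sin (c * z) + (a * c) * cos (c * z)).
  by exists c, (- (b * c)), (a * c). by move=> x; exact: is_derive_trig.
Qed.

Section smooth_functions.
Variables (V : normedModType R) (f : V -> R).
Hypothesis sf : smooth f.
Lemma smooth_flat k : smooth (fun x => flat k (f x)).
Proof. by apply: (smooth_chain flats_derive (flats_base k)). Qed.
Lemma smooth_sin c : smooth (fun x => sin (c * f x)).
Proof.
have Ht : trig (fun z => sin (c * z)). exists c, 1, 0; apply/funext => z; by rewrite mul1r mul0r addr0.
exact: (@smooth_chain _ _ _ trig_derive _ _ Ht).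
Qed.
Lemma smooth_cos c : smooth (fun x => cos (c * f x)).
Proof.
have Ht : trig (fun z => cos (c * z)). exists c, 0, 1; apply/funext => z; by rewrite mul0r mul1r add0r.
exact: (@smooth_chain _ _ _ trig_derive _ _ Ht).
Qed.
End smooth_functions.
End flat_functions.

(** * A periodic bump function of one variable *)

Section kernel1.
Variable R : realType.

(** y^2 = (y cos y)^2 + (y sin y)^2, where y cos y <= sin y by the mean value theorem and y <=
    pi. *)
Lemma sin_sqr_ge (y : R) : 0 <= y <= pi / 2 -> y ^+ 2 <= (1 + pi ^+ 2) * sin y ^+ 2.
Proof.
move=> /andP[y0 ypi]. have [c] := @MVT_segment R sin cos 0 y y0 (fun x _ => is_derive_sin x)
  (cont_subT (@continuous_sin R)). rewrite sin0 !subr0 in_itv/= => /andP[c0 cy] E. have cc : cos y <= cos c.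
  by rewrite leNgt ltr_cos -?leNgt// in_itv/=; apply/andP; split; lra.
have cy0 : 0 <= cos y by rewrite cos_ge0_pihalf//; lra. have s1 : y * cos y <= sin y by rewrite E mulrC ler_wpM2r.
have s2 : (y * cos y) ^+ 2 <= sin y ^+ 2 by rewrite ler_sqr ?nnegrE ?mulr_ge0// (le_trans _ s1)// mulr_ge0.
have ypi2 : y ^+ 2 <= pi ^+ 2 by rewrite ler_sqr ?nnegrE//; lra. have cs := cos2Dsin2 y; have sy := sqr_ge0 (sin y).
rewrite exprMn in s2; nra.
Qed.

Lemma sin_abs_le (y : R) : `|sin y| <= `|y|.
Proof.
have h (x : R) : 0 <= x -> `|sin x| <= x.
  move=> x0; have [c] := @MVT_segment R sin cos 0 x x0 (fun x _ => is_derive_sin x) (cont_subT (@continuous_sin R)).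
  by rewrite sin0 !subr0 => _ ->; rewrite normrM (ger0_norm x0) ler_piMl// cos_max.
have [y0|y0] := leP 0 y; first by rewrite (ger0_norm y0) h. by rewrite -normrN -sinN (ltr0_norm y0) h// oppr_ge0 ltW.
Qed.

(** A bump of width about 1/N around every integer: with sin(pi z) in the place of z the function is
    smooth and periodic at once. *)
Definition kappa (N : nat) (z : R) : R := flat 1 (1 - N%:R ^+ 2 * sin (pi * z) ^+ 2).
Definition dkappa (N : nat) (z : R) : R :=
  flat 3 (1 - N%:R ^+ 2 * sin (pi * z) ^+ 2) * - (N%:R ^+ 2 * (2 * pi * (sin (pi * z) * cos (pi * z)))).

Lemma is_derive_kappa N (z : R) : is_derive z (1 : R) (kappa N) (dkappa N z).
Proof.
have ds : is_derive z (1 : R) (fun z => sin (pi * z)) (pi * cos (pi * z)). have := @is_derive_trig R pi 1 0 z.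
  set D := (X in is_derive _ _ _ X); set f := (X in is_derive _ _ X _).
  have -> : f = fun z => sin (pi * z) by apply/funext => x; rewrite /f mul1r mul0r addr0.
  by have -> // : D = pi * cos (pi * z); rewrite /D; ring. have := is_deriveM ds ds.
set D := (X in is_derive _ _ _ X) => dd.
have := is_deriveB (is_derive_cst (1 : R) z (1 : R)) (is_deriveZ (N%:R ^+ 2) dd).
set f := (X in is_derive _ _ X _) => df.
have df' : is_derive z (1 : R) f (- (N%:R ^+ 2 * (2 * pi * (sin (pi * z) * cos (pi * z))))).
  apply: (is_derive_eq df); rewrite /D /GRing.scale/=; ring.
have fE : f = fun z => 1 - N%:R ^+ 2 * sin (pi * z) ^+ 2 by apply/funext => x. have dF := @is_derive_flat R 1 (f z).
have := @is_derive1_comp R (flat 1) f z _ _ dF df'. by rewrite subrr mul0r add0r fE.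
Qed.

Lemma kappa_ge0 N z : 0 <= kappa N z. Proof. exact: flat_ge0. Qed.

Lemma kappa_le1 N z : kappa N z <= 1.
Proof.
rewrite /kappa /flat; case: ifP => // r0; rewrite expr1 mulrA mulVf ?gt_eqF// mul1r.
apply: (@le_trans _ _ (expR 0)); last by rewrite expR0. by rewrite ler_expR oppr_le0 invr_ge0 ltW.
Qed.

Definition krad (N : nat) : R := (1 + pi ^+ 2) / N%:R.

Lemma sin_pi_floor (z : R) : sin (pi * z) ^+ 2 = sin (pi * (z - (Num.floor z)%:~R)) ^+ 2.
Proof.
have := @periodicZ R R (fun z => sin (pi * z) ^+ 2) _ (- Num.floor z) z; rewrite mulrNz => -> //.
by move=> x; rewrite mulrDr mulr1 sinDpi sqrrN.
Qed.

Lemma near_integer N (z : R) : (0 < N)%N -> 0 < 1 - N%:R ^+ 2 * sin (pi * z) ^+ 2 ->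
  exists k : int, `|z - k%:~R| <= krad N.
Proof.
move=> N0; rewrite sin_pi_floor subr_gt0. have pi0 := pi_gt0 R; have N0' : 0 < N%:R :> R by rewrite ltr0n.
have key (w : R) : 0 <= w <= 2^-1 -> N%:R ^+ 2 * sin (pi * w) ^+ 2 < 1 -> w <= krad N.
  move=> /andP[w0 w2] h; rewrite /krad ler_pdivlMr//.
  have hs : 0 <= pi * w <= pi / 2 by rewrite mulr_ge0 ?(ltW pi0)//= ler_wpM2l// ltW.
  have := sin_sqr_ge hs; rewrite exprMn => h2. have h3 : (pi * (w * N%:R)) ^+ 2 <= (1 + pi ^+ 2) * 1.
    rewrite 2!exprMn mulrA (le_trans (ler_wpM2r (sqr_ge0 N%:R) h2))//.
    by rewrite -mulrA ler_wpM2l ?addr_ge0 ?sqr_ge0// mulrC ltW. have pi1 : 1 <= pi :> R by have := pi_ge2 R; lra.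
  have wN : 0 <= w * N%:R by rewrite mulr_ge0// ltW. rewrite -ler_sqr ?nnegrE ?addr_ge0 ?sqr_ge0//.
  have pi2 : 1 <= pi ^+ 2 :> R by rewrite expr_ge1// ltW.
  rewrite exprMn mulr1 in h3; have := sqr_ge0 (w * N%:R) => a0.
  have a1 : (w * N%:R) ^+ 2 <= pi ^+ 2 * (w * N%:R) ^+ 2 by rewrite ler_peMl.
  rewrite (le_trans a1)// (le_trans h3)// expr2 ler_peMl//; lra. set w := z - _ => h.
have w0 : 0 <= w by rewrite subr_ge0 floor_le_tmp.
have w1 : w < 1 by rewrite ltrBlDl -[X in _ + X](mulr1z 1) -intrD floorD1_gt. have [w2|w2] := leP w 2^-1.
  by exists (Num.floor z); rewrite -/w (ger0_norm w0) key// w0.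
exists (Num.floor z + 1); rewrite intrD opprD addrA -/w mulr1z distrC ger0_norm ?subr_ge0 ?(ltW w1)//.
apply: key; first by lra. by rewrite mulrBr mulr1 sinB sinpi cospi mul0r sub0r mulN1r opprK.
Qed.

Lemma kappa_support N z : (0 < N)%N -> kappa N z != 0 -> exists k : int, `|z - k%:~R| <= krad N.
Proof.
move=> N0 h; apply: near_integer => //; rewrite ltNge; apply: contra h => h. by rewrite /kappa flat_neg.
Qed.

Lemma dkappa_support N z : (0 < N)%N -> dkappa N z != 0 -> exists k : int, `|z - k%:~R| <= krad N.
Proof.
move=> N0 h; apply: near_integer => //; rewrite ltNge; apply: contra h => h. by rewrite /dkappa flat_neg ?mul0r.
Qed.

(** [flat 3] is at most 6 on ]0,1], and on the support N |sin(pi z)| <= 1 absorbs one of the two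
    factors N. *)
Lemma dkappa_le N z : `|dkappa N z| <= 12 * pi * N%:R.
Proof.
rewrite /dkappa; set r := 1 - _; have pi0 := pi_gt0 R.
have [r0|r0] := leP r 0; first by rewrite flat_neg// mul0r normr0 !mulr_ge0// ltW.
have r1 : r <= 1 by rewrite gerBl mulr_ge0 ?sqr_ge0. have f6 : flat 3 r <= 6.
  have -> : flat 3 r = r^-1 * flat 2 r by rewrite /flat r0 exprS mulrA.
  rewrite ler_pdivrMl//; have := @flat_le R 2 2 r r0 (leqnn 2).
  rewrite subSnn expr1 (_ : 3`!%:R = 6)// => h; apply: (le_trans h). by rewrite mulrC ler_wpM2r// ger_pMr.
have Ns : N%:R * `|sin (pi * z)| <= 1. rewrite -(@expr_le1 _ 2) ?mulr_ge0// exprMn real_normK ?num_real//.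
  by move: r0; rewrite /r subr_gt0 => /ltW. rewrite normrM (ger0_norm (flat_ge0 _ _)) normrN.
have -> : 12 * pi * N%:R = 6 * (2 * pi * N%:R) :> R by ring. apply: ler_pM => //; first exact: flat_ge0.
rewrite !normrM (gtr0_norm pi0) !(ger0_norm (ler0n R _)).
have -> : N%:R * N%:R * (2 * pi * (`|sin (pi * z)| * `|cos (pi * z)|)) =
  (2 * pi * N%:R) * (N%:R * `|sin (pi * z)| * `|cos (pi * z)|) by ring.
rewrite -[leRHS]mulr1 ler_wpM2l ?mulr_ge0// ?(ltW pi0)//. by rewrite -[leRHS]mulr1 ler_pM ?mulr_ge0 ?cos_max.
Qed.

Lemma kappa_periodic N z : kappa N (z + 1) = kappa N z.
Proof. by rewrite /kappa mulrDr mulr1 sinDpi sqrrN. Qed.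

Lemma kappa_continuous N : continuous (kappa N).
Proof. exact: is_derive_cont (is_derive_kappa N). Qed.

End kernel1.

(** * Mass of the bump and of its derivative *)

Section torus_kernel.
Variable R : realType.

Lemma torus_integral_prod n (f : 'I_n -> R -> R) (c : 'I_n -> R) :
  (forall i z, 0 <= f i z) -> (forall i, mfun (f i : mR R -> R)) ->
  (forall i, (\int[unif]_z (f i z)%:E = (c i)%:E)%E) ->
  (\int[torus_measure R n]_x (\prod_i f i (x 0 i))%:E = (\prod_i c i)%:E)%E.
Proof.
elim: n f c => [|n IH] f c f0 mf fc. under eq_integral do rewrite big_ord0. by rewrite big_ord0 prob_int_cst.
have mp m (g : 'I_m -> R -> R) : (forall i, mfun (g i : mR R -> R)) ->
    mfun (fun x : 'rV[R]_m => (\prod_i g i (x 0 i))%:E). move=> mg; apply/mEFinP; apply: measurable_prod => i _.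
  exact: (mcomp (mg i) (@mcoord R m i)).
rewrite ge0_integral_cons; [|exact: mp|by move=> x; rewrite lee_fin prodr_ge0]. pose f' i := f (lift ord0 i).
have E z : (\int[torus_measure R n]_y (\prod_i f i (cons_rV (z, y) 0 i))%:E =
    (f ord0 z)%:E * (\prod_i c (lift ord0 i))%:E)%E. rewrite -(IH f') => [|*|*|*]; [|exact: f0|exact: mf|exact: fc].
  rewrite -int_scale//. apply: eq_integral => y _; rewrite big_ord_recl cons_rV0 -EFinM; congr (_ * _)%:E.
  by apply: eq_bigr => i _; rewrite cons_rVS. under eq_integral do rewrite E. rewrite ge0_integralZr//; last 3 first.
- by apply/mEFinP; exact: mf.
- by move=> x _; rewrite lee_fin.
- rewrite lee_fin prodr_ge0// => i _; rewrite -lee_fin -fc. by apply: int_ge0 => z _; rewrite lee_fin.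
by rewrite fc -EFinM big_ord_recl.
Qed.

Let mk N : mfun (kappa N : mR R -> R).
Proof. by apply: mcontinuous; exact: kappa_continuous. Qed.

Let mtrig (a b : R) : mfun (fun z : mR R => a * sin (pi * z) + b * cos (pi * z)).
Proof. exact: is_derive_mfun (is_derive_trig pi a b). Qed.

Lemma mfun_dkappa N : mfun (dkappa N : mR R -> R).
Proof.
have ms : mfun (fun z : mR R => sin (pi * z)).
  by have := mtrig 1 0; congr measurable_fun; apply/funext => x; rewrite mul1r mul0r addr0.
have mc : mfun (fun z : mR R => cos (pi * z)).
  by have := mtrig 0 1; congr measurable_fun; apply/funext => x; rewrite mul0r mul1r add0r.
have mf : mfun (flat 3 : mR R -> R) := is_derive_mfun (is_derive_flat 3). apply: mfunM.
  apply: (mcomp mf); apply: mfunB; first exact: mcst. by apply: mfunM; [exact: mcst|exact: measurable_funX].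
apply: measurable_funN; apply: mfunM; first exact: mcst. by apply: mfunM; [exact: mcst|exact: mfunM].
Qed.

Definition kmass N : R := fine (\int[unif]_z (kappa N z)%:E)%E.

Lemma kmassE N : (\int[unif]_z (kappa N z)%:E = (kmass N)%:E)%E.
Proof.
rewrite fineK// ge0_fin_numE; last by apply: int_ge0 => z _; rewrite lee_fin kappa_ge0.
apply: (@le_lt_trans _ _ (\int[unif]_z 1)%E). by apply: int_le => z _; rewrite lee_fin kappa_le1.
by rewrite integral_cst// mul1e; rewrite [X in (X < _)%E](_ : _ = 1%E) ?ltry//; exact: prob_setT.
Qed.

(** On [0, 1/(2 pi N)] one has N sin(pi z) <= 1/2, so [kappa] is at least exp(-1/(3/4)) there. *)
Definition kC : R := expR (- (4 / 3)) / (2 * pi).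

Lemma kmass_ge N : (0 < N)%N -> kC / N%:R <= kmass N.
Proof.
move=> N0; have N0' : 0 < N%:R :> R by rewrite ltr0n. have pi2 := pi_ge2 R; have pi0 := pi_gt0 R.
rewrite -lee_fin -kmassE unifE; last 2 first.
- by apply/mEFinP; exact: mk.
- by move=> z; rewrite lee_fin kappa_ge0. pose b : R := (2 * pi * N%:R)^-1.
have b0 : 0 < b by rewrite invr_gt0 !mulr_gt0. have b1 : b <= 1.
  rewrite invf_le1 ?mulr_gt0//; have : 1 <= N%:R :> R by rewrite ler1n. by move=> N1; nra.
apply: (@le_trans _ _ (\int[leb]_(z in `[0%R, b]) (kappa N z)%:E)%E); last first. apply: ge0_subset_integral => //.
  - by apply/mEFinP; apply: mfunTS; exact: mk.
  - by move=> z _; rewrite lee_fin kappa_ge0.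
  - by move=> z /=; rewrite !in_itv/= => /andP[-> zb]; rewrite (le_trans zb).
apply: (@le_trans _ _ (\int[leb]_(z in `[0%R, b]) (expR (- (4 / 3)))%:E)%E).
  rewrite integral_cst//= (@leb_itv R `[0, b]) /= lte_fin b0 -EFinB -EFinM lee_fin.
  by rewrite subr0 /kC /b [in leRHS]invfM mulrA.
apply: int_le => z /=; rewrite in_itv/= => /andP[z0 zb]; rewrite lee_fin.
have Ns : (N%:R * sin (pi * z)) ^+ 2 <= 4^-1. have : `|N%:R * sin (pi * z)| <= 2^-1.
    rewrite normrM (ger0_norm (ler0n R N)); apply: (@le_trans _ _ (N%:R * (pi * b))).
      rewrite ler_wpM2l// (le_trans (sin_abs_le _))// ger0_norm ?mulr_ge0 ?(ltW pi0)//. by rewrite ler_wpM2l// ltW.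
    rewrite (_ : N%:R * (pi * b) = 2^-1)// /b. have -> : 2 * pi * N%:R = pi * (2 * N%:R) :> R by ring.
    by rewrite invfM [pi * _]mulrA divff ?gt_eqF// mul1r invfM mulrCA divff ?gt_eqF// mulr1.
  move=> h; rewrite -real_normK ?num_real//. have -> : 4^-1 = (2^-1) ^+ 2 :> R by rewrite expr2 -invfM -natrM.
  by rewrite ler_sqr ?nnegrE. rewrite exprMn in Ns; rewrite /kappa /flat; set r := 1 - _.
have r3 : 3 / 4 <= r by rewrite /r; lra. have r0 : 0 < r by lra.
rewrite r0 expr1 mulrA mulVf ?gt_eqF// mul1r ler_expR lerN2.
by rewrite -[leRHS]invrK lef_pV2 ?posrE ?invr_gt0// invf_div.
Qed.

(** The bound 12 pi N on the derivative, times two intervals of length [krad], one at each end of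
    [0,1]. *)
Definition dkC : R := 24 * pi * (1 + pi ^+ 2).
Definition dkmass N : R := fine (\int[unif]_z (`|dkappa N z|)%:E)%E.

Lemma dkmass_le N : (0 < N)%N -> (\int[unif]_z (`|dkappa N z|)%:E <= dkC%:E)%E.
Proof.
move=> N0; have N0' : 0 < N%:R :> R by rewrite ltr0n. have pi0 := pi_gt0 R.
pose L : R := 12 * pi * N%:R; have L0 : 0 <= L by rewrite !mulr_ge0// ltW.
have rad0 : 0 < krad R N by rewrite divr_gt0// ltr_wpDr ?sqr_ge0.
have mdN : mfun (fun z : mR R => (`|dkappa N z|)%:E). by apply/mEFinP; apply: mfun_norm; exact: mfun_dkappa.
rewrite unifE//. pose S1 := `[0%R, krad R N]%classic : set (mR R). pose S2 := `[1 - krad R N, 1]%classic : set (mR R).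
have mS1 : measurable S1 by exact: mitv. have mS2 : measurable S2 by exact: mitv.
have iS (S : set (mR R)) : measurable S -> (leb S = (krad R N)%:E)%E ->
    (\int[leb]_(z in `[0%R, 1%R]) (L * \1_S z)%:E <= (L * krad R N)%:E)%E.
  move=> mS lS; under eq_integral do rewrite EFinM. rewrite int_scale//.
  rewrite [leRHS]EFinM; apply: lee_wpmul2l; first by rewrite lee_fin.
  rewrite integral_indic// -lS; apply: le_measure; rewrite ?inE//.
  - by apply: measurableI.
apply: (@le_trans _ _ (\int[leb]_(z in `[0%R, 1%R]) ((L * \1_S1 z)%:E + (L * \1_S2 z)%:E))%E).
  apply: int_le => z /=; rewrite in_itv/= => /andP[z0 z1]; rewrite -EFinD lee_fin -mulrDr.
  have [->|dz] := eqVneq (dkappa N z) 0; first by rewrite normr0 mulr_ge0// addr_ge0.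
  rewrite (le_trans (dkappa_le N z))// ler_peMr//. have [k kz] := dkappa_support N0 dz.
  rewrite !indicE /S1 /S2 !mem_setE !in_itv/= z0 z1 andbT/=. have [zr|zr] := leP z (krad R N); first by rewrite lerDl.
  rewrite add0r; have [//|rz] := leP (1 - krad R N) z; exfalso. move: kz; rewrite ler_norml => /andP[k1 k2].
  have [k0|k0] := leP k 0. have : k%:~R <= 0 :> R by rewrite lerz0. lra.
  have : 1 <= k%:~R :> R by rewrite ler1z -gtz0_ge1. lra. rewrite ge0_integralD//; last 4 first.
- by move=> z _; rewrite lee_fin mulr_ge0.
- by apply/mEFinP; apply: mfunM => //; apply: mfunTS; exact: mindic.
- by move=> z _; rewrite lee_fin mulr_ge0.
- by apply/mEFinP; apply: mfunM => //; apply: mfunTS; exact: mindic.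
apply: (@le_trans _ _ ((L * krad R N)%:E + (L * krad R N)%:E)%E). apply: leeD; apply: iS => //.
    by rewrite (@leb_itv R `[0, krad R N])/= lte_fin rad0 -EFinB subr0.
  by rewrite (@leb_itv R `[1 - krad R N, 1])/= lte_fin ltrBlDr ltrDl rad0 -EFinB; congr EFin; ring.
rewrite -EFinD lee_fin ?eqW//. by rewrite /L /krad /dkC; field; rewrite gt_eqF.
Qed.

Lemma dkmassE N : (0 < N)%N -> (\int[unif]_z (`|dkappa N z|)%:E = (dkmass N)%:E)%E.
Proof.
move=> N0; rewrite fineK// ge0_fin_numE; last by apply: int_ge0 => z _; rewrite lee_fin.
by rewrite (le_lt_trans (dkmass_le N0))// ltry.
Qed.
End torus_kernel.

(** * Mollifiers on the torus *)

Section torus_mollifiers.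
Variables (R : realType) (d : nat).

Definition near_lattice (a : R) (z : 'rV[R]_d) : Prop :=
  exists k : 'rV[int]_d, forall i, `|z 0 i - (k 0 i)%:~R| <= a.

(** [mol_dint] is scale invariant: one constant [C] serves all radii [a], which makes the commutator
    bound uniform. Supports are near the integer lattice because the kernels are periodic. *)
Record mollifier (K : 'rV[R]_d -> R) (a C : R) : Prop := Mollifier {
  mol_smooth : smooth K;
  mol_periodic : Zper K;
  mol_ge0 : forall z, 0 <= K z;
  mol_int : (\int[haar]_z (K z)%:E = 1)%E;
  mol_supp : forall z, K z != 0 -> near_lattice a z;
  mol_dsupp : forall j z, 'D_('e_j) K z != 0 -> near_lattice a z;
  mol_dint : forall j, (\int[haar]_z (`|'D_('e_j) K z| * a)%:E <= C%:E)%E }.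

Lemma smooth_coord (i : 'I_d) : smooth (fun x : 'rV[R]_d => x 0 i).
Proof.
have E (v x : 'rV[R]_d) : is_derive x v (fun x : 'rV[R]_d => x 0 i) (v 0 i). apply: is_derive_of_line.
  have -> : (fun s : R => (x + s *: v) 0 i) = (fun s : R => x 0 i + v 0 i * s).
    by apply/funext => s; rewrite !mxE mulrC.
  have := is_deriveD (is_derive_cst (x 0 i) (0 : R) (1 : R)) (is_deriveZ (v 0 i) (is_derive_id (0 : R) (1 : R))).
  by rewrite add0r [(v 0 i) *: _]mulr1. have c : continuous (fun x : 'rV[R]_d => x 0 i) by exact: coord_continuous.
case=> [|k]; split=> // v; split; first by move=> x; exact: (derive_ex (E v x)).
rewrite (_ : 'D_v _ = fun=> v 0 i); first exact: sm_cst. by apply/funext => x; exact: (derive_eq (E v x)).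
Qed.

Section kernel.
Variable N : nat.
Hypothesis N0 : (0 < N)%N.
Let kern (x : 'rV[R]_d) : R := \prod_i kappa N (x 0 i).
Let m : R := kmass R N.
Let N0' : 0 < N%:R :> R. Proof. by rewrite ltr0n. Qed.

Let m0 : 0 < m.
Proof.
apply: lt_le_trans (kmass_ge R N0); rewrite divr_gt0// divr_gt0 ?expR_gt0//. by rewrite mulr_gt0// pi_gt0.
Qed.

Let kern_smooth : smooth kern.
Proof.
apply: smooth_prod => i.
rewrite (_ : (fun x => _) = fun x : 'rV[R]_d => flat 1 (1 + - N%:R ^+ 2 * (sin (pi * x 0 i) * sin (pi * x 0 i)))).
  apply: smooth_flat; apply: sm_add; first exact: sm_cst. apply: sm_mul; first exact: sm_cst.
  by apply: sm_mul; apply: smooth_sin; exact: smooth_coord. by apply/funext => x; rewrite /kappa mulNr.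
Qed.

Let D_kern j x : 'D_('e_j) kern x = \prod_i (if i == j then dkappa N (x 0 i) else kappa N (x 0 i)).
Proof.
rewrite (bigD1 j)//= eqxx. have -> : \prod_(i | i != j) (if i == j then dkappa N (x 0 i) else kappa N (x 0 i)) =
    \prod_(i | i != j) kappa N (x 0 i) by apply: eq_bigr => i /negbTE ->. set P := \prod_(i | _) _.
suff E : is_derive x ('e_j) kern (dkappa N (x 0 j) * P) by exact: (derive_eq E). apply: is_derive_of_line.
have -> : (fun s : R => kern (x + s *: 'e_j)) = (fun s : R => P * kappa N (x 0 j + s)).
  apply/funext => s; rewrite /kern (bigD1 j)//= !mxE !eqxx mulr1 mulrC; congr (_ * _).
  by apply: eq_bigr => i ij; rewrite !mxE eqxx/= (negbTE ij) mulr0 addr0.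
have ds : is_derive (0 : R) (1 : R) (fun s : R => x 0 j + s) 1.
  have := is_deriveD (is_derive_cst (x 0 j) (0 : R) (1 : R)) (is_derive_id (0 : R) (1 : R)). by rewrite add0r.
have dk : is_derive ((fun s : R => x 0 j + s) 0) (1 : R) (kappa N) (dkappa N (x 0 j)).
  by rewrite addr0; exact: is_derive_kappa. have := is_deriveZ P (@is_derive1_comp _ (kappa N) _ 0 _ _ dk ds).
by rewrite mulr1 [P *: _]mulrC.
Qed.

Let kern_int : (\int[haar]_z (kern z)%:E = (m ^+ d)%:E)%E.
Proof.
rewrite (@torus_integral_prod R d (fun=> kappa N) (fun=> m)).
- by rewrite prodr_const card_ord.
- by move=> *; exact: kappa_ge0.
- by move=> _; apply: mcontinuous; exact: kappa_continuous.
- by move=> _; exact: kmassE.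
Qed.

Let near_row (a : R) (z : 'rV[R]_d) : (forall i, exists k : int, `|z 0 i - k%:~R| <= a) -> near_lattice a z.
Proof.
move=> h; exists (\row_i sval (cid (h i))) => i; rewrite mxE; exact: (svalP (cid (h i))).
Qed.

Definition molC : R := dkC R * (1 + pi ^+ 2) / kC R.

Lemma mollifier_kernel : exists K : 'rV[R]_d -> R, mollifier K (krad R N) molC.
Proof.
have md0 : 0 < m ^+ d by exact: exprn_gt0. exists (fun x => (m ^+ d)^-1 * kern x).
have DK j z : 'D_('e_j) (fun x => (m ^+ d)^-1 * kern x) z = (m ^+ d)^-1 * 'D_('e_j) kern z.
  rewrite derive_smooth_mul//; last exact: sm_cst. by rewrite derive_cst mulr0 addr0. split.
- by apply: sm_mul => //; exact: sm_cst.
- move=> x k; congr (_ * _); apply: eq_bigr => i _; rewrite !mxE.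
  exact: (@periodicZ R R (kappa N) (kappa_periodic N)).
- by move=> z; rewrite mulr_ge0 ?invr_ge0 ?(ltW md0)// prodr_ge0// => i _; exact: kappa_ge0.
- under eq_integral do rewrite EFinM. rewrite int_scale ?invr_ge0 ?(ltW md0)//.
  by rewrite kern_int -EFinM mulVf ?gt_eqF.
- move=> z; rewrite mulf_eq0 negb_or => /andP[_ /prodf_neq0 h]; apply: near_row => i.
  exact: (kappa_support N0 (h i isT)).
- move=> j z; rewrite DK D_kern mulf_eq0 negb_or => /andP[_ /prodf_neq0 h]; apply: near_row => i.
  have := h i isT; case: ifP => _; [exact: dkappa_support|exact: kappa_support].
- move=> j; pose c (i : 'I_d) := if i == j then dkmass R N else m.
  have c0 : 0 < krad R N by rewrite divr_gt0// ltr_wpDr ?sqr_ge0.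
  rewrite (eq_integral (fun z : 'rV[R]_d => (((m ^+ d)^-1 * krad R N)%:E *
      (\prod_i (if i == j then `|dkappa N (z 0 i)| else kappa N (z 0 i)))%:E)%E)); last first.
    move=> z _; rewrite DK D_kern normrM normr_prod -EFinM; congr EFin.
    rewrite (gtr0_norm (_ : 0 < (m ^+ d)^-1)) ?invr_gt0// mulrAC; congr (_ * _).
    by apply: eq_bigr => i _; case: ifP => // _; rewrite ger0_norm// kappa_ge0. have mk : mfun (kappa N : mR R -> R).
    by apply: mcontinuous; exact: kappa_continuous.
  have f0 (i : 'I_d) (z : R) : 0 <= (if i == j then `|dkappa N z| else kappa N z).
    by case: ifP => // _; exact: kappa_ge0.
  have mf (i : 'I_d) : mfun (fun z : mR R => if i == j then `|dkappa N z| else kappa N z).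
    case: (i == j) => //; apply: mfun_norm. exact: mfun_dkappa.
  rewrite int_scale; last by rewrite mulr_ge0 ?invr_ge0 ?(ltW md0) ?(ltW c0).
  rewrite (@torus_integral_prod R d _ c f0 mf); last first.
    by move=> i; rewrite /c; case: ifP => _; [exact: dkmassE|exact: kmassE].
  rewrite -EFinM lee_fin (bigD1 j)//= {1}/c eqxx.
  rewrite (eq_bigr (fun=> m)); last by move=> i ij; rewrite /c (negbTE ij).
  have mdE : m ^+ d = m * \prod_(i < d | i != j) m. by rewrite -[d in LHS]card_ord -prodr_const (bigD1 j).
  have P0 : 0 < \prod_(i < d | i != j) m by apply: prodr_gt0. rewrite mdE; set P := \prod_(i < d | _) m in P0 *.
  have -> : (m * P)^-1 * krad R N * (dkmass R N * P) = dkmass R N * krad R N / m. by field; rewrite !gt_eqF.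
  have b1 : dkmass R N <= dkC R by rewrite -lee_fin -dkmassE// dkmass_le. rewrite /molC ler_pdivrMr//.
  have pi0 := pi_gt0 R. have b0 : 0 <= dkC R by rewrite /dkC mulr_ge0 ?mulr_ge0 ?(ltW pi0)// addr_ge0// sqr_ge0.
  move: b0 b1; move: (dkC R) => c1 b0 b1. rewrite -[c1 * _ / _]mulrA -[leRHS]mulrA. rewrite ler_pM//.
  + by rewrite -lee_fin -dkmassE// int_ge0.
  + exact: ltW.
  + have kc : 0 < kC R by rewrite divr_gt0 ?expR_gt0// mulr_gt0. have := kmass_ge R N0; rewrite -/m /krad => h.
    have q0 : 0 <= (1 + pi ^+ 2) / kC R by rewrite divr_ge0 ?addr_ge0 ?sqr_ge0 ?(ltW kc).
    apply: le_trans (ler_wpM2l q0 h). by apply: eqW; field; rewrite !gt_eqF.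
Qed.
End kernel.
End torus_mollifiers.

(** * Translations and mollification on the torus *)
Lemma ecvg0P (R : realType) (u : (\bar R)^nat) : (forall n, 0 <= u n)%E ->
  (u n @[n --> \oo] --> 0%E) <-> (forall e : R, 0 < e -> \forall n \near \oo, (u n <= e%:E)%E).
Proof.
move=> u0; split=> [h e e0|h A [e /= e0 eA]].
  apply: (h [set x | (x <= e%:E)%E]); exists e => //= r; rewrite /ball/= sub0r normrN => re.
  by rewrite lee_fin ltW// (le_lt_trans (ler_norm _)). have e2 : 0 < e / 2 by rewrite divr_gt0.
apply: filterS (h _ e2) => n /=; have := u0 n; case: (u n) => [r||]//; rewrite !lee_fin => r0 re.
by apply: eA; rewrite /ball/= sub0r normrN ger0_norm// (le_lt_trans re)// ltr_pdivrMr// ltr_pMr// ltr1n.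
Qed.

Section translation_continuity.
Variable R : realType.

Lemma integral_lty_setU d (T : measurableType d) (mu : {measure set T -> \bar R}) (A B : set T) (f : T -> \bar R) :
  measurable A -> measurable B -> mfun f -> (forall x, 0 <= f x)%E ->
  (\int[mu]_(x in A) f x < +oo)%E -> (\int[mu]_(x in B) f x < +oo)%E -> (\int[mu]_(x in A `|` B) f x < +oo)%E.
Proof.
move=> mA mB mf f0 hA hB. have -> : A `|` B = A `|` (B `\` A).
  apply/seteqP; split=> x; last by case=> [|[]]; [left|right].
  by case=> [Ax|Bx]; [left|have [Ax|Ax] := pselect (A x); [left|right]].
have mBA : measurable (B `\` A) by exact: measurableD. rewrite ge0_integral_setU//; last 2 first.
- exact: (mfunTS mf).
- by apply/disj_setPS => x [Ax [_ /(_ Ax)]].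
rewrite lte_add_pinfty// (le_lt_trans _ hB)// ge0_subset_integral//; first exact: (mfunTS mf).
Qed.

(** Approximation in L^1 by a continuous function on [-1, 2[, an interval that contains z + h for z
    in [0,1[ and |h| <= 1; for the continuous function bounded convergence applies. *)
Lemma unif_translation (g : R -> R) (h : nat -> R) :
  mfun (g : mR R -> R) -> (forall z, g (z + 1) = g z) ->
  (\int[unif]_z `|g z|%:E < +oo)%E -> (forall n, `|h n| <= 1) -> h n @[n --> \oo] --> (0 : R) ->
  (\int[unif]_z `|g (z + h n) - g z|%:E)%E @[n --> \oo] --> 0%E.
Proof.
move=> mg pg ig h1 h0. pose E : set (mR R) := `[-1, 2[%classic. have mE : measurable E by exact: mitv.
have mn (k : mR R -> R) : mfun k -> mfun (fun z => `|k z|%:E). by move=> mk; apply/mEFinP; exact: mfun_norm.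
have ms (k : mR R -> R) r : mfun k -> mfun (fun z : mR R => k (z + r)).
  by move=> mk; exact: (mcomp mk (mfun_addr_m r)).
have unif_co (f : mR R -> \bar R) : mfun f -> (forall x, 0 <= f x)%E ->
    (\int[unif]_z f z = \int[leb]_(z in `[0%R, 1%R[) f z)%E.
  by move=> mf f0; rewrite unifE// integral_itv_bndo_bndc//; exact: mfunTS. have mG := mn _ mg.
have iE : (\int[leb]_(z in E) `|g z|%:E < +oo)%E.
  have -> : E = `[-1, 0[%classic `|` (`[0, 1[%classic `|` `[1, 2[%classic).
    by rewrite -!itv_bndbnd_setU// bnd_simp; lra.
  have i1 : (\int[leb]_(z in `[0%R, 1%R[) `|g z|%:E < +oo)%E by rewrite -unif_co.
  have sh (a : R) : (forall z, g (z + a) = g z) -> (\int[leb]_(z in `[a, (1 + a)%R[) `|g z|%:E < +oo)%E.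
    move=> pa; rewrite -[X in `[X, _[%classic]add0r -(@ge0_int_shift _ a 0 1 (fun z => `|g z|%:E))//.
    by under eq_integral do rewrite pa. apply: integral_lty_setU => //; last (apply: integral_lty_setU => //).
  - by apply: measurableU; exact: mitv.
  - have := sh (-1); rewrite subrr; apply => z. by rewrite -[in RHS](subrK 1 z) pg.
  - by have := sh 1; rewrite (_ : 1 + 1 = 2)//; apply. have ige : lL1 E g.
  by apply/integrableP; split=> //; apply/mEFinP; exact: mfunTS mg.
have Eoo : (leb E < +oo)%E by rewrite (@leb_itv R `[-1, 2[)/=; case: ifP => _; rewrite ?ltry// -EFinB ltry.
have [c_ [cc _ cg]] := @approximation_continuous_integrable R E g mE Eoo ige.
apply/ecvg0P => [n|e e0]; first by apply: int_ge0 => z _; rewrite lee_fin. have e3 : 0 < e / 3 by rewrite divr_gt0.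
have [k _ /(_ k (leqnn k)) hk] : \forall k \near \oo, (\int[leb]_(z in E) `|(g z - c_ k z)%:E| <= (e / 3)%:E)%E.
  by apply: (ecvg0P _).1 cg _ e3 => n; apply: int_ge0.
move: hk; set c := c_ k => hk; have {}cc : continuous c := cc k. have mc : mfun (c : mR R -> R) by exact: mcontinuous.
have [M cM] : exists M, forall z, -1 <= z <= 2 -> `|c z| <= M.
  have cn : {within `[-1, 2], continuous (fun z : R => `|c z|)}.
    by apply: cont_subT; apply: (cont_comp cc); exact: norm_continuous.
  have [x _ Hx] := @EVT_max R _ (-1) 2 (ltac:(lra)) cn. by exists `|c x| => z zI; apply: Hx; rewrite in_itv.
have m1 n : mfun (fun z : mR R => `|c (z + h n) - c z|). apply: mfun_norm; apply: mfunB => //. exact: (ms c).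
have I01 : measurable (`[0, 1[%classic : set (mR R)) by exact: mitv.
have I01oo : (@lebesgue_measure R `[0%R, 1%R[ < +oo)%E. by rewrite (@leb_itv R `[0, 1[)/= lte_fin ltr01 -EFinB ltry.
have hI n (z : R) : 0 <= z < 1 -> -1 <= z + h n <= 2.
  by have := h1 n; rewrite ler_norml => /andP[a1 a2] /andP[z0 z1]; apply/andP; split; lra.
have bM n (z : R) : `[0, 1[%classic z -> `| `|c (z + h n) - c z| | <= M + M.
  rewrite /= in_itv/= normr_id => zI; rewrite (le_trans (ler_normB _ _))// lerD// cM ?hI//.
  by move: zI => /andP[z0 z1]; apply/andP; split; lra.
have lim0 : \int[leb]_(z in `[0, 1[) `|c (z + h n) - c z| @[n --> \oo] --> (0 : R).
  rewrite [X in _ --> X](_ : _ = \int[leb]_(z in `[0, 1[) (0 : R)); last by rewrite /Rintegral integral0.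
  apply: (@Rintegral_cvg _ _ _ leb _ I01 I01oo _ _ (M + M)) => //.
  - by move=> n; exact: mfunTS.
  - move=> z _; apply/norm_cvg0P/subr_cvg0.
    have hz : z + h n @[n --> \oo] --> z by rewrite -[X in _ --> X]addr0; apply: cvgD => //; exact: cvg_cst.
    exact: (cvg_comp _ _ hz (cc z)). have /cvgr0Pnorm_le/(_ _ e3) := lim0; apply: filterS => n.
rewrite ger0_norm => [hn|]; last by rewrite /Rintegral fine_ge0// int_ge0.
have m2 : mfun (fun z : mR R => `|g z - c z|%:E) by apply: mn; exact: mfunB.
rewrite unif_co//; last exact: mn (mfunB (ms _ _ mg) mg).
have sub (a : R) : -1 <= a -> a <= 1 -> (\int[leb]_(z in `[a, (1 + a)%R[) `|g z - c z|%:E <= (e / 3)%:E)%E.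
  move=> a1 a2; apply: le_trans hk; apply: ge0_subset_integral => //.
  - exact: mfunTS m2.
  - move=> z /=; rewrite !in_itv/= => /andP[z1 z2]. rewrite /E /= in_itv/=.
    by rewrite (le_trans a1 z1)/= (lt_le_trans z2)// (_ : 2 = 1 + 1 :> R)// lerD2l.
have -> : e = e / 3 + (e / 3 + e / 3) by field.
rewrite !EFinD; apply: (int_leD I01 (mfunB (ms _ (h n) mg) (ms _ (h n) mc)) (mfunB (ms _ (h n) mc) mg)) => [z _||].
- by rewrite lee_fin ler_distD.
- rewrite (@ge0_int_shift _ (h n) 0 1 (fun z => `|g z - c z|%:E))// add0r.
  by have := h1 n; rewrite ler_norml => /andP[? ?]; exact: sub.
apply: (int_leD I01 (mfunB (ms _ (h n) mc) mc) (mfunB mg mc)) => [z _||].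
- by rewrite lee_fin [`|g z - _|]distrC ler_distD.
- move: hn; rewrite -lee_fin /Rintegral fineK//.
  apply: int_fin => //; apply: (bnd_int I01 I01oo (M := M + M)); [exact: mfunTS|exact: bM].
- by have := sub 0; rewrite addr0; apply; lra.
Qed.
End translation_continuity.

Section torus_translation_continuity.
Variables (R : realType) (d : nat).

Lemma mabsE dT (T : measurableType dT) (f : T -> R) :
  mfun f -> mfun (fun x => `|f x|%:E).
Proof.
by move=> mf; apply/mEFinP; exact: mfun_norm.
Qed.

Lemma measurable_shift (v : 'rV[R]_d) : mfun (fun x : 'rV[R]_d => x + v).
Proof.
apply: measurable_fun_rVP => i; rewrite (_ : (fun _ => _) = (fun x : 'rV[R]_d => x 0 i + v 0 i)).
  by apply: mfunD; [exact: mcoord|exact: mcst]. by apply/funext => x; rewrite mxE.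
Qed.

Lemma mfun_shift dT (T : measurableType dT) (f : 'rV[R]_d -> T) (v : 'rV[R]_d) : mfun f ->
  mfun (fun x : 'rV[R]_d => f (x + v)).
Proof. by move=> mf; exact: (mcomp mf (measurable_shift v)). Qed.

Lemma shift_ind (P : 'rV[R]_d -> Prop) : P 0 ->
  (forall i r v, P v -> P (v + r *: 'e_i)) -> forall v, P v.
Proof.
move=> P0 PS v; rewrite [v]row_sum_delta; elim: (index_enum _) => [|i r IH]. by rewrite big_nil.
by rewrite big_cons addrC; exact: PS.
Qed.

Lemma ge0_shift (f : 'rV[R]_d -> \bar R) (v : 'rV[R]_d) : mfun f ->
  (forall x, 0 <= f x)%E -> Zper f -> (\int[haar]_x f (x + v)%R = \int[haar]_x f x)%E.
Proof.
move=> mf f0 pf; elim/shift_ind: v => [|i r v IH]; first by under eq_integral do rewrite addr0.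
rewrite -IH -[RHS](@ge0_torus_shear _ _ i (cst r))//.
- by under [RHS]eq_integral do rewrite -addrA [_ *: _ + v]addrC.
- exact: mfun_shift.
- exact: Zper_shift.
Qed.

(** On almost every line in direction i this is the statement in one variable, and twice the
    integral of |f| over the line dominates. Dominated convergence speaks of sequences, so the
    uniform modulus is obtained by contradiction. *)
Lemma coord_translation (f : 'rV[R]_d -> R) (i : 'I_d) (e : R) : 0 < e ->
  mfun f -> Zper f -> (\int[haar]_x `|f x|%:E < +oo)%E ->
  exists2 dl : R, 0 < dl &
    forall h, `|h| <= dl -> (\int[haar]_x `|f (x + h *: 'e_i) - f x|%:E <= e%:E)%E.
Proof.
move=> e0 mf pf fi. have mD h : mfun (fun x : 'rV[R]_d => `|f (x + h *: 'e_i) - f x|%:E).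
  by apply: mabsE; apply: mfunB => //; exact: mfun_shift.
have mres (g : 'rV[R]_d -> \bar R) : mfun g -> (forall x, 0 <= g x)%E ->
    mfun (fun x : 'rV[R]_d => \int[unif]_z g (setc i z x))%E. move=> mg g0; apply: (@mfubiniF _ _ _ _ _ unif
    (fun w : 'rV[R]_d * mR R => g (setc i w.2 w.1))) => [|w]; last exact: g0. apply: (mcomp mg).
  by apply: mfun_set_coord; [exact: msnd|exact: mfst]. suff key (h : nat -> R) : (forall n, `|h n| <= n.+1%:R^-1) ->
    (\int[haar]_x `|f (x + h n *: 'e_i) - f x|%:E)%E @[n --> \oo] --> 0%E. apply: contrapT => N.
  have /choice[h Hh] : forall n : nat, exists h : R, `|h| <= n.+1%:R^-1 /\
      ~ (\int[haar]_x `|f (x + h *: 'e_i) - f x|%:E <= e%:E)%E.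
    move=> n; apply: contrapT => N'; apply: N; exists n.+1%:R^-1 => // h hn.
    by apply: contrapT => N2; apply: N'; exists h.
  have P0 n : (0 <= \int[haar]_x `|f (x + h n *: 'e_i)%R - f x|%:E)%E by apply: int_ge0.
  have [n _ /(_ n (leqnn n))] := (ecvg0P P0).1 (key h (fun n => (Hh n).1)) e e0. exact: (Hh n).2. move=> hn.
pose G n (x : 'rV[R]_d) := (\int[unif]_z `|f (setc i (z + h n) x) - f (setc i z x)|%:E)%E.
pose g (x : 'rV[R]_d) := (\int[unif]_z `|f (setc i z x)|%:E)%E. have mset x : mfun (fun z : mR R => f (setc i z x)).
  by apply: (mcomp mf); apply: mfun_set_coord.
have E n : (\int[haar]_x `|f (x + h n *: 'e_i) - f x|%:E = \int[haar]_x G n x)%E.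
  have nn x : (0 <= `|f (x + h n *: 'e_i)%R - f x|%:E)%E by rewrite lee_fin.
  etransitivity; first exact: (ge0_resample i (mD (h n)) nn).
  by apply: eq_integral => x _; apply: eq_integral => z _; rewrite set_coord_add. have mG n : mfun (G n).
  rewrite (_ : G n = fun x => (\int[unif]_z `|f (setc i z x + h n *: 'e_i) - f (setc i z x)|%:E)%E).
    exact: (mres (fun x => `|f (x + h n *: 'e_i) - f x|%:E) (mD (h n))).
  by apply/funext => x; apply: eq_integral => z _; rewrite set_coord_add. have mf' := mabsE mf.
have nf x : (0 <= `|f x|%:E)%E by rewrite lee_fin. have mg : mfun g := mres _ mf' nf.
have g0 x : (0 <= g x)%E by apply: int_ge0. have gi : haar.-integrable setT g.
  apply/integrableP; split=> //; under eq_integral do rewrite gee0_abs//. apply: le_lt_trans fi; apply/eqW/esym.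
  exact: (ge0_resample i mf' nf).
have pset x z : f (setc i (z + 1) x) = f (setc i z x) by exact: Zd_periodic_set_coord.
have h1 n : `|h n| <= 1 by rewrite (le_trans (hn n))// invf_le1// ler1n. have h0 : h n @[n --> \oo] --> (0 : R).
  apply/norm_cvg0P; apply: (@squeeze_cvgr _ _ _ _ (cst 0) (fun n => n.+1%:R^-1)).
  - by apply: nearW => n /=; rewrite normr_ge0 hn.
  - exact: cvg_cst.
  - exact: cvg_harmonic. have Gg n x : (`|G n x| <= g x + g x)%E. rewrite gee0_abs; last exact: int_ge0.
  have mh : mfun (fun z : mR R => `|f (setc i (z + h n) x)|%:E).
    by apply: mabsE; exact: (mcomp (mset x) (mfun_addr_m (h n))).
  have -> : (g x + g x = \int[unif]_z (`|f (setc i (z + h n) x)|%:E + `|f (setc i z x)|%:E))%E.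
    rewrite ge0_integralD//; last exact: mabsE. congr (_ + _)%E; rewrite -[LHS](@unif_integral_shift R (h n))//.
    - exact: mabsE.
    - by move=> z; rewrite pset. by apply: int_le => z _; rewrite -EFinD lee_fin ler_normB.
have cG : {ae haar, forall x, setT x -> G n x @[n --> \oo] --> 0%E}.
  have [N [mN N0 sN]] := integrable_ae measurableT gi.
  exists N; split=> // x /= nx; apply: sN => /= fx; apply: nx => _. apply: (unif_translation (mset x) (pset x)) => //.
  by have := fx I; rewrite ge0_fin_numE.
rewrite (_ : (fun n => _) = fun n => (\int[haar]_x G n x)%E); last by apply/funext.
have [_ _] := @dominated_convergence _ _ _ haar _ measurableT G (cst 0%E) (fun x => g x + g x)%E mG
  (mcst _) cG (integrableD measurableT gi gi) (aeW haar (fun x n _ => Gg n x)). by rewrite integral0.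
Qed.

Lemma torus_translation (f : 'rV[R]_d -> R) (e : R) : 0 < e ->
  mfun f -> Zper f -> (\int[haar]_x `|f x|%:E < +oo)%E ->
  exists2 dl : R, 0 < dl & forall w : 'rV[R]_d, (forall i, `|w 0 i| <= dl) ->
    (\int[haar]_x `|f (x + w) - f x|%:E <= e%:E)%E.
Proof.
move=> e0 mf pf fi; pose e' := e / d.+1%:R. have e'0 : 0 < e' by rewrite divr_gt0.
pose dl i := s2val (cid2 (coord_translation i e'0 mf pf fi)).
have dl0 i : 0 < dl i := s2valP (cid2 (coord_translation i e'0 mf pf fi)).
have Hdl i := s2valP' (cid2 (coord_translation i e'0 mf pf fi)).
exists (\big[Num.min/1]_i dl i); first by apply: lt_bigmin.
move=> w Hw; have {}Hw i : `|w 0 i| <= dl i by rewrite (le_trans (Hw i))// bigmin_le.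
have key (r : seq 'I_d) : (\int[haar]_x `|f (x + \sum_(i <- r) w 0 i *: 'e_i)%R - f x|%:E <= ((size r)%:R * e')%:E)%E.
  elim: r => [|i r IH]. by rewrite integral0_eq ?mul0r// => x _; rewrite big_nil addr0 subrr normr0.
  set v := \sum_(i <- r) _ in IH.
  have ms u : mfun (fun x : 'rV[R]_d => f (x + u) - f x) by apply: mfunB => //; exact: mfun_shift.
  rewrite /= -natr1 mulrDl mul1r addrC EFinD.
  apply: (int_leD measurableT (mfun_shift v (ms (w 0 i *: 'e_i))) (ms v)) => // [x _|].
    by rewrite lee_fin big_cons -/v [_ *: _ + v]addrC addrA ler_distD.
  rewrite (@ge0_shift (fun x => `|f (x + w 0 i *: 'e_i) - f x|%:E) v)//; first exact: Hdl.
  - exact: mabsE.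
  - by move=> x k; rewrite addrAC !pf. have := key (index_enum 'I_d); rewrite -row_sum_delta => /le_trans; apply.
have -> : size (index_enum 'I_d) = d by rewrite -sum1_size sum1_card card_ord.
by rewrite lee_fin /e' mulrCA ger_pMr// ler_pdivrMr// mul1r ler_nat.
Qed.
End torus_translation_continuity.

Section abs_integral.
Context d (T : measurableType d) (R : realType) (mu : {measure set T -> \bar R}).

Lemma mul_bounded_L1 (f g : T -> R) (C M : R) : (\int[mu]_x `|f x|%:E <= C%:E)%E -> 0 <= M ->
  (forall x, `|g x| <= M) -> (\int[mu]_x `|f x * g x|%:E <= (C * M)%:E)%E.
Proof.
move=> fC M0 gM; apply: (@le_trans _ _ (M%:E * \int[mu]_x `|f x|%:E)%E); last by rewrite mulrC EFinM lee_wpmul2l.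
by apply: int_le_scale => // x _; rewrite -EFinM lee_fin normrM mulrC ler_wpM2r.
Qed.

Lemma mulb_int (f g : T -> R) (C M : R) : mfun f -> mfun g ->
  (\int[mu]_x `|f x|%:E <= C%:E)%E -> 0 <= M -> (forall x, `|g x| <= M) ->
  mu.-integrable setT (EFin \o (fun x => f x * g x)) /\ `|\int[mu]_x (f x * g x)| <= C * M.
Proof.
by move=> mf mg fC M0 gM; apply: normr_Rint_le; [|exact: mfunM|exact: mul_bounded_L1].
Qed.
End abs_integral.

(** * Mollification *)

Section smear.
Variables (R : realType) (d : nat).
Implicit Types (f k : 'rV[R]_d -> R) (x y z v w : 'rV[R]_d).

Lemma torus_shift f v : mfun f -> Zper f ->
  \int[haar]_x f (x + v) = \int[haar]_x f x.
Proof.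
move=> mf pf; elim/shift_ind: v => [|i r v IH]; first by under eqRint do rewrite addr0.
rewrite -IH -[RHS](torus_translate i r (mfun_shift v mf) (Zper_shift v pf)).
by under [RHS]eqRint do rewrite -addrA [_ *: _ + v]addrC.
Qed.

Lemma sm_shift k v : smooth k -> smooth (fun x => k (x + v)).
Proof.
apply: (@smooth_precomp _ _ _ (fun x => x + v) id) => [h u w|]; first by rewrite addrA.
by move=> x; apply: continuousD; [exact: cvg_id|exact: cst_continuous].
Qed.

Lemma derive_shift k v u x : 'D_u (fun x => k (x + v)) x = 'D_u k (x + v).
Proof. by apply: (@derive_precomp _ _ _ (fun x => x + v) id) => h w w'; rewrite addrA. Qed.

Lemma sm_bounded k : smooth k -> Zper k ->
  exists2 M : R, 0 <= M & forall x, `|k x| <= M.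
Proof. by move=> sk pk; exact: Zper_bounded (sm_cont sk) pk. Qed.

Lemma torus_lip k : smooth k -> Zper k ->
  exists2 L : R, 0 <= L & forall x w a, 0 <= a -> (forall i, `|w 0 i| <= a) -> `|k (x + w) - k x| <= L * a.
Proof.
move=> sk pk. pose M i := s2val (cid2 (sm_bounded (sm_D ('e_i) sk) (periodic_D ('e_i) pk))).
have M0 i : 0 <= M i by rewrite /M; case: cid2.
have HM i x : `|'D_('e_i) k x| <= M i by rewrite /M; case: cid2 => ? ? H; exact: H.
exists (\sum_i M i) => [|x w a a0 wa]; first by apply: sumr_ge0.
have key (r : seq 'I_d) : `|k (x + \sum_(i <- r) w 0 i *: 'e_i) - k x| <= (\sum_(i <- r) M i) * a.
  elim: r => [|i r IH]; first by rewrite !big_nil addr0 subrr normr0 mul0r.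
  rewrite !big_cons; set v := \sum_(_ <- _) _ in IH *. have [c _ cE] := sm_MVT sk (x + v) ('e_i) (w 0 i).
  have -> : k (x + (w 0 i *: 'e_i + v)) - k x = (k (x + v + w 0 i *: 'e_i) - k (x + v)) + (k (x + v) - k x).
    by rewrite [_ + v]addrC addrA addrA subrK. rewrite (le_trans (ler_normD _ _))// mulrDl lerD// cE normrM mulrC.
  by apply: ler_pM. by have := key (index_enum 'I_d); rewrite -row_sum_delta.
Qed.

(** Convolution of [f] with the reflection of [k], equal to the mean of f(x + z) with weight k(z).
    With this sign the translated kernel is itself a test function of y, so weak derivatives pass
    through directly. *)
Definition smear k f x : R := \int[haar]_y (f y * k (y - x)).

Section smear_sm.
Variables (f : 'rV[R]_d -> R) (C : R).
Hypotheses (mf : mfun f) (fC : (\int[haar]_x `|f x|%:E <= C%:E)%E).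

Let C0 : 0 <= C.
Proof. by rewrite -lee_fin (le_trans _ fC)// int_ge0. Qed.

Let mk k x : smooth k -> mfun (fun y => k (y - x)).
Proof. by move=> sk; apply: mfun_shift; exact: (sm_mfun sk). Qed.

Lemma smear_int k x : smooth k -> Zper k ->
  hL1 (fun y => f y * k (y - x)).
Proof.
move=> sk pk; have [M M0 HM] := sm_bounded sk pk. exact: (mulb_int mf (mk x sk) fC M0 (fun y => HM (y - x))).1.
Qed.

Lemma is_derive_smear k x v : smooth k -> Zper k ->
  is_derive x v (smear k f) (- smear ('D_v k) f x).
Proof.
move=> sk pk; have sD := sm_D v sk. have [M M0 HM] := sm_bounded (sm_D v sD) (periodic_D v (periodic_D v pk)).
have q (h : R) : h != 0 -> `|h^-1 *: (smear k f (h *: v + x) - smear k f x) + smear ('D_v k) f x| <= C * M * `|h|.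
  move=> h0; have i1 := smear_int (h *: v + x) sk pk; have i2 := smear_int x sk pk.
  have i3 := smear_int x sD (periodic_D v pk). pose g y := h^-1 * (k (y - (h *: v + x)) - k (y - x)) + 'D_v k (y - x).
  have mg : mfun g. apply: mfunD; last exact: (mk x sD). by apply: mfunM; [exact: mcst|apply: mfunB; exact: mk].
  have gM y : `|g y| <= M * `|h|. have [c hc cE] := sm_MVT sk (y - x) v (- h).
    have [c' _ cE'] := sm_MVT sD (y - x) v c.
    rewrite /g (_ : y - (h *: v + x) = y - x + - h *: v); last by rewrite opprD addrA addrAC scaleNr.
    rewrite cE mulrA mulrN mulVf// mulN1r addrC -normrN opprB cE' normrM mulrC ler_pM//. by rewrite normrN in hc.
  have -> : h^-1 *: (smear k f (h *: v + x) - smear k f x) + smear ('D_v k) f x = \int[haar]_y (f y * g y).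
    have i12 : hL1 (fun y => f y * k (y - (h *: v + x)) - f y * k (y - x)) := integrableB measurableT i1 i2.
    have i13 : hL1 (fun y => h^-1 * (f y * k (y - (h *: v + x)) - f y * k (y - x))) := intZl measurableT h^-1 i12.
    rewrite /smear -RintB// -[h^-1 *: _]/(h^-1 * _) -RintZl// -RintD//. by apply: eqRint => y _; rewrite /g; ring.
  by rewrite -mulrA; apply: (mulb_int mf mg fC _ gM).2; rewrite mulr_ge0.
have lim : h^-1 *: ((smear k f \o shift x) (h *: v) - smear k f x) @[h --> 0^'] --> - smear ('D_v k) f x.
  apply/cvgrPdist_le => e e0; have M1 : 0 < C * M + 1 by rewrite ltr_wpDl// mulr_ge0.
  near=> h; have h0 : h != 0 by near: h; exact: nbhs_dnbhs_neq. rewrite distrC opprK (le_trans (q h h0))//.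
  apply: (@le_trans _ _ ((C * M + 1) * `|h|)); first by rewrite ler_wpM2r// lerDl.
  by rewrite mulrC -ler_pdivlMr//; near: h; apply: dnbhs0_le; rewrite divr_gt0.
apply: DeriveDef; first by apply/cvg_ex; exists (- smear ('D_v k) f x). exact: cvg_lim lim.
Unshelve. all: by end_near. Qed.

Lemma derive_smear k x v : smooth k -> Zper k ->
  'D_v (smear k f) x = smear (fun y => - 'D_v k y) f x.
Proof.
move=> sk pk; rewrite (derive_eq (is_derive_smear x v sk pk)) /smear.
rewrite -mulN1r -RintZl//; last exact: smear_int (sm_D v sk) (periodic_D v pk). by apply: eqRint => y _; ring.
Qed.

Lemma smear_continuous k : smooth k -> Zper k -> continuous (smear k f).
Proof.
move=> sk pk x; have [L L0 HL] := torus_lip sk pk.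
apply: (proj2 (@cvgrPdist_le _ _ _ (nbhs x) (nbhs_filter x) (smear k f) (smear k f x))) => e e0; have CL : 0 < C * L + 1 by rewrite ltr_wpDl// mulr_ge0.
have e1 : 0 < e / (C * L + 1) by rewrite divr_gt0.
near=> x'; have hx : `|x - x'| <= e / (C * L + 1) by near: x'; exact: cvgr_dist_le.
rewrite /smear -RintB//; try exact: smear_int.
have -> : \int[haar]_y (f y * k (y - x) - f y * k (y - x')) = \int[haar]_y (f y * (k (y - x) - k (y - x'))).
  by apply: eqRint => y _; ring. apply: (@le_trans _ _ (C * (L * (e / (C * L + 1))))).
  have M1 : 0 <= L * (e / (C * L + 1)) by rewrite mulr_ge0// ltW.
  apply: (mulb_int mf _ fC M1 _).2; first by apply: mfunB; exact: mk.
  move=> y; have -> : y - x = (y - x') + (x' - x) by rewrite addrA subrK. apply: HL => [|i]; first exact: ltW.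
  by rewrite (le_trans (rV_coord_le _ _))// distrC. rewrite mulrA mulrCA ger_pMr// ler_pdivrMr// mul1r lerDl//.
Unshelve. all: by end_near. Qed.

Lemma smear_sm k : smooth k -> Zper k -> smooth (smear k f).
Proof.
move=> sk pk n; elim: n k sk pk => [|n IH] k sk pk; first by split=> //; exact: smear_continuous.
split; first exact: smear_continuous. move=> v; have sD := sm_D v sk; have pD := periodic_D v pk.
split; first by move=> x; exact: (derive_ex (is_derive_smear x v sk pk)).
rewrite (_ : 'D_v _ = smear (fun y => -1 * 'D_v k y) f); last first.
  by apply/funext => x; rewrite derive_smear//; apply: eqRint => y _; rewrite mulN1r.
apply: IH; first by apply: sm_mul => //; exact: sm_cst. by move=> x z; rewrite pD.
Qed.
End smear_sm.

Lemma smear_periodic f k : Zper k -> Zper (smear k f).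
Proof.
move=> pk x z; apply: eqRint => y _; congr (_ * _).
rewrite opprD addrA -[in LHS](_ : map_mx intr (- z) = - map_mx intr z)//. by apply/rowP => i; rewrite !mxE mulrNz.
Qed.

Lemma weak_partial_smear i f g k x : smooth k -> Zper k -> weak_partial i f g ->
  mfun f -> (exists C : R, (\int[haar]_x `|f x|%:E <= C%:E)%E) ->
  'D_('e_i) (smear k f) x = smear k g x.
Proof.
move=> sk pk fg mf [C fC]; rewrite (derive_eq (is_derive_smear mf fC x ('e_i) sk pk)).
have := fg _ (sm_shift (- x) sk) (Zper_shift (- x) pk). under eqRint do rewrite derive_shift.
by rewrite /smear => ->; rewrite opprK.
Qed.

Lemma smearE f k x : mfun f -> Zper f -> smooth k -> Zper k ->
  smear k f x = \int[haar]_z (f (x + z) * k z).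
Proof.
move=> mf pf sk pk; rewrite /smear -(torus_shift x).
- by apply: eqRint => z _; rewrite addrK [z + x]addrC.
- by apply: mfunM => //; apply: mfun_shift; exact: (sm_mfun sk).
- by move=> y z; rewrite pf addrAC pk.
Qed.

Lemma mfun_rV_add : mfun (fun w : 'rV[R]_d * 'rV[R]_d => w.1 + w.2).
Proof.
apply: measurable_fun_rVP => i.
rewrite (_ : (fun _ => _) = fun w : 'rV[R]_d * 'rV[R]_d => w.1 0 i + w.2 0 i); last by apply/funext => w; rewrite mxE.
by apply: mfunD; apply: (mcomp (@mcoord R d i)).
Qed.

(* The bound is needed only where the weight [k] does not vanish. *)
Lemma weighted_Tonelli_le (F : 'rV[R]_d -> 'rV[R]_d -> R) k (e c : R) :
  mfun (fun w : 'rV[R]_d * 'rV[R]_d => F w.1 w.2) -> mfun k ->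
  (forall z, k z != 0 -> (\int[haar]_x `|F x z|%:E <= e%:E)%E) -> 0 <= e ->
  (\int[haar]_z `|k z|%:E <= c%:E)%E ->
  (\int[haar]_x \int[haar]_z (`|F x z| * `|k z|)%:E <= (e * c)%:E)%E.
Proof.
move=> mF mk Fe e0 kc. have mm : mfun (fun w : 'rV[R]_d * 'rV[R]_d => (`|F w.1 w.2| * `|k w.2|)%:E).
  apply/mEFinP; apply: mfunM; apply: mfun_norm => //. exact: (mcomp mk).
rewrite (@fubini_tonelli _ _ _ _ _ haar haar (fun w : 'rV[R]_d * 'rV[R]_d => (`|F w.1 w.2| * `|k w.2|)%:E))//.
apply: (@le_trans _ _ (\int[haar]_z (e%:E * `|k z|%:E))%E). apply: int_le => z _; have [k0|k0] := eqVneq (k z) 0.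
    by rewrite integral0_eq => [|x _]; rewrite k0 normr0 ?mulr0// mule0. under eq_integral do rewrite EFinM.
  rewrite /= ge0_integralZr//; first by rewrite lee_wpmul2r// Fe.
  by apply: mabsE; exact: (mcomp mF (measurable_pair2 z)). rewrite int_scale//.
by rewrite EFinM lee_wpmul2l// lee_fin.
Qed.

Lemma mollifier_Rint k a C : mollifier k a C -> \int[haar]_z k z = 1.
Proof. by move=> mol; rewrite /Rintegral (mol_int mol). Qed.

Lemma near_lattice_shift f a z : Zper f -> near_lattice a z ->
  exists2 w : 'rV[R]_d, (forall i, `|w 0 i| <= a) & forall x, f (x + z) = f (x + w).
Proof.
move=> pf [k kz]; exists (z - map_mx intr k) => [i|x]; first by rewrite !mxE; exact: kz.
by rewrite -[in LHS](subrK (map_mx intr k) z) addrA pf.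
Qed.

(** The error is a weighted mean of translation errors; modulo the lattice only translations of size
    at most [a] have nonzero weight, and there L^1 continuity of translations is available. *)
Lemma smear_approx f (e : R) : 0 < e -> mfun f -> Zper f ->
  (\int[haar]_x `|f x|%:E < +oo)%E -> exists2 dl : R, 0 < dl & forall k a C, a <= dl -> mollifier k a C ->
    (\int[haar]_x `|smear k f x - f x|%:E <= e%:E)%E.
Proof.
move=> e0 mf pf fi; have [dl dl0 Hdl] := torus_translation e0 mf pf fi. exists dl => // k a C adl mol.
have [[sk pk] k0] := (mol_smooth mol, mol_periodic mol, mol_ge0 mol). have mk := sm_mfun sk.
have [B fB] : exists B : R, (\int[haar]_x `|f x|%:E <= B%:E)%E.
  exists (fine (\int[haar]_x `|f x|%:E)); rewrite fineK// ge0_fin_numE//; exact: int_ge0. have ik : hL1 (k).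
  by have [M _ HM] := sm_bounded sk pk; exact: (haar_bnd mk (fun x _ => HM x)).
have mF : mfun (fun w : 'rV[R]_d * 'rV[R]_d => f (w.1 + w.2) - f w.1).
  by apply: mfunB; [exact: (mcomp mf mfun_rV_add)|exact: (mcomp mf)].
apply: (@le_trans _ _ (\int[haar]_x \int[haar]_z (`|f (x + z) - f x| * `|k z|)%:E)%E); last first.
  have := @weighted_Tonelli_le (fun x z => f (x + z) - f x) k e 1 mF mk; rewrite mulr1; apply.
  - move=> z /(mol_supp mol)/(near_lattice_shift pf)[w wa E]; under eq_integral do rewrite E.
    by apply: Hdl => i; rewrite (le_trans (wa i)).
  - exact: ltW.
  - by under eq_integral do rewrite ger0_norm//; rewrite (mol_int mol). apply: int_le => x _.
have mfx : mfun (fun z => f (x + z)).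
  by rewrite (_ : (fun z => _) = fun z => f (z + x)); [exact: mfun_shift|apply/funext => z; rewrite addrC].
have -> : smear k f x - f x = \int[haar]_z ((f (x + z) - f x) * k z). under eqRint do rewrite mulrBl. rewrite RintB//.
  + by rewrite -smearE// RintZl// (mollifier_Rint mol) mulr1.
  + have [M M0 HM] := sm_bounded sk pk. apply: (mulb_int mfx mk _ M0 HM (C := B)).1.
    under eq_integral do rewrite addrC. rewrite (@ge0_shift _ _ (fun z => `|f z|%:E) x)//; first exact: mabsE.
    by move=> y z; rewrite pf.
  + exact: (intZl measurableT (f x) ik).
by apply: (le_trans (Rint_abs_le _ _ _)); under eq_integral do rewrite normrM.
Qed.
End smear.

Section Lnorm_tools.
Context dT (T : measurableType dT) (R : realType) (mu : {measure set T -> \bar R}).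

Lemma powR_integral_le (p X : R) (f : T -> R) : 0 < p ->
  ('N[mu]_p%:E[EFin \o f] <= X%:E)%E -> (\int[mu]_x (`|f x| `^ p)%:E <= (X `^ p)%:E)%E.
Proof.
move=> p0; rewrite Lnorm_EFinE => h.
have I0 : (0 <= \int[mu]_x (`|f x| `^ p)%:E)%E by apply: int_ge0 => x _; rewrite lee_fin powR_ge0.
rewrite -[leLHS](poweRe1 I0) -(mulVf (lt0r_neq0 p0)) poweRrM -poweR_EFin.
apply: gt0_ler_poweR; rewrite ?(ltW p0)// ?in_itv/= ?leey ?poweR_ge0//. by rewrite (le_trans _ h)// poweR_ge0.
Qed.
End Lnorm_tools.

(** * Increments of Sobolev functions *)

Section torus_differences.
Variables (R : realType) (d : nat) (p q : R).
Hypotheses (p1 : 1 < p) (q1 : 1 < q) (pq : p^-1 + q^-1 = 1).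
Implicit Types (f k u g rho : 'rV[R]_d -> R) (x y z v w : 'rV[R]_d).
Let p0 : 0 < p := lt_trans ltr01 p1.
Let q0 : 0 < q := lt_trans ltr01 q1.

Lemma Lnorm_shift (r : R) f v : mfun f -> Zper f ->
  hnorm r ((fun x => f (x + v)%R))%E = hnorm r f%E.
Proof.
move=> mf pf; rewrite !Lnorm_EFinE; congr (_ `^ _)%E. apply: (@ge0_shift _ _ (fun x => (`|f x| `^ r)%:E)).
- exact: mfun_powR_EFin.
- by [].
- by move=> x k; rewrite pf.
Qed.

Lemma mollifier_near (dl : R) : 0 < dl -> (0 < d)%N -> exists k a, [/\ 0 < a, a <= dl & mollifier k a (molC R)].
Proof.
move=> dl0 d0; have pi0 := pi_gt0 R; pose c : R := 1 + pi ^+ 2. have c0 : 0 < c by rewrite ltr_pwDl// sqr_ge0.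
set N := (Num.truncn (c / dl)).+1; have [k mol] := mollifier_kernel R d (isT : (0 < N)%N).
exists k, (krad R N); split=> //; first by rewrite divr_gt0// ltr0n.
rewrite /krad ler_pdivrMr// -ler_pdivrMl// mulrC ltW//. by rewrite truncnS_gt.
Qed.

Hypothesis d0 : (0 < d)%N.

Section one_direction.
Variables (i : 'I_d) (u g : 'rV[R]_d -> R) (Y Z : R).
Hypotheses (mu : mfun u) (pu : Zper u) (uY : (hnorm q u <= Y%:E)%E).
Hypotheses (mg : mfun g) (pg : Zper g) (gZ : (hnorm q g <= Z%:E)%E).
Hypothesis ug : weak_partial i u g.

Let mnorm f := @mabsE R _ _ f.

Let qp : q^-1 + p^-1 = 1. Proof. by rewrite addrC. Qed.

Let weighted_shift_le rho f (M B : R) v : mfun rho -> (forall x, `|rho x| <= M) ->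
  mfun f -> Zper f -> (\int[haar]_x `|f x|%:E <= B%:E)%E ->
  (\int[haar]_x `|rho x * f (x + v)|%:E <= (M * B)%:E)%E.
Proof.
move=> mr rM mf pf fB; have M0 : 0 <= M by exact: le_trans (rM 0).
apply: (@le_trans _ _ (\int[haar]_x (M%:E * `|f (x + v)%R|%:E))%E).
  by apply: int_le => x _; rewrite -EFinM lee_fin normrM ler_wpM2r.
rewrite int_scale// (@ge0_shift _ _ (fun x => `|f x|%:E) v)//.
- by rewrite EFinM lee_wpmul2l.
- exact: mnorm.
- by move=> x k; rewrite pf.
Qed.

(** For the mollification of [u] the increment is an integral of its derivative along the segment,
    and that derivative is the mollification of [g]. A bounded weight turns the L^1 errors of
    mollifying [u] and [g] into small terms. *)
Let bounded_difference_le rho (M X h : R) : mfun rho -> (forall x, `|rho x| <= M) ->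
  (hnorm p rho <= X%:E)%E ->
  (\int[haar]_x (`|rho x| * `|u (x + h *: 'e_i) - u x|)%:E <= (`|h| * (X * Z))%:E)%E.
Proof.
move=> mr rM rX; have M0 : 0 <= M by exact: le_trans (rM 0).
(* The errors add up to M(2 + |h|)e': one at each end of the increment, and |h| times one for the
   gradient along the segment. *)
apply/lee_addgt0Pr => e e0; pose e' := e / (M * (2 + `|h|) + 1).
have D0 : 0 < M * (2 + `|h|) + 1 by rewrite ltr_wpDl// mulr_ge0// addr_ge0. have e'0 : 0 < e' by rewrite divr_gt0.
have uL := L1_le_Lp q1 p1 qp mu uY; have gL := L1_le_Lp q1 p1 qp mg gZ.
have [d1 d10 H1] := smear_approx e'0 mu pu (le_lt_trans uL (ltry _)).
have [d2 d20 H2] := smear_approx e'0 mg pg (le_lt_trans gL (ltry _)).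
have d12 : 0 < Num.min d1 d2 by rewrite lt_min d10.
have [k [a [a0 + mol]]] := mollifier_near d12 d0; rewrite le_min => /andP[a1 a2].
have {H1}H1 := H1 _ _ _ a1 mol; have {H2}H2 := H2 _ _ _ a2 mol.
have sk := mol_smooth mol; have pk := mol_periodic mol. pose U := smear k u; pose G := smear k g.
have sU : smooth U := smear_sm mu uL sk pk. have mU := sm_mfun sU. have sG : smooth G := smear_sm mg gL sk pk.
have cG := sm_cont sG; have mG := cont_meas cG. have pU : Zper U := smear_periodic u pk.
have pG : Zper G := smear_periodic g pk. have DU x : 'D_('e_i) U x = G x by apply: weak_partial_smear => //; exists Y.
have mUu : mfun (fun x => U x - u x) by exact: mfunB. have mGg : mfun (fun x => G x - g x) by exact: mfunB.
pose v := h *: ('e_i : 'rV[R]_d). have mshear : mfun (fun w : 'rV[R]_d * mR R => w.1 + (w.2 * h) *: 'e_i).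
  have := @mfun_shear2 R d i (fun w : ST R d => w.1 * h).
  move=> H; apply: (mcomp (H _) (@measurable_swap _ _ 'rV[R]_d (mR R))). by apply: mfunM; [exact: mfst|exact: mcst].
pose H (w : 'rV[R]_d * mR R) := `|rho w.1 * G (w.1 + (w.2 * h) *: 'e_i)|%:E. have mH : mfun H.
  by apply: mabsE; apply: mfunM; [exact: (mcomp mr)|exact: (mcomp mG mshear)].
have H0 (b : 'rV[R]_d * mR R) : (0 <= H b)%E by rewrite lee_fin.
have FTC x : (`|U (x + v) - U x|%:E <= `|h|%:E * \int[unif]_s `|G (x + (s * h) *: 'e_i)|%:E)%E.
  have E := @line_FTC _ _ U x v 0 1 sU ler01; rewrite scale1r scale0r addr0 in E.
  have mGx : mfun (fun s : mR R => G (x + (s * h) *: 'e_i)). exact: (mcomp mG (mcomp mshear (mpair1 x))).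
  rewrite unifE => [||s]; [|exact: mabsE|by rewrite lee_fin]. rewrite -int_scale//.
  have DE (s : R) : 'D_v U (x + s *: v) = h * G (x + (s * h) *: 'e_i).
    rewrite /v -[h *: _]add0r derive_dirDZ// DU add0r scalerA.
    by rewrite (_ : 'D_0 U _ = 0) ?add0r//; rewrite /derive; under eq_fun do rewrite scaler0 /= add0r subrr scaler0; exact: lim_cst.
  rewrite -E; under eqRint do rewrite DE.
  by apply: le_trans (Rint_abs_le _ _ _) _; under eq_integral do rewrite normrM EFinM.
have bU w : (\int[haar]_x `|rho x * (U (x + w) - u (x + w))|%:E <= (M * e')%:E)%E.
  by apply: (@weighted_shift_le rho (fun x => U x - u x)) => // x z; rewrite pU pu.
have b3 s : (\int[haar]_x `|rho x * G (x + s *: 'e_i)|%:E <= (M * e' + X * Z)%:E)%E. rewrite EFinD.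
  apply: (int_leD measurableT (mfunM mr (mfun_shift (s *: 'e_i) mGg)) (mfunM mr (mfun_shift (s *: 'e_i) mg))) => [x _||].
  - by rewrite lee_fin (le_trans _ (ler_normD _ _))// -mulrDr subrK.
  - by apply: (@weighted_shift_le rho (fun x => G x - g x)) => // x z; rewrite pG pg.
  - by apply: (hoelder_le p1 q1 pq mr (mfun_shift _ mg) rX); rewrite Lnorm_shift.
have b4 : (\int[haar]_x `|rho x * (U (x + v) - U x)|%:E <= `|h|%:E * (M * e' + X * Z)%:E)%E.
  apply: (@le_trans _ _ (`|h|%:E * \int[haar]_x \int[unif]_s H (x, s))%E).
    apply: int_le_scale => // x _; under eq_integral do rewrite /H /= normrM EFinM.
    by rewrite int_scale// muleCA normrM EFinM lee_wpmul2l ?lee_fin.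
  rewrite lee_wpmul2l ?lee_fin// (@fubini_tonelli _ _ _ _ _ haar unif H mH H0).
  by apply: (@prob_int_le _ _ _ unif) => s; exact: (b3 (s * h)).
apply: (@le_trans _ _ ((M * e')%:E + (`|h|%:E * (M * e' + X * Z)%:E + (M * e')%:E))%E).
  apply: (int_leD measurableT (mfunM mr (mfun_shift v mUu)) (mfunM mr (mfunB (mfun_shift v mU) mu))) => [x _||].
  - by rewrite lee_fin !normrM -mulrDr ler_wpM2l// [`|U _ - u (x + v)|]distrC ler_distD.
  - exact: bU. apply: (int_leD measurableT (mfunM mr (mfunB (mfun_shift v mU) mU)) (mfunM mr mUu)) => [x _|//|].
  - by rewrite lee_fin !normrM -mulrDr ler_wpM2l// ler_distD.
  - by apply: le_trans (bU 0); under [leRHS]eq_integral do rewrite addr0. rewrite -EFinM -!EFinD lee_fin.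
have -> : M * e' + (`|h| * (M * e' + X * Z) + M * e') = `|h| * (X * Z) + (M * (2 + `|h|)) * e' by ring.
rewrite lerD2l /e' mulrCA ger_pMr// ler_pdivrMr// mul1r lerDl//.
Qed.

(** The bound does not involve the supremum of the weight, so |rho| is truncated at n and the
    truncation is removed by Fatou's lemma. *)
Lemma difference_le rho (X h : R) : mfun rho -> (hnorm p rho <= X%:E)%E ->
  (\int[haar]_x (`|rho x| * `|u (x + h *: 'e_i) - u x|)%:E <= (`|h| * (X * Z))%:E)%E.
Proof.
move=> mr rX; pose cut (n : nat) x : R := Num.min `|rho x| n%:R. have mcut n : mfun (cut n).
  by apply: measurable_minr; [exact: mfun_norm|exact: mcst].
have cut0 n x : 0 <= cut n x by rewrite le_min normr_ge0/=.
apply: (@fatou_bound _ _ _ haar setT measurableT (fun n x => (`|cut n x| * `|u (x + h *: 'e_i) - u x|)%:E)).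
- move=> n; apply/mEFinP; apply: mfunM; apply: mfun_norm => //. by apply: mfunB => //; exact: mfun_shift.
- by move=> n x _; rewrite lee_fin mulr_ge0.
- move=> x _; apply: cvg_near_cst; exists (Num.truncn `|rho x|).+1 => // n /= hn.
  rewrite (ger0_norm (cut0 _ _)) /cut min_l// ltW// (lt_le_trans (truncnS_gt _))// ler_nat//.
- move=> n; apply: (bounded_difference_le h (mcut n) (M := n%:R)).
  + by move=> x; rewrite ger0_norm// ge_min lexx orbT.
  + apply: le_trans rX; apply: Lnorm_le_abs => // x. by rewrite ger0_norm// ge_min lexx.
Qed.
End one_direction.
End torus_differences.

(** * Density of smooth functions in L^p *)

Section smooth_density.
Variables (R : realType) (d : nat) (p : R).
Hypotheses (p1 : 1 < p) (d0 : (0 < d)%N).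
Implicit Types (f k eta rho : 'rV[R]_d -> R).
Let p0 : 0 < p := lt_trans ltr01 p1.

Lemma powR_le_scale (z M : R) : `|z| <= M -> `|z| `^ p <= M `^ (p - 1) * `|z|.
Proof.
move=> zM; have [->|z0] := eqVneq `|z| 0; first by rewrite powR0 ?mulr0 ?gt_eqF.
have zp : 0 < `|z| by rewrite lt_neqAle eq_sym z0/=.
rewrite -{2}(powRr1 (ltW zp)) (_ : `|z| `^ p = `|z| `^ (p - 1) * `|z| `^ 1).
  rewrite ler_wpM2r ?powR_ge0//; apply: ge0_ler_powR; rewrite ?subr_ge0 ?nnegrE ?(ltW p1)//. exact: le_trans zM.
by rewrite -powRD ?subrK// (gt_eqF zp) implybT.
Qed.

Lemma Lnorm_cvg0 (r X : R) (h : nat -> 'rV[R]_d -> R) f : 0 < r -> (forall n, mfun (h n)) -> mfun f ->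
  (hnorm r f <= X%:E)%E -> (forall n x, `|h n x| <= `|f x|) ->
  (forall x, \forall n \near \oo, h n x = 0) ->
  forall e : R, 0 < e -> \forall n \near \oo, (hnorm r (h n) <= e%:E)%E.
Proof.
move=> r0 mh mf fX hf h0 e e0; have mp g := @mfun_powR_EFin _ _ _ g r.
have cv : (\int[haar]_x (`|h n x| `^ r)%:E @[n --> \oo] --> 0)%E.
  rewrite -[X in _ --> X](@integral0 _ _ _ (torus_measure R d) setT).
  apply: (@dominated_cvg _ _ _ haar setT measurableT (fun n x => (`|h n x| `^ r)%:E) (cst 0%E) (fun x => (`|f x| `^ r)%:E)) => //.
  - by move=> n; exact: mp.
  - by move=> x _; apply: cvg_near_cst; apply: filterS (h0 x) => n ->; rewrite normr0 powR0 ?gt_eqF.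
  - apply/integrableP; split; first exact: mp. under eq_integral do rewrite gee0_abs ?lee_fin ?powR_ge0//.
    by rewrite (le_lt_trans (powR_integral_le r0 fX))// ltry.
  - by move=> n x _; rewrite gee0_abs ?lee_fin ?powR_ge0// ge0_ler_powR ?nnegrE// ltW.
have F0 n : (0 <= \int[haar]_x (`|h n x| `^ r)%:E)%E by apply: int_ge0 => x _; rewrite lee_fin powR_ge0.
have er : 0 < e `^ r by rewrite powR_gt0.
by apply: filterS ((ecvg0P F0).1 cv _ er) => n; apply: Lnorm_powR => //; exact: ltW.
Qed.

Definition clip (M z : R) : R := Num.max (- M) (Num.min z M).

Lemma clip_bound (M z : R) : 0 <= M -> `|clip M z| <= M.
Proof.
move=> M0; rewrite ler_norml /clip le_max lexx/= ge_max ge_min lexx orbT andbT. by rewrite (le_trans _ M0)// oppr_le0.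
Qed.

Lemma clip_id (M z : R) : `|z| <= M -> clip M z = z.
Proof. by rewrite ler_norml => /andP[h1 h2]; rewrite /clip min_l// max_r. Qed.

Lemma clip_diff (M z : R) : 0 <= M -> `|z - clip M z| <= `|z|.
Proof.
move=> M0; have [zM|zM] := leP `|z| M; first by rewrite clip_id// subrr normr0.
have [z0|z0] := leP 0 z; rewrite /clip. rewrite ger0_norm// in zM *; rewrite min_r ?(ltW zM)// max_r; last by lra.
  by rewrite ger0_norm; lra. rewrite ltr0_norm// in zM *; rewrite min_l; last by lra.
by rewrite max_l ?ler0_norm; lra.
Qed.

Lemma clip_mfun (M : R) rho : mfun rho -> mfun (fun x => clip M (rho x)).
Proof. by move=> mr; apply: measurable_maxr => //; apply: measurable_minr. Qed.

Lemma clip_approx rho (X e : R) : 0 < e -> mfun rho -> (hnorm p rho <= X%:E)%E ->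
  exists2 M : R, 0 <= M & (hnorm p ((fun x => rho x - clip M (rho x))%R) <= e%:E)%E.
Proof.
move=> e0 mr rX. have cut x : \forall n \near \oo, rho x - clip n%:R (rho x) = 0.
  exists (Num.truncn `|rho x|).+1 => // n /= hn.
  by rewrite clip_id ?subrr// ltW// (lt_le_trans (truncnS_gt _))// ler_nat.
have [n _ /(_ n (leqnn n)) H] := Lnorm_cvg0 p0 (fun n => mfunB mr (@clip_mfun n%:R _ mr)) mr rX
  (fun n x => clip_diff (rho x) (ler0n R n)) cut e0. by exists n%:R.
Qed.

Lemma smear_bound f k (M a C : R) x : 0 <= M -> mollifier k a C ->
  (forall y, k (y - x) != 0 -> `|f y| <= M) -> `|smear k f x| <= M.
Proof.
move=> M0 mol fM; rewrite -lee_fin (le_trans (Rint_abs_le _ _ _))//; apply: (@le_trans _ _ (M%:E * \int[haar]_y (k (y - x))%:E)%E).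
  apply: int_le_scale => // y _; have [->|ky] := eqVneq (k (y - x)) 0; first by rewrite mulr0 normr0 mule0.
  by rewrite -EFinM lee_fin normrM (ger0_norm (mol_ge0 mol _)) ler_wpM2r ?(mol_ge0 mol)// fM.
rewrite (@ge0_shift _ _ (fun y => (k y)%:E)) ?(mol_int mol) ?mule1//.
- by apply/mEFinP; exact: (sm_mfun (mol_smooth mol)).
- by move=> y; rewrite lee_fin (mol_ge0 mol).
- by move=> y z; rewrite (mol_periodic mol).
Qed.

(** Clipping makes the function bounded, and then mollification, which is controlled in L^1, is
    controlled in L^p as well: |z|^p <= (2M)^(p-1) |z|. *)
Lemma Lp_density rho (X e : R) : 0 < e -> mfun rho -> Zper rho ->
  (hnorm p rho <= X%:E)%E ->
  exists eta, [/\ smooth eta, Zper eta & (hnorm p ((fun x => rho x - eta x)%R) <= e%:E)%E].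
Proof.
move=> e0 mr pr rX; have e20 : 0 < e / 2 by rewrite divr_gt0. have [M M0 HM] := clip_approx e20 mr rX.
pose c x := clip M (rho x); have mc : mfun c by exact: clip_mfun. have pc : Zper c by move=> x z; rewrite /c pr.
have cM y : `|c y| <= M by exact: clip_bound. have cI : (\int[haar]_x `|c x|%:E <= M%:E)%E.
  by apply: prob_int_le => x; rewrite lee_fin.
pose D := (2 * M) `^ (p - 1) + 1; have D0 : 0 < D by rewrite ltr_wpDl ?powR_ge0.
pose e' := (e / 2) `^ p / D; have e'0 : 0 < e' by rewrite divr_gt0 ?powR_gt0.
have [dl dl0 Hdl] := smear_approx e'0 mc pc (le_lt_trans cI (ltry _)).
have [k [a [a0 adl mol]]] := mollifier_near dl0 d0. have ss := smear_sm mc cI (mol_smooth mol) (mol_periodic mol).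
have ms := sm_mfun ss. exists (smear k c); split => //; first exact: smear_periodic (mol_periodic mol).
have mB : mfun (fun x => c x - smear k c x) by exact: mfunB.
have N2 : (hnorm p ((fun x => c x - smear k c x)%R) <= (e / 2)%:E)%E. apply: Lnorm_powR => //; first exact: ltW.
  have sc x : setT x -> ((`|c x - smear k c x| `^ p)%:E <= ((2 * M) `^ (p - 1))%:E * `|smear k c x - c x|%:E)%E.
    move=> _; rewrite -EFinM lee_fin distrC powR_le_scale//.
    by rewrite (le_trans (ler_normB _ _))// mulr_natl mulr2n lerD// (smear_bound M0 mol).
  apply: (le_trans (int_le_scale (powR_ge0 _ _) sc)); apply: (@le_trans _ _ (((2 * M) `^ (p - 1))%:E * e'%:E)%E).
    by rewrite lee_wpmul2l ?lee_fin ?powR_ge0//; exact: Hdl mol.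
  rewrite -EFinM lee_fin /e' mulrCA ger_pMr ?powR_gt0// ler_pdivrMr// mul1r lerDl//.
have -> : (fun x => rho x - smear k c x) = ((fun x => rho x - c x) \+ (fun x => c x - smear k c x)).
  by apply/funext => x /=; rewrite addrA subrK. rewrite (_ : e = e / 2 + e / 2); last by lra.
rewrite EFinD; apply: le_trans (minkowski_EFin _ _ _ _) (leeD HM N2) => //; last exact: ltW. exact: mfunB.
Qed.
End smooth_density.

Lemma Rintegral_sum dT (T : measurableType dT) (R : realType) (mu : {measure set T -> \bar R})
    (I : Type) (s : seq I) (f : I -> T -> R) :
  (forall i, mu.-integrable setT (EFin \o f i)) ->
  mu.-integrable setT (EFin \o (fun x => \sum_(i <- s) f i x)) /\
  \int[mu]_x \sum_(i <- s) f i x = \sum_(i <- s) \int[mu]_x f i x.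
Proof.
move=> fi; elim: s => [|i s [IH1 IH2]].
  under eq_fun do rewrite big_nil; rewrite big_nil; split; first exact: integrable0. exact: Rint_eq0.
under eq_fun do rewrite big_cons; split; first exact: (integrableD measurableT (fi i) IH1).
by rewrite RintD// IH2 big_cons.
Qed.

Section weak_partials.
Variables (R : realType) (d : nat).

Lemma smooth_weak_partial (i : 'I_d) (eta : 'rV[R]_d -> R) : smooth eta -> Zper eta ->
  weak_partial i eta ('D_('e_i) eta).
Proof.
move=> se pe; have [M M0 HM] := sm_bounded se pe.
have [L L0 HL] := sm_bounded (sm_D ('e_i) se) (periodic_D ('e_i) pe).
apply: (@weak_partial_quotient _ _ _ _ _ M L) => //.
- exact: (sm_mfun se).
- move=> n x; have [c _ ->] := sm_MVT se x ('e_i) n.+1%:R^-1. by rewrite mulrA mulfV ?mul1r.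
- move=> x; apply: derive_seq; first by move=> y; exact: sm_dv. exact: (sm_cont (sm_D ('e_i) se)).
Qed.

Lemma weak_partial_translate (i : 'I_d) (f g : 'rV[R]_d -> R) (v : 'rV[R]_d) :
  mfun f -> Zper f -> mfun g -> Zper g ->
  weak_partial i f g -> weak_partial i (fun x => f (x + v)) (fun x => g (x + v)).
Proof.
move=> mf pf mg pg fg psi spsi ppsi; pose psi' x := psi (x - v). have spsi' : smooth psi' by exact: sm_shift.
have ppsi' : Zper psi' by exact: Zper_shift.
have mc (f' : 'rV[R]_d -> R) : smooth f' -> mfun f' by move=> sf; exact: (sm_mfun sf). have := fg _ spsi' ppsi'.
rewrite -(torus_shift v (mfunM mf (mc _ (sm_D ('e_i) spsi')))); last first.
  by move=> x z /=; rewrite pf (periodic_D ('e_i) ppsi').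
rewrite -[X in - X](torus_shift v (mfunM mg (mc _ spsi'))); last by move=> x z /=; rewrite pg ppsi'.
rewrite /=; under eqRint do rewrite (derive_shift psi (- v)) addrK.
by under [X in _ = - X]eqRint do rewrite /psi' addrK.
Qed.
End weak_partials.

(** * The commutator estimate *)

Section commutator.
Variables (R : realType) (d : nat) (p q : R).
Hypotheses (p1 : 1 < p) (q1 : 1 < q) (pq : p^-1 + q^-1 = 1) (d0 : (0 < d)%N).
Implicit Types (f k eta rho : 'rV[R]_d -> R) (x y z v w : 'rV[R]_d).
Let qp : q^-1 + p^-1 = 1. Proof. by rewrite addrC. Qed.
Let p0 : 0 < p := lt_trans ltr01 p1.
Let mn f := @mabsE R _ _ f.
Let mkn k (sk : smooth k) : mfun k := sm_mfun sk.
Let sD k (j : 'I_d) (sk : smooth k) : smooth ('D_('e_j) k) := sm_D ('e_j) sk.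
Let pD k (j : 'I_d) (pk : Zper k) : Zper ('D_('e_j) k) := periodic_D ('e_j) pk.

(** The increment is telescoped over the coordinates; every leg is [difference_le] for a translate
    of [u]. *)
Lemma difference_vector_le (u : 'rV[R]_d -> R) (g : 'I_d -> 'rV[R]_d -> R) rho (X Y a : R) w :
  mfun u -> Zper u -> (hnorm q u <= Y%:E)%E ->
  (forall i, [/\ mfun (g i), Zper (g i), (hnorm q (g i) <= Y%:E)%E & weak_partial i u (g i)]) ->
  mfun rho -> Zper rho -> (hnorm p rho <= X%:E)%E ->
  (forall i, `|w 0 i| <= a) ->
  (\int[haar]_x (`|rho (x + w)| * `|u (x + w) - u x|)%:E <= (d%:R * (a * (X * Y)))%:E)%E.
Proof.
move=> mu pu uY Hg mr pr rX wa. have X0 : 0 <= X by rewrite -lee_fin (le_trans _ rX)// Lnorm_ge0.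
have Y0 : 0 <= Y by rewrite -lee_fin (le_trans _ uY)// Lnorm_ge0.
pose r x := rho (x + w); have mr' : mfun r by exact: mfun_shift.
have rX' : (hnorm p r <= X%:E)%E by rewrite Lnorm_shift.
have mm v v' : mfun (fun x => r x * (u (x + v) - u (x + v'))). by apply: mfunM => //; apply: mfunB; exact: mfun_shift.
have key (s : seq 'I_d) : (\int[haar]_x (`|r x| * `|u (x + \sum_(i <- s) w 0 i *: 'e_i)%R - u x|)%:E <= ((size s)%:R * (a * (X * Y)))%:E)%E.
  elim: s => [|i s IH]. by rewrite integral0_eq ?lee_fin ?mul0r// => x _; rewrite big_nil addr0 subrr normr0 mulr0.
  set v := \sum_(i <- s) _ in IH. rewrite /= -natr1 mulrDl mul1r addrC EFinD.
  apply: (int_leD measurableT (mm (v + w 0 i *: 'e_i) v) (mm v 0)) => [x _||]; last by under eq_integral do rewrite normrM addr0.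
    by rewrite lee_fin !normrM -mulrDr ler_wpM2l// big_cons -/v [_ *: _ + v]addrC addr0 ler_distD.
  have [mg pg gY ug] := Hg i.
  have := @difference_le R d p q p1 q1 pq d0 i (fun x => u (x + v)) (fun x => g i (x + v)) Y Y
    (mfun_shift v mu) (Zper_shift v pu) _ (mfun_shift v mg) (Zper_shift v pg) _
    (weak_partial_translate v mu pu mg pg ug) r X (w 0 i) mr' rX'.
  rewrite !Lnorm_shift// => /(_ uY gY) h; apply: le_trans (le_trans h _).
    by under eq_integral do rewrite normrM addrA addrAC; rewrite lexx. by rewrite lee_fin ler_wpM2r ?mulr_ge0.
have := key (index_enum 'I_d); rewrite -row_sum_delta => /le_trans; apply.
by have -> : size (index_enum 'I_d) = d by rewrite -sum1_size sum1_card card_ord.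
Qed.

Section field.
Variables (u : 'I_d -> 'rV[R]_d -> R) (g : 'I_d -> 'I_d -> 'rV[R]_d -> R) (Y : R).
Hypotheses (mu : forall j, mfun (u j)) (pu : forall j, Zper (u j))
  (uY : forall j, (hnorm q (u j) <= Y%:E)%E).
Hypothesis Hg : forall j i, [/\ mfun (g j i), Zper (g j i),
  (hnorm q (g j i) <= Y%:E)%E & weak_partial i (u j) (g j i)].
Hypothesis divu : forall psi, smooth psi -> Zper psi ->
  \int[haar]_x (\sum_j u j x * 'D_('e_j) psi x) = 0.

(** The commutator u . grad rho_k - div (rho u)_k, where the index k stands for mollification and
    the derivatives are put on the kernel. *)
Definition comm k rho x : R := \int[haar]_y (rho y * \sum_j (u j y - u j x) * 'D_('e_j) k (y - x)).

Let Y0 : 0 <= Y.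
Proof. by rewrite -lee_fin (le_trans _ (uY (Ordinal d0)))// Lnorm_ge0. Qed.

Section weight.
Variables (rho : 'rV[R]_d -> R) (X : R).
Hypotheses (mr : mfun rho) (pr : Zper rho) (rX : (hnorm p rho <= X%:E)%E).
Let X0 : 0 <= X.
Proof. by rewrite -lee_fin (le_trans _ rX)// Lnorm_ge0. Qed.

Let rL : (\int[haar]_x `|rho x|%:E <= X%:E)%E := L1_le_Lp p1 q1 pq mr rX.
Let ruL j : (\int[haar]_x `|rho x * u j x|%:E <= (X * Y)%:E)%E := hoelder_le p1 q1 pq mr (mu j) rX (uY j).
Let mru j : mfun (fun x => rho x * u j x) := mfunM mr (mu j).

Lemma commE k x : smooth k -> Zper k ->
  comm k rho x = \sum_j (smear ('D_('e_j) k) (fun y => rho y * u j y) x - u j x * smear ('D_('e_j) k) rho x).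
Proof.
move=> sk pk. have i1 j := smear_int (mru j) (ruL j) x (sD j sk) (pD j pk).
have i2 j := smear_int mr rL x (sD j sk) (pD j pk).
transitivity (\int[haar]_y \sum_j (rho y * u j y * 'D_('e_j) k (y - x) - u j x * (rho y * 'D_('e_j) k (y - x)))).
  apply: eqRint => y _; rewrite mulr_sumr; apply: eq_bigr => j _; ring. rewrite (Rintegral_sum _ _).2; last first.
  by move=> j; exact: (integrableB measurableT (i1 j) (intZl measurableT (u j x) (i2 j))).
apply: eq_bigr => j _; rewrite RintB//; last exact: (intZl measurableT (u j x) (i2 j)). by rewrite RintZl.
Qed.

Lemma comm_mfun k : smooth k -> Zper k -> mfun (comm k rho).
Proof.
move=> sk pk.
rewrite (_ : comm k rho = fun x => \sum_j (smear ('D_('e_j) k) (fun y => rho y * u j y) x - u j x * smear ('D_('e_j) k) rho x)).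
  apply: measurable_sum => j; apply: mfunB. exact: mkn (smear_sm (mru j) (ruL j) (sD j sk) (pD j pk)).
  by apply: mfunM => //; exact: mkn (smear_sm mr rL (sD j sk) (pD j pk)). by apply/funext => x; rewrite commE.
Qed.

(** The radius cancels: the derivative of the kernel has L^1 norm C/a and lives within a of the
    lattice, where the increments of u weighted by rho are O(a) in L^1. *)
Lemma comm_bound k (a C : R) : 0 < a -> mollifier k a C ->
  (\int[haar]_x `|comm k rho x|%:E <= (d%:R * (d%:R * (C * (X * Y))))%:E)%E.
Proof.
move=> a0 mol; have [sk pk] := (mol_smooth mol, mol_periodic mol).
pose F j x z := rho (x + z) * (u j (x + z) - u j x). have mF j : mfun (fun w : 'rV[R]_d * 'rV[R]_d => F j w.1 w.2).
  apply: mfunM; first exact: (mcomp mr (@mfun_rV_add R d)).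
  by apply: mfunB; [exact: (mcomp (mu j) (@mfun_rV_add R d))|exact: (mcomp (mu j))]. have mD j := mkn (sD j sk).
have mm j : mfun (fun w : 'rV[R]_d * 'rV[R]_d => (`|F j w.1 w.2| * `|'D_('e_j) k w.2|)%:E).
  apply/mEFinP; apply: mfunM; apply: mfun_norm => //. exact: (mcomp (mD j)).
have one j : (\int[haar]_x \int[haar]_z (`|F j x z| * `|'D_('e_j) k z|)%:E <= (d%:R * (C * (X * Y)))%:E)%E.
  rewrite (_ : d%:R * (C * (X * Y)) = (d%:R * (a * (X * Y))) * (C / a)); last by field; rewrite gt_eqF.
  apply: weighted_Tonelli_le => //.
  (* By periodicity z may be replaced by z - l, which lies within a of the origin. *)
  - move=> z /(mol_dsupp mol)[l hl]. have pF x : F j x z = F j x (z - map_mx intr l).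
      by rewrite /F -[in LHS](subrK (map_mx intr l) z) addrA pr pu. under eq_integral do rewrite pF normrM.
    apply: (difference_vector_le (mu j) (pu j) (uY j) (Hg j) mr pr rX) => i. by rewrite !mxE; exact: hl.
  - by rewrite !mulr_ge0// ltW.
  - have := mol_dint mol j; under eq_integral do rewrite EFinM.
    rewrite ge0_integralZr ?lee_fin ?(ltW a0)//; last exact: mn.
    by rewrite EFinM -lee_pdivlMr// => /le_trans; apply; rewrite -EFinM.
apply: (@le_trans _ _ (\int[haar]_x \sum_j \int[haar]_z (`|F j x z| * `|'D_('e_j) k z|)%:E)%E).
  apply: int_le => x _; rewrite /comm.
  have mcs : mfun (fun y => rho y * \sum_j (u j y - u j x) * 'D_('e_j) k (y - x)).
    apply: mfunM => //; apply: measurable_sum => j; apply: mfunM. exact: mfunB. exact: (mfun_shift (- x) (mD j)).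
  apply: (le_trans (Rint_abs_le _ _ _)) => //. have mz j : mfun (fun z => (`|F j x z| * `|'D_('e_j) k z|)%:E).
    exact: (mcomp (mm j) (mpair1 x)). rewrite -ge0_integral_sum//.
  rewrite -(@ge0_shift _ _ _ x); [|exact: mn|by []|]; last first.
    move=> y l; rewrite pr addrAC; congr (`|_ * _|%:E); apply: eq_bigr => j _. by rewrite pu (pD j pk).
  apply: int_le => z _; rewrite sumEFin lee_fin mulr_sumr; apply: le_trans (ler_norm_sum _ _ _) _.
    by apply: ler_sum => j _; rewrite addrK [z + x]addrC mulrA normrM. rewrite ge0_integral_sum//; last 2 first.
- move=> j; by apply: (@mfubiniF _ _ _ _ _ haar _ (mm j)) => w; rewrite lee_fin mulr_ge0.
- by move=> j x _; apply: int_ge0 => z _; rewrite lee_fin mulr_ge0.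
apply: (@le_trans _ _ (\sum_(j < d) (d%:R * (C * (X * Y)))%:E)%E). by apply: lee_sum => j _; exact: one.
by rewrite sumEFin sumr_const card_ord lee_fin -[_ *+ d]mulr_natl.
Qed.
End weight.

Let bL f M : (forall x, `|f x| <= M) -> (\int[haar]_x `|f x|%:E <= M%:E)%E.
Proof. by move=> fM; apply: (@prob_int_le _ _ _ haar) => x; rewrite lee_fin. Qed.
Let uL j : (\int[haar]_x `|u j x|%:E <= Y%:E)%E.
Proof. exact: (L1_le_Lp q1 p1 qp (mu j) (uY j)). Qed.

Lemma smearB f f' k x (A B : R) : smooth k -> Zper k ->
  mfun f -> (\int[haar]_y `|f y|%:E <= A%:E)%E ->
  mfun f' -> (\int[haar]_y `|f' y|%:E <= B%:E)%E ->
  smear k (fun y => f y - f' y) x = smear k f x - smear k f' x.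
Proof.
move=> sk pk mf fA mf' fB; rewrite /smear -RintB//; last 2 first.
- exact: (smear_int mf fA).
- exact: (smear_int mf' fB). by apply: eqRint => y _; rewrite mulrBl.
Qed.

Lemma smear_near k (a C : R) (w : 'rV[R]_d -> R) x (L : R) : 0 <= a -> mollifier k a C -> smooth w -> Zper w ->
  (forall x v (a : R), 0 <= a -> (forall i, `|v 0 i| <= a) -> `|w (x + v) - w x| <= L * a) ->
  `|smear k w x - w x| <= L * a.
Proof.
move=> a0 mol sw pw wL; have [sk pk] := (mol_smooth mol, mol_periodic mol).
have mk := mkn sk; have [M M0 HM] := sm_bounded sw pw. have [K K0 HK] := sm_bounded sk pk.
have k1 : smear k (fun=> w x) x = w x.
  rewrite /smear RintZl//; last exact: (haar_bnd (mfun_shift (- x) mk) (fun y _ => HK _)).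
  by rewrite (torus_shift (- x) mk pk) (mollifier_Rint mol) mulr1.
rewrite -[X in _ - X]k1 -(smearB x sk pk (mkn sw) (bL HM) (@mcst _ _ _ _ _ (w x)) (bL (fun=> HM x))).
apply: (smear_bound _ mol) => [|y /(mol_supp mol)/(near_lattice_shift pw)[v va E]].
  by apply: le_trans (wL 0 0 a a0 _) => // i; rewrite mxE normr0.
by have := E x; rewrite addrC subrK => ->; rewrite wL.
Qed.

Section smooth_weight.
Variable eta : 'rV[R]_d -> R.
Hypotheses (se : smooth eta) (pe : Zper eta).
Let flux j y := u j y * 'D_('e_j) eta y.

Let flux_ok j : exists2 B : R, mfun (flux j) & (\int[haar]_x `|flux j x|%:E <= B%:E)%E.
Proof.
have [M M0 HM] := sm_bounded (sD j se) (pD j pe).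
by exists (Y * M); [exact: mfunM (mu j) (mkn (sD j se))|exact: mul_bounded_L1 (uL j) M0 HM].
Qed.

(** For a smooth weight the derivative moves from the kernel to [eta]: in the first sum because u is
    divergence-free, tested with [eta] times the translated kernel, in the second by integration by
    parts. Both terms then approximate u . grad eta. *)
Lemma comm_smoothE k x : smooth k -> Zper k ->
  comm k eta x = \sum_j (u j x * smear k ('D_('e_j) eta) x - smear k (flux j) x).
Proof.
move=> sk pk; have [M M0 HM] := sm_bounded se pe. have eM := Lnorm_bounded haar p0 M0 HM.
have ruL j := hoelder_le p1 q1 pq (mkn se) (mu j) eM (uY j).
have mru j : mfun (fun y => eta y * u j y) by apply: mfunM => //; exact: mkn.
have sk' := sm_shift (- x) sk; have pk' := Zper_shift (- x) pk. rewrite (commE (mkn se) eM x sk pk) sumrB.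
have -> : \sum_j smear ('D_('e_j) k) (fun y => eta y * u j y) x = - \sum_j smear k (flux j) x.
  apply/eqP; rewrite -subr_eq0 opprK -big_split/=.
  have pek : Zper (fun y => eta y * k (y - x)) by move=> y z; rewrite pe pk'.
  rewrite -[X in _ == X](divu (sm_mul se sk') pek).
  - have i1 j := smear_int (mru j) (ruL j) x (sD j sk) (pD j pk). have i2 j : hL1 (fun y => flux j y * k (y - x)).
      by have [B mf fB] := flux_ok j; exact: (smear_int mf fB).
    rewrite (eq_bigr (fun j => \int[haar]_y (eta y * u j y * 'D_('e_j) k (y - x) + flux j y * k (y - x)))); last first.
      by move=> j _; rewrite RintD. rewrite -(Rintegral_sum _ (fun j => integrableD measurableT (i1 j) (i2 j))).2.
    apply/eqP; apply: eqRint => y _; apply: eq_bigr => j _. by rewrite derive_smooth_mul// derive_shift /flux; ring.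
rewrite sumrB addrC -sumrN; congr (_ + _); apply: eq_bigr => j _. rewrite -mulrN; congr (_ * _).
have := smooth_weak_partial j se pe sk' pk'. under eqRint do rewrite derive_shift.
by rewrite /smear => ->; rewrite opprK.
Qed.

Lemma comm_smooth_cvg (e C : R) : 0 < e ->
  exists2 dl : R, 0 < dl & forall k (a : R), 0 < a -> a <= dl -> mollifier k a C ->
    (\int[haar]_x `|comm k eta x|%:E <= e%:E)%E.
Proof.
move=> e0; have dR : 0 < d%:R :> R by rewrite ltr0n.
pose e2 := e / (2 * d%:R); have e20 : 0 < e2 by rewrite divr_gt0// mulr_gt0.
have one j : exists2 dl : R, 0 < dl & forall k (a : R), 0 < a -> a <= dl -> mollifier k a C ->
    (\int[haar]_x `|u j x * smear k ('D_('e_j) eta) x - smear k (flux j) x|%:E <= (2 * e2)%:E)%E.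
  have [B mf fB] := flux_ok j. have pf : Zper (flux j) by move=> x z; rewrite /flux pu (pD j pe).
  have [dl dl0 Hdl] := smear_approx e20 mf pf (le_lt_trans fB (ltry _)).
  have [L L0 HL] := torus_lip (sD j se) (pD j pe). have D0 : 0 < Y * L + 1 by rewrite ltr_wpDl// mulr_ge0.
  exists (Num.min dl (e2 / (Y * L + 1))); first by rewrite lt_min dl0 divr_gt0.
  move=> k a a0; rewrite le_min => /andP[a1 a2] mol; have [sk pk] := (mol_smooth mol, mol_periodic mol).
  have mF : mfun (smear k (flux j)) := mkn (smear_sm mf fB sk pk). have La0 : 0 <= L * a by rewrite mulr_ge0// ltW.
  rewrite mulr_natl mulr2n EFinD.
  apply: (int_leD measurableT (mfunM (mcst (L * a)) (mu j)) (mfunB mF mf)) => [x _||]; last exact: Hdl mol.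
    rewrite lee_fin /= [X in _ <= X + _]normrM (ger0_norm La0).
    rewrite (_ : u j x * _ - _ = u j x * (smear k ('D_('e_j) eta) x - 'D_('e_j) eta x) - (smear k (flux j) x - flux j x)); last by rewrite /flux; ring.
    rewrite (le_trans (ler_normB _ _))// lerD2r normrM mulrC ler_wpM2r//.
    exact: (smear_near x (ltW a0) mol (sD j se) (pD j pe) HL).
  under eq_integral do rewrite normrM (ger0_norm La0) EFinM.
  apply: (@le_trans _ _ ((L * a)%:E * Y%:E)%E); first by rewrite int_scale// lee_wpmul2l ?lee_fin.
  rewrite -EFinM lee_fin mulrAC [L * Y]mulrC; apply: (@le_trans _ _ ((Y * L + 1) * a)).
    by rewrite ler_wpM2r ?lerDl// ltW. by rewrite mulrC -ler_pdivlMr. pose dl j := s2val (cid2 (one j)).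
have dl0 j : 0 < dl j := s2valP (cid2 (one j)). have Hdl j := s2valP' (cid2 (one j)).
exists (\big[Num.min/1]_j dl j); first by apply: lt_bigmin.
move=> k a a0 adl mol; have [sk pk] := (mol_smooth mol, mol_periodic mol).
have mT j : mfun (fun x => u j x * smear k ('D_('e_j) eta) x - smear k (flux j) x).
  have [M M0 HM] := sm_bounded (sD j se) (pD j pe); have [B mf fB] := flux_ok j.
  apply: mfunB; last exact: mkn (smear_sm mf fB sk pk). apply: mfunM => //.
  exact: mkn (smear_sm (mkn (sD j se)) (bL HM) sk pk). rewrite (_ : e = \sum_(j < d) (2 * e2)); last first.
  by rewrite sumr_const card_ord -[_ *+ d]mulr_natl /e2; field; rewrite gt_eqF.
rewrite -sumEFin; apply: (@le_trans _ _ (\sum_j \int[haar]_x `|u j x * smear k ('D_('e_j) eta) x - smear k (flux j) x|%:E)%E).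
  rewrite -ge0_integral_sum//; last by move=> j; exact: mn.
  by apply: int_le => x _; rewrite comm_smoothE// sumEFin lee_fin ler_norm_sum.
apply: lee_sum => j _; have adj : a <= dl j by rewrite (le_trans adl)// bigmin_le. exact: (Hdl j k a a0 adj mol).
Qed.
End smooth_weight.

(** Since [comm_bound] does not depend on the radius and the commutator is linear in the weight,
    convergence for smooth weights extends to their L^p limits. *)
Lemma comm_cvg rho (X C e : R) : mfun rho -> Zper rho ->
  (hnorm p rho <= X%:E)%E -> 0 <= C -> 0 < e ->
  exists2 dl : R, 0 < dl & forall k (a : R), 0 < a -> a <= dl -> mollifier k a C ->
    (\int[haar]_x `|comm k rho x|%:E <= e%:E)%E.
Proof.
move=> mr pr rX C0 e0; have dR : 0 < d%:R :> R by rewrite ltr0n. have D0 : 0 < 2 * (d%:R * (d%:R * (C * Y)) + 1).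
  by rewrite mulr_gt0// ltr_wpDl// !mulr_ge0// ltW.
pose e1 := e / (2 * (d%:R * (d%:R * (C * Y)) + 1)); have e10 : 0 < e1 by rewrite divr_gt0.
have [eta [se pe re]] := Lp_density p1 d0 e10 mr pr rX. have e20 : 0 < e / 2 by rewrite divr_gt0.
have [dl dl0 Hdl] := comm_smooth_cvg se pe C e20.
exists dl => // k a a0 adl mol; have [sk pk] := (mol_smooth mol, mol_periodic mol). pose w x := rho x - eta x.
have mw : mfun w by apply: mfunB => //; exact: mkn. have pw : Zper w by move=> x z; rewrite /w pr pe.
have [M M0 HM] := sm_bounded se pe. have eM := Lnorm_bounded haar p0 M0 HM.
have E x : comm k rho x = comm k w x + comm k eta x.
  rewrite (commE mr rX x sk pk) (commE mw re x sk pk) (commE (mkn se) eM x sk pk) -big_split/=. apply: eq_bigr => j _.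
  have -> : (fun y => w y * u j y) = (fun y => rho y * u j y - eta y * u j y). by apply/funext => y; rewrite mulrBl.
  rewrite (smearB x (sD j sk) (pD j pk) mr (L1_le_Lp p1 q1 pq mr rX) (mkn se) (L1_le_Lp p1 q1 pq (mkn se) eM)).
  rewrite (smearB x (sD j sk) (pD j pk) (mfunM mr (mu j)) (hoelder_le p1 q1 pq mr (mu j) rX (uY j))
    (mfunM (mkn se) (mu j)) (hoelder_le p1 q1 pq (mkn se) (mu j) eM (uY j))). ring.
have m1 : mfun (comm k w) := comm_mfun mw re sk pk. have m2 : mfun (comm k eta) := comm_mfun (mkn se) eM sk pk.
rewrite (_ : e = e / 2 + e / 2); last by lra.
rewrite EFinD; apply: (int_leD measurableT m1 m2) => [x _||]; [by rewrite E lee_fin ler_normD| |exact: Hdl mol].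
apply: le_trans (comm_bound mw pw re a0 mol) _; rewrite lee_fin.
have -> : d%:R * (d%:R * (C * (e1 * Y))) = (d%:R * (d%:R * (C * Y))) * e1 by ring.
apply: (@le_trans _ _ ((d%:R * (d%:R * (C * Y)) + 1) * e1)); first by rewrite ler_wpM2r ?lerDl// ltW.
rewrite /e1 [leLHS](_ : _ = e / 2)//; field. by rewrite gt_eqF//; move: D0; rewrite pmulr_rgt0.
Qed.
End field.
End commutator.

(** * The chain rule for weak time derivatives *)
Section time.
Variables (R : realType) (T : R).
Hypothesis T0 : 0 < T.
Local Notation I := `[0, T]%classic.
Implicit Types (h F G : mR R -> R).

Let mI : measurable (I : set (mR R)). Proof. exact: mitv. Qed.

Definition prim F (t : R) : R := \int[leb]_(s in `[0, t]) F s.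

Lemma prim_cont F : lL1 I F -> {within I, continuous (prim F)}.
Proof. by move=> iF; apply: parameterized_integral_continuous => //; exact: ltW. Qed.

Lemma primitive_mfun F : lL1 I F -> measurable_fun (I : set (mR R)) (prim F : mR R -> R).
Proof. by move=> iF; apply: subspace_continuous_measurable_fun => //; exact: prim_cont. Qed.

Let integrable_sub F t : 0 <= t <= T -> lL1 I F -> leb.-integrable `[0, t] (EFin \o F).
Proof.
move=> /andP[t0 tT] iF; apply: integrableS iF => // x /=; rewrite !in_itv/= => /andP[-> xt]/=. exact: le_trans tT.
Qed.

Lemma primitive_le F t (Z : R) : 0 <= t <= T -> mfun F -> (\int[leb]_(s in I) `|F s|%:E <= Z%:E)%E ->
  `|prim F t| <= Z.
Proof.
move=> /andP[t0 tT] mF FZ; rewrite -lee_fin (le_trans (Rint_abs_le _ _ _))//.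
apply: le_trans FZ; apply: ge0_subset_integral => //.
- by apply/mEFinP; apply: mfun_norm; exact: mfunTS.
- by move=> x /=; rewrite !in_itv/= => /andP[-> xt]/=; exact: le_trans tT.
Qed.

Lemma primitiveB F G t : 0 <= t <= T -> lL1 I F -> lL1 I G ->
  prim F t - prim G t = prim (fun s => F s - G s) t.
Proof. by move=> tT iF iG; rewrite /prim RintB//; exact: integrable_sub. Qed.

Section weak_derivative.
Variables (h F : mR R -> R).
Hypotheses (mh : mfun h) (mF : mfun F).
Hypotheses (ih : lL1 I h) (iF : lL1 I F).
Hypothesis hF : forall chi : R -> R, smooth chi -> (exists2 T1, T1 < T & forall t, T1 <= t -> chi t = 0) ->
  \int[leb]_(t in I) (h t * 'D_1 chi t + F t * chi t) = 0.

Lemma smooth_id : smooth (id : R -> R).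
Proof.
have dE (t v : R) := is_derive_id t v; have c : continuous (id : R -> R) by move=> ?; exact: cvg_id.
case=> [|k]; split=> // v; split; first by move=> x; exact: (derive_ex (dE x v)).
by rewrite (_ : 'D_v _ = cst v); [exact: sm_cst|apply/funext => x; exact: (derive_eq (dE x v))].
Qed.

Let arg (c : R) (n : nat) (t : R) : R := n.+1%:R * (c + -1 * t).
(** Smooth approximations of (c - t)_+ that vanish for t >= c. *)
Let ramp c n t := n.+1%:R^-1 * flat 0 (arg c n t).

Let smooth_ramp c n : smooth (ramp c n).
Proof.
by do ![exact: sm_cst|exact: smooth_id|apply: sm_mul|apply: sm_add|apply: smooth_flat].
Qed.

Let derive_ramp c n t : 'D_1 (ramp c n) t = - (flat 1 (arg c n t) + flat 2 (arg c n t)).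
Proof.
have d1 := is_deriveZ (n.+1%:R : R) (is_deriveD (is_derive_cst c t 1) (is_deriveZ (-1 : R) (is_derive_id t 1))).
have d3 := is_deriveZ (n.+1%:R^-1 : R) (@is_derive1_comp _ (flat 0) (arg c n) t _ _ (is_derive_flat 0 _) d1).
rewrite (derive_eq d3) subr0 mul1r add0r -[-1 *: 1]/(-1 * 1) mulr1 -[LHS]/(_ * (_ * (_ * _))).
by rewrite mulrCA mulKf// mulrN1.
Qed.

Let argE c n t : arg c n t = n.+1%:R * (c - t). Proof. by rewrite /arg mulN1r. Qed.

Let arg_gt0 c n t : (0 < arg c n t) = (t < c).
Proof. by rewrite argE pmulr_rgt0 ?ltr0n// subr_gt0. Qed.

Let flat_out k c n t : c <= t -> flat k (arg c n t) = 0.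
Proof. by move=> ct; rewrite flat_neg// [_ <= 0]leNgt arg_gt0 -leNgt. Qed.

Let damp c n t : R := expR (- (arg c n t)^-1).

Let rampE c n t : t < c -> ramp c n t = (c - t) * damp c n t.
Proof. by move=> tc; rewrite /ramp /flat arg_gt0 tc expr0 mul1r mulrA {1}argE mulKf. Qed.

Let drampE c n t : t < c -> 'D_1 (ramp c n) t = - (damp c n t + (arg c n t)^-1 * damp c n t).
Proof.
rewrite -(arg_gt0 _ n) derive_ramp /damp; move: (arg c n t) => r r0.
by rewrite /flat r0 expr1 expr2 -!mulrA !(mulKf (lt0r_neq0 r0)).
Qed.

Let inv_ge0 c n t : t < c -> 0 <= (arg c n t)^-1.
Proof. by move=> tc; rewrite invr_ge0 ltW// arg_gt0. Qed.

Let damp_le1 c n t : t < c -> damp c n t <= 1.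
Proof. by move=> tc; rewrite -expR0 ler_expR oppr_le0 inv_ge0. Qed.

Let ramp_bound c n t : c <= T -> 0 <= t -> `|ramp c n t| <= T.
Proof.
move=> cT t0; have [tc|tc] := ltP t c; last by rewrite /ramp flat_out// mulr0 normr0 ltW.
rewrite rampE// ger0_norm ?mulr_ge0 ?expR_ge0 ?subr_ge0 ?(ltW tc)//.
by rewrite (le_trans (ler_piMr _ (damp_le1 n tc)))// ?subr_ge0 ?(ltW tc)//; lra.
Qed.

Let dramp_bound c n t : `|'D_1 (ramp c n) t| <= 2.
Proof.
have [tc|tc] := ltP t c; last by rewrite derive_ramp !flat_out// addr0 oppr0 normr0. have i0 := inv_ge0 n tc.
rewrite drampE// normrN ger0_norm ?addr_ge0 ?mulr_ge0 ?expR_ge0// (_ : 2 = 1 + 1)// lerD ?damp_le1//.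
by rewrite /damp expRN ler_pdivrMr ?expR_gt0// mul1r (le_trans _ (expR_ge1Dx _))// lerDr.
Qed.

Let inv_cvg0 c t : (arg c n t)^-1 @[n --> \oo] --> (0 : R).
Proof.
rewrite (_ : (fun n => _) = (fun n => n.+1%:R^-1 * (c - t)^-1)); last by apply/funext => n; rewrite argE invfM.
rewrite -[X in _ --> X](mul0r (c - t)^-1). by apply: cvgMl; exact: cvg_harmonic.
Qed.

Let damp_cvg1 c t : damp c n t @[n --> \oo] --> (1 : R).
Proof.
rewrite -(@expR0 R) -oppr0; apply: (@cvg_comp _ _ _ (fun n => - (arg c n t)^-1) expR); last exact: continuous_expR.
by apply: cvgN; exact: inv_cvg0.
Qed.

Let ramp_cvg c t : ramp c n t @[n --> \oo] --> (if t < c then c - t else 0).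
Proof.
case: ltP => tc; last by under eq_fun do rewrite /ramp flat_out// mulr0; exact: cvg_cst.
rewrite (_ : (fun n => _) = (fun n => (c - t) * damp c n t)); last by apply/funext => n; exact: rampE.
by rewrite -[X in _ --> X]mulr1; apply: cvgMr; exact: damp_cvg1.
Qed.

Let dramp_cvg c t : 'D_1 (ramp c n) t @[n --> \oo] --> (if t < c then - 1 else 0 : R).
Proof.
case: ltP => tc; last by under eq_fun do rewrite derive_ramp !flat_out// addr0 oppr0; exact: cvg_cst.
rewrite (_ : (fun n => _) = (fun n => - (damp c n t + (arg c n t)^-1 * damp c n t))); last by apply/funext => n; exact: drampE.
apply: cvgN; rewrite -[X in _ --> X]addr0; apply: cvgD; first exact: damp_cvg1.
by rewrite -[X in _ --> X](mul0r (1 : R)); apply: cvgM; [exact: inv_cvg0|exact: damp_cvg1].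
Qed.

(** The limit test function is (c - t)_+, with derivative -1 before c and 0 after it. *)
Lemma weak_cut c : 0 < c < T -> \int[leb]_(t in `[0, c]) (F t * (c - t) - h t) = 0.
Proof.
move=> /andP[c0 cT]; pose g t : R := F t * (c - t) - h t.
pose f n t : R := h t * 'D_1 (ramp c n) t + F t * ramp c n t. have ms (k : R -> R) : smooth k -> mfun (k : mR R -> R).
  by move=> sk; apply: mcontinuous; exact: (sm_cont sk). have mf n : mfun (f n : mR R -> R).
  by apply: mfunD; apply: mfunM => //; apply: ms => //; exact: sm_D.
have int_dom : lL1 I (fun t => 2 * `|h t| + T * `|F t|).
  exact: (integrableD mI (intZl mI 2 (integrable_norm ih)) (intZl mI T (integrable_norm iF))).
have fdom n t : I t -> `|f n t| <= 2 * `|h t| + T * `|F t|.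
  rewrite /= in_itv/= => /andP[t0 _]; rewrite (le_trans (ler_normD _ _))// [`|h t * _|]normrM [`|F t * _|]normrM lerD//.
    by rewrite mulrC ler_wpM2r// dramp_bound. by rewrite mulrC ler_wpM2r// ramp_bound// ltW.
have f0 n : (\int[leb]_(t in I) (f n t)%:E = 0)%E. have : leb.-integrable I (EFin \o f n).
    apply: le_integrable int_dom => //; first by apply/mEFinP; exact: mfunTS.
    move=> t It; rewrite lee_fin [leRHS]ger0_norm ?fdom//. by rewrite addr_ge0// mulr_ge0// ltW.
  move=> fi; rewrite -[LHS]fineK; last exact: int_fin. congr EFin; apply: hF; first exact: smooth_ramp.
  by exists c => // t ct; rewrite /ramp flat_out// mulr0.
have lim : (\int[leb]_(t in I) (f n t)%:E @[n --> \oo] --> \int[leb]_(t in I) ((g \_ `[0, c[) t)%:E)%E.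
  apply: (@dominated_cvg _ _ _ leb I mI (fun n => EFin \o f n) _ (EFin \o (fun t => 2 * `|h t| + T * `|F t|))) => //.
  - by move=> n; apply/mEFinP; exact: mfunTS.
  - move=> t; rewrite /= in_itv/= => /andP[t0 tT]; apply: cvg_EFin; first exact: nearW.
    rewrite (_ : (g \_ `[0, c[) t = h t * (if t < c then - 1 else 0) + F t * (if t < c then c - t else 0)).
      by apply: cvgD; apply: cvgMr; [exact: dramp_cvg|exact: ramp_cvg].
    rewrite patchE mem_setE in_itv/= t0/=; case: ifP => _; first by rewrite /g; ring. by rewrite !mulr0 addr0.
have ig : leb.-integrable `[0, c] (EFin \o g). have sub : `[0, c] `<=` (I : set (mR R)).
    by move=> t /=; rewrite !in_itv/= => /andP[-> tc]/=; rewrite (le_trans tc)// ltW.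
  have mc : measurable (`[0, c]%classic : set (mR R)) by exact: mitv.
  have i1 : leb.-integrable `[0, c] (EFin \o h) by apply: integrableS ih.
  have i2 : leb.-integrable `[0, c] (EFin \o F) by apply: integrableS iF.
  suff i3 : leb.-integrable `[0, c] (EFin \o (fun t => F t * (c - t))) by exact: (integrableB mc i3 i1).
  apply: (le_integrable mc _ _ (intZl mc c i2)) => //. apply/mEFinP; apply: mfunTS; apply: mfunM => //. exact: mfunB.
  move=> t; rewrite /= in_itv/= => /andP[t0 tc]; rewrite lee_fin !normrM mulrC ler_wpM2r//.
  by rewrite !ger0_norm; lra.
have lim0 : (\int[leb]_(t in I) (f n t)%:E @[n --> \oo] --> 0)%E by under eq_fun do rewrite f0; exact: cvg_cst.
have E := cvg_unique (@ereal_hausdorff R) lim lim0.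
transitivity (\int[leb]_(t in I) (g \_ `[0, c[) t); last by rewrite /Rintegral E.
rewrite -Rintegral_mkcondr (_ : I `&` `[0, c[ = `[0, c[%classic); last first.
  by apply: setIidr => t /=; rewrite !in_itv/= => /andP[-> tc]/=; rewrite ltW// (lt_trans tc).
rewrite Rintegral_itv_bndo_bndc//; apply: integrableS ig => //. by move=> t /=; rewrite !in_itv/= => /andP[-> /ltW].
Qed.

Lemma ae_neq (a : R) : {ae leb, forall x, x != a}.
Proof.
exists [set a]; split => //; first exact: lebesgue_measure_set1. by move=> x /= /negP; rewrite negbK => /eqP.
Qed.

(** By [weak_cut], t times the primitive of F, minus the primitive of s F(s), minus the primitive of
    h, is 0 for all t in ]0,T[. At a common Lebesgue point differentiation gives t F + prim F - t F
    - h = 0. The value of the primitive at 0 is 0 because the test functions are free at time 0. *)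
Lemma weak_primitive : {ae leb, forall t, I t -> h t = prim F t}.
Proof.
pose ext (f : R -> R) := f \_ I. pose P f (y : R) : R := \int[leb]_(s in `[0, y]) ext f s. have FTC f : lL1 I f ->
    {ae leb, forall x, 0 < x < T -> is_derive x (1 : R) (P f) (f x)}.
  move=> jf; have jT : leb.-integrable setT (EFin \o ext f).
    by have /(integrable_mkcond _ mI) := jf; rewrite restrict_EFin.
  have jy y : leb.-integrable [set` Interval (BLeft 0) (BRight y)] (EFin \o ext f).
    by apply: integrableS jT => //; exact: mitv.
  apply: aesS (FTC1 jy (integrable_locally_restrict mI jf)) => x H /andP[x0 xT]; have [|d1 d2] := H; first by [].
    apply: DeriveDef => //; rewrite -derive1E d2 /ext patchE mem_setE in_itv/= (ltW x0) (ltW xT)//.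
have iG : lL1 I (fun t => F t * t). apply: (le_integrable mI _ _ (intZl mI T iF)) => //.
    by apply/mEFinP; apply: mfunTS; exact: mfunM.
  move=> t; rewrite /= in_itv/= => /andP[t0 tT]; rewrite lee_fin !normrM mulrC ler_wpM2r//.
  by rewrite !ger0_norm; lra. have aI A B := @filterI _ _ (ae_filter_ringOfSetsType (@lebesgue_measure R)) A B.
apply: aesS (aI _ _ (aI _ _ (FTC _ ih) (aI _ _ (FTC _ iF) (FTC _ iG))) (aI _ _ (ae_neq 0) (ae_neq T))) => t [[ah [aF aG]] [/= t0 t1]] It; have tT : 0 < t < T.
  by move: It t0 t1; rewrite /= in_itv/= !lt_neqAle [0 == t]eq_sym => /andP[-> ->] -> ->.
have {ah}dh := ah tT; have {aF}dF := aF tT; have {aG}dG := aG tT.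
have d1 := is_deriveB (is_deriveB (is_deriveM (is_derive_id t (1 : R)) dF) dG) dh.
have E : \near t, (id * P F - P (fun t => F t * t) - P h) t = cst 0 t.
  have := @near_in_itvoo R 0 T t; rewrite in_itv/= => /(_ tT); apply: filterS => y; rewrite in_itv/= => yT.
  have ay : 0 <= y <= T by case/andP: yT => /ltW-> /ltW->. have PE f : P f y = \int[leb]_(s in `[0, y]) f s.
    apply: eqRint => s; rewrite inE/= in_itv/= => /andP[s0 sy].
    by rewrite /ext patchE mem_setE in_itv/= s0 (le_trans sy)//; case/andP: ay.
  transitivity (\int[leb]_(s in `[0, y]) (F s * (y - s) - h s)); last exact: weak_cut.
  rewrite -[LHS]/(y * P F y - P (fun t => F t * t) y - P h y) !PE. rewrite -RintZl//; last exact: integrable_sub.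
  have my : measurable (`[0, y]%classic : set (mR R)) by exact: mitv. have j1 := intZl my y (integrable_sub ay iF).
  have j2 := integrable_sub ay iG. rewrite -RintB// -RintB//.
  - by apply: eqRint => s _; ring.
  - exact: (integrableB my j1 j2).
  - exact: integrable_sub. have := near_eq_is_derive E d1 => d2. have := derive_eq d2; rewrite derive_cst => H.
have : t * F t + P F t - F t * t - h t = 0. rewrite [RHS]H -[id t *: _]/(t * F t) -[P F t *: _]/(P F t * 1); ring.
have -> : P F t = prim F t. apply: eqRint => s; rewrite inE/= in_itv/= => /andP[s0 sy].
  by rewrite /ext patchE mem_setE in_itv/= s0 (le_trans sy)// ltW//; case/andP: tT. lra.
Qed.
End weak_derivative.

Section chain.
Variables (beta dbeta : R -> R) (B L : R).
Hypotheses (dB : forall z, is_derive z (1 : R) beta (dbeta z)) (bB : forall z, `|dbeta z| <= B)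
  (bL : forall z z', `|dbeta z - dbeta z'| <= L * `|z - z'|) (b0 : beta 0 = 0).

Let B0 : 0 <= B. Proof. exact: le_trans (bB 0). Qed.
Let L0 : 0 <= L.
Proof. by have := bL 1 0; rewrite subr0 normr1 mulr1; apply: le_trans. Qed.

Lemma chain_lipschitz z z' : `|beta z - beta z'| <= B * `|z - z'|.
Proof.
have [c _] := @line_MVT R R beta z' 1 (z - z') (fun x => derive_ex (dB x)).
rewrite [(z - z')%:A]mulr1 [z' + (z - z')]addrC subrK => ->. by rewrite normrM mulrC ler_wpM2r// (derive_eq (dB _)).
Qed.

Let cbeta : continuous beta.
Proof. exact: is_derive_cont dB. Qed.

Let cdbeta : continuous dbeta.
Proof.
move=> z; apply/cvgrPdist_le => e e0; have D0 : 0 < L + 1 by rewrite ltr_wpDl.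
near=> z'; rewrite (le_trans (bL _ _))//; apply: (@le_trans _ _ ((L + 1) * `|z - z'|)). by rewrite ler_wpM2r ?lerDl.
rewrite mulrC -ler_pdivlMr//; near: z'; apply: (@cvgr_dist_le _ _ _ _ _ id) => //. by rewrite divr_gt0.
Unshelve. all: by end_near. Qed.

(** The derivative of (T - t) beta(prim F t). The weight vanishes at T and beta(prim F 0) = beta 0 =
    0, so the integral over [0,T] is expected to be 0. *)
Definition cflux F (t : R) : R := - beta (prim F t) + (T - t) * (dbeta (prim F t) * F t).

Let chain_mfun F : lL1 I F ->
  measurable_fun (I : set (mR R)) (cflux F : mR R -> R).
Proof.
move=> iF; have mP := primitive_mfun iF.
have mc (f : R -> R) : continuous f -> measurable_fun (I : set (mR R)) (fun t : mR R => f (prim F t)).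
  by move=> cf; apply: (mcomp (mcontinuous cf)). have /integrableP[/mEFinP mF _] := iF.
apply: mfunD; first by apply: mcomp => //; exact: mc. apply: mfunM; first by apply: mfunB.
by apply: mfunM => //; exact: mc.
Qed.

Lemma chain_continuous F : continuous F -> lL1 I F -> \int[leb]_(t in I) cflux F t = 0.
Proof.
move=> cF iF; pose P (t : R) : R := (T - t) * beta (prim F t). have cP := prim_cont iF.
have cT : {within I, continuous (fun t : R => T - t)}.
  apply: cont_subT => t; apply: continuousB; [exact: cst_continuous|exact: cvg_id].
have cb (f : R -> R) : continuous f -> {within I, continuous (fun t => f (prim F t))}.
  by move=> cf; exact: (@cont_comp (subspace I) _ _ _ f cP cf).
have cFI : {within I, continuous F} by exact: cont_subT. have cPw : {within I, continuous P}.
  by move=> t; apply: cvgM; [exact: cT|exact: (cb _ cbeta)]. have cfw : {within I, continuous (cflux F)}.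
  move=> t; apply: cvgD. by apply: cvgN; exact: (cb _ cbeta). apply: cvgM; first exact: cT.
  by apply: cvgM; [exact: (cb _ cdbeta)|exact: cFI]. have dP (t : R) : 0 < t < T -> is_derive t (1 : R) P (cflux F t).
  move=> /andP[t0 tT]. have [d1 d2] := continuous_FTC1 (a := BLeft 0) tT iF t0 (cF t).
  have d3 : is_derive t (1 : R) (prim F) (F t). by apply: DeriveDef; [exact: d1|rewrite -d2 derive1E].
  have d4 : is_derive t (1 : R) (beta \o prim F) (dbeta (prim F t) * F t).
    by have := @is_derive1_comp _ beta (prim F) t _ _ (dB _) d3; rewrite mulrC.
  have d5 : is_derive t (1 : R) (fun t => T - t) (- 1).
    by have := is_deriveB (is_derive_cst T t (1 : R)) (is_derive_id t (1 : R)); rewrite sub0r.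
  have := is_deriveM d5 d4; set D := (X in is_derive _ _ _ X) => H. rewrite (_ : cflux F t = D)// /D /cflux.
  by rewrite -[_ *: (- 1)]/(_ * _) -[(T - t) *: _]/(_ * _) /=; ring.
have [c1 c2] : P x @[x --> 0^'+] --> P 0 /\ P x @[x --> T^'-] --> P T.
  by have /(continuous_within_itvP _ T0)[_] := cPw.
have P0 : P 0 = 0 by rewrite /P /prim set_itv1 Rintegral_set1 b0 mulr0.
rewrite /Rintegral (@continuous_FTC2 _ _ P _ _ T0 cfw).
- by rewrite P0 /P subrr mul0r -EFinB subr0.
- by split => // x; rewrite in_itv/= => /dP dx; exact: (derive_ex dx).
- move=> x; rewrite in_itv/= => /dP dx; rewrite derive1E. exact: (derive_eq dx).
Qed.

Lemma chain_diff F G (Z e : R) t : 0 <= t <= T -> mfun F -> mfun G ->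
  lL1 I F -> lL1 I G ->
  (\int[leb]_(s in I) `|F s - G s|%:E <= e%:E)%E ->
  `|cflux F t - cflux G t| <= B * e + T * (B * `|F t - G t| + L * e * `|F t|).
Proof.
move=> tT mF mG iF iG FGe; move: (tT) => /andP[t0 tT']. have PP : `|prim F t - prim G t| <= e.
  by rewrite primitiveB//; apply: (primitive_le tT _ FGe); exact: mfunB. rewrite /cflux.
have -> : - beta (prim F t) + (T - t) * (dbeta (prim F t) * F t) -
    (- beta (prim G t) + (T - t) * (dbeta (prim G t) * G t)) =
    - (beta (prim F t) - beta (prim G t)) + (T - t) * (dbeta (prim G t) * (F t - G t) +
      (dbeta (prim F t) - dbeta (prim G t)) * F t) by ring. rewrite (le_trans (ler_normD _ _))// normrN lerD//.
  by rewrite (le_trans (chain_lipschitz _ _))// ler_wpM2l.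
rewrite normrM ler_pM//; first by rewrite ger0_norm ?subr_ge0// lerBlDr lerDl.
rewrite (le_trans (ler_normD _ _))// !normrM lerD// ler_wpM2r//. by rewrite (le_trans (bL _ _))// ler_wpM2l.
Qed.

(** For continuous F this is the fundamental theorem of calculus; both beta(prim F) and dbeta(prim
    F) F depend on F continuously in L^1, so approximation by continuous functions suffices. *)
Lemma primitive_chain F : mfun F -> lL1 I F ->
  \int[leb]_(t in I) cflux F t = 0.
Proof.
move=> mF iF. have finI : (leb I < +oo)%E by rewrite leb_itv/= lte_fin T0 -EFinB ltry.
have lI : leb I = T%:E by rewrite leb_itv/= lte_fin T0 -EFinB subr0. pose Z := fine (\int[leb]_(s in I) `|F s|%:E)%E.
have ZE : (\int[leb]_(s in I) `|F s|%:E = Z%:E)%E. by rewrite /Z fineK//; exact: (int_fin mI (integrable_norm iF)).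
have Z0 : 0 <= Z by rewrite -lee_fin -ZE int_ge0.
have [G [cG iG limG]] := approximation_continuous_integrable mI finI iF.
(* The constant obtained by integrating [chain_diff] over [0,T]: an L^1 error e between F and G
   costs at most K e. *)
have mG n : mfun (G n : mR R -> R) by exact: mcontinuous. pose K := T * B + T * (B + L * Z).
have K0 : 0 <= K by rewrite /K; have T0' := ltW T0; apply: addr_ge0; apply: mulr_ge0 => //; apply: addr_ge0 => //; exact: mulr_ge0.
apply/eqP; rewrite -normr_le0; apply/ler_addgt0Pl => e e0; rewrite addr0.
have e10 : 0 < e / (K + 1) by rewrite divr_gt0// ltr_wpDl.
have /ecvg0P := limG; move=> /(_ (fun n => int_ge0 _ (fun x _ => abse_ge0 _)) _ e10)[n _ /(_ n (leqnn n)) Hn].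
move: e10 Hn; set e1 := e / (K + 1) => e10 Hn; have e1E : e1 = e / (K + 1) by []; clearbody e1.
rewrite -[\int[leb]_(t in I) _]subr0 -[X in _ - X](chain_continuous (cG n) (iG n)).
have bound t : I t -> `|cflux F t - cflux (G n) t| <= B * e1 + T * (B * `|F t - G n t| + L * e1 * `|F t|).
  by rewrite /= in_itv/= => tT; apply: chain_diff.
have mn (H : mR R -> R) : mfun H -> measurable_fun I (fun t => `|H t|%:E).
  by move=> mH; apply/mEFinP; apply: mfun_norm; exact: mfunTS.
have mFG := mn _ (mfunB mF (mG n)); have mFn := mn _ mF.
have tot : (\int[leb]_(t in I) `|cflux F t - cflux (G n) t|%:E <= (K * e1)%:E)%E.
  apply: (@le_trans _ _ (\int[leb]_(t in I) ((B * e1)%:E + ((T * B)%:E * `|F t - G n t|%:E + (T * (L * e1))%:E * `|F t|%:E)))%E).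
    apply: int_le => t It; rewrite -!EFinM -!EFinD lee_fin (le_trans (bound t It))//. by apply: eqW; ring.
  have e1' := ltW e10; have T0' := ltW T0.
  have pos (a : R) z : 0 <= a -> (0 <= a%:E * `|z|%:E)%E by move=> a0; rewrite -EFinM lee_fin mulr_ge0.
  rewrite !ge0_integralD//; try by [move=> t _; rewrite ?lee_fin ?pos ?mulr_ge0|move=> t _; apply: adde_ge0; apply: pos; rewrite !mulr_ge0|exact: measurable_funeM|
    apply: emeasurable_funD; exact: measurable_funeM].
  rewrite integral_cst// int_scale ?mulr_ge0// int_scale ?mulr_ge0// ZE.
  rewrite [X in ((B * e1)%:E * X + _)%E](_ : _ = T%:E); last exact: lI.
  apply: (@le_trans _ _ ((B * e1)%:E * T%:E + ((T * B)%:E * e1%:E + (T * (L * e1))%:E * Z%:E))%E).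
    rewrite leeD2l// leeD2r// lee_wpmul2l// ?lee_fin ?mulr_ge0//.
  by rewrite -!EFinM -!EFinD lee_fin ?eqW//; rewrite /K; ring.
have int_chain H : mfun H -> lL1 I H -> leb.-integrable I (EFin \o cflux H). move=> mH iH.
  pose c : R := B * fine (\int[leb]_(s in I) `|H s|%:E)%E. have c1 : lL1 I (fun=> c : R).
    by apply: (@bnd_int _ _ _ _ _ mI finI (cst c) `|c|) => //; exact: mcst.
  apply: le_integrable (integrableD mI c1 (intZl mI (T * B) (integrable_norm iH))) => //.
    by apply/mEFinP; exact: chain_mfun.
  move=> t; rewrite /= in_itv/= => tT; rewrite lee_fin (le_trans _ (ler_norm _))//.
  have PZ : `|prim H t| <= fine (\int[leb]_(s in I) `|H s|%:E)%E.
    by apply: primitive_le => //; rewrite fineK//; exact: (int_fin mI (integrable_norm iH)).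
  rewrite /cflux (le_trans (ler_normD _ _))// normrN lerD//.
    have := chain_lipschitz (prim H t) 0; rewrite b0 !subr0 => /le_trans; apply. exact: ler_wpM2l.
  rewrite !normrM -mulrA ler_pM//; last by rewrite ler_wpM2r.
  by move/andP: tT => [t0 tT]; rewrite ger0_norm ?subr_ge0// lerBlDr lerDl. rewrite -RintB//; try exact: int_chain.
rewrite -lee_fin; apply: (le_trans (Rint_abs_le _ _ _)); apply: (le_trans tot); rewrite lee_fin.
apply: (@le_trans _ _ ((K + 1) * e1)); first by rewrite ler_wpM2r ?lerDl ?(ltW e10).
rewrite e1E mulrCA mulfV ?mulr1//; by rewrite gt_eqF// ltr_wpDl.
Qed.

Lemma weak_chain h F : mfun h -> mfun F ->
  lL1 I h -> lL1 I F ->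
  (forall chi : R -> R, smooth chi -> (exists2 T1, T1 < T & forall t, T1 <= t -> chi t = 0) ->
    \int[leb]_(t in I) (h t * 'D_1 chi t + F t * chi t) = 0) ->
  \int[leb]_(t in I) (- beta (h t) + (T - t) * (dbeta (h t) * F t)) = 0.
Proof.
move=> mh mF ih iF hF; rewrite -[RHS](primitive_chain mF iF) /Rintegral; congr fine. apply: ae_eq_integral => //.
- apply/mEFinP; apply: mfunD. by apply: mcomp => //; apply: mfunTS; exact: (mcomp (mcontinuous cbeta)).
  apply: mfunM; first by apply: mfunB. apply: mfunM; last exact: mfunTS.
  by apply: mfunTS; exact: (mcomp (mcontinuous cdbeta)).
- by apply/mEFinP; exact: chain_mfun.
- by apply: aesS (weak_primitive mh mF ih iF hF) => t ht It; rewrite /cflux -ht.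
Qed.
End chain.
End time.

(** * Uniqueness *)
Section parameters.
Context d1 d2 (T1 : measurableType d1) (T2 : measurableType d2) (R : realType).
Variable mu : {sigma_finite_measure set T2 -> \bar R}.

Lemma mfun_Rintegral_param (f : T1 * T2 -> R) : mfun f ->
  mfun (fun t => \int[mu]_x f (t, x)).
Proof.
move=> mf; rewrite /Rintegral. have mEf : mfun (EFin \o f) by exact/mEFinP.
apply: (mcomp (fine_measurable measurableT)).
rewrite (_ : (fun t => _) = (fun t => (\int[mu]_x ((EFin \o f)^\+ (t, x)) - \int[mu]_x ((EFin \o f)^\- (t, x)))%E)).
  apply: emeasurable_funB.
  - apply: (@mfubiniF _ _ _ _ _ mu ((EFin \o f)^\+)%E) => //. exact: measurable_funepos.
  - apply: (@mfubiniF _ _ _ _ _ mu ((EFin \o f)^\-)%E) => //. exact: measurable_funeneg.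
apply/funext => t; rewrite integralE; congr (_ - _)%E; apply: eq_integral => x _. by rewrite !funeposE.
by rewrite !funenegE.
Qed.
End parameters.

(** * The renormalizing function *)

Section cosine.
Variable R : realType.
Implicit Types (lam z : R).

(** A nonnegative bounded function with bounded Lipschitz derivative and value 0 at 0. It has
    further zeros, in the nonzero multiples of 2 pi/lam, which is why several values of lam are used
    in the end. *)
Definition vercos lam z : R := 1 - cos (lam * z).
Definition dvercos lam z : R := lam * sin (lam * z).

Lemma dvercosP lam z : is_derive z (1 : R) (vercos lam) (dvercos lam z).
Proof.
have := is_deriveB (is_derive_cst (1 : R) z (1 : R)) (is_derive_trig lam 0 1 z).
rewrite /vercos (_ : cst 1 - _ = (fun z => 1 - cos (lam * z))); last first.
  by apply/funext => y; rewrite -[LHS]/(1 - (0 * sin (lam * y) + 1 * cos (lam * y))) mul0r add0r mul1r.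
by rewrite (_ : 0 - _ = dvercos lam z)// /dvercos; ring.
Qed.

Lemma dvercos_bound lam z : 0 <= lam -> `|dvercos lam z| <= lam.
Proof. by move=> l0; rewrite /dvercos normrM ger0_norm// ler_piMr ?sin_max. Qed.

Lemma vercos0 lam : vercos lam 0 = 0.
Proof. by rewrite /vercos mulr0 cos0 subrr. Qed.

Lemma vercos_ge0 lam z : 0 <= vercos lam z.
Proof. by rewrite subr_ge0 cos_le1. Qed.

Lemma vercos_bound lam z : `|vercos lam z| <= 2.
Proof. by rewrite ger0_norm ?vercos_ge0// /vercos; have := cos_geN1 (lam * z); lra. Qed.

Lemma vercos_lipschitz lam z z' : 0 <= lam -> `|vercos lam z - vercos lam z'| <= lam * `|z - z'|.
Proof. by move=> l0; apply: (chain_lipschitz (dvercosP lam)) => y; exact: dvercos_bound. Qed.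

Lemma dvercos_lipschitz lam z z' : `|dvercos lam z - dvercos lam z'| <= lam ^+ 2 * `|z - z'|.
Proof.
have d y : is_derive y (1 : R) (dvercos lam) (lam ^+ 2 * cos (lam * y)).
  have := is_derive_trig lam lam 0 y; rewrite mul0r oppr0 mul0r add0r -expr2.
  by rewrite (_ : (fun z => _) = dvercos lam)//; apply/funext => x; rewrite mul0r addr0.
apply: (chain_lipschitz d) => y; rewrite normrM ger0_norm ?sqr_ge0// ler_piMr ?sqr_ge0//. exact: cos_max.
Qed.

(** For lam = 1/(n+1) with n + 1 > |z|, a nonzero z gives an argument of modulus in ]0,1[; there the
    sine is nonzero, so the cosine is not 1. *)
Lemma vercos_eq0 z : (forall n : nat, vercos n.+1%:R^-1 z = 0) -> z = 0.
Proof.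
move=> H; apply/eqP; rewrite -normr_eq0; apply/negPn/negP => z0. have zp : 0 < `|z| by rewrite lt_neqAle eq_sym z0/=.
have [n hn] : exists n : nat, `|z| < n.+1%:R. by exists (Num.truncn `|z|); exact: truncnS_gt.
pose y := n.+1%:R^-1 * `|z|; have y0 : 0 < y by rewrite mulr_gt0 ?invr_gt0.
have y1 : y < 1 by rewrite /y mulrC ltr_pdivrMr ?mul1r. have c1 : cos y = 1.
  have := H n; rewrite /vercos => /eqP; rewrite subr_eq0 => /eqP E; rewrite [RHS]E /y.
  by case: (ger0P z) => _ //; rewrite mulrN cosN.
have s0 : sin y = 0 by apply/eqP; rewrite -sqrf_eq0 sin2cos2 c1 expr1n subrr.
have : 0 < sin y by rewrite sin_gt0_pi// y0 (lt_trans y1)// (lt_le_trans _ (pi_ge2 R))// ltr1n. by rewrite s0 ltxx.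
Qed.
End cosine.

Section smear_param.
Variables (R : realType) (d : nat).

Lemma mfun_rV_sub : mfun (fun w : 'rV[R]_d * 'rV[R]_d => w.1 - w.2).
Proof.
apply: measurable_fun_rVP => i.
rewrite (_ : (fun _ => _) = fun w : 'rV[R]_d * 'rV[R]_d => w.1 0 i - w.2 0 i); last by apply/funext => w; rewrite !mxE.
by apply: mfunB; apply: (mcomp (@mcoord R d i)).
Qed.

Lemma mfun_smear (f : R -> 'rV[R]_d -> R) k :
  jmfun (fun w => f w.1 w.2) -> mfun k ->
  jmfun (fun w => smear k (f w.1) w.2).
Proof.
move=> mf mk. apply: (@mfun_Rintegral_param _ _ (mST R d) 'rV[R]_d R haar
  (fun w : mST R d * 'rV[R]_d => f w.1.1 w.2 * k (w.2 - w.1.2))).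
have m11 : mfun (fun w : mST R d * 'rV[R]_d => w.1.1). exact: (mcomp mfst mfst).
have m12 : mfun (fun w : mST R d * 'rV[R]_d => w.1.2). exact: (mcomp msnd mfst). apply: mfunM.
  exact: (mcomp mf (measurable_fun_pair m11 msnd)). apply: (mcomp mk).
exact: (mcomp mfun_rV_sub (measurable_fun_pair msnd m12)).
Qed.

Lemma smear_le (f k : 'rV[R]_d -> R) (A M : R) x : mfun f -> (\int[haar]_y `|f y|%:E <= A%:E)%E -> smooth k -> 0 <= M ->
  (forall z, `|k z| <= M) -> `|smear k f x| <= A * M.
Proof.
move=> mf fA sk M0 kM; apply: (mulb_int mf _ fA M0 (fun y => kM (y - x))).2.
by apply: mfun_shift; exact: (sm_mfun sk).
Qed.
End smear_param.

Section product_tests.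
Variables (R : realType) (d : nat) (chi : R -> R) (k : 'rV[R]_d -> R).
Hypotheses (sc : smooth chi) (sk : smooth k).
Local Notation phi := (fun w : ST R d => chi w.1 * k w.2).

Lemma smooth_time : smooth (fun w : ST R d => chi w.1).
Proof. by apply: (@smooth_precomp R R _ fst fst) => // w; exact: cvg_fst. Qed.

Lemma smooth_space : smooth (fun w : ST R d => k w.2).
Proof. by apply: (@smooth_precomp R _ _ snd snd) => // w; exact: cvg_snd. Qed.

Lemma smooth_product : smooth phi.
Proof. by apply: sm_mul; [exact: smooth_time|exact: smooth_space]. Qed.

Lemma derive_dir0 (V : normedModType R) (f : V -> R) x : 'D_0 f x = 0.
Proof. by rewrite /derive; under eq_fun do rewrite scaler0 /= add0r subrr scaler0; exact: lim_cst. Qed.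

Lemma derive_product_time t x : 'D_((1, 0) : ST R d) phi (t, x) = 'D_1 chi t * k x.
Proof.
rewrite derive_smooth_mul; [|exact: smooth_time|exact: smooth_space].
rewrite (@derive_precomp R R _ fst fst)// (@derive_precomp R _ _ snd snd)//= derive_dir0.
by rewrite mulr0 add0r mulrC.
Qed.

Lemma derive_product_space v t x : 'D_((0, v) : ST R d) phi (t, x) = chi t * 'D_v k x.
Proof.
rewrite derive_smooth_mul; [|exact: smooth_time|exact: smooth_space].
rewrite (@derive_precomp R R _ fst fst)// (@derive_precomp R _ _ snd snd)//= derive_dir0. by rewrite mulr0 addr0.
Qed.
End product_tests.

(** All bounds are required at every time. A velocity that has them at almost every time is brought
    to this form by setting it to 0 at the exceptional times. *)
Record field (R : realType) (d : nat) (T q : R) (V : R -> 'rV[R]_d -> 'rV[R]_d) (Y : R -> R) : Prop := Field {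
  fld_measurable : forall j, jmfun
    (fun w => component V j w.1 w.2);
  fld_periodic : forall j t, Zper (component V j t);
  fld_norm : forall j t, (hnorm q (component V j t) <= (Y t)%:E)%E;
  fld_bound_measurable : mfun (Y : mR R -> R);
  fld_bound_integrable : (leb).-integrable `[0, T] (EFin \o Y);
  fld_div : forall t psi, smooth psi -> Zper psi ->
    \int[haar]_x (\sum_(i < d) V t x 0 i * 'D_('e_i) psi x) = 0 }.

(** * Renormalization and the zero solution *)

Section uniqueness.
Variables (R : realType) (d : nat) (p q T : R).
Hypotheses (p1 : 1 < p) (q1 : 1 < q) (pq : p^-1 + q^-1 = 1) (d0 : (0 < d)%N) (T0 : 0 < T).
Local Notation I := (`[0, T]%classic : set (mR R)).
Variables (V : R -> 'rV[R]_d -> 'rV[R]_d) (Y : R -> R) (g : 'I_d -> 'I_d -> R -> 'rV[R]_d -> R).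
Hypothesis fld : field T q V Y.
Hypothesis Hg : forall t j i, [/\ mfun (g j i t), Zper (g j i t),
  (hnorm q (g j i t) <= (Y t)%:E)%E & weak_partial i (component V j t) (g j i t)].
Variables (rho : R -> 'rV[R]_d -> R) (X : R).
Hypotheses (mr : jmfun (fun w => rho w.1 w.2))
  (pr : forall t, Zper (rho t)) (rX : forall t, (hnorm p (rho t) <= X%:E)%E).
Hypothesis weak : forall phi, test_function T phi ->
  \int[leb]_(t in I) (\int[haar]_x (rho t x * transport V phi t x)) = 0.

Let qp : q^-1 + p^-1 = 1. Proof. by rewrite addrC. Qed.
Let mI : measurable I. Proof. exact: mitv. Qed.
Let finI : (leb I < +oo)%E. Proof. by rewrite leb_itv/= lte_fin T0 -EFinB ltry. Qed.
Let mn := @mabsE R.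
Let X0 : 0 <= X. Proof. by rewrite -lee_fin (le_trans _ (rX 0))// Lnorm_ge0. Qed.
Let Y0 t : 0 <= Y t.
Proof. by rewrite -lee_fin (le_trans _ (fld_norm fld (Ordinal d0) t))// Lnorm_ge0. Qed.
Local Notation u := (component V).
Let mrt t : mfun (rho t) := slice_mfun t mr.
Let mut j t : mfun (u j t) := slice_mfun t (fld_measurable fld j).
Let rL t : (\int[haar]_x `|rho t x|%:E <= X%:E)%E := L1_le_Lp p1 q1 pq (mrt t) (rX t).
Let ruL t j : (\int[haar]_x `|rho t x * u j t x|%:E <= (X * Y t)%:E)%E :=
  hoelder_le p1 q1 pq (mrt t) (mut j t) (rX t) (fld_norm fld j t).
Let mru t j : mfun (fun x => rho t x * u j t x) := mfunM (mrt t) (mut j t).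

Section mollified.
Variable k : 'rV[R]_d -> R.
Hypotheses (sk : smooth k) (pk : Zper k).
Let sD (j : 'I_d) : smooth ('D_('e_j) k) := sm_D ('e_j) sk.
Let pD (j : 'I_d) : Zper ('D_('e_j) k) := periodic_D ('e_j) pk.
Let mD j : mfun ('D_('e_j) k) := sm_mfun (sD j).
Let mk : mfun k := sm_mfun sk.

Local Notation rn := (fun t x => smear k (rho t) x).
(** This is -div (rho u)_k, the weak time derivative of the mollified density at a fixed point x. *)
Definition mollified_flux t x : R := \sum_j smear ('D_('e_j) k) (fun y => rho t y * u j t y) x.
Local Notation Fn := mollified_flux.

Let bound_ex : exists M : R, [/\ 0 <= M, forall z, `|k z| <= M & forall j z, `|'D_('e_j) k z| <= M].
Proof.
have [M0 M00 HM0] := sm_bounded sk pk. pose M j := s2val (cid2 (sm_bounded (sD j) (pD j))).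
have Mge j : 0 <= M j by rewrite /M; case: cid2.
have HM j z : `|'D_('e_j) k z| <= M j by rewrite /M; case: cid2 => ? ? H; exact: H.
have Ms : 0 <= \sum_j M j by apply: sumr_ge0. exists (M0 + \sum_j M j); split; first exact: addr_ge0.
  by move=> z; rewrite (le_trans (HM0 z))// lerDl.
move=> j z; rewrite (le_trans (HM j z))// (bigD1 j)//= addrCA lerDl addr_ge0//. by apply: sumr_ge0.
Qed.

Let mrn : jmfun (fun w => rn w.1 w.2).
Proof. exact: mfun_smear. Qed.

Let mFn : jmfun (fun w => Fn w.1 w.2).
Proof.
apply: measurable_sum => j; apply: (@mfun_smear _ _ (fun t y => rho t y * u j t y)) => //.
by apply: mfunM => //; exact: (fld_measurable fld j).
Qed.

Lemma mollified_weak x (chi : R -> R) : smooth chi -> (exists2 T1, T1 < T & forall t, T1 <= t -> chi t = 0) ->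
  \int[leb]_(t in I) (rn t x * 'D_1 chi t + Fn t x * chi t) = 0.
Proof.
move=> sc [T1 T1T c0]; pose k' y := k (y - x). have sk' : smooth k' by exact: sm_shift.
have pk' : Zper k' by exact: Zper_shift. have tst : test_function T (fun w : ST R d => chi w.1 * k' w.2).
  split; [exact: smooth_product|by move=> t y z /=; rewrite pk'|]. by exists T1 => // t y /c0 /= ->; rewrite mul0r.
rewrite -[RHS](weak tst); apply: eqRint => t _. have i1 : hL1 (fun y => rho t y * k (y - x)).
  exact: (smear_int (mrt t) (rL t)). have i2 j : hL1 (fun y => rho t y * u j t y * 'D_('e_j) k (y - x)).
  exact: (smear_int (mru t j) (ruL t j) x (sD j) (pD j)). have [i3 i3E] := Rintegral_sum (index_enum 'I_d) i2.
transitivity (\int[haar]_y ('D_1 chi t * (rho t y * k (y - x)) + chi t * \sum_j (rho t y * u j t y * 'D_('e_j) k (y - x)))).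
  rewrite RintD//; [|exact: (intZl measurableT _ i1)|exact: (intZl measurableT _ i3)].
  by rewrite !RintZl// i3E mulrC [Fn t x * _]mulrC.
apply: eqRint => y _; rewrite /transport derive_product_time// mulrDr; congr (_ + _). by rewrite /k'; ring.
rewrite !mulr_sumr; apply: eq_bigr => j _; rewrite derive_product_space// derive_shift. by rewrite /component; ring.
Qed.

Variable lam : R.
Hypothesis l0 : 0 <= lam.
Let G t x := - vercos lam (rn t x) + (T - t) * (dvercos lam (rn t x) * Fn t x).

Let mver (c : R) : mfun (vercos c : R -> R) := is_derive_mfun (dvercosP c).

Let mdver : mfun (dvercos lam : R -> R).
Proof.
apply: mcontinuous => z; rewrite /dvercos; apply: cvgM; first exact: cst_continuous.
apply: (@cont_comp R R R (fun z => lam * z) sin _ (@continuous_sin R)) => y.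
by apply: cvgM; [exact: cst_continuous|exact: cvg_id].
Qed.

Let mG : jmfun (fun w => G w.1 w.2).
Proof.
apply: mfunD. by apply: mcomp => //; exact: (mcomp (mver lam) mrn).
apply: mfunM; first by apply: mfunB => //; exact: mfst. by apply: mfunM => //; exact: (mcomp mdver mrn).
Qed.

Let Fn_le : exists2 K : R, 0 <= K & forall t x, `|Fn t x| <= K * Y t.
Proof.
have [M [M0 kM DM]] := bound_ex; exists (d%:R * (X * M)); first by rewrite !mulr_ge0.
move=> t x; apply: le_trans (ler_norm_sum _ _ _) _. apply: (@le_trans _ _ (\sum_(j < d) (X * Y t * M))).
  by apply: ler_sum => j _; exact: (smear_le x (mru t j) (ruL t j) (sD j) M0 (DM j)).
by rewrite sumr_const card_ord -[_ *+ d]mulr_natl ?eqW//; ring.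
Qed.

Let mslice (f : R -> 'rV[R]_d -> R) x : jmfun (fun w => f w.1 w.2) ->
  mfun (fun t : mR R => f t x).
Proof. by move=> mf; exact: (mcomp mf (measurable_pair2 x)). Qed.

Lemma mollified_chain x : \int[leb]_(t in I) G t x = 0.
Proof.
have [M [M0 kM DM]] := bound_ex; have [K K0 FK] := Fn_le.
apply: (weak_chain T0 (dvercosP lam) (fun z => dvercos_bound z l0) (fun z z' => dvercos_lipschitz lam z z')
  (vercos0 lam) (mslice x mrn) (mslice x mFn)).
- apply: (@bnd_int _ _ _ _ _ mI finI _ (X * M)). by apply: mfunTS; exact: (mslice x mrn).
  by move=> t _; exact: (smear_le x (mrt t) (rL t) sk M0 kM).
- apply: (le_integrable mI _ _ (intZl mI K (fld_bound_integrable fld))).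
    by apply/mEFinP; apply: mfunTS; exact: (mslice x mFn).
  move=> t _; rewrite lee_fin; apply: le_trans (FK t x) _; exact: ler_norm.
- by move=> chi; exact: mollified_weak.
Qed.

Let comm_t t x := comm (fun j => u j t) k (rho t) x.

Let commFn t x : Fn t x = comm_t t x - \sum_j u j t x * 'D_('e_j) (rn t) x.
Proof.
rewrite /comm_t (commE p1 q1 pq (fun j => mut j t) (fun j => fld_norm fld j t) (mrt t) (rX t) x sk pk).
rewrite sumrB -addrA -opprD -[LHS]addr0; congr (_ + _); apply/esym/eqP; rewrite oppr_eq0 -big_split/=.
apply/eqP; apply: big1 => j _. by rewrite (derive_eq (is_derive_smear (mrt t) (rL t) x ('e_j) sk pk)) mulrN subrr.
Qed.

Lemma comm_time_mfun : jmfun (fun w => comm_t w.1 w.2).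
Proof.
rewrite (_ : (fun w => _) = fun w : ST R d => \sum_j (smear ('D_('e_j) k) (fun y => rho w.1 y * u j w.1 y) w.2 -
    u j w.1 w.2 * smear ('D_('e_j) k) (rho w.1) w.2)). apply: measurable_sum => j; apply: mfunB.
    apply: (@mfun_smear _ _ (fun t y => rho t y * u j t y)) => //.
    by apply: mfunM => //; exact: (fld_measurable fld j).
  by apply: mfunM; [exact: (fld_measurable fld j)|exact: mfun_smear]. apply/funext => w.
by rewrite /comm_t (commE p1 q1 pq (fun j => mut j w.1) (fun j => fld_norm fld j w.1) (mrt w.1) (rX w.1)).
Qed.

Let srn t : smooth (rn t) := smear_sm (mrt t) (rL t) sk pk.
Let prn t : Zper (rn t) := smear_periodic (rho t) pk.
Let mrnt t : mfun (rn t) := slice_mfun t mrn.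

Let bounded_int (f : 'rV[R]_d -> R) (c : R) : mfun f -> (forall x, `|f x| <= c) ->
  hL1 (f) /\ `|\int[haar]_x f x| <= c.
Proof.
by move=> mf fc; apply: normr_Rint_le => //; apply: prob_int_le => x; rewrite lee_fin.
Qed.

Lemma smooth_vercos (f : 'rV[R]_d -> R) : smooth f -> smooth (fun x => vercos lam (f x)).
Proof.
move=> sf; rewrite /vercos (_ : (fun x => _) = fun x => 1 + (-1) * cos (lam * f x)); last first.
  by apply/funext => x; rewrite mulN1r.
by apply: sm_add; [exact: sm_cst|apply: sm_mul; [exact: sm_cst|exact: smooth_cos]].
Qed.

(** The flux is the commutator minus u . grad of the mollified density. Multiplied by [dvercos] the
    latter becomes u . grad of a smooth function, whose integral is 0 because u is
    divergence-free. *)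
Lemma mollified_renormalized t :
  \int[haar]_x (dvercos lam (rn t x) * Fn t x) = \int[haar]_x (dvercos lam (rn t x) * comm_t t x).
Proof.
have [M [M0 kM DM]] := bound_ex; have [K K0 FK] := Fn_le. pose psi x := vercos lam (rn t x).
have spsi : smooth psi by exact: smooth_vercos. have ppsi : Zper psi by move=> x z; rewrite /psi prn.
have Dpsi j x : 'D_('e_j) psi x = dvercos lam (rn t x) * 'D_('e_j) (rn t) x.
  exact: (derive_eq (is_derive_chain ('e_j) (dvercosP lam (rn t x)) (srn t))). have mDpsi j : mfun ('D_('e_j) psi).
  exact: (sm_mfun (sm_D ('e_j) spsi)).
have mdv : mfun (fun x => dvercos lam (rn t x)) by exact: (mcomp mdver (mrnt t)).
have i1 j : hL1 (fun x => u j t x * 'D_('e_j) psi x).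
  have [N N0 HN] := sm_bounded (sm_D ('e_j) spsi) (periodic_D ('e_j) ppsi).
  exact: (mulb_int (mut j t) (mDpsi j) (L1_le_Lp q1 p1 qp (mut j t) (fld_norm fld j t)) N0 HN).1.
have [i2 _] := Rintegral_sum (index_enum 'I_d) i1. have i3 : hL1 (fun x => dvercos lam (rn t x) * Fn t x).
  have mdF : mfun (fun x => dvercos lam (rn t x) * Fn t x) := mfunM mdv (slice_mfun t mFn).
  have dF x : `|dvercos lam (rn t x) * Fn t x| <= lam * (K * Y t) by rewrite normrM ler_pM// dvercos_bound.
  exact: (bounded_int mdF dF).1. rewrite -[LHS]addr0 -[X in _ + X](fld_div fld t spsi ppsi) -RintD//.
apply: eqRint => x _; rewrite commFn mulrBr -[RHS]addr0 -addrA; congr (_ + _).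
by rewrite mulr_sumr -sumrN -big_split/=; apply: big1 => j _; rewrite Dpsi /component; ring.
Qed.

(** Integrating the chain rule over space, the integral of [vercos] equals that of (T - t) [dvercos]
    times the commutator, and these factors are at most T and lam. *)
Lemma vercos_comm_le : (\int[leb]_(t in I) (\int[haar]_x vercos lam (rn t x))%:E <=
  (T * lam)%:E * \int[leb]_(t in I) \int[haar]_x `|comm_t t x|%:E)%E.
Proof.
have [M [M0 kM DM]] := bound_ex; have [K K0 FK] := Fn_le; have T0' := ltW T0.
pose A t := \int[haar]_x vercos lam (rn t x). pose B t := \int[haar]_x (dvercos lam (rn t x) * Fn t x).
have mver_rn t : mfun (fun x => vercos lam (rn t x)) by exact: (mcomp (mver lam) (mrnt t)).
have mdF t : mfun (fun x => dvercos lam (rn t x) * Fn t x).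
  by apply: mfunM; [exact: (mcomp mdver (mrnt t))|exact: (slice_mfun t mFn)].
have [iv vA] : (forall t, hL1 (fun x => vercos lam (rn t x))) /\ (forall t, `|A t| <= 2).
  by split=> t; have [h1 h2] := bounded_int (mver_rn t) (fun x => vercos_bound lam (rn t x)).
have dF t x : `|dvercos lam (rn t x) * Fn t x| <= lam * (K * Y t) by rewrite normrM ler_pM// dvercos_bound.
have [idF BB] : (forall t, hL1 (fun x => dvercos lam (rn t x) * Fn t x)) /\ (forall t, `|B t| <= lam * (K * Y t)).
  by split=> t; have [h1 h2] := bounded_int (mdF t) (dF t).
have Tt t : I t -> 0 <= T - t <= T by rewrite /= in_itv/= => /andP[t0 tT]; rewrite subr_ge0 tT lerBlDr lerDl.
have mA : mfun (A : mR R -> R).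
  by apply: (@mfun_Rint _ _ _ haar (fun w => vercos lam (rn w.1 w.2))); exact: (mcomp (mver lam) mrn).
have mB : mfun (B : mR R -> R). apply: (@mfun_Rint _ _ _ haar (fun w => dvercos lam (rn w.1 w.2) * Fn w.1 w.2)).
  by apply: mfunM => //; exact: (mcomp mdver mrn). have iA : lL1 I A.
  by apply: (@bnd_int _ _ _ _ _ mI finI _ 2) => //; exact: mfunTS. have iB : lL1 I (fun t => (T - t) * B t).
  apply: (le_integrable mI _ _ (intZl mI (T * (lam * K)) (fld_bound_integrable fld))).
    by apply/mEFinP; apply: mfunTS; apply: mfunM => //; exact: mfunB.
  move=> t /Tt/andP[t1 t2]; rewrite lee_fin [leRHS]ger0_norm ?mulr_ge0//.
  by rewrite normrM ger0_norm// -!mulrA ler_pM. have zero : \int[leb]_(t in I) (- A t + (T - t) * B t) = 0.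
  transitivity (\int[leb]_(t in I) \int[haar]_x G t x). apply: eqRint => t _; rewrite /G RintD//.
    - rewrite [X in _ = _ + X]RintZl//; congr (_ + _).
      rewrite -[LHS]mulN1r -RintZl//; apply: eqRint => x _; exact: mulN1r.
    - by have := integrableN (iv t).
    - exact: (intZl measurableT (T - t) (idF t)).
  rewrite (@time_space_swap R _ _ haar I (fun w => G w.1 w.2) mI mG)/=.
    by apply: Rint_eq0 => x; exact: mollified_chain.
  apply: (@le_lt_trans _ _ (\int[leb]_(t in I) (2 + T * (lam * K) * Y t)%:E)%E).
    apply: int_le => t It; apply: (@prob_int_le _ _ _ haar _ (2 + T * (lam * K) * Y t)%:E) => x.
    rewrite lee_fin /G (le_trans (ler_normD _ _))// normrN lerD ?vercos_bound//. have /andP[t1 t2] := Tt t It.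
    by rewrite normrM ger0_norm// -!mulrA ler_pM//; have := dF t x; rewrite -mulrA.
  have : lL1 I (fun t => 2 + T * (lam * K) * Y t). have i2 : lL1 I (fun=> 2 : R).
      by apply: (@bnd_int _ _ _ _ _ mI finI (cst 2) 2) => // t _; rewrite ger0_norm.
    exact: (integrableD mI i2 (intZl mI (T * (lam * K)) (fld_bound_integrable fld))).
  move=> /integrableP[_]; apply: le_lt_trans; by apply: int_le => t _; rewrite lee_fin ler_norm.
have AB : \int[leb]_(t in I) A t = \int[leb]_(t in I) ((T - t) * B t).
  apply/eqP; rewrite eq_sym -subr_eq0 -RintB//; apply/eqP; rewrite -[RHS]zero. by apply: eqRint => t _; rewrite addrC.
rewrite -[leLHS]fineK; last exact: (int_fin mI iA). rewrite -[fine _]/(\int[leb]_(t in I) A t) AB.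
apply: (@le_trans _ _ (`|\int[leb]_(t in I) ((T - t) * B t)|%:E)%E); first by rewrite lee_fin ler_norm.
apply: (le_trans (Rint_abs_le _ _ _)). rewrite -int_scale ?mulr_ge0//.
apply: int_le => t /Tt/andP[t1 t2]; rewrite normrM ger0_norm// EFinM [in leRHS]EFinM -muleA lee_pmul ?lee_fin//.
rewrite /B mollified_renormalized. have mct := slice_mfun t comm_time_mfun.
apply: (le_trans (Rint_abs_le _ _ _)); by apply: (int_le_scale l0) => x _; rewrite -EFinM lee_fin normrM ler_wpM2r// dvercos_bound.
Qed.
End mollified.

Let aI A B := @filterI _ _ (ae_filter_ringOfSetsType (@lebesgue_measure R)) A B.

(** Along mollifiers with radii tending to 0 the commutators vanish in L^1 at each time, dominated
    by a multiple of Y, while the left-hand sides converge at each time; Fatou's lemma concludes. *)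
Lemma vercos_integral_eq0 lam : 0 <= lam -> (\int[leb]_(t in I) (\int[haar]_x vercos lam (rho t x))%:E = 0)%E.
Proof.
move=> l0; pose C := molC R. have /choice[K HK] : forall m : nat, exists ka : ('rV[R]_d -> R) * R,
    [/\ 0 < ka.2, ka.2 <= m.+1%:R^-1 & mollifier ka.1 ka.2 C].
  move=> m; have m0 : 0 < m.+1%:R^-1 :> R by rewrite invr_gt0.
  by have [k [a H]] := mollifier_near m0 d0; exists (k, a). have C0 : 0 <= C.
  have [_ _ mol] := HK 0%N; rewrite -lee_fin (le_trans _ (mol_dint mol (Ordinal d0)))//.
  apply: int_ge0 => z _; have [a0 _ _] := HK 0%N; by rewrite lee_fin mulr_ge0// ltW.
clearbody C; have sK m : smooth (K m).1 by have [_ _ mol] := HK m; exact: mol_smooth mol.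
have pK m : Zper (K m).1 by have [_ _ mol] := HK m; exact: mol_periodic mol.
pose c m t := (\int[haar]_x `|comm (fun j => u j t) (K m).1 (rho t) x|%:E)%E.
have c0 m t : (0 <= c m t)%E by apply: int_ge0 => x _; rewrite lee_fin. have mc m : mfun (c m : mR R -> \bar R).
  apply: (@mfubiniF _ _ (mR R) 'rV[R]_d R haar (fun w => `|comm (fun j => u j w.1) (K m).1 (rho w.1) w.2|%:E)) => //.
  apply/mEFinP; apply: mfun_norm. exact: comm_time_mfun. pose D := d%:R * (d%:R * (C * X)).
have cle m t : (c m t <= (D * Y t)%:E)%E. have [a0 _ mol] := HK m.
  have -> : D * Y t = d%:R * (d%:R * (C * (X * Y t))) by rewrite /D; ring.
  exact: (comm_bound p1 q1 pq d0 (fun j => mut j t) (fun j => fld_periodic fld j t) (fun j => fld_norm fld j t)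
    (fun j i => Hg t j i) (mrt t) (pr t) (rX t) a0 mol). have ccvg t : c m t @[m --> \oo] --> 0%E.
  apply/ecvg0P => // e e0.
  have [dl dl0 H] := comm_cvg p1 q1 pq d0 (fun j => mut j t) (fun j => fld_periodic fld j t) (fun j => fld_norm fld j t)
    (fun j i => Hg t j i) (fld_div fld t) (mrt t) (pr t) (rX t) C0 e0.
  have [N _ HN] : \forall m \near \oo, m.+1%:R^-1 <= dl. by apply: (cvgr_le (0 : R)) => //; exact: cvg_harmonic.
  exists N => // m Nm; have [a0 a1 mol] := HK m. by apply: (H _ _ a0 _ mol); rewrite (le_trans a1)// HN.
have Icvg : (\int[leb]_(t in I) c m t @[m --> \oo] --> 0)%E. rewrite -[X in _ --> X](@integral0 _ _ _ leb I).
  apply: (@dominated_cvg _ _ _ leb I mI c (cst 0%E) (EFin \o (fun t => D * Y t))) => //.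
  - by move=> m; exact: mfunTS.
  - by move=> t _; exact: ccvg.
  - exact: (intZl mI D (fld_bound_integrable fld)).
  - by move=> m t _; rewrite gee0_abs//; exact: cle. pose b t := \int[haar]_x vercos lam (rho t x).
pose bm m t := \int[haar]_x vercos lam (smear (K m).1 (rho t) x). have mver := is_derive_mfun (dvercosP lam).
have iver (f : 'rV[R]_d -> R) : mfun f -> hL1 (fun x => vercos lam (f x)).
  move=> mf; apply: (haar_bnd (M := 2)); first exact: (mcomp mver mf). by move=> x _; exact: vercos_bound.
have msm m t : mfun (smear (K m).1 (rho t)). exact: (sm_mfun (smear_sm (mrt t) (rL t) (sK m) (pK m))).
have bcvg t : bm m t @[m --> \oo] --> b t. apply/cvgrPdist_le => e e0.
  have e1 : 0 < e / (lam + 1) by rewrite divr_gt0// ltr_wpDl.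
  have [dl dl0 H] := smear_approx e1 (mrt t) (pr t) (le_lt_trans (rL t) (ltry _)).
  have [N _ HN] : \forall m \near \oo, m.+1%:R^-1 <= dl. by apply: (cvgr_le (0 : R)) => //; exact: cvg_harmonic.
  exists N => // m Nm /=; have [a0 a1 mol] := HK m. have {}H := H _ _ _ (le_trans a1 (HN m Nm)) mol.
  rewrite distrC /b /bm -RintB//; [|exact: (iver _ (msm m t))|exact: (iver _ (mrt t))].
  rewrite -lee_fin (le_trans (Rint_abs_le _ _ _))//.
  apply: (@le_trans _ _ (\int[haar]_x (lam%:E * `|smear (K m).1 (rho t) x - rho t x|%:E))%E).
    by apply: int_le => x _; rewrite -EFinM lee_fin vercos_lipschitz. rewrite int_scale//.
  apply: (@le_trans _ _ (lam%:E * (e / (lam + 1))%:E)%E); first by rewrite lee_wpmul2l ?lee_fin.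
  rewrite -EFinM lee_fin mulrCA ger_pMr// ler_pdivrMr ?mul1r ?lerDl//. by rewrite ltr_wpDl.
have mbm m : mfun (bm m : mR R -> R).
  apply: (@mfun_Rint _ _ _ haar (fun w => vercos lam (smear (K m).1 (rho w.1) w.2))).
  apply: (mcomp mver); apply: mfun_smear => //. exact: (sm_mfun (sK m)).
have bge0 t : 0 <= b t by apply: Rintegral_ge0 => x _; exact: vercos_ge0.
have bmge0 m t : 0 <= bm m t by apply: Rintegral_ge0 => x _; exact: vercos_ge0.
apply/eqP; rewrite eq_le; apply/andP; split; last by apply: int_ge0 => t _; rewrite lee_fin; exact: bge0.
apply/lee_addgt0Pr => e e0; rewrite add0e.
have e1 : 0 < e / (T * lam + 1) by rewrite divr_gt0// ltr_wpDl// mulr_ge0// ltW.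
have Ic0 m : (0 <= \int[leb]_(t in I) c m t)%E by apply: int_ge0. have [N _ HN] := (ecvg0P Ic0).1 Icvg _ e1.
apply: (@fatou_bound _ _ _ leb I mI (fun n t => (bm (n + N)%N t)%:E)).
- by move=> n; apply/mEFinP; exact: mfunTS.
- by move=> n t _; rewrite lee_fin.
- move=> t _; apply: cvg_EFin; first exact: nearW. have := bcvg t; rewrite -(cvg_shiftn N); exact.
- move=> n; apply: (le_trans (vercos_comm_le (sK (n + N)%N) (pK (n + N)%N) l0)).
  apply: (@le_trans _ _ ((T * lam)%:E * (e / (T * lam + 1))%:E)%E).
    rewrite lee_wpmul2l ?lee_fin//; first by rewrite mulr_ge0// ltW. by apply: HN; rewrite /= leq_addl.
  have Tl : 0 <= T * lam by rewrite mulr_ge0// ltW.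
  rewrite -EFinM lee_fin mulrCA ger_pMr// ler_pdivrMr ?mul1r ?lerDl//. by rewrite ltr_wpDl.
Qed.

(** The countably many values lam = 1/(n+1) leave a single null set of times, and at each other time
    a single null set of points, outside which [vercos_eq0] applies. *)
Theorem weak_solution_zero : {ae leb, forall t : R, I t -> {ae haar, forall x, rho t x = 0}}.
Proof.
have mver (lam : R) := is_derive_mfun (dvercosP lam).
have H (n : nat) : {ae leb, forall t, I t -> {ae haar, forall x, vercos n.+1%:R^-1 (rho t x) = 0}}.
  set lam : R := n.+1%:R^-1; have l0 : 0 <= lam by rewrite invr_ge0.
  have mb : mfun (fun t : mR R => \int[haar]_x vercos lam (rho t x)).
    by apply: (@mfun_Rint _ _ _ haar (fun w => vercos lam (rho w.1 w.2))); exact: (mcomp (mver lam) mr).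
  have E : (\int[leb]_(t in I) `|(\int[haar]_x vercos lam (rho t x))%:E| = 0)%E.
    rewrite -[RHS](vercos_integral_eq0 l0); apply: eq_integral => t _.
    by rewrite gee0_abs// lee_fin; apply: Rintegral_ge0 => x _; exact: vercos_ge0.
  have mEb : measurable_fun I (fun t => (\int[haar]_x vercos lam (rho t x))%:E). by apply/mEFinP; exact: mfunTS.
  have := (ae_eq_integral_abs leb mI mEb).1 E. apply: aesS => t h' It; have [h] := h' It.
  have mt : mfun (fun x => vercos lam (rho t x)) by exact: (mcomp (mver lam) (mrt t)).
  have it : hL1 (fun x => vercos lam (rho t x)). apply: (haar_bnd mt (M := 2)) => x _; exact: vercos_bound.
  have E2 : (\int[haar]_x `|(vercos lam (rho t x))%:E| = 0)%E.
    under eq_integral do rewrite gee0_abs ?lee_fin ?vercos_ge0//.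
    by rewrite -[LHS]fineK; [congr EFin|exact: (int_fin measurableT it)].
  have mEt : mfun (fun x => (vercos lam (rho t x))%:E) by exact/mEFinP.
  have := (ae_eq_integral_abs haar measurableT mEt).1 E2. by apply: filterS => x /(_ Logic.I) [].
have := ae_foralln H; apply: aesS => t ht It.
have := ae_foralln (fun n => ht n It); apply: filterS => x; exact: vercos_eq0.
Qed.
End uniqueness.

(** * Existence *)
Section hahn_banach.
Variables (R : realType) (W : lmodType R) (E : set W) (n : W -> R) (A0 : set (W * R)).
Hypotheses (En : forall f g (c : R), E f -> E g -> E (f + c *: g))
  (nD : forall f g, E f -> E g -> n (f + g) <= n f + n g)
  (nZ : forall f (c : R), 0 < c -> E f -> n (c *: f) = c * n f).

(** Partial linear functionals dominated by [n], encoded as graphs. That a graph is single-valued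
    follows: the difference of two values at one point is a value at 0, bounded by n 0 = 0 in both
    orders. *)
Definition dom_graph (A : set (W * R)) : Prop :=
  [/\ A0 `<=` A,
      forall f g a b (c : R), A (f, a) -> A (g, b) -> A (f + c *: g, a + c * b) &
      forall f a, A (f, a) -> E f /\ a <= n f].

Hypothesis A00 : A0 (0, 0).
Hypothesis A0P : dom_graph A0.

Let E0 : E 0. Proof. by have [_ _ H] := A0P; have [] := H 0 0 A00. Qed.

Let EZ f (c : R) : E f -> E (c *: f).
Proof. by move=> Ef; rewrite -[_ *: f]add0r; exact: En. Qed.

Let n0 : n 0 = 0.
Proof. by have := @nZ 0 2 (ltr0Sn _ 1) E0; rewrite scaler0 => h; lra. Qed.

Let graph_fun A f a b : dom_graph A -> A (f, a) -> A (f, b) -> a = b.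
Proof.
move=> [_ lin dom] Aa Ab. have := lin _ _ _ _ (-1) Aa Ab; rewrite scaleN1r subrr => /dom[_]; rewrite n0 => h1.
have := lin _ _ _ _ (-1) Ab Aa; rewrite scaleN1r subrr => /dom[_]; rewrite n0 => h2. lra.
Qed.

(** [alpha] is the supremum of the numbers a - n(g - f). They lie below every n(h + f) - b, because
    a + b <= n(g + h) and n is subadditive; homogeneity extends the bound to all multiples of f. *)
Let extension A f : dom_graph A -> E f -> exists2 alpha : R,
  dom_graph [set z | exists h c a, A (h, a) /\ z = (h + c *: f, a + c * alpha)] & True.
Proof.
move=> GA Ef; have [sub lin dom] := GA; have AZ := sub _ A00.
pose S := [set s : R | exists g a, A (g, a) /\ s = a - n (g - f)].
have EB g : E g -> E (g - f) by move=> Eg; rewrite -scaleN1r; exact: En.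
have ub h b : A (h, b) -> ubound S (n (h + f) - b).
  move=> Ab s [g [a [Aa ->]]]; have [Eg _] := dom _ _ Aa; have [Eh _] := dom _ _ Ab.
  have := lin _ _ _ _ 1 Aa Ab; rewrite scale1r mul1r => /dom[_ h1].
  rewrite (_ : g + h = (g - f) + (h + f)) in h1; last by rewrite addrACA [- f + f]addNr addr0.
  have Ehf : E (h + f) by rewrite -[f]scale1r; exact: En. have h2 := nD (EB _ Eg) Ehf; lra.
have S0 : S !=set0 by exists (0 - n (0 - f)), 0, 0.
have hS : has_sup S by split=> //; exists (n (0 + f) - 0); exact: ub. exists (sup S) => //; split.
- by move=> [g a] /sub Aa; exists g, 0, a; split=> //; rewrite scale0r mul0r !addr0.
- move=> _ _ _ _ c [h1 [c1 [a1 [Ah1 [-> ->]]]]] [h2 [c2 [a2 [Ah2 [-> ->]]]]].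
  exists (h1 + c *: h2), (c1 + c * c2), (a1 + c * a2); split; first exact: lin.
  by congr pair; [rewrite scalerDr scalerDl scalerA addrACA|ring].
- move=> _ _ [h [c [a [Aa [-> ->]]]]]; have [Eh ha] := dom _ _ Aa. split; first exact: En.
  have scaled (r : R) : A (r *: h, r * a) by have := lin _ _ _ _ r AZ Aa; rewrite !add0r.
  have [c0|c0|->] := ltrgtP c 0; last by rewrite scale0r mul0r !addr0.
  + have e0 : 0 < - c by rewrite oppr_gt0. have le1 : (- c)^-1 * a - n ((- c)^-1 *: h - f) <= sup S.
      by apply: ub_le_sup; [by case: hS|exists ((- c)^-1 *: h), ((- c)^-1 * a)].
    have E1 : n (h + c *: f) = (- c) * n ((- c)^-1 *: h - f). rewrite -nZ//; last by apply: EB; exact: EZ.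
      by rewrite scalerBr scalerA mulfV ?gt_eqF// scale1r scaleNr opprK. rewrite E1; have := ler_wpM2l (ltW e0) le1.
    by rewrite mulrBr mulrA mulfV ?gt_eqF// mul1r; lra.
  + have le1 : sup S <= n (c^-1 *: h + f) - c^-1 * a by apply: sup_le_ub => //; exact: ub.
    have E1 : n (h + c *: f) = c * n (c^-1 *: h + f).
      rewrite -nZ//; last by rewrite -[f]scale1r; apply: En => //; exact: EZ.
      by rewrite scalerDr scalerA mulfV ?gt_eqF// scale1r. rewrite E1; have := ler_wpM2l (ltW c0) le1.
    by rewrite mulrBr mulrA mulfV ?gt_eqF// mul1r; lra.
Qed.

Theorem Hahn_Banach : exists l : W -> R,
  [/\ forall f g (c : R), E f -> E g -> l (f + c *: g) = l f + c * l g,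
      forall f, E f -> l f <= n f & forall f a, A0 (f, a) -> l f = a].
Proof.
(* The union with [A0] makes the empty chain admissible: its union is the empty set, which
   corresponds to the given graph itself. *)
pose P := [set A : set (W * R) | dom_graph (A `|` A0)]. have [F FP Ftot|A [PA maxA]] := @Zorn_bigcup _ P.
  have two z w : (\bigcup_(X in F) X `|` A0) z -> (\bigcup_(X in F) X `|` A0) w ->
      (A0 z /\ A0 w) \/ exists2 X, F X & (X `|` A0) z /\ (X `|` A0) w.
    move=> [[X FX Xz]|z0] [[Z FZ Zw]|w0]; last by left.
    - right; have [XZ|ZX] := Ftot _ _ FX FZ. by exists Z => //; split; left => //; exact: XZ.
      by exists X => //; split; left => //; exact: ZX.
    - by right; exists X => //; split; [left|right].
    - by right; exists Z => //; split; [right|left]. have [_ lin0 dom0] := A0P.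
  have up X z : F X -> (X `|` A0) z -> (\bigcup_(X in F) X `|` A0) z. by move=> FX [Xz|]; [left; exists X|right].
  split=> //.
  - move=> f g a b c /two H /H[[h1 h2]|[X FX [h1 h2]]]; first by right; exact: lin0.
    by apply: (up _ _ FX); have [_ lin _] := FP _ FX; exact: lin.
  - move=> f a [[X FX Xz]|]; last exact: dom0. by have [_ _ dom] := FP _ FX; apply: dom; left.
have total f : E f -> exists a, (A `|` A0) (f, a). move=> Ef; apply: contrapT => nf.
  have [alpha GB _] := extension PA Ef; have [sub _ _] := GB. have [sub' _ _] := PA. set B := [set z | _] in GB sub.
  have AB : A `<=` B. by move=> [g a] Aa; exists g, 0, a; split; [left|rewrite scale0r mul0r !addr0]. apply: (maxA B).
    split=> // BA; apply: nf; exists alpha; left; apply: BA. exists 0, 1, 0; split; first exact: (sub' _ A00).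
    by rewrite add0r scale1r add0r mul1r. by rewrite /P/= (_ : B `|` A0 = B)//; apply: setUidl.
pose l f := xget 0 [set a | (A `|` A0) (f, a)]. have lP f : E f -> (A `|` A0) (f, l f).
  by move=> /total ex; exact: (xgetPex 0 ex). have [sub lin dom] := PA; exists l; split.
- move=> f g c Ef Eg; apply: (graph_fun PA); first by apply: lP; exact: En. by apply: lin; exact: lP.
- by move=> f /lP/dom[].
- move=> f a Aa; have [_ _ dom0] := A0P; have [Ef _] := dom0 _ _ Aa. by apply: (graph_fun PA (lP _ Ef)); exact: sub.
Qed.
End hahn_banach.

(** * Smooth substitutes for powers of the modulus *)

Section regularized_powers.
Variables (R : realType) (e : R).
Hypothesis e0 : 0 < e.

(** A smooth substitute for |z|^(2a); the test functions may vanish, where the power itself need not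
    be smooth. *)
Definition rpow (a z : R) : R := (z ^+ 2 + e) `^ a.

Inductive rpows : (R -> R) -> Prop :=
| rpows_base m a : rpows (fun z => z ^+ m * rpow a z)
| rpows_lin c f g : rpows f -> rpows g -> rpows (fun z => c * f z + g z).

Lemma rpow_base_gt0 z : 0 < z ^+ 2 + e.
Proof. by rewrite ltr_wpDl// sqr_ge0. Qed.

Lemma rpowD a b z : rpow (a + b) z = rpow a z * rpow b z.
Proof. by rewrite /rpow powRD// (gt_eqF (rpow_base_gt0 z)) implybT. Qed.

Lemma is_derive_rpow a z : is_derive z (1 : R) (rpow a) (2 * a * (z * rpow (a - 1) z)).
Proof.
have w0 := rpow_base_gt0 z. have d1 : is_derive z (1 : R) (fun z => z ^+ 2 + e) (2 * z).
  have := is_deriveD (is_deriveX 2 (is_derive_id z (1 : R))) (is_derive_cst e z (1 : R)).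
  by rewrite addr0 expr1 [_%:A]mulr1.
have := @is_derive1_comp _ ((@powR R)^~ a) (fun z => z ^+ 2 + e) z _ _ (is_derive1_powR a w0) d1.
by rewrite (_ : a * _ * (2 * z) = 2 * a * (z * rpow (a - 1) z)) /rpow; [|ring].
Qed.

Lemma rpows_derive h : rpows h -> exists2 h', rpows h' & forall x : R, is_derive x (1 : R) h (h' x).
Proof.
elim=> [m a|c f g _ [f' Ff' df] _ [g' Fg' dg]]; last first.
  exists (fun x => c * f' x + g' x) => [|x]; first exact: rpows_lin.
  by apply: is_deriveD; exact: (is_deriveZ c (df x)).
exists (fun z => 2 * a * (z ^+ m.+1 * rpow (a - 1) z) + ((m%:R - 1) * (z ^+ m.-1 * rpow a z) + z ^+ m.-1 * rpow a z)).
  by apply: rpows_lin; [exact: rpows_base|apply: rpows_lin; exact: rpows_base].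
move=> z; have := is_deriveM (is_deriveX m (is_derive_id z (1 : R))) (is_derive_rpow a z).
rewrite -![_ *: _]/(_ * _) (_ : id ^+ m * rpow a = (fun z => z ^+ m * rpow a z)).
  set D := (X in is_derive _ _ _ X); set D' := (X in _ -> is_derive _ _ _ X).
  have -> // : D = D'; rewrite /D /D' exprS; rewrite -[(id ^+ m) z]/((id ^+ m) z) exprfctE; ring.
by apply/funext => y; rewrite -[LHS]/((id ^+ m) y * rpow a y) exprfctE.
Qed.

Lemma smooth_rpow (V : normedModType R) (f : V -> R) a : smooth f -> smooth (fun x => rpow a (f x)).
Proof.
move=> sf; have H : rpows (rpow a). by rewrite (_ : rpow a = fun z => z ^+ 0 * rpow a z);
    [exact: rpows_base|apply/funext => z; rewrite expr0 mul1r]. exact: (@smooth_chain _ _ _ rpows_derive _ _ H).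
Qed.

Lemma rpow_ge0 a z : 0 <= rpow a z. Proof. exact: powR_ge0. Qed.

Lemma abs_le_rpow z : `|z| <= rpow 2^-1 z.
Proof.
have -> : `|z| = (`|z| `^ 2) `^ 2^-1 by rewrite -powRrM mulfV// powRr1.
apply: ge0_ler_powR; rewrite ?invr_ge0// ?nnegrE ?powR_ge0 ?(ltW (rpow_base_gt0 _))//.
by rewrite powR_mulrn// -normrX ger0_norm ?sqr_ge0// lerDl ltW.
Qed.

Lemma pow_abs_le_rpow a z : 0 <= a -> `|z| `^ a <= rpow (a / 2) z.
Proof.
move=> a0; apply: (@le_trans _ _ (rpow 2^-1 z `^ a)). by apply: ge0_ler_powR; rewrite ?nnegrE ?rpow_ge0 ?abs_le_rpow.
by rewrite /rpow -powRrM mulrC.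
Qed.

End regularized_powers.

(** * The adjoint a priori estimate *)

Section apriori.
Variables (R : realType) (d : nat) (p q T : R).
Hypotheses (p1 : 1 < p) (q1 : 1 < q) (pq : p^-1 + q^-1 = 1) (T0 : 0 < T).
Local Notation I := (`[0, T]%classic : set (mR R)).
Variables (V : R -> 'rV[R]_d -> 'rV[R]_d) (Y : R -> R).
Hypothesis fld : field T q V Y.
Let p0 : 0 < p := lt_trans ltr01 p1.
Let q0 : 0 < q := lt_trans ltr01 q1.
Let qp : q^-1 + p^-1 = 1. Proof. by rewrite addrC. Qed.
Let mn := @mabsE R.

Lemma slice_sm (f : ST R d -> R) t : smooth f -> smooth (fun x => f (t, x)).
Proof.
apply: (@smooth_precomp R _ _ (fun x : 'rV[R]_d => (t, x)) (fun x => (0, x))) => [h v w|].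
  by congr pair; rewrite /= scaler0 add0r.
by move=> x; apply: (@cvg_pair _ _ _ (nbhs x) (nbhs t) (nbhs x) _ _ _ (fun=> t) id); [exact: cvg_cst|exact: cvg_id].
Qed.

Lemma derive_slice (f : ST R d -> R) t x v : 'D_v (fun x => f (t, x)) x = 'D_((0, v) : ST R d) f (t, x).
Proof.
apply: (@derive_precomp R _ _ (fun x : 'rV[R]_d => (t, x)) (fun x => (0, x))) => h w w'.
by congr pair; rewrite /= scaler0 add0r.
Qed.

Lemma mtransport phi : smooth phi -> jmfun
  (fun w => transport V phi w.1 w.2).
Proof.
move=> sphi; rewrite /transport; have md v : jmfun ('D_v phi). by apply: cont_mfun2; exact: (sm_cont (sm_D v sphi)).
have E v : (fun w : ST R d => 'D_v phi (w.1, w.2)) = 'D_v phi by apply/funext => -[].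
apply: mfunD; first by rewrite E. apply: measurable_sum => i; apply: mfunM; first exact: (fld_measurable fld i).
by rewrite E.
Qed.

Section energy.
Variables (phi : ST R d -> R) (Lam : R).
Hypothesis tst : test_function T phi.
Hypothesis LamP : (\int[leb]_(t in I) hnorm q (transport V phi t) <= Lam%:E)%E.
Let sphi : smooth phi. Proof. by case: tst. Qed.
Let pphi t : Zper (fun x => phi (t, x)). Proof. by case: tst => _ H _; exact: H. Qed.

Section regularized.
Variable e : R.
Hypothesis e0 : 0 < e.
Let gam (w : ST R d) : R := rpow e (q / 2) (phi w).
Let dgam z : R := q * (z * rpow e (q / 2 - 1) z).
Let sgam : smooth gam. Proof. exact: smooth_rpow. Qed.
Let pgam t : Zper (fun x => gam (t, x)). Proof. by move=> x z; rewrite /gam pphi. Qed.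

Let Dgam v w : 'D_v gam w = dgam (phi w) * 'D_v phi w.
Proof.
have H := is_derive_rpow e0 (q / 2) (phi w). rewrite (derive_eq (is_derive_chain v H sphi)) /dgam.
by rewrite (_ : 2 * (q / 2) = q)//; field.
Qed.

Let dgam_le z : `|dgam z| <= q * rpow e ((q - 1) / 2) z.
Proof.
rewrite /dgam normrM gtr0_norm// ler_wpM2l ?(ltW q0)// normrM (ger0_norm (rpow_ge0 _ _ _)).
rewrite (_ : (q - 1) / 2 = 2^-1 + (q / 2 - 1)); last by field.
by rewrite (rpowD e0 2^-1) ler_wpM2r ?rpow_ge0 ?abs_le_rpow.
Qed.

Let G t := \int[haar]_x gam (t, x).

Let mgam t : mfun (fun x => gam (t, x)).
Proof. exact: (sm_mfun (slice_sm t sgam)). Qed.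

Let mL t : mfun (transport V phi t).
Proof. exact: (slice_mfun t (mtransport sphi)). Qed.

Let mdg t : mfun (fun x => dgam (phi (t, x))).
Proof.
have mphi : mfun (fun x => phi (t, x)). exact: (sm_mfun (slice_sm t sphi)). apply: mfunM => //; apply: mfunM => //.
exact: (sm_mfun (smooth_rpow e0 (q / 2 - 1) (slice_sm t sphi))).
Qed.

Let uL j t : (\int[haar]_x `|component V j t x|%:E <= (Y t)%:E)%E.
Proof. exact: (L1_le_Lp q1 p1 qp (slice_mfun t (fld_measurable fld j)) (fld_norm fld j t)). Qed.

(** The missing transport term u . grad gam integrates to 0 and may be added; the chain rule then
    collects [dgam] times the full transport of phi. *)
Lemma energy_rate t : \int[haar]_x 'D_((1, 0) : ST R d) gam (t, x) = \int[haar]_x (dgam (phi (t, x)) * transport V phi t x).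
Proof.
pose psi x := gam (t, x); have spsi : smooth psi by exact: slice_sm. have mDpsi j : mfun ('D_('e_j) psi).
  exact: (sm_mfun (sm_D ('e_j) spsi)). have i1 j : hL1 (fun x => component V j t x * 'D_('e_j) psi x).
  have [N N0 HN] := sm_bounded (sm_D ('e_j) spsi) (periodic_D ('e_j) (pgam t)).
  exact: (mulb_int (slice_mfun t (fld_measurable fld j)) (mDpsi j) (uL j t) N0 HN).1.
have [i2 _] := Rintegral_sum (index_enum 'I_d) i1. have i3 : hL1 (fun x => 'D_((1, 0) : ST R d) gam (t, x)).
  have sD := slice_sm t (sm_D ((1, 0) : ST R d) sgam). have pD : Zper (fun x => 'D_((1, 0) : ST R d) gam (t, x)).
    exact: (@periodic_derive2 R d gam _ (fun t => @pgam t) t). have [N N0 HN] := sm_bounded sD pD.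
  by apply: (haar_bnd (M := N)) => //; exact: (sm_mfun sD).
rewrite -[LHS]addr0 -[X in _ + X](fld_div fld t spsi (pgam t)) -RintD//.
apply: eqRint => x _; rewrite /transport mulrDr -Dgam; congr (_ + _).
by rewrite mulr_sumr; apply: eq_bigr => j _; rewrite derive_slice Dgam; ring.
Qed.

Lemma energy_balance t : 0 <= t <= T ->
  G T - G t = \int[leb]_(s in `[t, T]) \int[haar]_x (dgam (phi (s, x)) * transport V phi s x).
Proof.
move=> /andP[t0 tT]. have sD := sm_D ((1, 0) : ST R d) sgam.
transitivity (\int[haar]_x \int[leb]_(s in `[t, T]) 'D_((1, 0) : ST R d) gam (s, x)).
  have ig s : hL1 (fun x => gam (s, x)). have [N N0 HN] := sm_bounded (slice_sm s sgam) (@pgam s).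
    exact: (haar_bnd (mgam s) (fun x _ => HN x)). rewrite /G -RintB//; apply: eqRint => x _.
  have := line_FTC (0, x) ((1, 0) : ST R d) sgam tT. have E (s : R) : (0, x) + s *: ((1, 0) : ST R d) = (s, x).
    by congr pair; rewrite /= ?add0r ?scaler0 ?addr0// [_%:A]mulr1.
  by rewrite !E => <-; apply: eqRint => s _; rewrite E.
rewrite -(@time_space_swap R _ _ haar `[t, T] (fun w => 'D_((1, 0) : ST R d) gam (w.1, w.2)))//.
- by apply: eqRint => s _; rewrite energy_rate.
- rewrite (_ : (fun w => _) = 'D_((1, 0) : ST R d) gam); last by apply/funext => -[].
  by apply: cont_mfun2; exact: (sm_cont sD).
- have [N N0 HN] := @periodic_bounded2 R d _ t T (sm_cont sD) (@periodic_derive2 R d gam _ (fun t => @pgam t)).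
  apply: (@le_lt_trans _ _ (\int[leb]_(s in `[t, T]) (cst N%:E s))%E). apply: int_le => s; rewrite /= in_itv/= => sT.
    by apply: (@prob_int_le _ _ _ haar _ N%:E) => x; rewrite lee_fin HN.
  have ltT : (leb (`[t, T]%classic : set (mR R)) < +oo)%E.
    by rewrite leb_itv/=; case: ifP => _; rewrite ?ltry// -EFinB ltry. by rewrite integral_cst// lte_mul_pinfty.
Qed.

(** Hölder in space: since (q - 1)p = q, the p-th power of |dgam| is at most q^p gam, with integral
    at most q^p m. The energy at T is the constant e^(q/2), because phi vanishes there. *)
Lemma energy_le m : 0 <= m -> (forall t, 0 <= t <= T -> G t <= m) -> forall t, 0 <= t <= T ->
  G t <= rpow e (q / 2) 0 + q * m `^ p^-1 * Lam.
Proof.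
move=> m0 Gm t tT; have GT : G T = rpow e (q / 2) 0. have [_ _ [T1 T1T H]] := tst.
  rewrite /G (_ : (fun x => gam (T, x)) = cst (rpow e (q / 2) 0)); last first.
    by apply/funext => x; rewrite /gam H// ltW.
  by rewrite Rintegral_cst// [X in fine X](_ : _ = 1%E) ?mulr1//; exact: prob_setT.
rewrite -GT -lerBlDl -opprB lerNl -lerNl; apply: (@le_trans _ _ `|G T - G t|). by rewrite -normrN ler_norm.
rewrite energy_balance//; case/andP: tT => t0 tT. have mtT : measurable (`[t, T]%classic : set (mR R)) by exact: mitv.
have mdL : jmfun (fun w => dgam (phi w) * transport V phi w.1 w.2). apply: mfunM; last exact: mtransport.
  apply: mfunM => //; apply: mfunM. by apply: cont_mfun2; exact: (sm_cont sphi).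
  by apply: cont_mfun2; exact: (sm_cont (smooth_rpow e0 (q / 2 - 1) sphi)).
have mN : mfun (fun s : mR R => hnorm q (transport V phi s)%E). by apply: mfun_Lnorm_slices; exact: mtransport.
rewrite -lee_fin (le_trans (Rint_abs_le _ _ _))//. have c0 : 0 <= q * m `^ p^-1 by rewrite mulr_ge0 ?powR_ge0// ltW.
apply: (@le_trans _ _ (\int[leb]_(s in `[t, T]) ((q * m `^ p^-1)%:E * hnorm q (transport V phi s)))%E).
  apply: int_le => s; rewrite /= in_itv/= => /andP[ts sT]. apply: (le_trans (Rint_abs_le _ _ _)).
  have := hoelder haar (mdg s) (mL s) p0 q0 pq; rewrite Lnorm1 => h; apply: (le_trans h).
  rewrite lee_wpmul2r ?Lnorm_ge0//. apply: Lnorm_powR => //. have -> : (q * m `^ p^-1) `^ p = q `^ p * m.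
    by rewrite powRM ?powR_ge0 ?ltW// -powRrM mulVf ?gt_eqF// powRr1.
  apply: (@le_trans _ _ (\int[haar]_x ((q `^ p)%:E * (gam (s, x))%:E))%E).
    apply: int_le => x _; rewrite -EFinM lee_fin. have -> : gam (s, x) = rpow e ((q - 1) / 2) (phi (s, x)) `^ p.
      rewrite /gam /rpow -powRrM; congr (_ `^ _). have E : q + p = p * q.
        have <- : (p^-1 + q^-1) * (p * q) = p * q by rewrite pq mul1r. by field; rewrite !gt_eqF.
      rewrite (_ : (q - 1) / 2 * p = (p * q - p) / 2); last by field. by rewrite -E addrK.
    rewrite -powRM ?rpow_ge0 ?(ltW q0)//; apply: ge0_ler_powR; rewrite ?nnegrE ?(ltW p0)//.
    by rewrite mulr_ge0 ?rpow_ge0// ltW. rewrite int_scale ?powR_ge0//.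
  rewrite EFinM lee_wpmul2l ?lee_fin ?powR_ge0//. have ig : hL1 (fun x => gam (s, x)).
    have [N N0 HN] := sm_bounded (slice_sm s sgam) (@pgam s). exact: (haar_bnd (mgam s) (fun x _ => HN x)).
  rewrite -[leLHS]fineK; last exact: (int_fin measurableT ig).
  by rewrite lee_fin; apply: Gm; rewrite sT (le_trans t0). rewrite int_scale//.
rewrite [leRHS]EFinM lee_wpmul2l ?lee_fin//; apply: (le_trans _ LamP).
have mI : measurable (`[0%R, T]%classic : set (mR R)) by exact: mitv.
have sub := @ge0_subset_integral _ _ R leb _ _ mtT mI _ (mfunTS mN). apply: sub => [s _|s /=]; first exact: Lnorm_ge0.
by rewrite !in_itv/= => /andP[ts ->]; rewrite (le_trans t0).
Qed.

(** For m the supremum of the energy, m <= e^(q/2) + m^(1/p) q Lam; Young's inequality absorbs m/p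
    in the left-hand side and leaves m/q. *)
Lemma energy_bound : G 0 <= q * rpow e (q / 2) 0 + (q * Lam) `^ q.
Proof.
have Lam0 : 0 <= Lam. by rewrite -lee_fin (le_trans _ LamP)// int_ge0// => t _; exact: Lnorm_ge0.
have [N N0 HN] := @periodic_bounded2 R d _ 0 T (sm_cont sgam) pgam. have gam0 w : 0 <= gam w by exact: rpow_ge0.
have GN t : 0 <= t <= T -> G t <= N.
  move=> tT; have := Rintegral_le_bound measurableT (@haar_ltoo R d) N0 (mgam t) (fun x _ => HN t x tT).
  rewrite [X in _ * fine X](_ : _ = 1%E) ?mulr1; last exact: prob_setT. exact: le_trans (ler_norm _).
have G0 t : 0 <= G t by exact: Rintegral_ge0. pose S := [set G t | t in [set t | 0 <= t <= T]]. have hS : has_sup S.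
  split; first by exists (G 0), 0 => //=; rewrite lexx ltW. by exists N => _ [t tT <-]; exact: GN.
pose m := sup S; have Gm t : 0 <= t <= T -> G t <= m. by move=> tT; apply: ub_le_sup; [by case: hS|exists t].
have T00 : 0 <= (0 : R) <= T by apply/andP; split => //; exact: ltW.
have m0 : 0 <= m by exact: le_trans (G0 0) (Gm 0 T00). have mle : m <= rpow e (q / 2) 0 + q * m `^ p^-1 * Lam.
  apply: sup_le_ub; first by case: hS. by move=> _ [t tT <-]; exact: energy_le.
have young : m `^ p^-1 * (q * Lam) <= m / p + (q * Lam) `^ q / q.
  have := conjugate_powR (powR_ge0 m p^-1) (_ : 0 <= q * Lam) p0 q0 pq.
  by rewrite -powRrM mulVf ?gt_eqF// powRr1//; apply; rewrite mulr_ge0// ltW. apply: (le_trans (Gm 0 T00)).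
have : m * q^-1 <= rpow e (q / 2) 0 + (q * Lam) `^ q / q.
  have -> : m * q^-1 = m - m / p by rewrite -{2}[m]mulr1 -pq; ring.
  rewrite lerBlDr; apply: (le_trans mle); rewrite -addrA lerD2l.
  by rewrite (_ : q * _ * Lam = m `^ p^-1 * (q * Lam)) 1?addrC//; ring.
rewrite ler_pdivrMr// mulrDl divfK ?gt_eqF// => /le_trans; apply. by rewrite mulrC.
Qed.
End regularized.

Lemma apriori : (hnorm q ((fun x => phi (0%R, x))) <= (q * Lam)%:E)%E.
Proof.
have Lam0 : 0 <= Lam. by rewrite -lee_fin (le_trans _ LamP)// int_ge0// => t _; exact: Lnorm_ge0.
apply: Lnorm_powR => //; first by rewrite mulr_ge0// ltW. apply/lee_addgt0Pr => eta eta0.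
(* Chosen so that the regularization error q e^(q/2) is exactly [eta]. *)
pose e := (eta / q) `^ (2 / q); have e0 : 0 < e by rewrite powR_gt0// divr_gt0. have := energy_bound e0.
have -> : rpow e (q / 2) 0 = eta / q.
  rewrite /rpow expr0n add0r /e -powRrM (_ : 2 / q * (q / 2) = 1); last by field; rewrite gt_eqF.
  by rewrite powRr1// ltW// divr_gt0. rewrite mulrCA mulfV ?gt_eqF// mulr1 addrC => h.
pose gam x := rpow e (q / 2) (phi (0, x)). have sg : smooth gam by exact: (slice_sm 0 (smooth_rpow e0 (q / 2) sphi)).
have pg : Zper gam by move=> x z; rewrite /gam pphi. have ig : hL1 (gam). have [N N0 HN] := sm_bounded sg pg.
  exact: (haar_bnd (sm_mfun sg) (fun x _ => HN x)). apply: (@le_trans _ _ (\int[haar]_x (gam x)%:E)%E).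
  by apply: int_le => x _; rewrite lee_fin pow_abs_le_rpow// ltW.
rewrite -[leLHS]fineK; last exact: (int_fin measurableT ig). by rewrite -EFinD lee_fin.
Qed.
End energy.
End apriori.

(** * The space L^1(0,T;L^q) *)

Section mixN.
Variables (R : realType) (d : nat) (q T : R).
Hypotheses (q1 : 1 < q) (T0 : 0 < T).
Local Notation I := (`[0, T]%classic : set (mR R)).
Implicit Types (f g : ST R d -> R) (t c : R).
Let q0 : 0 < q := lt_trans ltr01 q1.
Let mI : measurable I. Proof. exact: mitv. Qed.

Definition snorm f t := (hnorm q ((fun x => f (t, x))))%E.

Record mixed f : Prop := Mixed {
  mixed_meas : jmfun f;
  mixed_slice : forall t, (snorm f t < +oo)%E;
  mixed_int : lL1 I (fun t => fine (snorm f t)) }.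

Definition mixN f := \int[leb]_(t in I) fine (snorm f t).

Lemma slice_fineE f t : mixed f -> (fine (snorm f t))%:E = snorm f t.
Proof. by move=> mf; rewrite fineK// ge0_fin_numE ?Lnorm_ge0//; exact: mixed_slice. Qed.

Lemma jmslice f t : jmfun f -> mfun (fun x => f (t, x)).
Proof. by move=> mf; apply: (mcomp mf); exact: mpair1. Qed.

Lemma mfun_snorm f : jmfun f -> mfun (snorm f : mR R -> \bar R).
Proof.
move=> mf; apply: (@mfun_Lnorm_slices R d q (fun t x => f (t, x))).
by rewrite (_ : (fun w => _) = f)//; apply/funext => -[].
Qed.

Lemma mixed_dom f (Y : R -> R) : jmfun f -> lL1 I Y ->
  (forall t, snorm f t <= (Y t)%:E)%E -> mixed f /\ mixN f <= \int[leb]_(t in I) Y t.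
Proof.
move=> mf iY fY; have ff t : snorm f t \is a fin_num.
  by rewrite ge0_fin_numE ?Lnorm_ge0// (le_lt_trans (fY t))// ltry.
have le t : fine (snorm f t) <= Y t by rewrite -lee_fin fineK. have ifn : lL1 I (fun t => fine (snorm f t)).
  apply: le_integrable iY => //.
    by apply/mEFinP; apply: mfunTS; apply: (mcomp (fine_measurable measurableT)); exact: mfun_snorm.
  by move=> t _; rewrite /= lee_fin ger0_norm ?fine_ge0 ?Lnorm_ge0// (le_trans (le t))// ler_norm.
split; last exact: le_Rintegral. by split=> // t; rewrite (le_lt_trans (fY t))// ltry.
Qed.

Lemma slice_Lnorm_le f g t : (forall x, `|f (t, x)| <= `|g (t, x)|) -> (snorm f t <= snorm g t)%E.
Proof. exact: Lnorm_le_abs. Qed.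

Lemma mixed_le f g : jmfun f -> mixed g -> (forall w, `|f w| <= `|g w|) -> mixed f.
Proof.
move=> mf mg fg; apply: (mixed_dom mf (mixed_int mg) _).1 => t. by rewrite slice_fineE//; exact: slice_Lnorm_le.
Qed.

Lemma slice_Lnorm_scale f c t (X : R) : jmfun f -> (snorm f t <= X%:E)%E -> (snorm (c *: f) t <= (`|c| * X)%:E)%E.
Proof.
move=> mf h; have X0 : 0 <= X by rewrite -lee_fin (le_trans (Lnorm_ge0 _ _ _) h).
apply: Lnorm_powR => //; first by rewrite mulr_ge0. under eq_integral do rewrite /= normrM powRM// EFinM.
rewrite powRM// EFinM int_scale ?powR_ge0//. by rewrite lee_wpmul2l ?lee_fin ?powR_ge0//; exact: powR_integral_le.
Qed.

Lemma mixed_scale f c : mixed f -> mixed (c *: f) /\ mixN (c *: f) <= `|c| * mixN f.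
Proof.
move=> mf; have iY : lL1 I (fun t => `|c| * fine (snorm f t)). exact: (intZl mI `|c| (mixed_int mf)).
rewrite -RintZl//; last exact: mixed_int. apply: mixed_dom => //; first by apply: mfunM => //; exact: mixed_meas.
by move=> t; apply: slice_Lnorm_scale; [exact: mixed_meas|rewrite slice_fineE].
Qed.

Lemma mixed_add f g : mixed f -> mixed g -> mixed (f + g) /\ mixN (f + g) <= mixN f + mixN g.
Proof.
move=> mf mg; rewrite -RintD//; [|exact: mixed_int..]. apply: mixed_dom; first by apply: mfunD; exact: mixed_meas.
  exact: (integrableD mI (mixed_int mf) (mixed_int mg)).
move=> t; rewrite EFinD !slice_fineE//; apply: minkowski_EFin; [| |exact: ltW]; by apply: jmslice; exact: mixed_meas.
Qed.

Lemma mixed_lin f g c : mixed f -> mixed g -> mixed (f + c *: g).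
Proof. by move=> mf mg; apply: (mixed_add mf _).1; exact: (mixed_scale c mg).1. Qed.

Lemma mixed_normZ f c : 0 < c -> mixed f -> mixN (c *: f) = c * mixN f.
Proof.
move=> c0 mf; have [mcf] := mixed_scale c mf; rewrite gtr0_norm// => le1. apply/le_anti; rewrite le1/= -ler_pdivlMl//.
have [_] := mixed_scale c^-1 mcf; rewrite gtr0_norm ?invr_gt0// scalerA mulVf ?gt_eqF//. by rewrite scale1r.
Qed.

Lemma mixed_bounded f (M : R) : jmfun f -> 0 <= M -> (forall w, `|f w| <= M) ->
  mixed f /\ mixN f <= M * T.
Proof.
move=> mf M0 fM. have -> : M * T = \int[leb]_(t in I) M. rewrite Rintegral_cst//; congr (_ * _).
  by rewrite [X in fine X]leb_itv/= lte_fin T0 oppr0 adde0. apply: mixed_dom => //.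
  apply/integrableP; split; first exact: mcst. by rewrite integral_cst//= [X in (_ * X)%E]leb_itv/= lte_fin T0 ltry.
by move=> t; exact: Lnorm_bounded.
Qed.

Lemma mixed_cvg0 (h : nat -> ST R d -> R) f : (forall n, jmfun (h n)) -> mixed f ->
  (forall n w, `|h n w| <= `|f w|) -> (forall w, \forall n \near \oo, h n w = 0) ->
  mixN (h n) @[n --> \oo] --> 0.
Proof.
move=> mh mf hf h0; have mhn n := mixed_le (mh n) mf (hf n); have mf' := mixed_meas mf.
have sl t : (snorm (h n) t @[n --> \oo] --> 0)%E. apply/ecvg0P => [n|]; first exact: Lnorm_ge0.
  apply: (Lnorm_cvg0 (X := fine (snorm f t)) q0 (fun n => jmslice t (mh n)) (jmslice t mf')) => //.
  by rewrite slice_fineE.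
have := @dominated_cvg _ _ _ leb I mI (fun n => snorm (h n)) (cst 0%E) (EFin \o (fun t => fine (snorm f t))).
rewrite integral0 => cv; apply: (@fine_cvg _ _ _ _ (fun n => \int[leb]_(t in I) (fine (snorm (h n) t))%:E)%E 0).
under eq_fun do under eq_integral do rewrite slice_fineE//. apply: cv => //.
- by move=> n; apply: mfunTS; exact: mfun_snorm.
- by move=> t _; exact: sl.
- exact: mixed_int.
- move=> n t _; rewrite /= slice_fineE// gee0_abs ?Lnorm_ge0//; exact: slice_Lnorm_le.
Qed.
End mixN.

(** * Space-time measure *)

Section spacetime.
Variables (R : realType) (d : nat).
Local Notation Z := (mST R d).
Let mu : {measure set Z -> \bar R} := (leb \x haar)%E.

(** The product measure under a name of its own, to which the sigma-finite structure used by the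
    Radon-Nikodym theorem is attached. *)
Definition spacetime : set Z -> \bar R := mu.
HB.instance Definition _ := Measure.on spacetime.

Let spacetime_sigma_finite : sigma_finite setT spacetime.
Proof.
have [F TF Foo] := sigma_finiteT (@lebesgue_measure R); exists (fun n => F n `*` setT).
  rewrite -setXTT TF predeqE => -[x y]; split; last by move=> [n _ []/= Fx _]; split=> //; exists n.
  by move=> [/= [n _ Fnx] _]; exists n. move=> k; have [? ?] := Foo k; split; first exact: measurableX.
by rewrite /spacetime /mu/= product_measure1E// lte_mul_pinfty ?ge0_fin_numE//; exact: haar_ltoo.
Qed.
HB.instance Definition _ := Measure_isSigmaFinite.Build _ _ _ spacetime spacetime_sigma_finite.

Lemma spacetime_Rint (f : ST R d -> R) : spacetime.-integrable setT (EFin \o f : Z -> \bar R) ->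
  \int[spacetime]_w f w = \int[leb]_t \int[haar]_x f (t, x).
Proof.
move=> intf; have iF := integrable_fubini_F intf. congr fine; rewrite -[LHS](integral12_prod_meas1 intf).
apply: ae_eq_integral => //.
- by have /integrableP[] := iF.
- have /integrableP[mF _] := iF; apply/mEFinP. exact: (mcomp (fine_measurable measurableT) mF).
- apply: aesS (integrable_ae measurableT iF) => x /(_ Logic.I) xf _. by rewrite /Rintegral fineK.
Qed.
End spacetime.

(** * Representation of functionals on L^1(0,T;L^q) *)

Section representation.
Variables (R : realType) (d : nat) (p q T C : R).
Hypotheses (p1 : 1 < p) (q1 : 1 < q) (pq : p^-1 + q^-1 = 1) (T0 : 0 < T) (C0 : 0 < C).
Local Notation I := (`[0, T]%classic : set (mR R)).
Local Notation Z := (mST R d).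
Local Notation mu := (@spacetime R d).
Local Notation mixed := (mixed q T).
Local Notation mixN := (mixN q T).
Variable l : (ST R d -> R) -> R.
Hypotheses (l_lin : forall f g (c : R), mixed f -> mixed g -> l (f + c *: g) = l f + c * l g)
  (l_le : forall f, mixed f -> l f <= C * mixN f).
Let p0 : 0 < p := lt_trans ltr01 p1.
Let q0 : 0 < q := lt_trans ltr01 q1.
Let mI : measurable I. Proof. exact: mitv. Qed.

Let mixed0 : mixed (0 : ST R d -> R).
Proof.
apply: (@mixed_bounded R d q T q1 T0 (fun=> 0) 0 _ (lexx 0) _).1; first exact: mcst. by move=> w; rewrite normr0.
Qed.

Let l0 : l 0 = 0.
Proof. by have := l_lin 1 mixed0 mixed0; rewrite scale1r addr0 mul1r => h; lra. Qed.

Let lZ f c : mixed f -> l (c *: f) = c * l f.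
Proof. by move=> mf; have := l_lin c mixed0 mf; rewrite l0 !add0r. Qed.

Let lD f g : mixed f -> mixed g -> l (f + g) = l f + l g.
Proof. by move=> mf mg; have := l_lin 1 mf mg; rewrite scale1r mul1r. Qed.

Lemma functional_abs_le f : mixed f -> `|l f| <= C * mixN f.
Proof.
move=> mf; rewrite ler_norml l_le// andbT lerNl -mulN1r -lZ//.
have [m1 h1] := mixed_scale q1 (-1) mf; apply: (le_trans (l_le m1)).
by rewrite ler_pM2l//; move: h1; rewrite normrN1 mul1r.
Qed.

Let indic_mixed (A : set Z) : measurable A -> mixed (\1_A : ST R d -> R).
Proof.
move=> mA; apply: (mixed_bounded q1 T0 _ ler01 _).1; first exact: mindic.
by move=> w; rewrite indicE; case: (_ \in _); rewrite ?normr1 ?normr0.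
Qed.

Let nu (A : set Z) : \bar R := (l (\1_A : ST R d -> R))%:E.

Let nu0 : nu set0 = 0%E.
Proof. by rewrite /nu (_ : \1_set0 = 0) ?l0//; apply/funext => w; rewrite indic0. Qed.

Let nu_fin A : measurable A -> nu A \is a fin_num.
Proof. by []. Qed.

(** The indicator of the union minus a partial sum of indicators tends to 0 pointwise and is at most
    1, hence tends to 0 in [mixN], and the functional is continuous for that norm. *)
Let nu_sigma : semi_sigma_additive nu.
Proof.
move=> F mF tF mU. pose s n : ST R d -> R := \sum_(0 <= i < n) (\1_(F i) : ST R d -> R). have mixs n : mixed (s n).
  rewrite /s; elim: n => [|n IH]; first by rewrite big_geq//; exact: mixed0.
  by rewrite big_nat_recr//=; exact: (mixed_add q1 IH (indic_mixed (mF n))).1.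
have ls n : \sum_(0 <= i < n) nu (F i) = (l (s n))%:E. rewrite /s; elim: n => [|n IH]; first by rewrite !big_geq// l0.
  by rewrite !big_nat_recr//= IH -EFinD -lD//; [exact: mixs|exact: indic_mixed].
have sE n w : s n w = \sum_(0 <= i < n) \1_(F i) w. rewrite /s; elim: n => [|n IH]; first by rewrite !big_geq.
  by rewrite !big_nat_recr//= -IH. have disj i w : F i w -> forall j, j != i -> \1_(F j) w = 0 :> R.
  move=> Fi j ji; rewrite indicE memNset// => Fj; move/eqP: ji; apply. by apply: (tF j i) => //; exists w.
have sF n i w : F i w -> s n w = (i < n)%:R. move=> Fi; rewrite sE; have [lt|ge] := ltnP i n.
    rewrite (bigD1_seq i) ?mem_index_iota ?iota_uniq//= big1 ?addr0 => [|j ji]; last exact: (disj _ _ Fi).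
    by rewrite indicE mem_set. rewrite big_nat big1// => j /andP[_ jn]; apply: (disj i) => //.
  by rewrite neq_ltn (leq_trans jn ge). pose h n := (\1_(\bigcup_i F i) : ST R d -> R) + (-1) *: s n.
have mh n : mixed (h n) by apply: mixed_lin => //; exact: indic_mixed.
have hE n w : h n w = if pselect (exists i, F i w) is left _ then 1 - s n w else 0.
  rewrite /h /= -[(_ + _) w]/(_ + -1 * s n w) mulN1r; case: pselect => [[i Fi]|nF].
    by rewrite indicE mem_set//; exists i. rewrite indicE memNset => [|[i _ Fi]]; last by apply: nF; exists i.
  rewrite sE big1 ?subr0// => i _; rewrite indicE memNset// => Fi; by apply: nF; exists i.
have cv : mixN (h n) @[n --> \oo] --> 0. apply: (@mixed_cvg0 _ _ _ _ q1 h (fun=> 1)) => [n| |n w|w].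
  - exact: mixed_meas (mh n).
  - by apply: (mixed_bounded q1 T0 _ ler01 _).1 => // w; rewrite normr1.
  - rewrite hE normr1; case: pselect => [[i Fi]|_]; last by rewrite normr0.
    by rewrite (sF _ _ _ Fi); case: (_ < _)%N; rewrite ?subrr ?subr0 ?normr0 ?normr1.
  - have [[i Fi]|nF] := pselect (exists i, F i w). exists i.+1 => // n /= ni; rewrite hE; case: pselect => // _.
      by rewrite (sF _ _ _ Fi) ni subrr. by apply: nearW => n; rewrite hE; case: pselect.
rewrite (_ : (fun n => _) = (fun n => (l (s n))%:E)); last by apply/funext => n; exact: ls.
apply: cvg_EFin; first exact: nearW.
apply/cvgrPdist_le => e e0; move/cvgrPdist_le: cv => /(_ (e / C)); rewrite divr_gt0// => /(_ isT).
apply: filterS => n; rewrite sub0r normrN => hn /=.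
rewrite (_ : _ - _ = l (h n)); last by rewrite /h l_lin ?mulN1r//; exact: indic_mixed.
apply: (le_trans (functional_abs_le (mh n))); rewrite -ler_pdivlMl// mulrC; apply: le_trans hn. exact: ler_norm.
Qed.

HB.instance Definition _ := isCharge.Build _ _ _ nu nu0 nu_fin nu_sigma.

Let nu_mu : nu `<< mu.
Proof.
apply/null_content_dominatesP => A mA A0. have mm := indic_mixed mA; suff n0 : mixN \1_A = 0.
  by have := functional_abs_le mm; rewrite n0 mulr0 normr_le0 => /eqP lA; rewrite /nu lA.
have E0 : (\int[leb]_t `|haar (xsection A t)| = 0)%E.
  by rewrite -[RHS]A0; apply: eq_integral => t _; rewrite gee0_abs.
have mX : mfun (fun t : mR R => haar (xsection A t)) by exact: measurable_fun_xsection.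
suff H : {ae leb, forall t, I t -> (fine (snorm q \1_A t))%:E = 0%E}.
  rewrite /mixN /Rintegral (ae_eq_integral (cst 0%E) _ mI _ _ H) ?integral0//. exact: measurable_int (mixed_int mm).
apply: aesS ((ae_eq_integral_abs leb measurableT mX).1 E0) => t /(_ Logic.I) h _.
rewrite (slice_fineE t mm) /snorm Lnorm_EFinE. rewrite (_ : \int[haar]_x _ = 0)%E ?poweR0r ?invr_eq0 ?gt_eqF//.
rewrite -[RHS]h -[in RHS](setIT (xsection A t)) -integral_indic//; last exact: measurable_xsection.
apply: eq_integral => x _; rewrite !indicE mem_xsection.
by case: (_ \in _); rewrite ?normr1 ?powR1// normr0 powR0 ?gt_eqF.
Qed.

Lemma representation_density : exists g : ST R d -> R,
  [/\ jmfun g, mu.-integrable setT (EFin \o g : Z -> \bar R) &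
    forall A : set Z, measurable A -> l \1_A = \int[mu]_w (\1_A w * g w)].
Proof.
pose G := Radon_Nikodym nu mu. have Gf w : G w \is a fin_num by exact: (Radon_Nikodym_fin_num _ nu_mu).
have iG : mu.-integrable setT G by exact: (Radon_Nikodym_integrable nu_mu).
have GE : (EFin \o (fine \o G) : Z -> \bar R) = G by apply/funext => w /=; rewrite fineK. exists (fine \o G); split.
- by apply/mEFinP; rewrite GE; exact: (measurable_int mu).
- by rewrite GE.
- move=> A mA; have := @Radon_Nikodym_integral _ _ _ nu mu A nu_mu mA.
  rewrite /nu => /(congr1 fine)/= ->; rewrite integral_mkcond; congr fine.
  apply: eq_integral => w _; rewrite patchE indicE; case: ifP => _; last by rewrite mul0r.
  by rewrite mul1r -[RHS]/((EFin \o (fine \o G)) w) GE.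
Qed.
Let l_abs := functional_abs_le.

(** The sum counts the positive integers up to y, so it is the integer part of y. *)
Lemma layer_cake (n : nat) (y : R) : 0 <= y <= n%:R ->
  `|y - \sum_(k < n) (k.+1%:R <= y)%R%:R| <= 1.
Proof.
have full m (z : R) : m%:R <= z -> \sum_(k < m) (k.+1%:R <= z)%R%:R = m%:R :> R.
  move=> mz; rewrite (eq_bigr (fun=> 1)) ?sumr_const ?card_ord// => k _. by rewrite (le_trans _ mz)// ler_nat ltn_ord.
elim: n => [|n IH] /andP[y0 yn]; first by rewrite big_ord0 subr0 (le_trans _ ler01)// ger0_norm.
rewrite big_ord_recr/=; have [le|gt] := leP y n%:R. rewrite [X in _ - (_ + X)](_ : _ = 0) ?addr0 ?IH ?y0//.
  by rewrite leNgt (le_lt_trans le) ?ltr_nat.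
rewrite (full n y (ltW gt)); have E : n%:R + 1 = n.+1%:R :> R := natr1 n; have [h|h] := leP n.+1%:R y; rewrite /= ?addr0 ler_norml; apply/andP; split; lra.
Qed.

Section density.
Variable g : ST R d -> R.
Hypotheses (mg : jmfun g) (ig : mu.-integrable setT (EFin \o g : Z -> \bar R))
  (lg : forall A : set Z, measurable A -> l \1_A = \int[mu]_w (\1_A w * g w)).
Implicit Types f : ST R d -> R.

Let bounded f M := [/\ jmfun f, 0 <= M & forall w, `|f w| <= M].

Let bmixed f M : bounded f M -> mixed f /\ mixN f <= M * T.
Proof. by case=> mf M0 fM; exact: mixed_bounded. Qed.

Let K := \int[mu]_w `|g w|.

Let pairing f M : bounded f M -> mu.-integrable setT (EFin \o (fun w => g w * f w) : Z -> \bar R) /\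
  `|\int[mu]_w (g w * f w)| <= K * M.
Proof.
case=> mf M0 fM; apply: (@mulb_int _ Z R mu g f K M) => //.
rewrite /K /Rintegral fineK//; apply: (int_fin measurableT). exact: (integrable_norm ig).
Qed.

Let K0 : 0 <= K. Proof. by apply: Rintegral_ge0. Qed.

Let defect f := l f - \int[mu]_w (g w * f w).

Let b_lin f h (M N c : R) : bounded f M -> bounded h N -> bounded (f + c *: h) (M + `|c| * N).
Proof.
move=> [mf M0 fM] [mh N0 hN]; split.
- by apply: mfunD => //; exact: mfunM.
- by rewrite addr_ge0// mulr_ge0.
- by move=> w; rewrite (le_trans (ler_normD _ _))// lerD// normrM ler_wpM2l.
Qed.

Let defect_lin f h (M N c : R) : bounded f M -> bounded h N -> defect (f + c *: h) = defect f + c * defect h.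
Proof.
move=> bf bh; rewrite /defect l_lin; [|exact: (bmixed bf).1|exact: (bmixed bh).1].
have [i1 _] := pairing bf; have [i2 _] := pairing bh.
rewrite (_ : \int[mu]_w _ = \int[mu]_w (g w * f w) + c * \int[mu]_w (g w * h w)); first by ring.
rewrite -RintZl// -RintD//; last exact: (intZl measurableT c i2).
by apply: eqRint => w _; rewrite -[(f + c *: h) w]/(f w + c * h w) mulrDr mulrCA.
Qed.

Let b_indic (A : set Z) : measurable A -> bounded (\1_A) 1.
Proof.
move=> mA; split=> [|//|w]; first exact: mindic. by rewrite indicE; case: (_ \in _); rewrite ?normr1 ?normr0.
Qed.

Let defect_indic (A : set Z) : measurable A -> defect (\1_A) = 0.
Proof. by move=> mA; apply/eqP; rewrite subr_eq0 lg//; apply/eqP/eqRint => w _; rewrite mulrC. Qed.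

Let defect_sum (A : nat -> set Z) (n : nat) : (forall k, measurable (A k)) ->
  bounded (\sum_(k < n) (\1_(A k) : ST R d -> R)) n%:R /\
  defect (\sum_(k < n) (\1_(A k) : ST R d -> R)) = 0.
Proof.
move=> mA; elim: n => [|n [IH1 IH2]]. rewrite big_ord0; have b0 : bounded 0 0.
    by split=> //; [exact: mcst|move=> w; rewrite normr0].
  split=> //; have := defect_lin 1 b0 b0; rewrite scaler0 addr0; lra.
rewrite big_ord_recr/= -[X in _ + X]scale1r; split.
  by have := b_lin 1 IH1 (b_indic (mA n)); rewrite normr1 mul1r natr1.
by rewrite (defect_lin 1 IH1 (b_indic (mA n))) IH2 defect_indic// mulr0 addr0.
Qed.

(** The defect vanishes on indicators, hence on combinations of indicators of superlevel sets, and
    such combinations approximate a bounded function uniformly. *)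
Lemma representation_bounded f (M : R) : jmfun f -> 0 <= M -> (forall w, `|f w| <= M) ->
  l f = \int[mu]_w (g w * f w).
Proof.
move=> mf M0 fM; have bf : bounded f M by []. suff H (n : nat) : (0 < n)%N -> `|defect f| <= (C * T + K) / n%:R.
  apply/eqP; rewrite -subr_eq0 -normr_le0; apply/ler_addgt0Pr => e e0; rewrite add0r.
  have [n n0 hn] := nat_above ((C * T + K + 1) / e).
  apply: (le_trans (H n n0)); rewrite ler_pdivrMr ?ltr0n// -ler_pdivrMl// mulrC.
  by apply: le_trans hn; rewrite ler_pM2r ?invr_gt0// lerDl. move=> n0; have n0' : 0 < n%:R :> R by rewrite ltr0n.
have [m m0 Mm] := nat_above (n%:R * (M + M)). pose A k : set Z := [set w | k.+1%:R <= n%:R * (f w + M)].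
have mA k : measurable (A k). rewrite -[A k]setTI; apply: (measurable_fun_le measurableT (mcst _)).
  by apply: mfunM => //; apply: mfunD. have [bS rS] := defect_sum m mA; set S := \sum_(k < m) _ in bS rS.
have b1 := b_indic (@measurableT _ Z); have r1 := defect_indic (@measurableT _ Z).
(* f' = f + M - S/n, where S is the integer part of n(f + M); hence |f'| <= 1/n. *)
pose h := f + (- n%:R^-1) *: S; pose f' := h + M *: \1_(setT : set Z).
have [bh bs] : bounded h (M + `|- n%:R^-1| * m%:R) /\ bounded f' (M + `|- n%:R^-1| * m%:R + `|M| * 1).
  have bh := b_lin (- n%:R^-1) bf bS; split=> //; exact: b_lin. have le w : `|f' w| <= n%:R^-1.
  rewrite (_ : f' w = n%:R^-1 * (n%:R * (f w + M) - S w)); last first.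
    rewrite -[f' w]/(f w + - n%:R^-1 * S w + M * \1_setT w) indicE in_setT mulr1. by field; rewrite gt_eqF.
  rewrite normrM gtr0_norm ?invr_gt0// ler_piMr// ?invr_ge0 ?(ltW n0')//.
  rewrite (_ : S w = \sum_(k < m) (k.+1%:R <= n%:R * (f w + M))%R%:R).
    apply: layer_cake; have := fM w; rewrite ler_norml => /andP[f1 f2].
    rewrite mulr_ge0 ?ler0n//=; last by rewrite -lerBlDr sub0r. by apply: (le_trans _ Mm); rewrite ler_pM2l// lerD2r.
  rewrite /S fct_sumE; apply: eq_bigr => k _; rewrite indicE; congr (nat_of_bool _)%:R.
  by apply/idP/idP => [/set_mem|hk]; [|apply/mem_set].
have bf' : bounded f' n%:R^-1 by case: bs => mf' _ _; split=> //; rewrite invr_ge0. have E : defect f = defect f'.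
  by rewrite /f' (defect_lin M bh b1) /h (defect_lin _ bf bS) rS r1 !mulr0 !addr0.
rewrite E (le_trans (ler_normB _ _))// mulrDl lerD//; last exact: (pairing bf').2.
have [mf' h'] := bmixed bf'; apply: (le_trans (l_abs mf')). by rewrite -mulrA ler_pM2l// mulrC.
Qed.
End density.

Section pairing.
Variable rho : ST R d -> R.
Hypotheses (mrho : jmfun rho) (rhoC : forall t, (snorm p rho t <= C%:E)%E).
Implicit Types f : ST R d -> R.
Let pair f t := \int[haar]_x (rho (t, x) * f (t, x)).

Lemma pairing_slice f t : mixed f ->
  hL1 (fun x => rho (t, x) * f (t, x)) /\ `|pair f t| <= C * fine (snorm q f t).
Proof.
move=> mf; have mf' := mixed_meas mf; apply: normr_Rint_le => //.
  by apply: mfunM; [exact: (jmslice t mrho)|exact: jmslice].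
apply: (hoelder_le p1 q1 pq); [exact: (jmslice t mrho)|exact: jmslice|exact: rhoC|]. by rewrite (slice_fineE t mf).
Qed.

Lemma pairing_integrable f : mixed f -> leb.-integrable I (EFin \o pair f) /\ `|\int[leb]_(t in I) pair f t| <= C * mixN f.
Proof.
move=> mf; have iC := intZl mI C (mixed_int mf). have ip : leb.-integrable I (EFin \o pair f).
  apply: (le_integrable mI _ _ iC). apply/mEFinP/mfunTS; apply: (@mfun_Rint _ _ _ haar (fun w => rho w * f w)).
    by apply: mfunM => //; exact: mixed_meas mf.
  by move=> t _; rewrite /= lee_fin (le_trans (pairing_slice t mf).2)// ler_norm.
split=> //; apply: (le_trans (le_normr_Rintegral mI ip)). rewrite -RintZl//; last exact: mixed_int.
apply: le_Rintegral => //; first exact: (integrable_norm ip). by move=> t _; exact: (pairing_slice t mf).2.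
Qed.
End pairing.

Section dual_bound.
Variable g : ST R d -> R.
Hypotheses (mg : jmfun g) (ig : mu.-integrable setT (EFin \o g : Z -> \bar R))
  (lg : forall (f : Z -> R) M, jmfun f -> 0 <= M -> (forall w, `|f w| <= M) -> l f = \int[mu]_w (g w * f w)).
Implicit Types f : ST R d -> R.

Let K := \int[mu]_w `|g w|.
Let gK : (\int[mu]_w `|g w|%:E <= K%:E)%E.
Proof. by rewrite /K /Rintegral fineK//; apply: (int_fin measurableT); exact: (integrable_norm ig). Qed.

Section truncated.
Variable k : nat.
Let G w : R := Num.min `|g w| k%:R.
Let phi t := \int[haar]_x (G (t, x) `^ p).

Let G0 w : 0 <= G w. Proof. by rewrite le_min normr_ge0 ler0n. Qed.
Let Gk w : G w <= k%:R. Proof. by rewrite ge_min lexx orbT. Qed.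
Let mG (r : R) : jmfun (fun w => G w `^ r).
Proof.
apply: (mcomp (measurable_powR r)); apply: measurable_minr; last exact: mcst. exact: mfun_norm.
Qed.
Let Gb r w : 0 <= r -> `|G w `^ r| <= k%:R `^ r.
Proof. by move=> r0; rewrite ger0_norm ?powR_ge0// ge0_ler_powR// nnegrE. Qed.
Let ms t : mfun (fun x => G (t, x) `^ p).
Proof. exact: (jmslice t (mG p)). Qed.
Let isl t : hL1 (fun x => G (t, x) `^ p).
Proof. by apply: (haar_bnd (ms t)) => x _; apply: Gb; exact: ltW. Qed.
Let mphi : mfun (phi : mR R -> R).
Proof. exact: (@mfun_Rint _ _ _ haar _ (mG p)). Qed.
Let phi0 t : 0 <= phi t. Proof. by apply: Rintegral_ge0 => x _; exact: powR_ge0. Qed.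
Let phik t : phi t <= k%:R `^ p.
Proof.
have := Rintegral_le_bound measurableT (@haar_ltoo R d) (powR_ge0 k%:R p) (ms t) (fun x _ => Gb (t, x) (ltW p0)).
rewrite [X in _ * fine X](_ : _ = 1%E) ?mulr1; last exact: prob_setT. exact: le_trans (ler_norm _).
Qed.

Let S : set R := [set t | I t /\ C `^ p < phi t].
Let mS : measurable (S : set (mR R)).
Proof.
rewrite (_ : S = I `&` phi @^-1` `]C `^ p, +oo[%classic); last first.
  by apply/seteqP; split=> t [It h]; split=> //; move: h; rewrite /= in_itv/= andbT.
by apply: measurableI => //; rewrite -[_ @^-1` _]setTI; apply: mphi.
Qed.
Let mS1 : mfun (\1_(S : set (mR R)) : mR R -> R).
Proof. exact: mindic. Qed.

(** The extremal function of Hölder's inequality, sign(g) |g|^(p-1), with |g| truncated at k and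
    restricted to the times where the slice is too large. The truncation makes it bounded, so the
    density represents the functional on it. *)
Let f w : R := \1_S w.1 * (if 0 <= g w then G w `^ (p - 1) else - (G w `^ (p - 1))).
Let p10 : 0 <= p - 1. Proof. by rewrite subr_ge0 ltW. Qed.
Let mf : jmfun f.
Proof.
apply: mfunM; first exact: (mcomp mS1 mfst).
apply: (@measurable_fun_ifT _ _ Z R (fun w => G w `^ (p - 1)) (fun w => - G w `^ (p - 1)) (fun w => 0 <= g w)).
- by apply: measurable_fun_ler => //; exact: mcst.
- exact: mG.
- by apply: mcomp => //; exact: mG.
Qed.
Let fE w : `|f w| = \1_S w.1 * G w `^ (p - 1).
Proof. by rewrite normrM [`|\1_S _|]ger0_norm//; case: ifP => _; rewrite ?normrN ger0_norm ?powR_ge0. Qed.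
Let fb w : `|f w| <= k%:R `^ (p - 1).
Proof.
rewrite fE indicE; case: (_ \in _); rewrite ?mul0r ?powR_ge0// mul1r.
by have := Gb w p10; rewrite ger0_norm ?powR_ge0.
Qed.

Let Ifin : (leb I < +oo)%E.
Proof. by rewrite [X in (X < _)%E]leb_itv/= lte_fin T0 ltry. Qed.

Let i1 : lL1 I (fun t => \1_S t * phi t).
Proof.
apply: (bnd_int mI Ifin (M := k%:R `^ p)); first by apply: mfunTS; exact: mfunM.
move=> t _; rewrite ger0_norm ?mulr_ge0// indicE; case: (_ \in _); first by rewrite mul1r. by rewrite mul0r powR_ge0.
Qed.

Let i2 : lL1 I (fun t => \1_S t * phi t `^ q^-1).
Proof.
apply: (bnd_int mI Ifin (M := (k%:R `^ p) `^ q^-1)).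
  by apply: mfunTS; apply: mfunM => //; exact: (mcomp (measurable_powR q^-1) mphi).
move=> t _; rewrite ger0_norm ?mulr_ge0 ?powR_ge0// indicE; case: (_ \in _); last by rewrite mul0r powR_ge0.
by rewrite mul1r ge0_ler_powR ?nnegrE ?powR_ge0// invr_ge0 ltW.
Qed.

Let test_lower : \int[leb]_(t in I) (\1_S t * phi t) <= l f.
Proof.
rewrite (lg mf (powR_ge0 _ _) fb). pose h w := \1_S w.1 * G w `^ p. have hg w : h w <= g w * f w.
  rewrite /h /f mulrCA ler_wpM2l//.
  have -> : g w * (if 0 <= g w then G w `^ (p - 1) else - G w `^ (p - 1)) = `|g w| * G w `^ (p - 1).
    by case: leP => g0; rewrite ?mulrN -?mulNr; [rewrite ger0_norm|rewrite ltr0_norm].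
  have -> : G w `^ p = G w * G w `^ (p - 1). transitivity (G w `^ (1 + (p - 1))); first by rewrite addrC subrK.
    have c : (1 + (p - 1) == 0) = false by rewrite addrC subrK gt_eqF. by rewrite [LHS]powRD ?c// powRr1.
  by rewrite ler_wpM2r ?powR_ge0// ge_min lexx. have h0 w : 0 <= h w by rewrite mulr_ge0 ?powR_ge0.
have mh : jmfun h by apply: mfunM; [exact: (mcomp mS1 mfst)|exact: mG].
have [igf _] := @mulb_int _ Z R mu g f _ _ mg mf gK (powR_ge0 _ _) fb.
have ih : mu.-integrable setT (EFin \o h : Z -> \bar R).
  apply: (le_integrable measurableT _ _ igf); first exact/mEFinP.
  by move=> w _; rewrite /= lee_fin ger0_norm// (le_trans (hg w))// ler_norm.
apply: (@le_trans _ _ (\int[mu]_w h w)); last exact: le_Rintegral.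
rewrite spacetime_Rint// [leLHS]Rintegral_mkcond ?eqW//.
apply: eqRint => t _; have -> : \int[haar]_x h (t, x) = \1_S t * phi t by rewrite /phi -RintZl//; exact: isl.
rewrite patchE; case: ifPn => // /negP nI. by rewrite indicE memNset ?mul0r// => -[It]; case: nI; exact/mem_set.
Qed.

Let test_upper : l f <= C * \int[leb]_(t in I) (\1_S t * phi t `^ q^-1).
Proof.
have [mxf nf] : mixed f /\ mixN f <= \int[leb]_(t in I) (\1_S t * phi t `^ q^-1).
  apply: mixed_dom => // t; rewrite /snorm; apply: Lnorm_powR => //; first by rewrite mulr_ge0 ?powR_ge0.
  have -> : (\1_S t * phi t `^ q^-1) `^ q = \1_S t * phi t :> R.
    rewrite powRM ?powR_ge0// -powRrM mulVf ?gt_eqF// powRr1//; congr (_ * _).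
    by rewrite indicE; case: (_ \in _); rewrite ?powR1// powR0 ?gt_eqF. have pq' : (p - 1) * q = p.
    have E : q + p = p * q. have <- : (p^-1 + q^-1) * (p * q) = p * q by rewrite pq mul1r. by field; rewrite !gt_eqF.
    by rewrite mulrBl -E mul1r addrC addKr. rewrite (eq_integral (fun x => (\1_S t)%:E * (G (t, x) `^ p)%:E)%E).
    rewrite int_scale//. by rewrite EFinM /phi /Rintegral fineK//; exact: (int_fin measurableT (isl t)).
  move=> x _; rewrite fE powRM ?powR_ge0// -powRrM pq' EFinM; congr (_%:E * _)%E.
  by rewrite indicE; case: (_ \in _); rewrite ?powR1// powR0 ?gt_eqF.
apply: (le_trans (ler_norm _)); apply: (le_trans (l_abs mxf)). by rewrite ler_pM2l.
Qed.

Let gap_gt0 t : C `^ p < phi t -> 0 < phi t - C * phi t `^ q^-1.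
Proof.
move=> Cphi; have ph0 : 0 < phi t by rewrite (le_lt_trans (powR_ge0 _ _) Cphi).
have E : phi t = phi t `^ p^-1 * phi t `^ q^-1 by rewrite -powRD ?pq ?powRr1// oner_eq0.
rewrite [X in X - _]E -mulrBl mulr_gt0 ?powR_gt0// subr_gt0.
have -> : C = (C `^ p) `^ p^-1 by rewrite -powRrM mulfV ?gt_eqF// powRr1// ltW.
by apply: gt0_ltr_powR; rewrite ?invr_gt0// nnegrE ?powR_ge0// ltW.
Qed.

(** Testing with the extremal function bounds the integral of phi over S by C times that of
    phi^(1/q). But phi > C phi^(1/q) as soon as phi > C^p, so S is a null set. *)
Lemma truncated_slice_bound : {ae leb, forall t, I t -> phi t <= C `^ p}.
Proof.
pose H t := \1_S t * phi t - C * (\1_S t * phi t `^ q^-1).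
have HE t : H t = \1_S t * (phi t - C * phi t `^ q^-1) by rewrite /H; ring. have H0 t : 0 <= H t.
  rewrite HE indicE; have [/set_mem[_ h]|] := boolP (t \in S); last by rewrite mul0r. by rewrite mul1r ltW// gap_gt0.
have iH : lL1 I H. exact: (integrableB mI i1 (intZl mI C i2)). have E : (\int[leb]_(t in I) `|(H t)%:E| = 0)%E.
  under eq_integral do rewrite gee0_abs ?lee_fin//. rewrite -[LHS]fineK; last exact: (int_fin mI iH).
  congr EFin; apply/eqP; rewrite eq_le Rintegral_ge0// andbT -/(Rintegral leb I H) RintB//; last exact: (intZl mI C i2).
  by rewrite RintZl// subr_le0 (le_trans test_lower test_upper). have mH := measurable_int leb iH.
apply: aesS ((ae_eq_integral_abs leb mI mH).1 E) => t h It.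
rewrite leNgt; apply/negP => Cphi; have := h It; rewrite /= HE indicE mem_set// mul1r => -[h0].
by have := gap_gt0 Cphi; rewrite h0 ltxx.
Qed.
End truncated.

Lemma dual_slice_bound : {ae leb, forall t, I t -> (snorm p g t <= C%:E)%E}.
Proof.
have := ae_foralln truncated_slice_bound; apply: aesS => t h It.
rewrite /snorm; apply: Lnorm_powR => //; first exact: ltW. have ms k : mfun (fun x => Num.min `|g (t, x)| k%:R `^ p).
  apply: (mcomp (measurable_powR p)); apply: measurable_minr; last exact: mcst. by apply: mfun_norm; exact: jmslice.
apply: (@fatou_bound _ _ _ haar setT measurableT (fun k x => (Num.min `|g (t, x)| k%:R `^ p)%:E)).
- by move=> k; apply/mEFinP; exact: ms.
- by move=> k x _; rewrite lee_fin powR_ge0.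
- move=> x _; apply: cvg_near_cst; exists (Num.truncn `|g (t, x)|).+1 => // k /= hk.
  by rewrite min_l// ltW// (lt_le_trans (truncnS_gt _))// ler_nat.
- move=> k; rewrite -[leLHS]fineK ?lee_fin; first exact: (h k It).
  apply: (int_fin measurableT); apply: (haar_bnd (ms k) (M := k%:R `^ p)) => x _.
  by rewrite ger0_norm ?powR_ge0// ge0_ler_powR ?nnegrE ?(ltW p0)// ?le_min ?normr_ge0 ?ler0n// ge_min lexx orbT.
Qed.

Let B : set (mR R) := [set t | (snorm p g t <= C%:E)%E].
Let mB : measurable B.
Proof.
by rewrite -[B]setTI; apply: measurable_lee => //; exact: mfun_snorm.
Qed.

(** The density is set to 0 at the exceptional times, so that its slice bound holds at every
    time. *)
Let g' w : R := \1_B w.1 * g w.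
Let mg' : jmfun g'.
Proof.
apply: mfunM => //. have m1 : mfun (\1_B : mR R -> R) by exact: mindic. exact: (mcomp m1 mfst).
Qed.
Let g'C t : (snorm p g' t <= C%:E)%E.
Proof.
have [Bt|Bt] := boolP (t \in B). rewrite (_ : snorm p g' t = snorm p g t); first exact: (set_mem Bt).
  by apply: eq_Lnorm => x; rewrite /= /g' indicE Bt mul1r.
by rewrite /snorm; apply: Lnorm_bounded; rewrite ?(ltW C0)// => x; rewrite /g' indicE (negbTE Bt) mul0r normr0 ltW.
Qed.

Let pair f t := \int[haar]_x (g' (t, x) * f (t, x)).

Let pair_slice f t (mf : mixed f) := pairing_slice mg' g'C t mf.
Let pair_integrable f (mf : mixed f) := pairing_integrable mg' g'C mf.

Let pair_bounded f M : jmfun f -> 0 <= M -> (forall w, `|f w| <= M) -> l f = \int[leb]_(t in I) pair f t.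
Proof.
move=> mf M0 fM; have m1 : mfun (\1_I : mR R -> R) by exact: mindic.
pose f1 w : R := \1_I w.1 * f w; pose f2 w := f w - f1 w.
have mf1 : jmfun f1 by apply: mfunM => //; exact: (mcomp m1 mfst). have mf2 : jmfun f2 by exact: mfunB.
have f1M w : `|f1 w| <= M by rewrite /f1 indicE; case: (_ \in _); rewrite ?mul1r// mul0r normr0.
have f2M w : `|f2 w| <= M by rewrite /f2 /f1 indicE; case: (_ \in _); rewrite ?mul1r ?mul0r ?subrr ?subr0 ?normr0.
have l2 : l f2 = 0.
  have := l_abs (mixed_bounded q1 T0 mf2 M0 f2M).1; rewrite /mixN [X in C * X](_ : _ = 0); last first.
    transitivity (\int[leb]_(t in I) (0 : R)); last by rewrite Rintegral_cst// mul0r.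
    apply: eqRint => t It; rewrite (_ : snorm q f2 t = 0%E)//; apply/le_anti; rewrite Lnorm_ge0 andbT.
    rewrite /snorm; apply: Lnorm_bounded => // x. by rewrite /f2 /f1 indicE It mul1r subrr normr0.
  by rewrite mulr0 normr_le0 => /eqP. have [i1 _] := @mulb_int _ Z R mu g f1 _ _ mg mf1 gK M0 f1M.
have [i2 _] := @mulb_int _ Z R mu g f2 _ _ mg mf2 gK M0 f2M. have -> : l f = \int[mu]_w (g w * f1 w).
  rewrite (lg mf M0 fM) -[RHS]addr0 -l2 (lg mf2 M0 f2M) -RintD//.
  by apply: eqRint => w _; rewrite -mulrDr /f2 addrC subrK.
rewrite spacetime_Rint//; transitivity (\int[leb]_(t in I) \int[haar]_x (g (t, x) * f (t, x))).
  rewrite [RHS]Rintegral_mkcond; apply: eqRint => t _; rewrite patchE.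
  case: ifPn => It; first by apply: eqRint => x _; rewrite /f1 indicE It mul1r.
  by apply: Rint_eq0 => x; rewrite /f1 indicE (negbTE It) mul0r mulr0. congr fine; apply: ae_eq_integral => //.
- apply/mEFinP/mfunTS; apply: (@mfun_Rint _ _ _ haar (fun w => g w * f w)). exact: mfunM.
- apply/mEFinP/mfunTS; apply: (@mfun_Rint _ _ _ haar (fun w => g' w * f w)). exact: mfunM.
- apply: aesS dual_slice_bound => t h It; congr EFin.
  by apply: eqRint => x _; rewrite /g' indicE mem_set ?mul1r//; exact: h.
Qed.

(** Both sides are continuous for [mixN], where the clippings of f converge to f, so the bounded
    case suffices. *)
Lemma dual_representation : exists rho : ST R d -> R,
  [/\ jmfun rho, forall t, (snorm p rho t <= C%:E)%E &
    forall f, mixed f -> l f = \int[leb]_(t in I) \int[haar]_x (rho (t, x) * f (t, x))].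
Proof.
exists g'; split=> // f mf; have mf' := mixed_meas mf.
pose c n w : R := clip n%:R (f w); pose h n w : R := f w - c n w. have mc n : jmfun (c n).
  by apply: measurable_maxr; [exact: mcst|apply: measurable_minr => //; exact: mcst].
have cb n w : `|c n w| <= n%:R by exact: clip_bound. have mh n : jmfun (h n) by exact: mfunB.
have hf n w : `|h n w| <= `|f w| by exact: clip_diff.
have xc n : mixed (c n) := (mixed_bounded q1 T0 (mc n) (ler0n _ n) (cb n)).1.
have xh n : mixed (h n) := mixed_le q1 (mh n) mf (hf n). have cv : mixN (h n) @[n --> \oo] --> 0.
  apply: (mixed_cvg0 q1 mh mf hf) => w; exists (Num.truncn `|f w|).+1 => // n /= hn.
  by rewrite /h /c clip_id ?subrr// ltW// (lt_le_trans (truncnS_gt _))// ler_nat.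
apply/eqP; rewrite -subr_eq0 -normr_le0; apply/ler_addgt0Pr => e e0; rewrite add0r.
have C2 : 0 < 2 * C by rewrite mulr_gt0.
move/cvgrPdist_le: cv => /(_ (e / (2 * C))); rewrite divr_gt0// => /(_ isT)[n _ /(_ n (leqnn n))].
rewrite sub0r normrN ler_pdivlMr// mulrC => hn; apply: le_trans hn.
have -> : l f - \int[leb]_(t in I) pair f t = l (h n) - \int[leb]_(t in I) pair (h n) t.
  have -> : l f = l (c n) + l (h n). rewrite -[l (h n)]mul1r -l_lin//; congr l; apply/funext => w.
    by rewrite -[RHS]/(c n w + 1 * h n w) mul1r addrC subrK.
  have -> : \int[leb]_(t in I) pair f t = \int[leb]_(t in I) pair (c n) t + \int[leb]_(t in I) pair (h n) t.
    rewrite -RintD//; [|exact: (pair_integrable (xc n)).1|exact: (pair_integrable (xh n)).1].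
    apply: eqRint => t _; rewrite /pair -RintD//; [|exact: (pair_slice t (xc n)).1|exact: (pair_slice t (xh n)).1].
    by apply: eqRint => x _; rewrite -mulrDr addrC subrK.
  by rewrite (pair_bounded (mc n) (ler0n _ n) (cb n)) opprD addrACA subrr add0r. apply: (le_trans (ler_normB _ _)).
apply: (@le_trans _ _ (2 * C * mixN (h n))); last by rewrite ler_pM2l// ler_norm.
by rewrite -mulrA mulr2n mulrDl mul1r lerD ?l_abs ?(pair_integrable (xh n)).2.
Qed.
End dual_bound.
End representation.

(** * Periodic representatives *)

Section fractional_part.
Variables (R : realType) (d : nat).

(** The representing density carries no periodicity. Composition with the fractional part makes it
    periodic and changes nothing almost everywhere, as the Haar measure is carried by [0,1[^d. *)
Definition frac_rV (x : 'rV[R]_d) : 'rV[R]_d := \row_i (x 0 i - (Num.floor (x 0 i))%:~R).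

Lemma mfun_frac_rV : mfun frac_rV.
Proof.
apply: measurable_fun_rVP => i; rewrite (_ : (fun x : 'rV[R]_d => _) = (fun x : 'rV[R]_d => x 0 i - (Num.floor (x 0 i))%:~R)); last first.
  by apply/funext => x; rewrite mxE. have mi := @mcoord R d i; apply: mfunB => //.
have mfl : mfun (fun z : mR R => (Num.floor z)%:~R : R). apply/mEFinP; have := @mfun_floorM R 1 (fun k => k%:~R%:E).
  by under eq_fun do rewrite mul1r. exact: (mcomp mfl mi).
Qed.

Lemma frac_rV_periodic : Zper frac_rV.
Proof.
move=> x k; apply/rowP => i; rewrite !mxE. have -> : Num.floor (x 0 i + (k 0 i)%:~R) = Num.floor (x 0 i) + k 0 i.
  by apply: floor_def; have := floor_itv (x 0 i); rewrite !intrD => /andP[h1 h2]; rewrite lerD2r h1/= addrAC ltrD2r.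
by rewrite intrD opprD addrACA subrr addr0.
Qed.

Lemma ae_frac_rV : {ae haar, forall x, frac_rV x = x}.
Proof.
have H (i : 'I_d) : {ae haar, forall x : 'rV[R]_d, `[0, 1[%classic (x 0 i)}.
  pose J : set (mR R) := ~` `[0, 1[%classic. have mJ : measurable J by apply: measurableC; exact: mitv.
  pose N : set 'rV[R]_d := (fun x : 'rV[R]_d => x 0 i) @^-1` J.
  have mN : measurable N by rewrite -[N]setTI; exact: (@mcoord R d i).
  exists N; split=> //; rewrite -[N]setIT -integral_indic// (ge0_resample i)//; last first.
    by apply/mEFinP; exact: mindic.
  apply: integral0_eq => x _; rewrite (eq_integral (fun z => (\1_J z)%:E)) => [|z _]; last first.
    rewrite !indicE; congr ((nat_of_bool _)%:R%:E).
    by apply/idP/idP => /set_mem h; apply/mem_set; move: h; rewrite /N/= setcE eqxx.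
  have mJ1 : mfun (EFin \o \1_J : mR R -> \bar R). by apply/mEFinP; exact: mindic.
  rewrite unifE// -integral_itv_bndo_bndc; last exact: mfunTS.
  by apply: integral0_eq => z z01; rewrite indicE memNset// /J /=; apply.
have H' : {ae haar, forall x : 'rV[R]_d, forall i : 'I_d, `[0, 1[%classic (x 0 i)} by apply: filter_forall => i; exact: H.
apply: filterS H' => x h; apply/rowP => i; rewrite mxE. have -> : Num.floor (x 0 i) = 0.
  by apply: floor_def; rewrite add0r; have := h i; rewrite /= in_itv. by rewrite subr0.
Qed.
End fractional_part.

(** * Existence of weak solutions *)

Section existence.
Variables (R : realType) (d : nat) (p q T : R).
Hypotheses (p1 : 1 < p) (q1 : 1 < q) (pq : p^-1 + q^-1 = 1) (T0 : 0 < T).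
Local Notation I := (`[0, T]%classic : set (mR R)).
Variables (V : R -> 'rV[R]_d -> 'rV[R]_d) (Y : R -> R) (rho0 : 'rV[R]_d -> R).
Hypotheses (fld : field T q V Y) (mrho0 : mfun rho0) (rho0_fin : (hnorm p rho0 < +oo)%E).
Let p0 : 0 < p := lt_trans ltr01 p1.
Let q0 : 0 < q := lt_trans ltr01 q1.
Let mI : measurable I. Proof. exact: mitv. Qed.

Let X := fine (hnorm p rho0).
(** q X comes from Hölder and the a priori estimate; the 1 keeps the constant positive when rho0
    vanishes. *)
Let C := q * X + 1.
Let XE : hnorm p rho0%E = X%:E.
Proof. by rewrite fineK// ge0_fin_numE// Lnorm_ge0. Qed.
Let X0 : 0 <= X. Proof. by rewrite -lee_fin -XE Lnorm_ge0. Qed.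
Let C0 : 0 < C. Proof. by rewrite ltr_wpDl// mulr_ge0// ltW. Qed.

Definition cut_tr (phi : ST R d -> R) (w : ST R d) : R := \1_I w.1 * transport V phi w.1 w.2.
Let ini (phi : ST R d -> R) := - \int[haar]_x (rho0 x * phi (0, x)).

Let m1 : jmfun (fun w : mST R d => \1_I w.1 : R).
Proof.
have m1 : mfun (\1_I : mR R -> R) by exact: mindic. exact: (mcomp m1 mfst).
Qed.

Let mixed_component i : mixed q T (fun w => component V i w.1 w.2).
Proof.
have h t : (snorm q (fun w => component V i w.1 w.2) t <= (Y t)%:E)%E by exact: (fld_norm fld).
exact: (mixed_dom (fld_measurable fld i) (fld_bound_integrable fld) h).1.
Qed.

Let bounded_derivative phi v : test_function T phi -> exists2 M, 0 <= M & forall w : ST R d, `|\1_I w.1 * 'D_v phi w| <= M.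
Proof.
case=> sphi pphi _.
have [M M0 HM] := @periodic_bounded2 R d ('D_v phi) 0 T (sm_cont (sm_D v sphi)) (periodic_derive2 v pphi).
exists M => // -[t x]; rewrite indicE; have [/set_mem|_] := boolP (t \in _); last by rewrite mul0r normr0.
by rewrite /= in_itv/= mul1r => tT; exact: HM.
Qed.

Lemma mixed_transport phi : test_function T phi -> mixed q T (cut_tr phi).
Proof.
move=> tst; have [sphi _ _] := tst. have md v : jmfun (fun w => \1_I w.1 * 'D_v phi w).
  apply: mfunM => //; apply: cont_mfun2. exact: (sm_cont (sm_D v sphi)).
have h1 : mixed q T (fun w => \1_I w.1 * 'D_((1, 0) : ST R d) phi w).
  by have [M M0 HM] := bounded_derivative (1, 0) tst; exact: (mixed_bounded q1 T0 _ M0 HM).1.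
have h2 i : mixed q T (fun w => component V i w.1 w.2 * (\1_I w.1 * 'D_((0, 'e_i) : ST R d) phi w)).
  have [M M0 HM] := bounded_derivative (0, 'e_i) tst.
  apply: (mixed_le q1 _ (mixed_scale q1 M (mixed_component i)).1) => [|w].
    by apply: mfunM => //; exact: (fld_measurable fld).
  by rewrite -[(M *: _) w]/(M * component V i w.1 w.2) !normrM mulrC [`|M|]ger0_norm// ler_wpM2r// -normrM HM.
have h3 (r : seq 'I_d) : mixed q T (\sum_(i <- r) (fun w => component V i w.1 w.2 * (\1_I w.1 * 'D_((0, 'e_i) : ST R d) phi w))).
  elim: r => [|i r IH]; last by rewrite big_cons; exact: (mixed_add q1 (h2 i) IH).1.
  rewrite big_nil; apply: (mixed_bounded q1 T0 _ (lexx 0) _).1 => [|w]; first exact: mcst. by rewrite normr0.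
have := (mixed_add q1 h1 (h3 (index_enum 'I_d))).1; congr mixed; apply/funext => -[t x].
rewrite -[LHS]/(\1_I t * 'D_((1, 0) : ST R d) phi (t, x) + _ (t, x)) fct_sumE /cut_tr /transport mulrDr; congr (_ + _).
by rewrite mulr_sumr; apply: eq_bigr => i _; rewrite mulrCA.
Qed.

Let transport_lin (phi psi : ST R d -> R) (c : R) : smooth phi -> smooth psi ->
  cut_tr (fun w => phi w + c * psi w) = cut_tr phi + c *: cut_tr psi.
Proof.
move=> sp ss. have D v w : 'D_v (fun w => phi w + c * psi w) w = 'D_v phi w + c * 'D_v psi w.
  rewrite (_ : (fun w => _) = phi + c \*: psi)// deriveD ?deriveZ//; try exact: sm_dv.
  by apply: derivableZ; exact: sm_dv.
apply/funext => -[t x]; rewrite -[RHS]/(cut_tr phi (t, x) + c * cut_tr psi (t, x)) /cut_tr /transport/= !D.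
under eq_bigr do rewrite D mulrDr mulrCA. rewrite big_split/= -mulr_sumr; ring.
Qed.

Let test_lin (phi psi : ST R d -> R) (c : R) : test_function T phi -> test_function T psi -> test_function T (fun w => phi w + c * psi w).
Proof.
move=> [s1 pe1 [T1 T1T z1]] [s2 pe2 [T2 T2T z2]]; split.
- by apply: sm_add => //; apply: sm_mul => //; exact: sm_cst.
- by move=> t x k; rewrite pe1 pe2.
- exists (Num.max T1 T2); first by rewrite gt_max T1T.
  by move=> t x; rewrite ge_max => /andP[h1 h2]; rewrite z1// z2// mulr0 addr0.
Qed.

Let ini_int phi : test_function T phi -> hL1 (fun x => rho0 x * phi (0, x)) /\
  ini phi <= C * mixN q T (cut_tr phi).
Proof.
move=> tst; have mx := mixed_transport tst; have [sphi _ _] := tst. pose Lam := mixN q T (cut_tr phi).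
have Lam0 : 0 <= Lam by apply: Rintegral_ge0 => t _; rewrite fine_ge0// Lnorm_ge0.
have LamP : (\int[leb]_(t in I) hnorm q (transport V phi t) <= Lam%:E)%E.
  rewrite /Lam /mixN /Rintegral fineK; last exact: (int_fin mI (mixed_int mx)).
  apply: eqW; apply: eq_integral => t It. rewrite (slice_fineE t mx) /snorm; congr Lnorm; apply/funext => x.
  by rewrite /= /cut_tr/= indicE It mul1r. have ap := apriori p1 q1 pq T0 fld tst LamP.
have mphi : mfun (fun x => phi (0, x)). exact: (sm_mfun (slice_sm 0 sphi)).
have XL : (hnorm p rho0 <= X%:E)%E by rewrite XE.
have [i1 le1] := normr_Rint_le measurableT (mfunM mrho0 mphi) (hoelder_le p1 q1 pq mrho0 mphi XL ap).
split=> //; rewrite (le_trans (ler_norm _))// normrN (le_trans le1)//.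
by rewrite mulrCA mulrA -/Lam ler_wpM2r// /C lerDl.
Qed.

Theorem weak_solution_exists : exists rho : R -> 'rV[R]_d -> R,
  [/\ jmfun (fun w => rho w.1 w.2), forall t, Zper (rho t),
      forall t, (hnorm p (rho t) <= C%:E)%E & weak_solution T V rho0 rho].
Proof.
(* The functional is prescribed on transported test functions as a set of pairs. That two test
   functions with the same transport have the same initial pairing is then a consequence of
   domination by the norm. *)
pose A0 : set ((ST R d -> R) * R) := [set z | exists phi, test_function T phi /\ z = (cut_tr phi, ini phi)].
have t0 : test_function T (fun _ : ST R d => 0). split; [exact: sm_cst|by []|by exists 0]. have A00 : A0 (0, 0).
  exists (fun=> 0); split=> //; congr pair.
    apply/funext => w; rewrite /cut_tr /transport derive_cst big1 ?addr0 ?mulr0// => i _. by rewrite derive_cst mulr0.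
  by rewrite /ini Rint_eq0 ?oppr0// => x; rewrite mulr0.
have A0P : dom_graph (mixed q T) (fun f => C * mixN q T f) A0 A0. split=> //.
  - move=> _ _ _ _ c [phi [tphi [-> ->]]] [psi [tpsi [-> ->]]].
    exists (fun w => phi w + c * psi w); split; first exact: test_lin. have [s1 _ _] := tphi; have [s2 _ _] := tpsi.
    have [i1 _] := ini_int tphi; have [i2 _] := ini_int tpsi.
    rewrite transport_lin//; congr pair; rewrite /ini mulrN -opprD -RintZl// -RintD//; last first.
      exact: (intZl measurableT c i2). by congr (- _); apply: eqRint => x _; rewrite mulrDr mulrCA.
  - move=> _ _ [phi [tphi [-> ->]]]; split; first exact: mixed_transport. exact: (ini_int tphi).2.
have nD (f g : ST R d -> R) : mixed q T f -> mixed q T g -> C * mixN q T (f + g) <= C * mixN q T f + C * mixN q T g.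
  by move=> mf mg; rewrite -mulrDr ler_pM2l// (mixed_add q1 mf mg).2.
have nZ (f : ST R d -> R) c : 0 < c -> mixed q T f -> C * mixN q T (c *: f) = c * (C * mixN q T f).
  by move=> c0 mf; rewrite (mixed_normZ q1 c0 mf) mulrCA.
have [l [l_lin l_le lA0]] := Hahn_Banach (mixed_lin q1) nD nZ A00 A0P.
have [g [mg ig lg]] := representation_density q1 T0 C0 l_lin l_le.
have lb := representation_bounded q1 T0 C0 l_lin l_le mg ig lg.
have [rho [mrho rhoC rhoE]] := dual_representation p1 q1 pq T0 C0 l_lin l_le mg ig lb.
exists (fun t x => rho (t, frac_rV x)). have mr : jmfun (fun w => rho (w.1, frac_rV w.2)).
  apply: (mcomp mrho); apply: measurable_fun_pair; first exact: mfst. exact: (mcomp (@mfun_frac_rV R d) msnd).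
have mrt t : mfun (fun x => rho (t, x)) by exact: jmslice.
have mrs t : mfun (fun x => rho (t, frac_rV x)) by exact: (mcomp (mrt t) (@mfun_frac_rV R d)).
have mpow (f : 'rV[R]_d -> R) := @mfun_powR_EFin _ _ _ f p. split=> //.
- by move=> t x k; rewrite frac_rV_periodic.
- move=> t; rewrite (_ : Lnorm _ _ _ = snorm p rho t)// /snorm !Lnorm_EFinE; congr poweR.
  apply: ae_eq_integral => //; [exact: mpow (mrs t)|exact: mpow (mrt t)|].
  by apply: filterS (@ae_frac_rV R d) => x -> _.
- move=> phi tphi; rewrite -[RHS](lA0 (cut_tr phi)); last by exists phi. rewrite rhoE; last exact: mixed_transport.
  have mtr : jmfun (fun w => transport V phi w.1 w.2). by apply: (mtransport fld); case: tphi.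
  apply: eqRint => t It; congr fine; apply: ae_eq_integral => //.
  - by apply/mEFinP; apply: mfunM; [exact: mrs|exact: (jmslice t mtr)].
  - apply/mEFinP; apply: mfunM => //. exact: (jmslice t (mixed_meas (mixed_transport tphi))).
  - by apply: filterS (@ae_frac_rV R d) => x -> _; rewrite /cut_tr/= indicE It mul1r.
Qed.
End existence.

(** * Restriction to good times *)

Section time_restriction.
Variables (R : realType) (d : nat) (q T : R).
Hypotheses (q1 : 1 < q) (T0 : 0 < T).
Local Notation I := (`[0, T]%classic : set (mR R)).
Implicit Types (f : R -> 'rV[R]_d -> R) (B : set (mR R)).
Let q0 : 0 < q := lt_trans ltr01 q1.
Let mI : measurable I. Proof. exact: mitv. Qed.

Definition cutoff B f (w : ST R d) : R := if w.1 \in B then f w.1 w.2 else 0.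

Lemma cutoff_mfun B f : measurable B -> B `<=` I ->
  @measurable_fun _ _ (mST R d) R (I `*` setT) (fun w => f w.1 w.2) ->
  jmfun (cutoff B f).
Proof.
move=> mB BI mf; rewrite (_ : cutoff B f = (fun w : mST R d => f w.1 w.2) \_ (B `*` setT)); last first.
  by apply/funext => w; rewrite patchE in_setX in_setT andbT.
have mBX : measurable (B `*` setT : set (mST R d)) by exact: measurableX. apply/(measurable_restrictT _ mBX).
by apply: measurable_funS mf; [exact: measurableX|move=> w [/BI h _]].
Qed.

Lemma slice_cutoff (r : R) B f t : 0 < r ->
  snorm r (cutoff B f) t = if t \in B then hnorm r (f t)%E else 0%E.
Proof.
move=> r0; case: ifP => Bt; first by apply: eq_Lnorm => x; rewrite /= /cutoff Bt.
rewrite -(@Lnorm0 _ _ _ (torus_measure R d) r%:E) ?eqe ?gt_eqF//. by apply: eq_Lnorm => x; rewrite /= /cutoff Bt.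
Qed.

Lemma LsLp_slice_integrable f : LsLp T 1%E q%:E f ->
  leb.-integrable I (snorm q (cutoff I f)).
Proof.
move=> [pf mf fin]; apply/integrableP; split. by apply: mfunTS; apply: mfun_snorm; exact: cutoff_mfun.
apply: le_lt_trans fin; rewrite (Lnorm1 leb) ?eqW//.
rewrite [LHS]integral_mkcond; apply: eq_integral => t _; rewrite !patchE; case: ifP => It; last by rewrite abse0.
by rewrite slice_cutoff// It.
Qed.

Lemma cutoff_mixed B f : measurable B -> B `<=` I -> LsLp T 1%E q%:E f ->
  (forall t, B t -> snorm q (cutoff I f) t \is a fin_num) ->
  mixed q T (cutoff B f).
Proof.
move=> mB BI Lf fin; have [_ mf _] := Lf; have mr := cutoff_mfun mB BI mf.
have sl t : (snorm q (cutoff B f) t <= snorm q (cutoff I f) t)%E.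
  rewrite !slice_cutoff//; case: ifP => Bt; last by case: ifP => // _; exact: Lnorm_ge0.
  by rewrite mem_set//; apply: BI; exact/set_mem. have ff t : snorm q (cutoff B f) t \is a fin_num.
  have [Bt|Bt] := boolP (t \in B); last by rewrite slice_cutoff// (negbTE Bt).
  have := fin t (set_mem Bt); rewrite !slice_cutoff// Bt mem_set//; apply: BI; exact/set_mem.
split=> // [t|]; first by rewrite -ge0_fin_numE ?Lnorm_ge0. apply: (le_integrable mI _ _ (LsLp_slice_integrable Lf)).
  apply/mEFinP/mfunTS/(mcomp (fine_measurable measurableT)). exact: mfun_snorm.
by move=> t _; rewrite [(EFin \o _) t](fineK (ff t)) !gee0_abs ?Lnorm_ge0.
Qed.

Lemma ae_time_Rintegral (F G : R -> 'rV[R]_d -> R) :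
  @measurable_fun _ _ (mST R d) R (I `*` setT) (fun w => F w.1 w.2) ->
  @measurable_fun _ _ (mST R d) R (I `*` setT) (fun w => G w.1 w.2) ->
  {ae leb, forall t, I t -> F t = G t} ->
  \int[leb]_(t in I) \int[haar]_x F t x = \int[leb]_(t in I) \int[haar]_x G t x.
Proof.
move=> mF mG FG.
have cut (H : R -> 'rV[R]_d -> R) : @measurable_fun _ _ (mST R d) R (I `*` setT) (fun w => H w.1 w.2) ->
    measurable_fun I (fun t => (\int[haar]_x H t x)%:E).
  move=> mH; have := cutoff_mfun mI (@subset_refl _ I) mH => /(@mfun_Rint _ _ _ haar) m.
  apply/mEFinP; apply: (eq_measurable_fun (fun t => \int[haar]_x cutoff I H (t, x))) => [t It|].
    by apply: eqRint => x _; rewrite /cutoff It. exact: mfunTS.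
congr fine; apply: ae_eq_integral => //; [exact: cut|exact: cut|]. by apply: aesS FG => t h It; rewrite h.
Qed.

End time_restriction.

(** The finitely many components and partial derivatives have finite slice norms, weak gradients and
    zero divergence at almost every time. At all other times velocity and gradients are set to 0,
    which keeps every property. *)
Lemma good_times (R : realType) (d : nat) (q T : R) (u : R -> 'rV[R]_d -> 'rV[R]_d) : 1 < q -> 0 < T ->
  divergence_free T u -> vLrW1q T 1%E q%:E u ->
  exists (V : R -> 'rV[R]_d -> 'rV[R]_d) (Y : R -> R) (g : 'I_d -> 'I_d -> R -> 'rV[R]_d -> R),
    [/\ {ae leb, forall t, t \in `[0, T] -> V t = u t}, field T q V Y &
      forall t j i, [/\ mfun (g j i t), Zper (g j i t),
        (hnorm q (g j i t) <= (Y t)%:E)%E & weak_partial i (component V j t) (g j i t)]].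
Proof.
move=> q1 T0 divu hu; have q0 := lt_trans ltr01 q1. set I := (`[0, T]%classic : set (mR R)).
have mI : measurable I by exact: mitv. pose G i j := sval (cid2 ((hu i).2 j)).
have LG i j : LsLp T 1%E q%:E (G i j) := s2valP (cid2 ((hu i).2 j)).
have wG i j : {ae leb, forall t, t \in `[0, T] -> weak_partial j (component u i t) (G i j t)} := s2valP' (cid2 ((hu i).2 j)).
(* One index set for all functions to be bounded: [None] for a component, [Some j] for its j-th
   partial derivative. The sum of all their slice norms is the common bound Y. *)
pose F (k : 'I_d * option 'I_d) := if k.2 is Some j then G k.1 j else component u k.1.
have LF k : LsLp T 1%E q%:E (F k) by case: k => i [j|]; [exact: LG|exact: (hu i).1].
pose P t := [/\ forall k, snorm q (cutoff I (F k)) t \is a fin_num,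
    forall i j, weak_partial j (component u i t) (G i j t) & forall psi : 'rV[R]_d -> R, smooth psi -> Zper psi ->
      \int[haar]_x (\sum_(i < d) u t x 0 i * 'D_('e_i) psi x) = 0].
have [N [mN N0 sN]] : {ae leb, forall t, I t -> P t}. have h1 k := integrable_ae mI (LsLp_slice_integrable q1 (LF k)).
  have h2 : {ae leb, forall t, forall k, I t -> snorm q (cutoff I (F k)) t \is a fin_num}.
    by apply: (@filter_forall _ _ _ _ (ae_filter_ringOfSetsType _)) => k; exact: h1.
  have h3 : {ae leb, forall t, forall ij : 'I_d * 'I_d, t \in `[0, T] -> weak_partial ij.2 (component u ij.1 t) (G ij.1 ij.2 t)}.
    by apply: (@filter_forall _ _ _ _ (ae_filter_ringOfSetsType _)) => -[i j]; exact: wG.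
  apply: (@filterS3 _ _ (ae_filter_ringOfSetsType _)) h2 h3 divu => t a1 a2 a3 It; split.
  - by move=> k; exact: a1.
  - by move=> i j; exact: (a2 (i, j)).
  - exact: a3. pose B := I `\` N; have mB : measurable B by exact: measurableD. have BI : B `<=` I by move=> t [].
have good t : B t -> P t by move=> [It nN]; apply: contrapT => nP; apply: nN; apply: sN => /(_ It).
pose V t x : 'rV[R]_d := \row_i cutoff B (component u i) (t, x).
have VE i t : component V i t = fun x => cutoff B (component u i) (t, x).
  by apply/funext => x; rewrite /component /V mxE. pose n k t := fine (snorm q (cutoff B (F k)) t).
have mxF k : mixed q T (cutoff B (F k)). by apply: cutoff_mixed => // t /good[]. pose Y t := \sum_k n k t.
have nY k t : (snorm q (cutoff B (F k)) t <= (Y t)%:E)%E.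
  rewrite -(slice_fineE t (mxF k)) lee_fin /Y (bigD1 k)//= lerDl.
  by apply: sumr_ge0 => k' _; rewrite fine_ge0// Lnorm_ge0.
exists V, Y, (fun j i t x => cutoff B (G j i) (t, x)); split.
- exists N; split=> // t nt; apply: contrapT => nN; apply: nt => It; apply/funext => x; apply/rowP => i.
  by rewrite mxE /cutoff mem_set.
- split.
  + move=> j; rewrite (_ : (fun w => _) = cutoff B (component u j)); first exact: (mixed_meas (mxF (j, None))).
    by apply/funext => -[t x]; rewrite VE.
  + move=> j t x k; rewrite VE /cutoff/=; case: ifP => // /set_mem/BI It. by have [[pu _ _] _] := hu j; exact: pu.
  + by move=> j t; rewrite VE; exact: (nY (j, None)).
  + apply: measurable_sum => k; apply: (mcomp (fine_measurable measurableT)). exact: mfun_snorm (mixed_meas (mxF k)).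
  + rewrite (_ : EFin \o Y = fun t => \sum_k (n k t)%:E)%E; last by apply/funext => t; rewrite /= /Y sumEFin.
    by apply: integrable_sum => // k _; exact: (mixed_int (mxF k)).
  + move=> t psi spsi ppsi; have [Bt|Bt] := boolP (t \in B).
      have [_ _ h] := good t (set_mem Bt); rewrite -[RHS](h psi spsi ppsi).
      apply: eqRint => x _; apply: eq_bigr => i _; rewrite mxE /cutoff Bt//.
    apply: Rint_eq0 => x; apply: big1 => i _; by rewrite mxE /cutoff (negbTE Bt) mul0r.
- move=> t j i; split.
  + exact: (jmslice t (mixed_meas (mxF (j, Some i)))).
  + move=> x k; rewrite /cutoff/=; case: ifP => // /set_mem/BI It. by have [pu _ _] := LG j i; exact: pu.
  + exact: (nY (j, Some i)).
  + move=> psi spsi ppsi; rewrite VE /cutoff/=; have [Bt|Bt] := boolP (t \in B).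
      by have [_ h _] := good t (set_mem Bt); exact: h. by rewrite !Rint_eq0 ?oppr0// => x; rewrite mul0r.
Qed.

(** * Well-posedness for s = oo *)

Section wellposedness.
Variables (R : realType) (d : nat) (p q T : R).
Hypotheses (p1 : 1 < p) (q1 : 1 < q) (pq : p^-1 + q^-1 = 1) (d0 : (0 < d)%N) (T0 : 0 < T).
Local Notation I := (`[0, T]%classic : set (mR R)).
Variables (u : R -> 'rV[R]_d -> 'rV[R]_d) (rho0 : 'rV[R]_d -> R).
Hypotheses (divu : divergence_free T u) (hu : vLrW1q T 1%E q%:E u) (hrho0 : Lp_torus p%:E rho0).
Let p0 : 0 < p := lt_trans ltr01 p1.
Let mI : measurable I. Proof. exact: mitv. Qed.
Local Notation imeasurable f := (@measurable_fun _ _ (mST R d) R (I `*` setT) f).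

Let mfun_mul_transport (r : R -> 'rV[R]_d -> R) (v : R -> 'rV[R]_d -> 'rV[R]_d) phi : smooth phi ->
  imeasurable (fun w => r w.1 w.2) -> (forall i, imeasurable (fun w => component v i w.1 w.2)) ->
  imeasurable (fun w => r w.1 w.2 * transport v phi w.1 w.2).
Proof.
move=> sphi mr mv; rewrite /transport. have md w : imeasurable (fun z => 'D_w phi (z.1, z.2)).
  rewrite (_ : (fun z => _) = 'D_w phi); last by apply/funext => -[].
  by apply: mfunTS; apply: cont_mfun2; exact: (sm_cont (sm_D w sphi)). apply: mfunM => //; apply: mfunD => //.
by apply: measurable_sum => i; apply: mfunM => //; exact: mv.
Qed.

Theorem wellposedness : exists rho : R -> 'rV[R]_d -> R,
  [/\ LsLp T +oo%E p%:E rho, weak_solution T u rho0 rho &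
    forall rho' : R -> 'rV[R]_d -> R, LsLp T +oo%E p%:E rho' -> weak_solution T u rho0 rho' ->
      ae_same T rho rho'].
Proof.
have [V [Y [g [Vu fld Hg]]]] := good_times q1 T0 divu hu. have [prho0 mrho0 frho0] := hrho0.
have [rho [mrho prho rhoC wrho]] := weak_solution_exists p1 q1 pq T0 fld mrho0 frho0. set C := _ + 1 in rhoC.
have C0 : 0 <= C by rewrite -lee_fin (le_trans _ (rhoC 0))// Lnorm_ge0.
have mV i : imeasurable (fun w => component V i w.1 w.2) by apply: mfunTS; exact: (fld_measurable fld i).
have mu i : imeasurable (fun w => component u i w.1 w.2) by have [[_ h _] _] := hu i.
have irho : imeasurable (fun w => rho w.1 w.2) by exact: mfunTS.
have transfer (r r' : R -> 'rV[R]_d -> R) phi : smooth phi -> imeasurable (fun w => r w.1 w.2) -> imeasurable (fun w => r' w.1 w.2) ->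
    {ae leb, forall t, I t -> r t = r' t} ->
    \int[leb]_(t in I) \int[haar]_x (r t x * transport u phi t x) = \int[leb]_(t in I) \int[haar]_x (r' t x * transport V phi t x).
  move=> sphi mr mr' rr'; apply: (@ae_time_Rintegral _ _ _ (fun t x => r t x * transport u phi t x) (fun t x => r' t x * transport V phi t x)).
  - exact: mfun_mul_transport.
  - exact: mfun_mul_transport.
  - apply: (@filterS2 _ _ (ae_filter_ringOfSetsType (@lebesgue_measure R))) rr' Vu => t h1 h2 It.
    by apply/funext => x; rewrite h1// /transport h2. exists rho; split.
- exact: (LsLp_bounded T mrho prho C0 rhoC).
- move=> phi tphi; rewrite -[RHS](wrho phi tphi); apply: transfer => //; first by case: tphi. by apply: aeW.
move=> rho' [pr' mr' fin'] w'.
have [M M0 hM] : exists2 M : R, 0 <= M & {ae leb, forall t, I t -> (hnorm p (rho' t) <= M%:E)%E}.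
  have leb0 : (0 < @lebesgue_measure R setT)%E.
    apply: (@lt_le_trans _ _ (leb I)); last by apply: le_measure; rewrite ?inE.
    by rewrite [X in (_ < X)%E]leb_itv/= lte_fin T0 oppr0 adde0 lte_fin.
  move: fin'; rewrite LnormyE leb0; set e := ess_sup_inf.ess_sup _ _ => fin'.
  exists (Num.max 0 (fine e)); first by rewrite le_max lexx. have : (e <= (Num.max 0 (fine e))%:E)%E.
    by case: e fin' => [r||]// _; rewrite ?leNye// lee_fin le_max lexx orbT.
  move=> /ess_sup_inf.ess_supP; apply: aesS => t /=.
  by rewrite patchE => + It; rewrite mem_set// gee0_abs// Lnorm_ge0.
(* The competitor is set to 0 at the null set of times where its slice norm exceeds M, since the
   theorem on the zero solution is applied to bounds valid at every time. *)
pose B : set (mR R) := I `&` [set t | (snorm p (cutoff I rho') t <= M%:E)%E].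
have mrI := cutoff_mfun mI (@subset_refl _ I) mr'. have mB : measurable B.
  apply: measurableI => //; rewrite -[X in measurable X]setTI; apply: measurable_lee => //. exact: mfun_snorm.
have BI : B `<=` I by move=> t []. pose rb t x := cutoff B rho' (t, x).
have mrb : jmfun (cutoff B rho') := cutoff_mfun mB BI mr'. have rbM t : (snorm p (cutoff B rho') t <= M%:E)%E.
  rewrite slice_cutoff//; case: ifP => [/set_mem[It]|_]; last by rewrite lee_fin.
  by rewrite /= slice_cutoff// mem_set. have Bae : {ae leb, forall t, I t -> B t}.
  apply: aesS hM => t h It; split=> //=. by rewrite slice_cutoff// mem_set//; exact: h.
have rbE : {ae leb, forall t, I t -> rho' t = rb t}. apply: aesS Bae => t h It; apply/funext => x.
  by rewrite /rb /cutoff mem_set//; exact: h. pose del t x := rho t x - rb t x.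
have zero : {ae leb, forall t, I t -> {ae haar, forall x, del t x = 0}}.
  apply: (@weak_solution_zero R d p q T p1 q1 pq d0 T0 V Y g fld Hg del (C + M)).
  - exact: mfunB.
  - move=> t x k; rewrite /del prho; congr (_ - _); rewrite /rb /cutoff/=; case: ifP => // /set_mem/BI It. exact: pr'.
  - move=> t; rewrite EFinD; apply: le_trans (leeD (rhoC t) (rbM t)).
    have mt : mfun (rho t) by exact: (jmslice t mrho). have mbt : mfun (rb t) by exact: (jmslice t mrb).
    rewrite -[X in (_ + X)%E](oppe_Lnorm haar _ p%:E).
    by apply: (minkowski_EFin haar mt (mcomp (@oppr_measurable R setT) mbt)); exact: ltW.
  - move=> phi tphi; have [sphi _ _] := tphi; have mx := mixed_transport q1 T0 fld tphi.
    have [iA _] := pairing_integrable p1 q1 pq mrho rhoC mx. have [iB _] := pairing_integrable p1 q1 pq mrb rbM mx.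
    have sA t := (pairing_slice p1 q1 pq mrho rhoC t mx).1. have sB t := (pairing_slice p1 q1 pq mrb rbM t mx).1.
    have E1 : \int[leb]_(t in I) \int[haar]_x (rho t x * cut_tr T V phi (t, x)) = - \int[haar]_x (rho0 x * phi (0, x)).
      rewrite -(wrho phi tphi); apply: eqRint => t It; apply: eqRint => x _. by rewrite /cut_tr/= indicE It mul1r.
    have E2 : \int[leb]_(t in I) \int[haar]_x (rb t x * cut_tr T V phi (t, x)) = - \int[haar]_x (rho0 x * phi (0, x)).
      rewrite -(w' phi tphi) (transfer _ rb phi sphi mr' _ rbE); last exact: mfunTS.
      apply: eqRint => t It; apply: eqRint => x _. by rewrite /cut_tr/= indicE It mul1r.
    transitivity (\int[leb]_(t in I) (\int[haar]_x (rho t x * cut_tr T V phi (t, x)) -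
        \int[haar]_x (rb t x * cut_tr T V phi (t, x)))); last first. by rewrite (RintB mI iA iB) E1 E2 subrr.
    apply: eqRint => t It; rewrite -(RintB measurableT (sA t) (sB t)); apply: eqRint => x _.
    by rewrite /cut_tr/= indicE It mul1r mulrBl.
apply: (@filterS2 _ _ (ae_filter_ringOfSetsType (@lebesgue_measure R))) zero rbE => t z e It.
by apply: filterS (z It) => x; rewrite /del e// => /eqP; rewrite subr_eq0 => /eqP.
Qed.
End wellposedness.

Theorem corollary1p2 (R : realType) (T : R) (d : nat) (p : R) (s : \bar R)
    (hT : 0 < T) (hd : (3 <= d)%N) (hp : 1 < p) (hs : (1 <= s)%E) :
  let p' := hoelder_conjugate p%:E in
  let s' := hoelder_conjugate s in
  ((s < +oo)%E ->
    exists u : R -> 'rV[R]_d -> 'rV[R]_d,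
      [/\ divergence_free T u,
          vLrW1q T 1%E p' u,
          vLsLp T s' p' u &
          exists (rho0 : 'rV[R]_d -> R) (rho1 rho2 : R -> 'rV[R]_d -> R),
            [/\ Lp_torus p%:E rho0,
                LsLp T s p%:E rho1 /\ weak_solution T u rho0 rho1,
                LsLp T s p%:E rho2 /\ weak_solution T u rho0 rho2 &
                ~ ae_same T rho1 rho2]])
  /\
  (s = +oo%E ->
    forall u : R -> 'rV[R]_d -> 'rV[R]_d,
      divergence_free T u -> vLrW1q T 1%E p' u ->
      forall rho0 : 'rV[R]_d -> R, Lp_torus p%:E rho0 ->
        exists rho : R -> 'rV[R]_d -> R,
          [/\ LsLp T +oo%E p%:E rho,
              weak_solution T u rho0 rho &
              forall rho' : R -> 'rV[R]_d -> R,
                LsLp T +oo%E p%:E rho' -> weak_solution T u rho0 rho' ->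
                ae_same T rho rho']).
Proof.
move=> p' s'; split=> [soo|_]; first exact: nonuniqueness.
have [q qE [q1 pq]] := conjE hp.
rewrite /p' qE => u divu hu rho0 hrho0; apply: (wellposedness hp q1 pq) => //.
exact: leq_trans hd.
Qed.
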